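(* Let $H$ be a hereditary algebra and let $A=\begin{pmatrix} B & 0\\ M & H_1\end{pmatrix}$ be a silted algebra with respect to $(T,P)$ for $H$, where $(T,P)$ is a support $\tau$-tilting pair in $\operatorname{mod}H$, $B=\operatorname{End}_H(T)$, $H_1=\operatorname{End}_H(P)$ and $M=\operatorname{Ext}^1_H(T,P)$. Then the matrix algebra $$\begin{pmatrix} B\ltimes \operatorname{Ext}^1_H(T,\tau_H^{-1}T) & \operatorname{Hom}_H(P,\tau_H^{-1}T)\\ M & H_1\end{pmatrix}$$ is a cluster-tilted algebra.
   Context: All algebras are finite dimensional over an algebraically closed field $k$; $\operatorname{mod}A$ is the category of finitely generated right $A$-modules, $\operatorname{proj}A$ its full subcategory of projectives, $\mathrm K^b(\operatorname{proj}A)$ the bounded homotopy category, $\mathcal D^b(A)$ the bounded derived category of $\operatorname{mod}A$. All modules are basic. $|X|$ is the number of pairwise non-isomorphic indecomposable direct summands of $X$ (and $|A|$ that of $A$ as a module over itself). $D=\operatorname{Hom}_k(-,k)$. $\tau$ (or $\tau_A$) denotes the Auslander–Reiten translation of $\operatorname{mod}A$, and $\tau_H^{-1}$ the inverse translation; for $H$ hereditary, $\tau_H^{-1}=\operatorname{Ext}^1_H(DH,-)$ is a functor. Blocks of matrix algebras are allowed to be zero. A module $T\in\operatorname{mod}A$ is $\tau$-rigid if $\operatorname{Hom}_A(T,\tau T)=0$. A pair $(T,P)$ with $T\in\operatorname{mod}A$ and $P\in\operatorname{proj}A$ is a support $\tau$-tilting pair if $T$ is $\tau$-rigid, $\operatorname{Hom}_A(P,T)=0$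 and $|T|+|P|=|A|$. A complex $\mathbf P\in\mathrm K^b(\operatorname{proj}A)$ is silting if $\operatorname{Hom}_{\mathrm K^b(\operatorname{proj}A)}(\mathbf P,\mathbf P[i])=0$ for all $i>0$ and $\mathbf P$ generates $\mathrm K^b(\operatorname{proj}A)$ as a triangulated category; it is 2-term if it has nonzero terms only in degrees $-1$ and $0$. The support $\tau$-tilting pair $(T,P)$ corresponds to the 2-term silting complex $P_1\oplus P\to P_0$, where $P_1\to P_0$ is a minimal projective presentation of $T$ and the map is zero on $P$. An algebra $A$ is a silted algebra with respect to $(T,P)$ for a hereditary algebra $H$ if $A\cong\operatorname{End}_{\mathcal D^b(H)}(\mathbf P)$, where $\mathbf P$ is the 2-term silting complex corresponding to the support $\tau$-tilting pair $(T,P)$ in $\operatorname{mod}H$. For such $A$, since $\mathbf P\cong T\oplus P[1]$ in $\mathcal D^b(H)$, one writes $A$ as the triangular matrix algebra $\begin{pmatrix} B & 0\\ M & H_1\end{pmatrix}$ with $B=\operatorname{End}_{\mathcal D^b(H)}(T)=\operatorname{End}_H(T)$, $H_1=\operatorname{End}_{\mathcal D^b(H)}(P[1])\cong\operatorname{End}_H(P)$, and $M=\operatorname{Hom}_{\mathcal D^b(H)}(T,P[1])\cong\operatorname{Ext}^1_H(T,P)$, which is an $H_1$-$B$-bimodule ($H_1$ acting by postcomposition, $B$ by precomposition). Let $E=\operatorname{Ext}^1_H(T,\tau_H^{-1}T)=\operatorname{Hom}_{\mathcal D^b(H)}(T,\tau_H^{-1}T[1])$, a $B$-$B$-bimodule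 with right action by precomposition and left action $b\cdot\xi=(\tau_H^{-1}b)[1]\circ\xi$. $B\ltimes E$ denotes the trivial extension: the vector space $B\oplus E$ with $(b,\xi)(b',\xi')=(bb',b\xi'+\xi b')$. Let $N=\operatorname{Hom}_H(P,\tau_H^{-1}T)$, a $B$-$H_1$-bimodule with right action by precomposition and left action $b\cdot x=(\tau_H^{-1}b)\circ x$. In the matrix algebra $\begin{pmatrix} B\ltimes E & N\\ M & H_1\end{pmatrix}$ multiplication is matrix multiplication, where $B\ltimes E$ acts on $M$ and $N$ through the projection $B\ltimes E\to B$, the product $N\times M\to B\ltimes E$ is $(x,m)\mapsto x[1]\circ m\in E$, and the product $M\times N\to H_1$ is zero. The cluster category $\mathcal C_H$ of a hereditary algebra $H$ is the orbit category $\mathcal D^b(H)/F$, $F=\tau_{\mathcal D}^{-1}[1]$, where $\tau_{\mathcal D}^{-1}$ is the inverse Auslander–Reiten translation of $\mathcal D^b(H)$; $\operatorname{Hom}_{\mathcal C_H}(\tilde X,\tilde Y)=\bigoplus_{i\in\mathbb Z}\operatorname{Hom}_{\mathcal D^b(H)}(X,F^iY)$. It is a triangulated category. An object $\tilde T$ of $\mathcal C_H$ is tilting if $\operatorname{Ext}^1_{\mathcal C_H}(\tilde T,\tilde T)=\operatorname{Hom}_{\mathcal C_H}(\tilde T,\tilde T[1])=0$ and the number of isomorphism classes of indecomposable summands of $\tilde T$ equals $|H|$. An algebra is cluster-tilted if it is isomorphic to $\operatorname{End}_{\mathcal C_{H}}(\tilde T)$ for some hereditary algebra $H$ and some (basic)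 tilting object $\tilde T$ of $\mathcal C_{H}$. *)

(* Defs.v *)
From HB Require Import structures.
From mathcomp Require Import all_boot all_algebra all_field.
From mathcomp Require Import mathcomp_extra boolp classical_sets fsbigop.
From mathcomp Require Import zify.
From mathcomp Require Import generic_quotient.

Set Implicit Arguments.
Unset Strict Implicit.
Unset Printing Implicit Defensive.

Import GRing.Theory VectorInternalTheory.
Local Open Scope ring_scope.

Section Subspace.
Variables (k : fieldType) (V : lmodType k) (P : V -> Prop).
Hypothesis P0 : P 0.
Hypothesis PL : forall a u v, P u -> P v -> P (a *: u + v).

Definition subsp : Type := {x : V | P x}.
HB.instance Definition _ := gen_eqMixin subsp.
HB.instance Definition _ := gen_choiceMixin subsp.

Lemma subsp_inj (x y : subsp) : sval x = sval y -> x = y.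
Proof. by case: x y => [x Px] [y Py] /= exy; apply: eq_exist. Qed.

Definition subsp0 : subsp := exist P 0 P0.
Definition subspN (x : subsp) : subsp.
Proof.
exists (- sval x).
by rewrite -[- _]addr0 -scaleN1r; exact: (@PL (-1) _ _ (svalP x) P0).
Defined.
Definition subspD (x y : subsp) : subsp.
Proof.
exists (sval x + sval y).
by rewrite -[sval x]scale1r; exact: (@PL 1 _ _ (svalP x) (svalP y)).
Defined.
Definition subspZ (a : k) (x : subsp) : subsp.
Proof.
exists (a *: sval x).
by rewrite -[_ *: _]addr0; exact: (@PL a _ _ (svalP x) P0).
Defined.

Fact subspDA : associative subspD.
Proof. by move=> x y z; apply: subsp_inj; rewrite /= addrA. Qed.
Fact subspDC : commutative subspD.
Proof. by move=> x y; apply: subsp_inj; rewrite /= addrC. Qed.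
Fact subsp0D : left_id subsp0 subspD.
Proof. by move=> x; apply: subsp_inj; rewrite /= add0r. Qed.
Fact subspND : left_inverse subsp0 subspN subspD.
Proof. by move=> x; apply: subsp_inj; rewrite /= addNr. Qed.
HB.instance Definition _ := GRing.isZmodule.Build subsp subspDA subspDC subsp0D subspND.

Fact subspZA a b (x : subsp) : subspZ a (subspZ b x) = subspZ (a * b) x.
Proof. by apply: subsp_inj; rewrite /= scalerA. Qed.
Fact subspZ1 : left_id 1 subspZ.
Proof. by move=> x; apply: subsp_inj; rewrite /= scale1r. Qed.
Fact subspZDr : right_distributive subspZ +%R.
Proof. by move=> a x y; apply: subsp_inj; rewrite /= scalerDr. Qed.
Fact subspZDl x : {morph subspZ^~ x : a b / a + b}.
Proof. by move=> a b; apply: subsp_inj; rewrite /= scalerDl. Qed.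
HB.instance Definition _ :=
  GRing.Zmodule_isLmodule.Build k subsp subspZA subspZ1 subspZDr subspZDl.

Definition subspace : lmodType k := subsp.
End Subspace.

Section DependentProduct.
Variables (k : fieldType) (I : Type) (V : I -> lmodType k).

Definition dprodv : Type := forall i, V i.
HB.instance Definition _ := gen_eqMixin dprodv.
HB.instance Definition _ := gen_choiceMixin dprodv.

Implicit Types f g h : dprodv.
Let dpD f g : dprodv := fun i => f i + g i.
Let dpN f : dprodv := fun i => - f i.
Let dp0 : dprodv := fun=> 0.
Let dpZ a f : dprodv := fun i => a *: f i.

Fact dpDA : associative dpD.
Proof. by move=> f g h; apply: functional_extensionality_dep => i; exact: addrA. Qed.
Fact dpDC : commutative dpD.
Proof. by move=> f g; apply: functional_extensionality_dep => i; exact: addrC. Qed.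
Fact dp0D : left_id dp0 dpD.
Proof. by move=> f; apply: functional_extensionality_dep => i; exact: add0r. Qed.
Fact dpND : left_inverse dp0 dpN dpD.
Proof. by move=> f; apply: functional_extensionality_dep => i; exact: addNr. Qed.
HB.instance Definition _ := GRing.isZmodule.Build dprodv dpDA dpDC dp0D dpND.

Fact dpZA a b f : dpZ a (dpZ b f) = dpZ (a * b) f.
Proof. by apply: functional_extensionality_dep => i; exact: scalerA. Qed.
Fact dpZ1 : left_id 1 dpZ.
Proof. by move=> f; apply: functional_extensionality_dep => i; exact: scale1r. Qed.
Fact dpZDr : right_distributive dpZ +%R.
Proof. by move=> a f g; apply: functional_extensionality_dep => i; exact: scalerDr. Qed.
Fact dpZDl f : {morph dpZ^~ f : a b / a + b}.
Proof. by move=> a b; apply: functional_extensionality_dep => i; exact: scalerDl. Qed.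
HB.instance Definition _ :=
  GRing.Zmodule_isLmodule.Build k dprodv dpZA dpZ1 dpZDr dpZDl.
End DependentProduct.

(* The algType of the library excludes the zero algebra, but the blocks
   End_H(T) and End_H(P) may be zero. *)
Record algebra (k : fieldType) := MkAlgebra {
  acar :> lmodType k;
  amul : acar -> acar -> acar;
  aone : acar;
  amulA : associative amul;
  amul1l : left_id aone amul;
  amul1r : right_id aone amul;
  amul_linl : forall c a b x, amul (c *: a + b) x = c *: amul a x + amul b x;
  amul_linr : forall c x a b, amul x (c *: a + b) = c *: amul x a + amul x b
}.

Definition alg_iso (k : fieldType) (A B : algebra k) : Prop :=
  exists f : {linear acar A -> acar B},
    [/\ bijective f, f (aone A) = aone B
      & forall x y, f (amul x y) = amul (f x) (f y)].

Record lincat (k : fieldType) := LinCat {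
  obj :> Type;
  hom : obj -> obj -> lmodType k;
  idm : forall X, hom X X;
  comp : forall X Y Z, hom Y Z -> hom X Y -> hom X Z;
  compA : forall X Y Z W (h : hom Z W) (g : hom Y Z) (f : hom X Y),
    comp h (comp g f) = comp (comp h g) f;
  comp1l : forall X Y (f : hom X Y), comp (idm Y) f = f;
  comp1r : forall X Y (f : hom X Y), comp f (idm X) = f;
  comp_linl : forall X Y Z c (g g' : hom Y Z) (f : hom X Y),
    comp (c *: g + g') f = c *: comp g f + comp g' f;
  comp_linr : forall X Y Z c (g : hom Y Z) (f f' : hom X Y),
    comp g (c *: f + f') = c *: comp g f + comp g f'
}.
Arguments hom {k l} X Y.
Arguments idm {k l} X : simpl never.
Arguments comp {k l X Y Z} g f : simpl never.
Notation "g \oc f" := (comp g f) (at level 40, left associativity).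

Section CategoryNotions.
Variables (k : fieldType) (C : lincat k).
Implicit Types X Y Z : C.

Lemma compDl X Y Z (g g' : hom Y Z) (f : hom X Y) :
  (g + g') \oc f = g \oc f + g' \oc f.
Proof. by rewrite -[g]scale1r comp_linl !scale1r. Qed.
Lemma compDr X Y Z (g : hom Y Z) (f f' : hom X Y) :
  g \oc (f + f') = g \oc f + g \oc f'.
Proof. by rewrite -[f]scale1r comp_linr !scale1r. Qed.
Lemma comp0l X Y Z (f : hom X Y) : (0 : hom Y Z) \oc f = 0.
Proof. by apply: (@addrI _ (0 \oc f)); rewrite -compDl !addr0. Qed.
Lemma comp0r X Y Z (g : hom Y Z) : g \oc (0 : hom X Y) = 0.
Proof. by apply: (@addrI _ (g \oc 0)); rewrite -compDr !addr0. Qed.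
Lemma compZl X Y Z c (g : hom Y Z) (f : hom X Y) : (c *: g) \oc f = c *: (g \oc f).
Proof. by rewrite -[c *: g]addr0 comp_linl comp0l addr0. Qed.
Lemma compZr X Y Z c (g : hom Y Z) (f : hom X Y) : g \oc (c *: f) = c *: (g \oc f).
Proof. by rewrite -[c *: f]addr0 comp_linr comp0r addr0. Qed.
Lemma compNl X Y Z (g : hom Y Z) (f : hom X Y) : (- g) \oc f = - (g \oc f).
Proof. by rewrite -scaleN1r compZl scaleN1r. Qed.
Lemma compNr X Y Z (g : hom Y Z) (f : hom X Y) : g \oc (- f) = - (g \oc f).
Proof. by rewrite -scaleN1r compZr scaleN1r. Qed.
Lemma comp_suml X Y Z (I : Type) (r : seq I) (g : I -> hom Y Z) (f : hom X Y) :
  (\sum_(i <- r) g i) \oc f = \sum_(i <- r) (g i \oc f).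
Proof.
elim: r => [|i r IH]; first by rewrite !big_nil comp0l.
by rewrite !big_cons compDl IH.
Qed.
Lemma comp_sumr X Y Z (I : Type) (r : seq I) (g : hom Y Z) (f : I -> hom X Y) :
  g \oc (\sum_(i <- r) f i) = \sum_(i <- r) (g \oc f i).
Proof.
elim: r => [|i r IH]; first by rewrite !big_nil comp0r.
by rewrite !big_cons compDr IH.
Qed.

Definition is_iso X Y (f : hom X Y) : Prop :=
  exists g : hom Y X, g \oc f = idm X /\ f \oc g = idm Y.

Definition isomorphic X Y : Prop := exists f : hom X Y, is_iso f.

Definition is_zero X : Prop := idm X = 0.

Definition is_direct_sum n X (Y : 'I_n -> C) : Prop :=
  exists (i : forall j, hom (Y j) X) (p : forall j, hom X (Y j)),
    [/\ forall j, p j \oc i j = idm (Y j),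
        forall j l, j != l -> p j \oc i l = 0
      & \sum_j (i j \oc p j) = idm X].

Definition is_direct_sum2 X Y Z : Prop :=
  is_direct_sum X (fun j : 'I_2 => if j == ord0 then Y else Z).

Definition indecomposable X : Prop :=
  ~ is_zero X /\ forall Y Z, is_direct_sum2 X Y Z -> is_zero Y \/ is_zero Z.

Definition summand Y X : Prop := exists Z, is_direct_sum2 X Y Z.

Definition pairwise_nonisomorphic n (Y : 'I_n -> C) : Prop :=
  forall j l, isomorphic (Y j) (Y l) -> j = l.

(* |X| = n *)
Definition num_summands X (n : nat) : Prop :=
  exists Y : 'I_n -> C,
    [/\ forall j, indecomposable (Y j) /\ summand (Y j) X,
        pairwise_nonisomorphic Y
      & forall Z, indecomposable Z -> summand Z X -> exists j, isomorphic Z (Y j)].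

Definition basic X : Prop :=
  exists n (Y : 'I_n -> C),
    [/\ forall j, indecomposable (Y j), pairwise_nonisomorphic Y & is_direct_sum X Y].

Definition endalg X : algebra k :=
  MkAlgebra (fun f g h => compA f g h) (@comp1l _ C X X) (@comp1r _ C X X)
    (fun c g g' f => comp_linl c g g' f) (fun c g f f' => comp_linr c g f f').
End CategoryNotions.

Record functor (k : fieldType) (C D : lincat k) := Functor {
  fobj :> C -> D;
  fmap : forall X Y : C, hom X Y -> hom (fobj X) (fobj Y);
  fmap1 : forall X, fmap (idm X) = idm (fobj X);
  fmapM : forall X Y Z (g : hom Y Z) (f : hom X Y), fmap (g \oc f) = fmap g \oc fmap f;
  fmap_lin : forall X Y c (f g : hom X Y), fmap (c *: f + g) = c *: fmap f + fmap g
}.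
Arguments fmap {k C D} F {X Y} f : rename, simpl never.

Section Functors.
Variable k : fieldType.

Lemma fmapD (C D : lincat k) (F : functor C D) (X Y : C) (f g : hom X Y) :
  fmap F (f + g) = fmap F f + fmap F g.
Proof. by rewrite -[f]scale1r fmap_lin !scale1r. Qed.
Lemma fmap0 (C D : lincat k) (F : functor C D) (X Y : C) : fmap F (0 : hom X Y) = 0.
Proof. by apply: (@addrI _ (fmap F 0)); rewrite -fmapD !addr0. Qed.
Lemma fmapZ (C D : lincat k) (F : functor C D) (X Y : C) c (f : hom X Y) :
  fmap F (c *: f) = c *: fmap F f.
Proof. by rewrite -[c *: f]addr0 fmap_lin fmap0 addr0. Qed.
Lemma fmap_sum (C D : lincat k) (F : functor C D) (X Y : C) (I : Type) (r : seq I)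
    (f : I -> hom X Y) :
  fmap F (\sum_(i <- r) f i) = \sum_(i <- r) fmap F (f i).
Proof.
elim: r => [|i r IH]; first by rewrite !big_nil fmap0.
by rewrite !big_cons fmapD IH.
Qed.

Definition idfunctor (C : lincat k) : functor C C.
Proof. by exists id (fun X Y f => f). Defined.

Definition compfunctor (C D E : lincat k) (G : functor D E) (F : functor C D) :
  functor C E.
Proof.
exists (fun X => G (F X)) (fun X Y f => fmap G (fmap F f)).
- by move=> X; rewrite !fmap1.
- by move=> X Y Z g f; rewrite !fmapM.
- by move=> X Y c f g; rewrite !fmap_lin.
Defined.

Definition natiso (C D : lincat k) (F G : functor C D) : Prop :=
  exists phi : forall X, hom (F X) (G X),
    (forall X, is_iso (phi X)) /\
    (forall X Y (f : hom X Y), phi Y \oc fmap F f = fmap G f \oc phi X).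

Definition quasi_inverse (C D : lincat k) (F : functor C D) (G : functor D C) : Prop :=
  natiso (compfunctor G F) (idfunctor C) /\ natiso (compfunctor F G) (idfunctor D).
End Functors.

(* The powers (F^i), i in Z, of an autoequivalence F: a (weak) action of the
   group Z, with coherent isomorphisms F^i F^j = F^n for i + j = n.  Since Z is
   free on one generator, an autoequivalence F extends to such an action, and
   the action is determined by F up to isomorphism. *)
Record zaction (k : fieldType) (C : lincat k) := ZAction {
  pow :> int -> functor C C;
  pow0 : forall X : C, hom X (pow 0 X);
  powD : forall i j n (e : i + j = n) (X : C), hom (pow i (pow j X)) (pow n X);
  pow0_iso : forall X, is_iso (pow0 X);
  powD_iso : forall i j n (e : i + j = n) X, is_iso (powD e X);
  pow0_nat : forall X Y (f : hom X Y), pow0 Y \oc f = fmap (pow 0) f \oc pow0 X;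
  powD_nat : forall i j n (e : i + j = n) X Y (f : hom X Y),
    powD e Y \oc fmap (pow i) (fmap (pow j) f) = fmap (pow n) f \oc powD e X;
  powD0l : forall i (e : 0 + i = i) X, powD e X \oc pow0 (pow i X) = idm (pow i X);
  powD0r : forall i (e : i + 0 = i) X,
    powD e X \oc fmap (pow i) (pow0 X) = idm (pow i X);
  powDA : forall i j l a b n (ea : i + j = a) (en : a + l = n) (eb : j + l = b)
      (en' : i + b = n) X,
    powD en X \oc powD ea (pow l X) = powD en' X \oc fmap (pow i) (powD eb X)
}.
Arguments pow0 {k C} F X : rename.
Arguments powD {k C} F {i j n} e X : rename.
Arguments powDA {k C} F {i j l a b n} ea en eb en' X : rename.

Section FiniteSums.
Variable V : zmodType.
Implicit Types F G : int -> V.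

Definition zrange (N : nat) : seq int := [seq i%:Z - N%:Z | i <- iota 0 (N.*2).+1].

Lemma zrange_uniq N : uniq (zrange N).
Proof. by rewrite map_inj_uniq ?iota_uniq// => i j /addIr[]. Qed.

Lemma mem_zrange N (i : int) : (absz i <= N)%N -> i \in zrange N.
Proof.
move=> iN; apply/mapP; exists (absz (i + N%:Z)); last by lia.
by rewrite mem_iota; lia.
Qed.

Definition vanish_above F (N : nat) := forall i : int, (N < absz i)%N -> F i = 0.

Lemma vanish_above_notin F N i : vanish_above F N -> i \notin zrange N -> F i = 0.
Proof. by move=> FN iN; apply: FN; rewrite ltnNge; apply: contra iN; exact: mem_zrange. Qed.

Lemma zsumE F N : vanish_above F N ->
  \sum_(i \in [set: int]) F i = \sum_(i <- zrange N) F i.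
Proof.
move=> FN; rewrite (fsbigE (zrange N)) ?zrange_uniq//; last first.
  by move=> i _; exact: vanish_above_notin.
by apply: eq_bigl => i; rewrite in_setT.
Qed.

Lemma zsum0 : \sum_(i \in [set: int]) (0 : V) = 0.
Proof. by rewrite fsbig1. Qed.

Lemma zsum_shift F (j : int) :
  \sum_(i \in [set: int]) F (i - j) = \sum_(i \in [set: int]) F i.
Proof.
rewrite [RHS](@reindex_fsbigT _ _ _ _ _ (fun i => i - j))//.
by exists (fun i => i + j) => i; rewrite ?subrK ?addrK.
Qed.

Lemma zsum_single F i : (forall j, j != i -> F j = 0) ->
  \sum_(j \in [set: int]) F j = F i.
Proof.
move=> F0; rewrite (fsbigE [:: i])//; last first.
  by move=> j _; rewrite inE => /F0.
by rewrite big_cons big_nil in_setT /= addr0.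
Qed.
End FiniteSums.

Section OrbitCategory.
Variables (k : fieldType) (C : lincat k) (F : zaction C).
Implicit Types X Y Z W : C.

Definition orbit_fun X Y : lmodType k := dprodv (fun i : int => hom X (F i Y)).

Definition finite_support X Y (f : orbit_fun X Y) : Prop :=
  exists N : nat, forall i : int, (N < absz i)%N -> f i = 0.

Fact finite_support0 X Y : finite_support (0 : orbit_fun X Y).
Proof. by exists 0%N. Qed.

Fact finite_supportL X Y a (f g : orbit_fun X Y) :
  finite_support f -> finite_support g -> finite_support (a *: f + g).
Proof.
move=> [N fN] [M gM]; exists (maxn N M) => i; rewrite gtn_max => /andP[Ni Mi].
by rewrite -[LHS]/(a *: f i + g i) fN// gM// scaler0 addr0.
Qed.

(* Hom(X, Y) = (+)_{i in Z} Hom_C(X, F^i Y) *)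
Definition orbit_hom X Y : lmodType k :=
  subspace (@finite_support0 X Y) (@finite_supportL X Y).

Definition orbit_id X : orbit_hom X X.
Proof.
exists (fun i : int => match i return hom X (F i X) with
               | Posz 0 => pow0 F X | _ => 0 end).
by exists 0%N => -[[|i]|i].
Defined.

Definition orbit_comp_term X Y Z (g : orbit_fun Y Z) (f : orbit_fun X Y)
    (i j n : int) (e : i + j = n) : hom X (F n Z) :=
  powD F e Z \oc fmap (F i) (g j) \oc f i.

Definition orbit_comp_fun X Y Z (g : orbit_fun Y Z) (f : orbit_fun X Y) :
    orbit_fun X Z :=
  fun n => \sum_(i \in [set: int]) orbit_comp_term g f (subrKC i n).

Lemma orbit_comp_term0l X Y Z (g : orbit_fun Y Z) (f : orbit_fun X Y) i j n
    (e : i + j = n) : g j = 0 -> orbit_comp_term g f e = 0.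
Proof. by move=> g0; rewrite /orbit_comp_term g0 fmap0 comp0r comp0l. Qed.

Lemma orbit_comp_term0r X Y Z (g : orbit_fun Y Z) (f : orbit_fun X Y) i j n
    (e : i + j = n) : f i = 0 -> orbit_comp_term g f e = 0.
Proof. by move=> f0; rewrite /orbit_comp_term f0 comp0r. Qed.

Lemma orbit_comp_term_irr X Y Z (g : orbit_fun Y Z) (f : orbit_fun X Y) i j j' n
    (e : i + j = n) (e' : i + j' = n) :
  orbit_comp_term g f e = orbit_comp_term g f e'.
Proof.
have ejj' : j = j' by apply: (@addrI _ i); rewrite e e'.
by subst j'; rewrite (Prop_irrelevance e e').
Qed.

Fact orbit_comp_fin X Y Z (g : orbit_fun Y Z) (f : orbit_fun X Y) :
  finite_support g -> finite_support f -> finite_support (orbit_comp_fun g f).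
Proof.
move=> [N gN] [M fM]; exists (N + M)%N => n ltn.
rewrite /orbit_comp_fun fsbig1// => i _.
have [ltMi|leiM] := ltnP M (absz i); first by apply: orbit_comp_term0r; exact: fM.
by apply: orbit_comp_term0l; apply: gN; lia.
Qed.

Definition orbit_comp X Y Z (g : orbit_hom Y Z) (f : orbit_hom X Y) : orbit_hom X Z :=
  exist _ (orbit_comp_fun (sval g) (sval f)) (orbit_comp_fin (svalP g) (svalP f)).

Lemma orbit_comp_funE X Y Z (g : orbit_fun Y Z) (f : orbit_fun X Y) n M :
  (forall i : int, (M < absz i)%N -> f i = 0) ->
  orbit_comp_fun g f n = \sum_(i <- zrange M) orbit_comp_term g f (subrKC i n).
Proof.
move=> fM; apply: zsumE => i /fM f0; exact: orbit_comp_term0r.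
Qed.

Fact orbit_compA X Y Z W (h : orbit_hom Z W) (g : orbit_hom Y Z) (f : orbit_hom X Y) :
  orbit_comp h (orbit_comp g f) = orbit_comp (orbit_comp h g) f.
Proof.
case: h g f => [h [A hA]] [g [B gB]] [f [M fM]].
apply: subsp_inj => /=; apply: functional_extensionality_dep => n.
have gfN p : (B + M < absz p)%N -> orbit_comp_fun g f p = 0.
  move=> ltp; rewrite (orbit_comp_funE _ _ fM) big1_seq// => i /andP[_ _].
  have [ltMi|leiM] := ltnP M (absz i); first by apply: orbit_comp_term0r; exact: fM.
  by apply: orbit_comp_term0l; apply: gB; lia.
rewrite (orbit_comp_funE _ _ gfN) (orbit_comp_funE _ _ fM).
pose G i p : hom X (F n W) :=
  powD F (subrKC p n) W \oc fmap (F p) (h (n - p)) \oc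
    orbit_comp_term g f (subrKC i p).
transitivity (\sum_(p <- zrange (B + M)) \sum_(i <- zrange M) G i p).
  apply: eq_bigr => p _; rewrite /orbit_comp_term (orbit_comp_funE _ _ fM).
  by rewrite comp_sumr.
rewrite exchange_big /=; apply: eq_big_seq => i; move: (mem_zrange) => _ _.
have G0 p : (B + M < absz p)%N -> G i p = 0.
  move=> ltp; have [ltMi|leiM] := ltnP M (absz i).
    by rewrite /G orbit_comp_term0r ?comp0r//; exact: fM.
  by rewrite /G orbit_comp_term0l ?comp0r//; apply: gB; lia.
rewrite -(zsumE G0) /orbit_comp_term (orbit_comp_funE _ _ gB).
rewrite fmap_sum comp_sumr comp_suml -(zsum_shift _ (- i)).
rewrite -(@zsumE _ (fun j => _ \oc fmap (F i) (orbit_comp_term h g (subrKC j (n - i))) \oc f i)).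
  apply: eq_fsbigr => j _; rewrite /G /orbit_comp_term.
  have ej : j - - i - i = j by rewrite opprK addrK.
  have eb : j + (n - (j - - i)) = n - i by lia.
  have ea : i + j = j - - i by lia.
  rewrite -/(orbit_comp_term g f (subrKC i (j - - i))).
  rewrite (orbit_comp_term_irr g f (subrKC i (j - - i)) ea).
  rewrite -/(orbit_comp_term h g (subrKC j (n - i))).
  rewrite (orbit_comp_term_irr h g (subrKC j (n - i)) eb) /orbit_comp_term.
  rewrite !fmapM !compA; congr (_ \oc _ \oc _).
  rewrite -(powDA F ea (subrKC (j - - i) n) eb (subrKC i n)).
  by rewrite -!compA powD_nat.
move=> j /gB g0.
by rewrite orbit_comp_term0r// fmap0 comp0r comp0l.
Qed.

Fact orbit_comp1l X Y (f : orbit_hom X Y) : orbit_comp (orbit_id Y) f = f.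
Proof.
case: f => [f [M fM]]; apply: subsp_inj => /=.
apply: functional_extensionality_dep => n.
rewrite /orbit_comp_fun (zsum_single (i := n)).
  have e : n + 0 = n by rewrite addr0.
  rewrite (orbit_comp_term_irr _ _ (subrKC n n) e) /orbit_comp_term.
  by rewrite powD0r comp1l.
move=> j jn; apply: orbit_comp_term0l.
have : n - j != 0 by rewrite subr_eq0 eq_sym.
by case: (n - j) => [[|?]|?].
Qed.

Fact orbit_comp1r X Y (f : orbit_hom X Y) : orbit_comp f (orbit_id X) = f.
Proof.
case: f => [f [M fM]]; apply: subsp_inj => /=.
apply: functional_extensionality_dep => n.
rewrite /orbit_comp_fun (zsum_single (i := 0)).
  have e : 0 + n = n by rewrite add0r.
  rewrite (orbit_comp_term_irr _ _ (subrKC 0 n) e) /orbit_comp_term.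
  by rewrite -compA -pow0_nat compA powD0l comp1l.
by move=> -[[|j]|j] //= _; apply: orbit_comp_term0r.
Qed.

Fact orbit_comp_linl X Y Z c (g g' : orbit_hom Y Z) (f : orbit_hom X Y) :
  orbit_comp (c *: g + g') f = c *: orbit_comp g f + orbit_comp g' f.
Proof.
case: f g g' => [f [M fM]] [g gP] [g' gP']; apply: subsp_inj => /=.
apply: functional_extensionality_dep => n.
rewrite -[RHS]/(c *: orbit_comp_fun g f n + orbit_comp_fun g' f n).
rewrite !(orbit_comp_funE _ _ fM) scaler_sumr -big_split /=.
by apply: eq_bigr => i _; rewrite /orbit_comp_term fmap_lin comp_linr comp_linl.
Qed.

Fact orbit_comp_linr X Y Z c (g : orbit_hom Y Z) (f f' : orbit_hom X Y) :
  orbit_comp g (c *: f + f') = c *: orbit_comp g f + orbit_comp g f'.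
Proof.
case: f f' g => [f [M fM]] [f' [M' fM']] [g gP]; apply: subsp_inj => /=.
apply: functional_extensionality_dep => n.
rewrite -[RHS]/(c *: orbit_comp_fun g f n + orbit_comp_fun g f' n).
have fN i : (maxn M M' < absz i)%N -> f i = 0.
  by rewrite gtn_max => /andP[/fM].
have fN' i : (maxn M M' < absz i)%N -> f' i = 0.
  by rewrite gtn_max => /andP[_ /fM'].
have cfN i : (maxn M M' < absz i)%N -> (c *: f + f') i = 0.
  by move=> lti; rewrite -[LHS]/(c *: f i + f' i) fN// fN'// scaler0 addr0.
rewrite (orbit_comp_funE _ _ fN) (orbit_comp_funE _ _ fN').
rewrite (orbit_comp_funE _ _ cfN) scaler_sumr -big_split /=.
by apply: eq_bigr => i _; rewrite /orbit_comp_term -comp_linr.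
Qed.

Definition orbit_category : lincat k :=
  LinCat orbit_compA orbit_comp1l orbit_comp1r orbit_comp_linl orbit_comp_linr.
End OrbitCategory.

(* C[S^-1] by generators and relations: morphisms are the formal linear
   combinations of composites of morphisms of C and of formal inverses of the
   elements of S, modulo the relations making C[S^-1] a linear category, C ->
   C[S^-1] a linear functor and the formal inverses inverses. *)
Section Localization.
Variables (k : fieldType) (C : lincat k) (S : forall X Y : C, hom X Y -> Prop).

Inductive lterm : C -> C -> Type :=
| lmap X Y (f : hom X Y) : lterm X Y
| linv X Y (s : hom X Y) (Ss : S s) : lterm Y X
| lcomp X Y Z (g : lterm Y Z) (f : lterm X Y) : lterm X Z
| ladd X Y (f g : lterm X Y) : lterm X Y
| lscale X Y (c : k) (f : lterm X Y) : lterm X Y.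

Inductive leqv : forall X Y, lterm X Y -> lterm X Y -> Prop :=
| leqv_refl X Y (f : lterm X Y) : leqv f f
| leqv_sym X Y (f g : lterm X Y) : leqv f g -> leqv g f
| leqv_trans X Y (f g h : lterm X Y) : leqv f g -> leqv g h -> leqv f h
| leqv_comp X Y Z (g g' : lterm Y Z) (f f' : lterm X Y) :
    leqv g g' -> leqv f f' -> leqv (lcomp g f) (lcomp g' f')
| leqv_add X Y (f f' g g' : lterm X Y) :
    leqv f f' -> leqv g g' -> leqv (ladd f g) (ladd f' g')
| leqv_scale X Y c (f f' : lterm X Y) : leqv f f' -> leqv (lscale c f) (lscale c f')
| leqv_addA X Y (f g h : lterm X Y) : leqv (ladd f (ladd g h)) (ladd (ladd f g) h)
| leqv_addC X Y (f g : lterm X Y) : leqv (ladd f g) (ladd g f)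
| leqv_add0 X Y (f : lterm X Y) : leqv (ladd (lmap 0) f) f
| leqv_addN X Y (f : lterm X Y) : leqv (ladd (lscale (-1) f) f) (lmap 0)
| leqv_scaleA X Y a b (f : lterm X Y) : leqv (lscale a (lscale b f)) (lscale (a * b) f)
| leqv_scale1 X Y (f : lterm X Y) : leqv (lscale 1 f) f
| leqv_scaleDr X Y c (f g : lterm X Y) :
    leqv (lscale c (ladd f g)) (ladd (lscale c f) (lscale c g))
| leqv_scaleDl X Y a b (f : lterm X Y) :
    leqv (lscale (a + b) f) (ladd (lscale a f) (lscale b f))
| leqv_compA X Y Z W (h : lterm Z W) (g : lterm Y Z) (f : lterm X Y) :
    leqv (lcomp h (lcomp g f)) (lcomp (lcomp h g) f)
| leqv_comp1l X Y (f : lterm X Y) : leqv (lcomp (lmap (idm Y)) f) f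
| leqv_comp1r X Y (f : lterm X Y) : leqv (lcomp f (lmap (idm X))) f
| leqv_compDl X Y Z (g g' : lterm Y Z) (f : lterm X Y) :
    leqv (lcomp (ladd g g') f) (ladd (lcomp g f) (lcomp g' f))
| leqv_compDr X Y Z (g : lterm Y Z) (f f' : lterm X Y) :
    leqv (lcomp g (ladd f f')) (ladd (lcomp g f) (lcomp g f'))
| leqv_compZl X Y Z c (g : lterm Y Z) (f : lterm X Y) :
    leqv (lcomp (lscale c g) f) (lscale c (lcomp g f))
| leqv_compZr X Y Z c (g : lterm Y Z) (f : lterm X Y) :
    leqv (lcomp g (lscale c f)) (lscale c (lcomp g f))
| leqv_mapM X Y Z (g : hom Y Z) (f : hom X Y) :
    leqv (lmap (g \oc f)) (lcomp (lmap g) (lmap f))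
| leqv_mapD X Y (f g : hom X Y) : leqv (lmap (f + g)) (ladd (lmap f) (lmap g))
| leqv_mapZ X Y c (f : hom X Y) : leqv (lmap (c *: f)) (lscale c (lmap f))
| leqv_invl X Y (s : hom X Y) (Ss : S s) :
    leqv (lcomp (linv Ss) (lmap s)) (lmap (idm X))
| leqv_invr X Y (s : hom X Y) (Ss : S s) :
    leqv (lcomp (lmap s) (linv Ss)) (lmap (idm Y)).

HB.instance Definition _ X Y := gen_eqMixin (lterm X Y).
HB.instance Definition _ X Y := gen_choiceMixin (lterm X Y).

Definition leqvb X Y : rel (lterm X Y) := fun f g => `[< leqv f g >].

Fact leqvb_refl X Y : reflexive (@leqvb X Y).
Proof. by move=> f; apply/asboolP; exact: leqv_refl. Qed.
Fact leqvb_sym X Y : symmetric (@leqvb X Y).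
Proof. by move=> f g; apply/asboolP/asboolP; exact: leqv_sym. Qed.
Fact leqvb_trans X Y : transitive (@leqvb X Y).
Proof.
by move=> g f h /asboolP fg /asboolP gh; apply/asboolP; exact: leqv_trans fg gh.
Qed.
Canonical leqvb_equiv X Y :=
  EquivRel (@leqvb X Y) (@leqvb_refl X Y) (@leqvb_sym X Y) (@leqvb_trans X Y).

Definition loc_quot X Y : Type := {eq_quot (leqvb_equiv X Y)}%qT.
HB.instance Definition _ X Y := Choice.on (loc_quot X Y).

Definition lcls X Y (t : lterm X Y) : loc_quot X Y := (\pi_{eq_quot (leqvb_equiv X Y)} t)%qT.
Definition lrep X Y (f : loc_quot X Y) : lterm X Y := repr f.

Lemma lrepK X Y (f : loc_quot X Y) : lcls (lrep f) = f.
Proof. exact: reprK. Qed.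
Lemma lclsP X Y (t u : lterm X Y) : lcls t = lcls u <-> leqv t u.
Proof.
split=> [/eqmodP/asboolP//|tu]; apply/eqmodP; exact/asboolP.
Qed.
Lemma lrep_cls X Y (t : lterm X Y) : leqv (lrep (lcls t)) t.
Proof. by apply/lclsP; rewrite lrepK. Qed.

Definition loc_add X Y (f g : loc_quot X Y) : loc_quot X Y := lcls (ladd (lrep f) (lrep g)).
Definition loc_scale X Y c (f : loc_quot X Y) : loc_quot X Y := lcls (lscale c (lrep f)).
Definition loc_comp X Y Z (g : loc_quot Y Z) (f : loc_quot X Y) : loc_quot X Z :=
  lcls (lcomp (lrep g) (lrep f)).

Lemma lcls_add X Y (t u : lterm X Y) : lcls (ladd t u) = loc_add (lcls t) (lcls u).
Proof. by apply/lclsP; apply: leqv_add; apply: leqv_sym; exact: lrep_cls. Qed.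
Lemma lcls_scale X Y c (t : lterm X Y) : lcls (lscale c t) = loc_scale c (lcls t).
Proof. by apply/lclsP; apply: leqv_scale; apply: leqv_sym; exact: lrep_cls. Qed.
Lemma lcls_comp X Y Z (t : lterm Y Z) (u : lterm X Y) :
  lcls (lcomp t u) = loc_comp (lcls t) (lcls u).
Proof. by apply/lclsP; apply: leqv_comp; apply: leqv_sym; exact: lrep_cls. Qed.

Fact loc_addA X Y : associative (@loc_add X Y).
Proof.
move=> f g h; rewrite -(lrepK f) -(lrepK g) -(lrepK h) -!lcls_add.
by apply/lclsP; exact: leqv_addA.
Qed.
Fact loc_addC X Y : commutative (@loc_add X Y).
Proof.
move=> f g; rewrite -(lrepK f) -(lrepK g) -!lcls_add.
by apply/lclsP; exact: leqv_addC.
Qed.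
Fact loc_add0 X Y : left_id (lcls (lmap 0)) (@loc_add X Y).
Proof.
by move=> f; rewrite -(lrepK f) -!lcls_add; apply/lclsP; exact: leqv_add0.
Qed.
Fact loc_addN X Y : left_inverse (lcls (lmap 0)) (@loc_scale X Y (-1)) (@loc_add X Y).
Proof.
move=> f; rewrite -(lrepK f) -lcls_scale -!lcls_add.
by apply/lclsP; exact: leqv_addN.
Qed.
HB.instance Definition _ X Y :=
  GRing.isZmodule.Build (loc_quot X Y)
    (@loc_addA X Y) (@loc_addC X Y) (@loc_add0 X Y) (@loc_addN X Y).

Lemma loc_addE X Y (f g : loc_quot X Y) : f + g = loc_add f g. Proof. by []. Qed.

Fact loc_scaleA X Y a b (f : loc_quot X Y) :
  loc_scale a (loc_scale b f) = loc_scale (a * b) f.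
Proof.
by rewrite -(lrepK f) -!lcls_scale; apply/lclsP; exact: leqv_scaleA.
Qed.
Fact loc_scale1 X Y : left_id 1 (@loc_scale X Y).
Proof.
by move=> f; rewrite -(lrepK f) -!lcls_scale; apply/lclsP; exact: leqv_scale1.
Qed.
Fact loc_scaleDr X Y : right_distributive (@loc_scale X Y) +%R.
Proof.
move=> c f g; rewrite !loc_addE.
rewrite -(lrepK f) -(lrepK g) -(lcls_add (lrep f)) -!(lcls_scale c (lrep _)).
by rewrite -lcls_scale -lcls_add; apply/lclsP; exact: leqv_scaleDr.
Qed.
Fact loc_scaleDl X Y (f : loc_quot X Y) : {morph (@loc_scale X Y)^~ f : a b / a + b}.
Proof.
move=> a b; rewrite loc_addE.
rewrite -(lrepK f) -!(lcls_scale _ (lrep _)) -lcls_add.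
by apply/lclsP; exact: leqv_scaleDl.
Qed.
HB.instance Definition _ X Y :=
  GRing.Zmodule_isLmodule.Build k (loc_quot X Y)
    (@loc_scaleA X Y) (@loc_scale1 X Y) (@loc_scaleDr X Y) (@loc_scaleDl X Y).

Lemma loc_scaleE X Y c (f : loc_quot X Y) : c *: f = loc_scale c f. Proof. by []. Qed.

Definition loc_hom X Y : lmodType k := loc_quot X Y.
Definition loc_id X : loc_hom X X := lcls (lmap (idm X)).

Fact loc_compA X Y Z W (h : loc_hom Z W) (g : loc_hom Y Z) (f : loc_hom X Y) :
  loc_comp h (loc_comp g f) = loc_comp (loc_comp h g) f.
Proof.
rewrite -(lrepK f) -(lrepK g) -(lrepK h) -!lcls_comp.
by apply/lclsP; exact: leqv_compA.
Qed.
Fact loc_comp1l X Y (f : loc_hom X Y) : loc_comp (loc_id Y) f = f.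
Proof. by rewrite -(lrepK f) -lcls_comp; apply/lclsP; exact: leqv_comp1l. Qed.
Fact loc_comp1r X Y (f : loc_hom X Y) : loc_comp f (loc_id X) = f.
Proof. by rewrite -(lrepK f) -lcls_comp; apply/lclsP; exact: leqv_comp1r. Qed.
Fact loc_comp_linl X Y Z c (g g' : loc_hom Y Z) (f : loc_hom X Y) :
  loc_comp (c *: g + g') f = c *: (loc_comp g f : loc_hom X Z) + loc_comp g' f.
Proof.
rewrite !(loc_addE, loc_scaleE).
rewrite -(lrepK f) -(lrepK g) -(lrepK g') -(lcls_scale c (lrep g)).
rewrite -(lcls_add _ (lrep g')) -!(lcls_comp (lrep _) (lrep f)).
rewrite -lcls_scale -lcls_comp -lcls_add; apply/lclsP.
apply: leqv_trans (leqv_compDl _ _ _) _.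
by apply: leqv_add; [exact: leqv_compZl|exact: leqv_refl].
Qed.
Fact loc_comp_linr X Y Z c (g : loc_hom Y Z) (f f' : loc_hom X Y) :
  loc_comp g (c *: f + f') = c *: (loc_comp g f : loc_hom X Z) + loc_comp g f'.
Proof.
rewrite !(loc_addE, loc_scaleE).
rewrite -(lrepK f) -(lrepK g) -(lrepK f') -(lcls_scale c (lrep f)).
rewrite -(lcls_add _ (lrep f')) -!(lcls_comp (lrep g) (lrep _)).
rewrite -lcls_scale -lcls_comp -lcls_add; apply/lclsP.
apply: leqv_trans (leqv_compDr _ _ _) _.
by apply: leqv_add; [exact: leqv_compZr|exact: leqv_refl].
Qed.

Definition localization : lincat k :=
  LinCat loc_compA loc_comp1l loc_comp1r loc_comp_linl loc_comp_linr.

Definition loc_functor : functor C localization.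
Proof.
exists (fun X : C => X : localization)
  (fun X Y f => lcls (lmap f) : @hom k localization X Y).
- by [].
- by move=> X Y Z g f; rewrite -[RHS]lcls_comp; apply/lclsP; exact: leqv_mapM.
- move=> X Y c f g.
  rewrite loc_addE loc_scaleE -lcls_scale -lcls_add; apply/lclsP.
  apply: leqv_trans (leqv_mapD _ _) _.
  by apply: leqv_add; [exact: leqv_mapZ|exact: leqv_refl].
Defined.

Lemma loc_functor_iso X Y (s : hom X Y) : S s -> is_iso (fmap loc_functor s).
Proof.
move=> Ss; exists (lcls (linv Ss)); split.
- by rewrite -[LHS]lcls_comp; apply/lclsP; exact: leqv_invl.
- by rewrite -[LHS]lcls_comp; apply/lclsP; exact: leqv_invr.
Qed.

Section Lift.
Variables (D : lincat k) (G : functor C D).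
Hypothesis GS : forall X Y (s : hom X Y), S s -> is_iso (fmap G s).

Fixpoint lterm_lift X Y (t : lterm X Y) : hom (G X) (G Y) :=
  match t with
  | lmap _ _ f => fmap G f
  | linv _ _ _ Ss => projT1 (cid (GS Ss))
  | lcomp _ _ _ g f => lterm_lift g \oc lterm_lift f
  | ladd _ _ f g => lterm_lift f + lterm_lift g
  | lscale _ _ c f => c *: lterm_lift f
  end.

Lemma lterm_lift_eqv X Y (t u : lterm X Y) : leqv t u -> lterm_lift t = lterm_lift u.
Proof.
elim=> {X Y t u} //=.
- by move=> X Y f g h _ -> _ ->.
- by move=> X Y Z g g' f f' _ -> _ ->.
- by move=> X Y f f' g g' _ -> _ ->.
- by move=> X Y c f f' _ ->.
- by move=> X Y f g h; rewrite addrA.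
- by move=> X Y f g; rewrite addrC.
- by move=> X Y f; rewrite fmap0 add0r.
- by move=> X Y f; rewrite scaleN1r addNr fmap0.
- by move=> X Y a b f; rewrite scalerA.
- by move=> X Y f; rewrite scale1r.
- by move=> X Y c f g; rewrite scalerDr.
- by move=> X Y a b f; rewrite scalerDl.
- by move=> X Y Z W h g f; rewrite compA.
- by move=> X Y f; rewrite fmap1 comp1l.
- by move=> X Y f; rewrite fmap1 comp1r.
- by move=> X Y Z g g' f; rewrite compDl.
- by move=> X Y Z g f f'; rewrite compDr.
- by move=> X Y Z c g f; rewrite compZl.
- by move=> X Y Z c g f; rewrite compZr.
- by move=> X Y Z g f; rewrite fmapM.
- by move=> X Y f g; rewrite fmapD.
- by move=> X Y c f; rewrite fmapZ.
- by move=> X Y s Ss; case: cid => g /= [-> _]; rewrite fmap1.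
- by move=> X Y s Ss; case: cid => g /= [_ ->]; rewrite fmap1.
Qed.

Definition loc_lift : functor localization D.
Proof.
exists (fun X : localization => G X) (fun X Y (f : loc_hom X Y) => lterm_lift (lrep f)).
- by move=> X; rewrite (lterm_lift_eqv (lrep_cls _)) /= fmap1.
- by move=> X Y Z g f; rewrite (lterm_lift_eqv (lrep_cls _)).
- move=> X Y c f g; rewrite loc_addE loc_scaleE.
  rewrite /loc_add (lterm_lift_eqv (lrep_cls _)) /=.
  by rewrite /loc_scale (lterm_lift_eqv (lrep_cls _)).
Defined.

Lemma loc_liftE X Y (f : hom X Y) : fmap loc_lift (fmap loc_functor f) = fmap G f.
Proof. exact: (lterm_lift_eqv (lrep_cls _)). Qed.
End Lift.
End Localization.

(* A right H-module of dimension n is k^n, as a space of row vectors, with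
   v . a = v *m mact a. *)
Record fdmod (k : fieldType) (H : falgType k) := FdMod {
  mdim : nat;
  mact : {linear H -> 'M[k]_mdim};
  mact1 : mact 1 = 1%:M;
  mactM : forall a b, mact (a * b) = mact a *m mact b
}.

(* The first two differentials of the bar complex C^n(H, Hom_k(X, Y)), n >= 0,
   whose cohomology is Ext^n_H(X, Y): the kernel of bar0 is Hom_H(X, Y) and
   Ext^1_H(X, Y) is the kernel of bar1 modulo the image of bar0. *)
Section BarComplex.
Variables (k : fieldType) (H : falgType k) (X Y : fdmod H).
Notation Homk := 'M[k]_(mdim X, mdim Y).

Definition bar0_fun (f : Homk) (a : H) : Homk := mact X a *m f - f *m mact Y a.

Fact bar0_fun_linear f : linear (bar0_fun f).
Proof.
move=> c a b; rewrite /bar0_fun (linearP (mact X)) (linearP (mact Y)) mulmxDl mulmxDr -scalemxAl -scalemxAr.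
by rewrite scalerBr opprD addrACA.
Qed.
HB.instance Definition _ f := GRing.isLinear.Build k H Homk _ (bar0_fun f) (bar0_fun_linear f).

Definition bar0_lfun (f : Homk) : 'Hom(H, Homk) := linfun (bar0_fun f).

Fact bar0_lfun_linear : linear bar0_lfun.
Proof.
move=> c f g; apply/lfunP => a.
rewrite add_lfunE scale_lfunE !lfunE /= /bar0_fun.
rewrite mulmxDr mulmxDl -scalemxAl -scalemxAr scalerBr opprD.
by rewrite addrACA.
Qed.
HB.instance Definition _ :=
  GRing.isLinear.Build k Homk 'Hom(H, Homk) _ bar0_lfun bar0_lfun_linear.

Definition bar0 : 'Hom(Homk, 'Hom(H, Homk)) := linfun bar0_lfun.

Lemma bar0E f a : bar0 f a = mact X a *m f - f *m mact Y a.
Proof.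
have -> : bar0 f = bar0_lfun f by exact: lfunE.
by have -> : bar0_lfun f a = bar0_fun f a by exact: lfunE.
Qed.

Definition bar1_fun2 (d : 'Hom(H, Homk)) (a b : H) : Homk :=
  mact X a *m d b - d (a * b) + d a *m mact Y b.

Fact bar1_fun2_linear d a : linear (bar1_fun2 d a).
Proof.
move=> c b b'; rewrite /bar1_fun2 mulrDr -scalerAr !(linearP d) (linearP (mact Y)) !mulmxDr.
rewrite -!scalemxAr opprD [X in X + _]addrACA !scalerDr scalerN.
by rewrite [LHS]addrACA.
Qed.
HB.instance Definition _ d a :=
  GRing.isLinear.Build k H Homk _ (bar1_fun2 d a) (bar1_fun2_linear d a).

Definition bar1_fun (d : 'Hom(H, Homk)) (a : H) : 'Hom(H, Homk) := linfun (bar1_fun2 d a).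

Fact bar1_fun_linear d : linear (bar1_fun d).
Proof.
move=> c a a'; apply/lfunP => b; rewrite add_lfunE scale_lfunE !lfunE /= /bar1_fun2.
rewrite mulrDl -scalerAl !(linearP d) (linearP (mact X)) !mulmxDl -!scalemxAl opprD.
rewrite [X in X + _]addrACA !scalerDr scalerN.
by rewrite [LHS]addrACA.
Qed.
HB.instance Definition _ d :=
  GRing.isLinear.Build k H 'Hom(H, Homk) _ (bar1_fun d) (bar1_fun_linear d).

Definition bar1_lfun (d : 'Hom(H, Homk)) : 'Hom(H, 'Hom(H, Homk)) := linfun (bar1_fun d).

Fact bar1_lfun_linear : linear bar1_lfun.
Proof.
move=> c d d'; apply/lfunP => a; apply/lfunP => b.
have E1 d0 : bar1_lfun d0 a = bar1_fun d0 a by exact: lfunE.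
have E2 d0 : bar1_fun d0 a b = bar1_fun2 d0 a b by exact: lfunE.
rewrite add_lfunE scale_lfunE !E1 add_lfunE scale_lfunE !E2 /bar1_fun2.
rewrite !add_lfunE !scale_lfunE mulmxDr mulmxDl -scalemxAl -scalemxAr opprD.
rewrite [X in X + _]addrACA !scalerDr scalerN.
by rewrite [LHS]addrACA.
Qed.
HB.instance Definition _ :=
  GRing.isLinear.Build k 'Hom(H, Homk) 'Hom(H, 'Hom(H, Homk)) _ bar1_lfun bar1_lfun_linear.

Definition bar1 : 'Hom('Hom(H, Homk), 'Hom(H, 'Hom(H, Homk))) := linfun bar1_lfun.

Lemma bar1E d a b : bar1 d a b = mact X a *m d b - d (a * b) + d a *m mact Y b.
Proof.
have -> : bar1 d = bar1_lfun d by exact: lfunE.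
have -> : bar1_lfun d a = bar1_fun d a by exact: lfunE.
by have -> : bar1_fun d a b = bar1_fun2 d a b by exact: lfunE.
Qed.

Lemma bar1_bar0 : (limg bar0 <= lker bar1)%VS.
Proof.
apply/subvP => _ /memv_imgP[f _ ->]; rewrite memv_ker; apply/eqP/lfunP => a.
apply/lfunP => b; rewrite !zero_lfunE bar1E !bar0E !mactM.
rewrite mulmxBr mulmxBl !mulmxA opprB [X in X + _]addrC !addrA.
by rewrite subrK subrK subrr.
Qed.

(* Hom_H(X, Y) *)
Definition homsp : {vspace Homk} := lker bar0.

Lemma mem_homsp f : (f \in homsp) <-> (forall a, mact X a *m f = f *m mact Y a).
Proof.
rewrite memv_ker; split=> [/eqP f0 a|fXY].
  by apply/eqP; rewrite -subr_eq0 -bar0E f0 zero_lfunE.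
by apply/eqP/lfunP => a; rewrite bar0E fXY subrr zero_lfunE.
Qed.

Definition modhom := subvs_of homsp.

Definition mk_modhom f (fXY : forall a, mact X a *m f = f *m mact Y a) : modhom :=
  Subvs (introT idP ((mem_homsp f).2 fXY)).

Lemma modhomP (f : modhom) a : mact X a *m vsval f = vsval f *m mact Y a.
Proof. exact: (mem_homsp (vsval f)).1 (subvsP f) a. Qed.

End BarComplex.

(* The quotient Z / B of subspaces B <= Z of V, carried by a complement of B in Z;
   qcls is the projection Z -> Z / B. *)
Section Quotient.
Variables (k : fieldType) (V : vectType k) (Z B : {vspace V}).

Definition quotv := subvs_of (Z :\: B)%VS.

Definition qcls (v : V) : quotv := vsproj (Z :\: B)%VS (addv_pi1 Z B v).

Fact qcls_linear : linear qcls.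
Proof. by move=> c u v; rewrite /qcls !linearP. Qed.
HB.instance Definition _ := GRing.isLinear.Build k V quotv _ qcls qcls_linear.

Lemma memv_quot (x : quotv) : vsval x \in Z.
Proof. exact: subvP (diffvSl Z B) _ (subvsP x). Qed.

Lemma qclsK (x : quotv) : qcls (vsval x) = x.
Proof. by rewrite /qcls daddv_pi_id ?capv_diff ?subvsP// vsvalK. Qed.

Lemma qcls_sub v : v \in Z -> v - vsval (qcls v) \in B.
Proof.
move=> vZ; rewrite /qcls vsprojK ?memv_pi//.
have vZB : v \in (Z + B)%VS by exact: subvP (addvSl Z B) _ vZ.
by rewrite -{1}(addv_pi1_pi2 vZB) addrAC subrr add0r memv_pi2.
Qed.

Lemma qcls_eq0 v : v \in B -> qcls v = 0.
Proof.
move=> vB; have vZB : v \in (Z + B)%VS by exact: subvP (addvSr Z B) _ vB.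
have := addv_pi1_pi2 vZB; rewrite addv_pi2_id// -[RHS]add0r => /addIr e.
by rewrite /qcls e linear0.
Qed.

Lemma qcls_eq u v : u - v \in B -> qcls u = qcls v.
Proof. by move=> uvB; apply/eqP; rewrite -subr_eq0 -linearB /= qcls_eq0. Qed.
End Quotient.

Section Modules.
Variables (k : fieldType) (H : falgType k).
Implicit Types X Y Z : fdmod H.

Fact modhom_id_proof X a : mact X a *m 1%:M = 1%:M *m mact X a.
Proof. by rewrite mulmx1 mul1mx. Qed.
Definition modhom_id X : modhom X X := mk_modhom (@modhom_id_proof X).

Fact modhom_comp_proof X Y Z (g : modhom Y Z) (f : modhom X Y) a :
  mact X a *m (vsval f *m vsval g) = (vsval f *m vsval g) *m mact Z a.
Proof. by rewrite mulmxA (modhomP f) -!mulmxA (modhomP g). Qed.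
Definition modhom_comp X Y Z (g : modhom Y Z) (f : modhom X Y) : modhom X Z :=
  mk_modhom (modhom_comp_proof g f).

Fact modhom_compA X Y Z W (h : modhom Z W) (g : modhom Y Z) (f : modhom X Y) :
  modhom_comp h (modhom_comp g f) = modhom_comp (modhom_comp h g) f.
Proof. by apply: val_inj; rewrite /= mulmxA. Qed.
Fact modhom_comp1l X Y (f : modhom X Y) : modhom_comp (modhom_id Y) f = f.
Proof. by apply: val_inj; rewrite /= mulmx1. Qed.
Fact modhom_comp1r X Y (f : modhom X Y) : modhom_comp f (modhom_id X) = f.
Proof. by apply: val_inj; rewrite /= mul1mx. Qed.
Fact modhom_comp_linl X Y Z c (g g' : modhom Y Z) (f : modhom X Y) :
  modhom_comp (c *: g + g') f = c *: modhom_comp g f + modhom_comp g' f.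
Proof. by apply: val_inj; rewrite /= mulmxDr -scalemxAr. Qed.
Fact modhom_comp_linr X Y Z c (g : modhom Y Z) (f f' : modhom X Y) :
  modhom_comp g (c *: f + f') = c *: modhom_comp g f + modhom_comp g f'.
Proof. by apply: val_inj; rewrite /= mulmxDl -scalemxAl. Qed.

End Modules.

Definition modcat (k : fieldType) (H : falgType k) : lincat k :=
  @LinCat k (fdmod H) (fun X Y => modhom X Y) (@modhom_id k H) (@modhom_comp k H)
    (@modhom_compA k H) (@modhom_comp1l k H) (@modhom_comp1r k H)
    (@modhom_comp_linl k H) (@modhom_comp_linr k H).

Section RightAction.
Variables (k : fieldType) (H : falgType k).

Record raction (W : vectType k) := RAction {
  ract :> W -> H -> W;
  ract_linl : forall a, linear (ract^~ a);
  ract_linr : forall w, linear (ract w);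
  ract1 : forall w, ract w 1 = w;
  ractM : forall w a b, ract w (a * b) = ract (ract w a) b
}.

Section ModOf.
Variables (W : vectType k) (r : raction W).

Definition mod_of_act (a : H) : 'M[k]_(dim W) :=
  \matrix_i v2r (r (r2v (delta_mx 0 i)) a).

Let ract_at a (w : W) : W := r w a.
HB.instance Definition _ a := GRing.isLinear.Build k W W _ (ract_at a) (ract_linl r a).

Lemma mod_of_actE a (w : W) : v2r w *m mod_of_act a = v2r (r w a).
Proof.
rewrite mulmx_sum_row -[r w a]/(ract_at a w) -{2}(v2rK w) {2}[v2r w]row_sum_delta.
rewrite !linear_sum /=; apply: eq_bigr => i _.
by rewrite rowK !linearZ.
Qed.

Fact mod_of_act_linear : linear mod_of_act.
Proof.
move=> c a b; apply/row_matrixP => i.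
by rewrite linearP /= !rowK ract_linr linearP.
Qed.
HB.instance Definition _ :=
  GRing.isLinear.Build k H 'M[k]_(dim W) _ mod_of_act mod_of_act_linear.

Fact mod_of_act1 : mod_of_act 1 = 1%:M.
Proof. by apply/row_matrixP => i; rewrite rowK ract1 r2vK row1. Qed.

Fact mod_of_actM a b : mod_of_act (a * b) = mod_of_act a *m mod_of_act b.
Proof.
by apply/row_matrixP => i; rewrite row_mul !rowK ractM mod_of_actE.
Qed.

Definition mod_of : fdmod H := FdMod mod_of_act1 mod_of_actM.

Lemma mod_ofE a (w : W) : v2r w *m mact mod_of a = v2r (r w a).
Proof. exact: mod_of_actE. Qed.
End ModOf.

Section HomOf.
Variables (W W' : vectType k) (r : raction W) (r' : raction W') (f : 'Hom(W, W')).
Hypothesis fr : forall w a, f (r w a) = r' (f w) a.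

Lemma f2mxE (U U' : vectType k) (g : 'Hom(U, U')) u : v2r u *m f2mx g = v2r (g u).
Proof. by rewrite unlock /= r2vK. Qed.

Fact hom_of_proof a :
  mact (mod_of r) a *m f2mx f = f2mx f *m mact (mod_of r') a.
Proof.
apply/row_matrixP => i; rewrite !rowE !mulmxA -[delta_mx 0 i](@r2vK _ W).
by rewrite mod_ofE !f2mxE mod_ofE fr.
Qed.

Definition hom_of : modhom (mod_of r) (mod_of r') :=
  @mk_modhom k H (mod_of r) (mod_of r') (f2mx f) hom_of_proof.
End HomOf.
End RightAction.

Section ModuleTheory.
Variables (k : fieldType) (H : falgType k).
Implicit Types X Y P Q T : modcat H.

Definition mapp X Y (f : hom X Y) (v : 'rV[k]_(mdim X)) : 'rV[k]_(mdim Y) :=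
  v *m vsval f.

Lemma vsval_comp X Y Z (g : hom Y Z) (f : hom X Y) :
  vsval (g \oc f : modhom X Z) = vsval f *m vsval g.
Proof. by []. Qed.
Lemma vsval_lin X Y c (f g : hom X Y) :
  vsval (c *: f + g : modhom X Y) = c *: vsval f + vsval g.
Proof. by []. Qed.

Definition mono X Y (f : hom X Y) : Prop := injective (mapp f).
Definition epi X Y (f : hom X Y) : Prop := forall w, exists v, mapp f v = w.

Definition projective P : Prop :=
  forall X Y (p : hom X Y) (f : hom P Y), epi p -> exists g : hom P X, p \oc g = f.

Definition hereditary : Prop :=
  forall P Q (i : hom Q P), projective P -> mono i -> projective Q.

Definition reg_fun (x a : H) : H := x * a.
Fact reg_linl a : linear (reg_fun^~ a).
Proof. by move=> c x y; rewrite /reg_fun mulrDl -scalerAl. Qed.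
Fact reg_linr x : linear (reg_fun x).
Proof. by move=> c a b; rewrite /reg_fun mulrDr -scalerAr. Qed.
Definition reg_act : raction H H :=
  RAction reg_linl reg_linr (@mulr1 H) (@mulrA H).
Definition regmod : modcat H := mod_of reg_act.

Fact lmul_proof a (x b : H) : amull a (reg_act x b) = reg_act (amull a x) b.
Proof. by rewrite !lfunE /= /reg_fun mulrA. Qed.
Definition lmul a : hom regmod regmod := hom_of (lmul_proof a).

(* DH, with (phi . a)(x) = phi(ax) *)
Definition dual_fun (phi : 'Hom(H, k^o)) (a : H) : 'Hom(H, k^o) := (phi \o amull a)%VF.
Fact dual_linl a : linear (dual_fun^~ a).
Proof. by move=> c x y; rewrite /dual_fun comp_lfunDl comp_lfunZl. Qed.
Fact dual_linr x : linear (dual_fun x).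
Proof. by move=> c a b; rewrite /dual_fun linearP comp_lfunDr comp_lfunZr. Qed.
Fact dual_1 x : dual_fun x 1 = x.
Proof. by rewrite /dual_fun amull1 comp_lfun1r. Qed.
Fact dual_M x a b : dual_fun x (a * b) = dual_fun (dual_fun x a) b.
Proof.
by apply/lfunP => y; rewrite /dual_fun !comp_lfunE !lfunE /= mulrA.
Qed.
Definition dual_act : raction H 'Hom(H, k^o) := RAction dual_linl dual_linr dual_1 dual_M.
Definition dualmod : modcat H := mod_of dual_act.

(* the left action of H on DH, (a . phi)(x) = phi(xa) *)
Definition dual_lmul_fun (a : H) (phi : 'Hom(H, k^o)) : 'Hom(H, k^o) :=
  (phi \o amulr a)%VF.
Fact dual_lmul_linear a : linear (dual_lmul_fun a).
Proof. by move=> c x y; rewrite /dual_lmul_fun comp_lfunDl comp_lfunZl. Qed.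
HB.instance Definition _ a :=
  GRing.isLinear.Build k 'Hom(H, k^o) 'Hom(H, k^o) _ (dual_lmul_fun a) (dual_lmul_linear a).
Fact dual_lmul_proof a (phi : 'Hom(H, k^o)) b :
  linfun (dual_lmul_fun a) (dual_act phi b) = dual_act (linfun (dual_lmul_fun a) phi) b.
Proof.
have E x : linfun (dual_lmul_fun a) x = dual_lmul_fun a x by exact: lfunE.
apply/lfunP => x; rewrite !E /= /dual_lmul_fun /dual_fun !comp_lfunE !lfunE /=.
by rewrite mulrA.
Qed.
Definition dual_lmul a : hom dualmod dualmod := hom_of (@dual_lmul_proof a).

Lemma dual_lmulE a (phi : 'Hom(H, k^o)) : v2r phi *m vsval (dual_lmul a) = v2r (dual_lmul_fun a phi).
Proof. by rewrite [LHS]f2mxE lfunE. Qed.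

Lemma dual_mx_eq n (A B : 'M[k]_(mdim dualmod, n)) :
  (forall phi : 'Hom(H, k^o), v2r phi *m A = v2r phi *m B) -> A = B.
Proof.
move=> AB; apply/row_matrixP => i.
by rewrite !rowE -[delta_mx 0 i](@r2vK _ 'Hom(H, k^o)) AB.
Qed.

Lemma dual_lmul1 : dual_lmul 1 = idm dualmod.
Proof.
apply: subvs_inj; apply: dual_mx_eq => phi; rewrite dual_lmulE mulmx1.
by congr v2r; apply/lfunP => x; rewrite comp_lfunE lfunE /= mulr1.
Qed.
Lemma dual_lmulM a b : dual_lmul (a * b) = dual_lmul a \oc dual_lmul b.
Proof.
apply: subvs_inj; apply: dual_mx_eq => phi.
rewrite dual_lmulE vsval_comp mulmxA !dual_lmulE; congr v2r; apply/lfunP => x.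
by rewrite !comp_lfunE !lfunE /= mulrA.
Qed.
Lemma dual_lmul_linr : linear dual_lmul.
Proof.
move=> c a b; apply: subvs_inj; apply: dual_mx_eq => phi.
rewrite dual_lmulE vsval_lin mulmxDr -scalemxAr !dual_lmulE -(linearP v2r).
congr v2r; apply/lfunP => x.
by rewrite add_lfunE scale_lfunE !comp_lfunE !lfunE /= mulrDr -scalerAr linearP.
Qed.
End ModuleTheory.

Section Ext1.
Variables (k : fieldType) (H : falgType k).

Definition ext1 (X Y : modcat H) := quotv (lker (bar1 X Y)) (limg (bar0 X Y)).

Section Cochain.
Variables (X Y X' Y' : modcat H) (u : hom X' X) (w : hom Y Y').
Notation Homk := 'M[k]_(mdim X, mdim Y).
Notation Homk' := 'M[k]_(mdim X', mdim Y').

Definition ext1_cochain_fun (d : 'Hom(H, Homk)) (a : H) : Homk' :=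
  vsval u *m d a *m vsval w.
Fact ext1_cochain_fun_linear d : linear (ext1_cochain_fun d).
Proof.
move=> c a b; rewrite /ext1_cochain_fun (linearP d) mulmxDr mulmxDl.
by rewrite -scalemxAr -scalemxAl.
Qed.
HB.instance Definition _ d :=
  GRing.isLinear.Build k H Homk' _ (ext1_cochain_fun d) (ext1_cochain_fun_linear d).

Definition ext1_cochain (d : 'Hom(H, Homk)) : 'Hom(H, Homk') := linfun (ext1_cochain_fun d).

Lemma ext1_cochainE d a : ext1_cochain d a = vsval u *m d a *m vsval w.
Proof. exact: lfunE. Qed.

Fact ext1_cochain_linear : linear ext1_cochain.
Proof.
move=> c d d'; apply/lfunP => a.
rewrite add_lfunE scale_lfunE !ext1_cochainE add_lfunE scale_lfunE.
by rewrite mulmxDr mulmxDl -scalemxAr -scalemxAl.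
Qed.
HB.instance Definition _ :=
  GRing.isLinear.Build k 'Hom(H, Homk) 'Hom(H, Homk') _ ext1_cochain ext1_cochain_linear.

Lemma ext1_cochain_ker d : d \in lker (bar1 X Y) -> ext1_cochain d \in lker (bar1 X' Y').
Proof.
rewrite !memv_ker => /eqP d0; apply/eqP/lfunP => a; apply/lfunP => b.
have := bar1E d a b; rewrite d0 !zero_lfunE bar1E !ext1_cochainE => e.
rewrite !mulmxA (modhomP u) -!mulmxA -(modhomP w) !mulmxA.
have -> : vsval u *m mact X a *m d b *m vsval w =
    vsval u *m (mact X a *m d b) *m vsval w by rewrite !mulmxA.
have -> : vsval u *m d a *m mact Y b *m vsval w =
    vsval u *m (d a *m mact Y b) *m vsval w by rewrite !mulmxA.
by rewrite -mulmxBl -mulmxBr -mulmxDl -mulmxDr -e mulmx0 mul0mx.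
Qed.

Lemma ext1_cochain_img d : d \in limg (bar0 X Y) -> ext1_cochain d \in limg (bar0 X' Y').
Proof.
move=> /memv_imgP[f _ ->]; apply/memv_imgP.
exists (vsval u *m f *m vsval w); rewrite ?memvf//.
apply/lfunP => a; rewrite bar0E ext1_cochainE bar0E mulmxBr mulmxBl !mulmxA.
by rewrite (modhomP u) -!mulmxA -(modhomP w).
Qed.

Definition ext1_map (x : ext1 X Y) : ext1 X' Y' :=
  qcls (lker (bar1 X' Y')) (limg (bar0 X' Y')) (ext1_cochain (vsval x)).

Fact ext1_map_linear : linear ext1_map.
Proof. by move=> c x y; rewrite /ext1_map !linearP. Qed.
HB.instance Definition _ :=
  GRing.isLinear.Build k (ext1 X Y) (ext1 X' Y') _ ext1_map ext1_map_linear.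

Lemma ext1_map_cls d : d \in lker (bar1 X Y) ->
  ext1_map (qcls (lker (bar1 X Y)) (limg (bar0 X Y)) d) =
  qcls (lker (bar1 X' Y')) (limg (bar0 X' Y')) (ext1_cochain d).
Proof.
move=> dZ; apply/esym/qcls_eq; rewrite -linearB; apply: ext1_cochain_img.
exact: qcls_sub.
Qed.
End Cochain.

Lemma ext1_map_id X Y (x : ext1 X Y) : ext1_map (idm X) (idm Y) x = x.
Proof.
rewrite -[RHS]qclsK; congr qcls; apply/lfunP => a.
by rewrite ext1_cochainE mul1mx mulmx1.
Qed.

Lemma ext1_map_comp X Y X' Y' X'' Y'' (u : hom X' X) (u' : hom X'' X')
    (w : hom Y Y') (w' : hom Y' Y'') (x : ext1 X Y) :
  ext1_map u' w' (ext1_map u w x) = ext1_map (u \oc u') (w' \oc w) x.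
Proof.
rewrite [ext1_map u w x]/(qcls _ _ _) ext1_map_cls; last first.
  by apply: ext1_cochain_ker; exact: memv_quot.
congr qcls; apply/lfunP => a; rewrite !ext1_cochainE.
by rewrite !vsval_comp !mulmxA.
Qed.

Lemma ext1_map_linl X Y X' Y' (w : hom Y Y') (x : ext1 X Y) :
  linear (fun u : hom X' X => ext1_map u w x).
Proof.
move=> c u v; rewrite /ext1_map -linearP; congr qcls; apply/lfunP => a.
rewrite add_lfunE scale_lfunE !ext1_cochainE vsval_lin.
by rewrite !mulmxDl -!scalemxAl.
Qed.

Lemma ext1_map_linr X Y X' Y' (u : hom X' X) (x : ext1 X Y) :
  linear (fun w : hom Y Y' => ext1_map u w x).
Proof.
move=> c w w'; rewrite /ext1_map -linearP; congr qcls; apply/lfunP => a.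
rewrite add_lfunE scale_lfunE !ext1_cochainE vsval_lin.
by rewrite !mulmxDr -!scalemxAr.
Qed.

(* The functor tau^-1 = Ext^1_H(DH, -) : mod H -> mod H, where H acts on
   Ext^1_H(DH, Y) on the right by precomposition with its left action on DH. *)
Section TauInv.
Variable Y : modcat H.

Definition tau_inv_fun (x : ext1 (dualmod H) Y) (a : H) : ext1 (dualmod H) Y :=
  ext1_map (dual_lmul a) (idm Y) x.
Fact tau_inv_linl a : linear (tau_inv_fun^~ a).
Proof. by move=> c x y; rewrite /tau_inv_fun linearP. Qed.
Fact tau_inv_linr x : linear (tau_inv_fun x).
Proof. by move=> c a b; rewrite /tau_inv_fun dual_lmul_linr ext1_map_linl. Qed.
Fact tau_inv_1 x : tau_inv_fun x 1 = x.
Proof. by rewrite /tau_inv_fun dual_lmul1 ext1_map_id. Qed.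
Fact tau_inv_M x a b : tau_inv_fun x (a * b) = tau_inv_fun (tau_inv_fun x a) b.
Proof. by rewrite /tau_inv_fun ext1_map_comp dual_lmulM comp1l. Qed.

Definition tau_inv_act : raction H (ext1 (dualmod H) Y) :=
  RAction tau_inv_linl tau_inv_linr tau_inv_1 tau_inv_M.
Definition tau_inv_obj : modcat H := mod_of tau_inv_act.
End TauInv.

Fact tau_inv_map_proof Y Y' (w : hom Y Y') x a :
  linfun (ext1_map (idm (dualmod H)) w) (tau_inv_act Y x a) =
  tau_inv_act Y' (linfun (ext1_map (idm (dualmod H)) w) x) a.
Proof.
have E y : linfun (ext1_map (idm (dualmod H)) w) y = ext1_map (idm (dualmod H)) w y.
  exact: lfunE.
by rewrite !E /= /tau_inv_fun !ext1_map_comp !comp1l !comp1r.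
Qed.

Definition tau_inv_map Y Y' (w : hom Y Y') : hom (tau_inv_obj Y) (tau_inv_obj Y') :=
  hom_of (tau_inv_map_proof w).

Lemma tau_inv_mapE Y Y' (w : hom Y Y') (x : ext1 (dualmod H) Y) :
  v2r x *m vsval (tau_inv_map w) = v2r (ext1_map (idm (dualmod H)) w x).
Proof. by rewrite [LHS]f2mxE lfunE. Qed.

Lemma tau_inv_mx_eq Y n (A B : 'M[k]_(mdim (tau_inv_obj Y), n)) :
  (forall x : ext1 (dualmod H) Y, v2r x *m A = v2r x *m B) -> A = B.
Proof.
move=> AB; apply/row_matrixP => i.
by rewrite !rowE -[delta_mx 0 i](@r2vK _ (ext1 (dualmod H) Y)) AB.
Qed.

Definition tau_inv : functor (modcat H) (modcat H).
Proof.
exists tau_inv_obj tau_inv_map.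
- move=> Y; apply: subvs_inj; apply: tau_inv_mx_eq => x.
  by rewrite tau_inv_mapE ext1_map_id mulmx1.
- move=> X Y Z g f; apply: subvs_inj; apply: tau_inv_mx_eq => x.
  rewrite tau_inv_mapE vsval_comp.
  by rewrite mulmxA !tau_inv_mapE ext1_map_comp comp1l.
- move=> X Y c f g; apply: subvs_inj; apply: tau_inv_mx_eq => x.
  rewrite tau_inv_mapE ext1_map_linr linearP vsval_lin mulmxDr -scalemxAr.
  by rewrite !tau_inv_mapE.
Defined.
End Ext1.

Section AuslanderReiten.
Variables (k : fieldType) (H : falgType k).
Implicit Types X Y P Q T : modcat H.

(* f is onto the submodule U (a set of vectors) and f is minimal as a map to U,
   i.e., g is onto as soon as f g : Z -> U is *)
Definition minimal_onto X Y (f : hom X Y) (U : 'rV[k]_(mdim Y) -> Prop) : Prop :=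
  (forall y, U y <-> exists x, mapp f x = y) /\
  (forall Z (g : hom Z X), (forall y, U y -> exists z, mapp (f \oc g) z = y) -> epi g).

(* P1 -d-> P0 -p-> T -> 0 is a minimal projective presentation of T *)
Definition min_presentation P1 P0 T (d : hom P1 P0) (p : hom P0 T) : Prop :=
  [/\ projective P1, projective P0, minimal_onto p (fun _ => True)
    & minimal_onto d (fun x => mapp p x = 0)].

(* Hom_H(P, H) as a left module, with a . f = (left multiplication by a) o f *)
Definition star P := modhom P (regmod H).
Definition star_lmul_fun P (a : H) (f : star P) : star P := lmul a \oc (f : hom P (regmod H)).
Fact star_lmul_fun_linear P a : linear (@star_lmul_fun P a).
Proof. by move=> c f g; exact: (comp_linr c (lmul a) f g). Qed.
HB.instance Definition _ P a :=
  GRing.isLinear.Build k (star P) (star P) _ (@star_lmul_fun P a) (@star_lmul_fun_linear P a).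
Definition star_lmul P (a : H) : 'End(star P) := linfun (@star_lmul_fun P a).

Lemma reg_mx_eq n (A B : 'M[k]_(mdim (regmod H), n)) :
  (forall x : H, v2r x *m A = v2r x *m B) -> A = B.
Proof.
move=> AB; apply/row_matrixP => i.
by rewrite !rowE -[delta_mx 0 i](@r2vK _ H) AB.
Qed.

Lemma lmulE a (x : H) : v2r x *m vsval (lmul a) = v2r (a * x).
Proof. by rewrite [LHS]f2mxE lfunE. Qed.

Lemma lmul1 : lmul (1 : H) = idm (regmod H).
Proof.
by apply: subvs_inj; apply: reg_mx_eq => x; rewrite lmulE mulmx1 mul1r.
Qed.
Lemma lmulM (a b : H) : lmul (a * b) = lmul a \oc lmul b.
Proof.
apply: subvs_inj; apply: reg_mx_eq => x.
by rewrite lmulE vsval_comp mulmxA !lmulE mulrA.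
Qed.
Lemma lmul_lin : linear (@lmul k H).
Proof.
move=> c a b; apply: subvs_inj; apply: reg_mx_eq => x.
by rewrite lmulE vsval_lin mulmxDr -scalemxAr !lmulE mulrDl -scalerAl linearP.
Qed.

Lemma star_lmulE P a (f : star P) : star_lmul P a f = lmul a \oc (f : hom P (regmod H)).
Proof. exact: lfunE. Qed.

Fact star_lmul_lin P : linear (star_lmul P).
Proof.
move=> c a b; apply/lfunP => f.
by rewrite add_lfunE scale_lfunE !star_lmulE lmul_lin comp_linl.
Qed.

Fact star_lmul1 P : star_lmul P 1 = \1%VF.
Proof. by apply/lfunP => f; rewrite star_lmulE lmul1 id_lfunE comp1l. Qed.

Fact star_lmulM P a b : star_lmul P (a * b) = (star_lmul P a \o star_lmul P b)%VF.
Proof.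
by apply/lfunP => f; rewrite comp_lfunE !star_lmulE lmulM compA.
Qed.

(* the Nakayama functor nu P = D Hom_H(P, H) *)
Definition nu P := 'Hom(star P, k^o).

Definition star_map_fun P1 P0 (d : hom P1 P0) (g : star P0) : star P1 :=
  (g : hom P0 (regmod H)) \oc d.
Fact star_map_fun_linear P1 P0 (d : hom P1 P0) : linear (star_map_fun d).
Proof. by move=> c f g; exact: (comp_linl c (f : hom P0 (regmod H)) (g : hom P0 (regmod H)) d). Qed.
HB.instance Definition _ P1 P0 (d : hom P1 P0) :=
  GRing.isLinear.Build k (star P0) (star P1) _ (star_map_fun d) (star_map_fun_linear d).
Definition star_map P1 P0 (d : hom P1 P0) : 'Hom(star P0, star P1) :=
  linfun (star_map_fun d).

Lemma star_mapE P1 P0 (d : hom P1 P0) (g : star P0) :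
  star_map d g = (g : hom P0 (regmod H)) \oc d.
Proof. exact: lfunE. Qed.

Definition nu_map_fun P1 P0 (d : hom P1 P0) (phi : nu P1) : nu P0 := (phi \o star_map d)%VF.
Fact nu_map_fun_linear P1 P0 (d : hom P1 P0) : linear (nu_map_fun d).
Proof. by move=> c x y; rewrite /nu_map_fun comp_lfunDl comp_lfunZl. Qed.
HB.instance Definition _ P1 P0 (d : hom P1 P0) :=
  GRing.isLinear.Build k (nu P1) (nu P0) _ (nu_map_fun d) (nu_map_fun_linear d).
Definition nu_map P1 P0 (d : hom P1 P0) : 'Hom(nu P1, nu P0) := linfun (nu_map_fun d).

Lemma nu_mapE P1 P0 (d : hom P1 P0) (phi : nu P1) :
  nu_map d phi = (phi \o star_map d)%VF.
Proof. exact: lfunE. Qed.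

(* D Tr of the cokernel of d : P1 -> P0, as the kernel of nu d : nu P1 -> nu P0 *)
Section DTr.
Variables (P1 P0 : modcat H) (d : hom P1 P0).

Definition dtr_space := subvs_of (lker (nu_map d)).

Fact dtr_stable (x : dtr_space) a : (vsval x \o star_lmul P1 a)%VF \in lker (nu_map d).
Proof.
have := subvsP x; rewrite !memv_ker !nu_mapE => /eqP x0.
apply/eqP/lfunP => g; rewrite zero_lfunE !comp_lfunE star_mapE star_lmulE.
have -> : lmul a \oc ((g : hom P0 (regmod H)) \oc d) = star_map d (star_lmul P0 a g).
  by rewrite star_mapE star_lmulE compA.
by have := congr1 (fun h : nu P0 => h (star_lmul P0 a g)) x0; rewrite comp_lfunE zero_lfunE.
Qed.

Definition dtr_fun (x : dtr_space) (a : H) : dtr_space := Subvs (dtr_stable x a).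

Fact dtr_linl a : linear (dtr_fun^~ a).
Proof.
by move=> c x y; apply: subvs_inj; rewrite /= comp_lfunDl comp_lfunZl.
Qed.
Fact dtr_linr x : linear (dtr_fun x).
Proof.
move=> c a b; apply: subvs_inj => /=.
by rewrite star_lmul_lin comp_lfunDr comp_lfunZr.
Qed.
Fact dtr_1 x : dtr_fun x 1 = x.
Proof. by apply: subvs_inj; rewrite /= star_lmul1 comp_lfun1r. Qed.
Fact dtr_M x a b : dtr_fun x (a * b) = dtr_fun (dtr_fun x a) b.
Proof. by apply: subvs_inj; rewrite /= star_lmulM comp_lfunA. Qed.

Definition dtr : modcat H := mod_of (RAction dtr_linl dtr_linr dtr_1 dtr_M).
End DTr.

(* X is the Auslander-Reiten translate tau T = D Tr T *)
Definition is_tau T X : Prop :=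
  exists P1 P0 (d : hom P1 P0) (p : hom P0 T), min_presentation d p /\ isomorphic X (dtr d).

Definition tau_rigid T : Prop :=
  exists X, is_tau T X /\ forall f : hom T X, f = 0.

Definition support_tau_tilting T P : Prop :=
  [/\ tau_rigid T, projective P, forall f : hom P T, f = 0
    & exists t p, [/\ num_summands T t, num_summands P p & num_summands (regmod H) (t + p)]].
End AuslanderReiten.

Section SmallModules.
Variables (k : fieldType) (H : falgType k).

Definition zeromod_act (a : H) : 'M[k]_0 := 0.
Fact zeromod_act_linear : linear zeromod_act.
Proof. by move=> c a b; rewrite /zeromod_act scaler0 addr0. Qed.
HB.instance Definition _ :=
  GRing.isLinear.Build k H 'M[k]_0 _ zeromod_act zeromod_act_linear.
Fact zeromod_act1 : zeromod_act 1 = 1%:M. Proof. by rewrite [RHS]flatmx0 [LHS]flatmx0. Qed.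
Fact zeromod_actM a b : zeromod_act (a * b) = zeromod_act a *m zeromod_act b.
Proof. by rewrite [RHS]flatmx0 [LHS]flatmx0. Qed.
Definition zeromod : modcat H := FdMod zeromod_act1 zeromod_actM.

Section DirectSum.
Variables X Y : modcat H.

Definition dsum_act (a : H) : 'M[k]_(mdim X + mdim Y) :=
  block_mx (mact X a) 0 0 (mact Y a).
Fact dsum_act_linear : linear dsum_act.
Proof.
move=> c a b; rewrite /dsum_act !linearP scale_block_mx add_block_mx.
by rewrite !scaler0 !addr0.
Qed.
HB.instance Definition _ :=
  GRing.isLinear.Build k H 'M[k]_(mdim X + mdim Y) _ dsum_act dsum_act_linear.
Fact dsum_act1 : dsum_act 1 = 1%:M.
Proof. by rewrite /dsum_act !mact1 -scalar_mx_block. Qed.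
Fact dsum_actM a b : dsum_act (a * b) = dsum_act a *m dsum_act b.
Proof.
by rewrite /dsum_act mulmx_block !mactM !mul0mx !mulmx0 !addr0 add0r.
Qed.
Definition dsum : modcat H := FdMod dsum_act1 dsum_actM.

(* the map X (+) Y -> Z equal to f on X and g on Y *)
Variables (Z : modcat H) (f : hom X Z) (g : hom Y Z).
Fact dsum_map_proof a :
  mact dsum a *m col_mx (vsval f) (vsval g) = col_mx (vsval f) (vsval g) *m mact Z a.
Proof.
rewrite [mact dsum a]/(block_mx _ _ _ _) mul_block_col mul_col_mx.
by rewrite !mul0mx addr0 add0r !modhomP.
Qed.
Definition dsum_map : hom dsum Z :=
  @mk_modhom k H dsum Z (col_mx (vsval f) (vsval g)) dsum_map_proof.
End DirectSum.
End SmallModules.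

Section Complexes.
Variables (k : fieldType) (H : falgType k).

Record cplx := Cplx {
  cob :> int -> modcat H;
  cdiff : forall i, hom (cob i) (cob (i + 1));
  cdiff2 : forall i, cdiff (i + 1) \oc cdiff i = 0;
  cbounded : exists n : nat, forall i : int, (n < absz i)%N -> mdim (cob i) = 0%N
}.

Definition is_chain (X Y : cplx) (f : dprodv (fun i => hom (X i) (Y i))) : Prop :=
  forall i, f (i + 1) \oc cdiff X i = cdiff Y i \oc f i.

Fact is_chain0 (X Y : cplx) : is_chain (0 : dprodv (fun i => hom (X i) (Y i))).
Proof. by move=> i; rewrite [LHS]comp0l [RHS]comp0r. Qed.
Fact is_chainL (X Y : cplx) a (f g : dprodv (fun i => hom (X i) (Y i))) :
  is_chain f -> is_chain g -> is_chain (a *: f + g).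
Proof.
by move=> fP gP i; rewrite [LHS]comp_linl [RHS]comp_linr fP gP.
Qed.

Definition chain_hom (X Y : cplx) : lmodType k := subspace (@is_chain0 X Y) (@is_chainL X Y).

Definition chain_id (X : cplx) : chain_hom X X.
Proof. by exists (fun i => idm (X i)) => i; rewrite comp1l comp1r. Defined.

Definition chain_comp (X Y Z : cplx) (g : chain_hom Y Z) (f : chain_hom X Y) : chain_hom X Z.
Proof.
exists (fun i => sval g i \oc sval f i) => i.
by rewrite -compA (svalP f i) [LHS]compA (svalP g i) [RHS]compA.
Defined.

Fact chain_compA (X Y Z W : cplx) (h : chain_hom Z W) (g : chain_hom Y Z) (f : chain_hom X Y) :
  chain_comp h (chain_comp g f) = chain_comp (chain_comp h g) f.
Proof.
by apply: subsp_inj; apply: functional_extensionality_dep => i; exact: compA.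
Qed.
Fact chain_comp1l (X Y : cplx) (f : chain_hom X Y) : chain_comp (chain_id Y) f = f.
Proof.
by apply: subsp_inj; apply: functional_extensionality_dep => i; exact: comp1l.
Qed.
Fact chain_comp1r (X Y : cplx) (f : chain_hom X Y) : chain_comp f (chain_id X) = f.
Proof.
by apply: subsp_inj; apply: functional_extensionality_dep => i; exact: comp1r.
Qed.
Fact chain_comp_linl (X Y Z : cplx) c (g g' : chain_hom Y Z) (f : chain_hom X Y) :
  chain_comp (c *: g + g') f = c *: chain_comp g f + chain_comp g' f.
Proof.
by apply: subsp_inj; apply: functional_extensionality_dep => i; exact: comp_linl.
Qed.
Fact chain_comp_linr (X Y Z : cplx) c (g : chain_hom Y Z) (f f' : chain_hom X Y) :
  chain_comp g (c *: f + f') = c *: chain_comp g f + chain_comp g f'.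
Proof.
by apply: subsp_inj; apply: functional_extensionality_dep => i; exact: comp_linr.
Qed.

(* C^b(mod H) *)
Definition cplxcat : lincat k :=
  LinCat chain_compA chain_comp1l chain_comp1r chain_comp_linl chain_comp_linr.

(* f induces an isomorphism in cohomology, injective and surjective, in degree
   i + 1 for every i *)
Definition quasi_iso (X Y : cplxcat) (f : hom X Y) : Prop :=
  forall i : int,
    (forall x, mapp (cdiff X (i + 1)) x = 0 ->
       (exists y, mapp (cdiff Y i) y = mapp (sval f (i + 1)) x) ->
       exists x', mapp (cdiff X i) x' = x) /\
    (forall y, mapp (cdiff Y (i + 1)) y = 0 ->
       exists x, mapp (cdiff X (i + 1)) x = 0 /\
         exists y', mapp (cdiff Y i) y' = y - mapp (sval f (i + 1)) x).

(* D^b(H).  Homotopic maps become equal in this localization, so that it is also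
   the localization of K^b(mod H) at the quasi-isomorphisms. *)
Definition dercat : lincat k := localization quasi_iso.

(* X[1]^i = X^{i+1}, with differential - d *)
Definition shift_cplx (X : cplxcat) : cplxcat.
Proof.
exists (fun i => X (i + 1)) (fun i => - cdiff X (i + 1)).
- by move=> i; rewrite compNl compNr opprK cdiff2.
- have [n Xn] := cbounded X; exists n.+1 => i lti; apply: Xn; lia.
Defined.

Definition shift_chain (X Y : cplxcat) (f : hom X Y) : hom (shift_cplx X) (shift_cplx Y).
Proof.
exists (fun i => sval f (i + 1)) => i.
by rewrite compNl compNr (svalP f (i + 1)).
Defined.

Definition shift_cplxcat : functor cplxcat cplxcat.
Proof.
exists shift_cplx shift_chain.
- by move=> X; apply: subsp_inj.
- by move=> X Y Z g f; apply: subsp_inj.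
- by move=> X Y c f g; apply: subsp_inj.
Defined.

Lemma mappN (X Y : modcat H) (f : hom X Y) x : mapp (- f) x = - mapp f x.
Proof. exact: mulmxN. Qed.
Lemma mapp_oppr (X Y : modcat H) (f : hom X Y) x : mapp f (- x) = - mapp f x.
Proof. exact: mulNmx. Qed.

Lemma shift_quasi_iso (X Y : cplxcat) (f : hom X Y) :
  quasi_iso f -> quasi_iso (fmap shift_cplxcat f).
Proof.
move=> fq i; have [finj fsurj] := fq (i + 1); split.
- move=> x; rewrite mappN => /eqP; rewrite oppr_eq0 => /eqP x0 [y].
  rewrite mappN => yx; have [|x' <-] := finj x x0.
    by exists (- y); rewrite mapp_oppr.
  by exists (- x'); rewrite mappN mapp_oppr opprK.
- move=> y; rewrite mappN => /eqP; rewrite oppr_eq0 => /eqP y0.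
  have [x [x0 [y' y'E]]] := fsurj y y0; exists x; split.
    by rewrite mappN x0 oppr0.
  by exists (- y'); rewrite mappN mapp_oppr opprK.
Qed.

Lemma shift_inverts (X Y : cplxcat) (f : hom X Y) : quasi_iso f ->
  is_iso (fmap (compfunctor (loc_functor quasi_iso) shift_cplxcat) f).
Proof. by move=> /shift_quasi_iso; exact: loc_functor_iso. Qed.

(* the shift [1] of D^b(H) *)
Definition shift : functor dercat dercat := loc_lift shift_inverts.

Definition stalk_ob (X : modcat H) (i : int) : modcat H :=
  match i with Posz 0 => X | _ => zeromod H end.

Definition stalk_cplx (X : modcat H) : cplxcat.
Proof.
exists (stalk_ob X) (fun i => 0).
- by move=> i; rewrite comp0l.
- by exists 0%N => -[[|i]|i].
Defined.

Definition stalk_map (X Y : modcat H) (f : hom X Y) : hom (stalk_cplx X) (stalk_cplx Y).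
Proof.
exists (fun i => match i return hom (stalk_ob X i) (stalk_ob Y i) with
        | Posz 0 => f | _ => 0 end) => i.
by rewrite comp0r comp0l.
Defined.

Lemma zeromod_hom0 (X : modcat H) (f g : hom X (zeromod H)) : f = g.
Proof. by apply: subvs_inj; rewrite [LHS]thinmx0 [RHS]thinmx0. Qed.

Definition stalk_cplxcat : functor (modcat H) cplxcat.
Proof.
exists stalk_cplx stalk_map.
- move=> X; apply: subsp_inj; apply: functional_extensionality_dep.
  by move=> -[[|i]|i]; [|exact: (@zeromod_hom0 (zeromod H))..].
- move=> X Y Z g f; apply: subsp_inj; apply: functional_extensionality_dep.
  by move=> -[[|i]|i]; [|exact: (@zeromod_hom0 (zeromod H))..].
- move=> X Y c f g; apply: subsp_inj; apply: functional_extensionality_dep.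
  by move=> -[[|i]|i]; [|exact: (@zeromod_hom0 (zeromod H))..].
Defined.

(* mod H -> D^b(H) *)
Definition stalk : functor (modcat H) dercat :=
  compfunctor (loc_functor quasi_iso) stalk_cplxcat.

(* the complex Q -d-> P with P in degree 0 *)
Section TwoTerm.
Variables (Q P : modcat H) (d : hom Q P).
Definition two_term_ob (i : int) : modcat H :=
  match i with Posz 0 => P | Negz 0 => Q | _ => zeromod H end.
Definition two_term_diff (i : int) : hom (two_term_ob i) (two_term_ob (i + 1)) :=
  match i return hom (two_term_ob i) (two_term_ob (i + 1)) with
  | Negz 0 => d | _ => 0 end.
Definition two_term : dercat.
Proof.
exists two_term_ob two_term_diff.
- by move=> -[i|[|i]]; [exact: comp0r|exact: comp0l|exact: comp0r].
- by exists 1%N => -[[|i]|[|i]].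
Defined.
End TwoTerm.
End Complexes.

Section Cluster.
Variables (k : fieldType) (H : falgType k).
Notation D := (dercat H).

(* tau is the Auslander-Reiten translation of D^b(H): tau[1] is a Serre functor,
   i.e., h |-> beta(-, h) is an isomorphism Hom(Y, tau X[1]) ~ D Hom(X, Y)
   natural in X and Y. *)
Definition AR_translation (tau : functor D D) : Prop :=
  exists beta : forall X Y : D, hom X Y -> hom Y (shift H (tau X)) -> k,
  (forall X Y c (f f' : hom X Y) (h : hom Y (shift H (tau X))),
    beta X Y (c *: f + f') h = c * beta X Y f h + beta X Y f' h) /\
  (forall X Y c (f : hom X Y) (h h' : hom Y (shift H (tau X))),
    beta X Y f (c *: h + h') = c * beta X Y f h + beta X Y f h') /\
  (forall X Y Y' (f : hom X Y) (g : hom Y Y') (h : hom Y' (shift H (tau X))),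
    beta X Y' (g \oc f) h = beta X Y f (h \oc g)) /\
  (forall X X' Y (u : hom X X') (f : hom X' Y) (h : hom Y (shift H (tau X))),
    beta X Y (f \oc u) h = beta X' Y f (fmap (shift H) (fmap tau u) \oc h)) /\
  (forall X Y (l : {linear hom X Y -> k^o}),
    exists! h : hom Y (shift H (tau X)), forall f, l f = beta X Y f h).

(* F = tau_D^-1 [1] *)
Definition cluster_functor (F : functor D D) : Prop :=
  exists tau tau' : functor D D,
    [/\ AR_translation tau, quasi_inverse tau tau' & natiso F (compfunctor (shift H) tau')].

Definition cluster_tilting (F : zaction D) (T : orbit_category F) : Prop :=
  (forall f : hom T (shift H T : orbit_category F), f = 0) /\
  exists n, num_summands T n /\ num_summands (regmod H) n.
End Cluster.

Definition cluster_tilted (k : fieldType) (A : algebra k) : Prop :=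
  exists (H : falgType k) (F : zaction (dercat H)) (T : orbit_category F),
    [/\ hereditary H, cluster_functor (F 1), cluster_tilting T, basic T
      & alg_iso A (endalg T)].

Section Silted.
Variables (k : fieldType) (H : falgType k) (T P : modcat H).

(* the 2-term complex P1 (+) P -> P0 given by d on P1 and 0 on P *)
Definition silted (A : algebra k) : Prop :=
  support_tau_tilting T P /\
  exists P1 P0 (d : hom P1 P0) (p : hom P0 T),
    min_presentation d p /\ alg_iso A (endalg (two_term (dsum_map d (0 : hom P P0)))).
End Silted.

(* For iota : mod H -> D^b(H), sh = [1] and tm = tau_H^-1. *)
Section MatrixAlgebras.
Variables (k : fieldType) (C D : lincat k).
Variables (iota : functor C D) (sh : functor D D) (tm : functor C C) (T P : C).

Definition blockB : lmodType k := hom T T.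
Definition blockE : lmodType k := hom (iota T) (sh (iota (tm T))).
Definition blockN : lmodType k := hom P (tm T).
Definition blockM : lmodType k := hom (iota T) (sh (iota P)).
Definition blockH1 : lmodType k := hom P P.

(* triples (b, m, u), standing for the matrices ( b  0 )
                                                ( m  u ) *)
Definition tri_car : lmodType k := (blockB * blockM * blockH1)%type.

Definition tri_mul (a a' : tri_car) : tri_car :=
  let: (b, m, u) := a in let: (b', m', u') := a' in
  (b \oc b', m \oc fmap iota b' + fmap sh (fmap iota u) \oc m', u \oc u').
Definition tri_one : tri_car := (idm T, 0, idm P).

Fact tri_mulA : associative tri_mul.
Proof.
move=> [[b m] u] [[b' m'] u'] [[b'' m''] u'']; rewrite /tri_mul; congr (_, _, _).
- exact: compA.
- by rewrite !fmapM compDl compDr !compA !addrA.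
- exact: compA.
Qed.
Fact tri_mul1l : left_id tri_one tri_mul.
Proof.
move=> [[b m] u]; congr (_, _, _); rewrite ?comp1l//.
by rewrite !fmap1 comp1l comp0l add0r.
Qed.
Fact tri_mul1r : right_id tri_one tri_mul.
Proof.
move=> [[b m] u]; congr (_, _, _); rewrite ?comp1r//.
by rewrite !fmap1 comp1r comp0r addr0.
Qed.
Fact tri_linl c (x y z : tri_car) : tri_mul (c *: x + y) z = c *: tri_mul x z + tri_mul y z.
Proof.
case: x y z => [[b m] u] [[b' m'] u'] [[b'' m''] u''].
congr (_, _, _); rewrite ?comp_linl//=.
by rewrite !fmap_lin !comp_linl scalerDr addrACA.
Qed.
Fact tri_linr c (z x y : tri_car) : tri_mul z (c *: x + y) = c *: tri_mul z x + tri_mul z y.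
Proof.
case: x y z => [[b m] u] [[b' m'] u'] [[b'' m''] u''].
congr (_, _, _); rewrite ?comp_linr//=.
by rewrite !fmap_lin !comp_linr scalerDr addrACA.
Qed.

Definition tri_alg : algebra k := MkAlgebra tri_mulA tri_mul1l tri_mul1r tri_linl tri_linr.

(* tuples (b, xi, x, m, u), standing for the matrices ( (b, xi)  x )
                                                      (    m     u )
   with (b, xi) in the trivial extension of B by E *)
Definition ext_car : lmodType k := (blockB * blockE * blockN * blockM * blockH1)%type.

Definition ext_mul (a a' : ext_car) : ext_car :=
  let: (b, xi, x, m, u) := a in let: (b', xi', x', m', u') := a' in
  (b \oc b',
   fmap sh (fmap iota (fmap tm b)) \oc xi' + xi \oc fmap iota b'
     + fmap sh (fmap iota x) \oc m',
   fmap tm b \oc x' + x \oc u',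
   m \oc fmap iota b' + fmap sh (fmap iota u) \oc m',
   u \oc u').
Definition ext_one : ext_car := (idm T, 0, 0, 0, idm P).

Fact ext_mulA : associative ext_mul.
Proof.
move=> [[[[b e] x] m] u] [[[[b' e'] x'] m'] u'] [[[[b'' e''] x''] m''] u''].
rewrite /ext_mul; congr (_, _, _, _, _).
- exact: compA.
- rewrite !(fmapM, fmapD) !compDl !compDr !compA !addrA; congr (_ + _).
  by rewrite [RHS]addrAC; congr (_ + _); rewrite addrAC.
- by rewrite !fmapM compDl compDr !compA !addrA.
- by rewrite !fmapM compDl compDr !compA !addrA.
- exact: compA.
Qed.
Fact ext_mul1l : left_id ext_one ext_mul.
Proof.
move=> [[[[b e] x] m] u]; congr (_, _, _, _, _); rewrite ?comp1l//.
- by rewrite !fmap1 !fmap0 !comp0l comp1l !addr0.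
- by rewrite fmap1 comp1l comp0l addr0.
- by rewrite !fmap1 comp1l comp0l add0r.
Qed.
Fact ext_mul1r : right_id ext_one ext_mul.
Proof.
move=> [[[[b e] x] m] u]; congr (_, _, _, _, _); rewrite ?comp1r//.
- by rewrite !fmap1 !comp0r comp1r addr0 add0r.
- by rewrite comp0r add0r.
- by rewrite !fmap1 comp1r comp0r addr0.
Qed.
Fact ext_lin_tuple c (b b' : blockB) (e e' : blockE) (x x' : blockN) (m m' : blockM)
    (u u' : blockH1) :
  c *: ((b, e, x, m, u) : ext_car) + (b', e', x', m', u') =
  (c *: b + b', c *: e + e', c *: x + x', c *: m + m', c *: u + u').
Proof. by []. Qed.
Fact ext_linl c (y z a : ext_car) : ext_mul (c *: y + z) a = c *: ext_mul y a + ext_mul z a.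
Proof.
case: y z a => [[[[b e] x] m] u] [[[[b' e'] x'] m'] u'] [[[[b'' e''] x''] m''] u''].
rewrite ext_lin_tuple /ext_mul ext_lin_tuple; congr (_, _, _, _, _); rewrite ?comp_linl//.
- rewrite !fmap_lin !comp_linl !scalerDr [X in X + _ = _]addrACA.
  by rewrite [LHS]addrACA.
- by rewrite !fmap_lin !comp_linl scalerDr addrACA.
- by rewrite !fmap_lin !comp_linl scalerDr addrACA.
Qed.
Fact ext_linr c (a y z : ext_car) : ext_mul a (c *: y + z) = c *: ext_mul a y + ext_mul a z.
Proof.
case: y z a => [[[[b e] x] m] u] [[[[b' e'] x'] m'] u'] [[[[b'' e''] x''] m''] u''].
rewrite ext_lin_tuple /ext_mul ext_lin_tuple; congr (_, _, _, _, _); rewrite ?comp_linr//.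
- rewrite !fmap_lin !comp_linr !scalerDr [X in X + _ = _]addrACA.
  by rewrite [LHS]addrACA.
- by rewrite scalerDr addrACA.
- by rewrite !fmap_lin !comp_linr scalerDr addrACA.
Qed.

Definition ext_alg : algebra k := MkAlgebra ext_mulA ext_mul1l ext_mul1r ext_linl ext_linr.
End MatrixAlgebras.

Section SiltedMatrixAlgebras.
Variables (k : fieldType) (H : falgType k) (T P : modcat H).

(* ( B  0  )
   ( M  H1 ) *)
Definition silted_matrix_algebra : algebra k := tri_alg (stalk H) (shift H) T P.

(* ( B |x Ext^1_H(T, tau^-1 T)   Hom_H(P, tau^-1 T) )
   (           M                         H1         ) *)
Definition cluster_matrix_algebra : algebra k :=
  ext_alg (stalk H) (shift H) (tau_inv H) T P.
End SiltedMatrixAlgebras.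

(* Main.v *)
(* We take H itself as the hereditary algebra and T (+) P[1] as the cluster-tilting
   object.  Over a hereditary algebra every object of D^b(H) is a direct sum of
   shifted modules, and a module is isomorphic to a two-term complex of projectives,
   the maps out of which are chain maps up to homotopy.

   Serre duality is handled through Serre pairs: objects Z, Y with a functional t on
   Hom(Z, Y) such that (f, g) |-> t(f g) is nondegenerate on Hom(X, Y) x Hom(Z, X) for
   all X.  For projectives Q and P the complex Q -> P is paired with nu Q -> nu P, and
   R M = (C^0(DH, M) -> Z^1(DH, M)), a piece of the bar complex, is paired with M[1]
   by a trace form which is natural in M.  Hence a Serre functor exists, and the
   inverse of the AR translation is isomorphic to R, naturally in the module M.  Since
   H is hereditary, R M is the sum of tau_H^{-1} M and of K[1] with K projective, and
   K[2] receives no nonzero map from T or P[1].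

   Put F = tau^{-1}[1].  By Serre duality Hom(X, F^n Y) = 0 for n <> 0, 1 and X, Y in
   {T, P[1]}, while Hom(T, F T) = Ext^1(T, tau_H^{-1} T), Hom(P[1], F T) =
   Hom(P, tau_H^{-1} T) and Hom(-, F P[1]) = 0, so that the endomorphism algebra is the
   matrix algebra.  The vanishing of self-extensions comes from Hom(T, tau T) = 0 and
   the 2-Calabi-Yau symmetry.  The summands are counted by Krull-Schmidt: idempotents
   are lifted modulo two square-zero ideals to End(T) x End(P). *)
From HB Require Import structures.
From mathcomp Require Import all_boot all_algebra all_field.
From mathcomp Require Import boolp classical_sets fsbigop zify.

Require Import Defs.

Set Implicit Arguments.
Unset Strict Implicit.
Unset Printing Implicit Defensive.

Import GRing.Theory VectorInternalTheory.
Local Open Scope ring_scope.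

(** * Linear functionals *)

(** Two obstacles shape the proof. The derived category is given by generators and relations, so
    nothing is known about its morphisms beforehand; only maps out of two-term complexes of
    projectives are computed, and every other statement is reduced to these by resolving modules and
    splitting complexes. Second, the functor [tau_inv] is one concrete functor, and the matrix
    algebra uses its action on morphisms, so isomorphisms of objects are not enough. This is why two
    families of Serre pairs occur. The pairs with nu Q -> nu P give each object a partner on the
    right, but depend on chosen resolutions and Serre pairs. The pairs with the bar complex give
    partners on the left and vary functorially with the module; since a partner is unique up to a
    unique isomorphism respecting the traces, they identify the inverse translation on modules
    naturally. The powers of F must form a coherent action of the integers, although its inverse is
    known only up to isomorphism. They are realized by sequences of objects linked by isomorphisms,
    maps of which are determined by a single component, so that each coherence law is checked at one
    index. *)

Section LinearAlgebra.
Variable k : fieldType.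

(** The predicate is arbitrary, so a spanning matrix is found by maximality: if the rows lie in [P]
    and the rank is the largest possible, appending another vector of [P] cannot raise it, hence
    that vector is already in the row space. *)
Lemma linclosed_mx n (P : 'rV[k]_n -> Prop) :
  P 0 -> (forall a u v, P u -> P v -> P (a *: u + v)) ->
  exists A : 'M[k]_n, forall v, P v <-> (v <= A)%MS.
Proof.
move=> P0 PL.
have Psum m (A : 'M[k]_(m, n)) (u : 'rV_m) : (forall i, P (row i A)) -> P (u *m A).
  move=> PA; rewrite mulmx_sum_row; elim/big_rec: _ => // i x _ Px; exact: PL.
pose Q r := `[< exists m (A : 'M[k]_(m, n)), (forall i, P (row i A)) /\ \rank A = r >].
have exQ : exists r, Q r.
  exists 0%N; apply/asboolP; exists 0%N, 0; split; last by rewrite mxrank0.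
  by move=> [].
have Qn r : Q r -> (r <= n)%N.
  by move=> /asboolP[m [A [_ <-]]]; exact: rank_leq_col.
case: (ex_maxnP exQ Qn) => r /asboolP[m [A [PA rA]]] rmax.
exists <<A>>%MS => v; rewrite genmxE; split; last by move=> /submxP[u ->]; exact: Psum.
move=> Pv; have : Q (\rank (col_mx A v)).
  apply/asboolP; exists (m + 1)%N, (col_mx A v); split=> // i.
  case: (splitP i) => j ej.
    have -> : i = lshift 1 j by apply: val_inj.
    by rewrite rowKu.
  have -> : i = rshift m j by apply: val_inj.
  by rewrite rowKd; rewrite (_ : row j v = v)//; apply/rowP=> l; rewrite mxE ord1.
move=> /rmax; rewrite -rA -addsmxE => le.
have [ler er] := mxrank_leqif_sup (addsmxSl A v).
have sub : (A + v <= A)%MS by rewrite -er eqn_leq ler le.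
exact: submx_trans (addsmxSr A v) sub.
Qed.

Definition linfunct (V : lmodType k) (l : V -> k) :=
  forall c u v, l (c *: u + v) = c * l u + l v.

Lemma linfunct0 (V : lmodType k) (l : V -> k) : linfunct l -> l 0 = 0.
Proof. by move=> ll; have := ll (-1) 0 0; rewrite scaleN1r oppr0 addr0 mulN1r addNr. Qed.
Lemma linfunctD (V : lmodType k) (l : V -> k) : linfunct l -> forall u v, l (u + v) = l u + l v.
Proof. by move=> ll u v; rewrite -[u]scale1r ll mul1r scale1r. Qed.
Lemma linfunctZ (V : lmodType k) (l : V -> k) : linfunct l -> forall c v, l (c *: v) = c * l v.
Proof. by move=> ll c v; rewrite -[c *: v]addr0 ll linfunct0// addr0. Qed.
Lemma linfunctN (V : lmodType k) (l : V -> k) : linfunct l -> forall v, l (- v) = - l v.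
Proof. by move=> ll v; rewrite -scaleN1r linfunctZ// mulN1r. Qed.
Lemma linfunct_sum (V : lmodType k) (l : V -> k) I (r : seq I) (F : I -> V) :
  linfunct l -> l (\sum_(i <- r) F i) = \sum_(i <- r) l (F i).
Proof.
move=> ll; elim: r => [|i r IH]; first by rewrite !big_nil linfunct0.
by rewrite !big_cons linfunctD// IH.
Qed.

Definition findim (V : lmodType k) : Prop :=
  exists n (e : 'I_n -> V), forall v, exists c : 'I_n -> k, v = \sum_i c i *: e i.

(* The image of V in the dual of U is separated from l by some u in U. *)
Lemma perfect_pairing (U V : lmodType k) (b : U -> V -> k) :
  findim U -> (forall v, linfunct (b^~ v)) -> (forall u, linfunct (b u)) ->
  (forall u, (forall v, b u v = 0) -> u = 0) ->
  forall l : U -> k, linfunct l -> exists v, forall u, l u = b u v.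
Proof.
move=> [n [e eU]] bl br nd l ll.
pose P (w : 'rV[k]_n) := exists v, w = \row_i b (e i) v.
have [|a u v [x ->] [y ->]|A PA] := @linclosed_mx n P.
- by exists 0; apply/rowP => i; rewrite !mxE linfunct0.
- by exists (a *: x + y); apply/rowP => i; rewrite !mxE br.
pose w : 'rV_n := \row_i l (e i).
case: (boolP (w <= A)%MS) => [/PA[v wv]|].
  exists v => u; have [c ->] := eU u.
  rewrite (linfunct_sum _ _ ll) [RHS](linfunct_sum _ _ (bl v)).
  apply: eq_bigr => i _; rewrite (linfunctZ ll) (linfunctZ (bl v)).
  by have := congr1 (fun w : 'rV_n => w ord0 i) wv; rewrite !mxE => ->.
rewrite submxE => /eqP/rowP/eqfunP; rewrite negb_forall => /existsP[j /eqP wj].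
(* A column of the cokernel is a linear relation satisfied by all rows [b (e i) v], and this one is
   violated by the values [l (e i)]. Used as coefficients, it gives a vector that nondegeneracy
   forces to be zero although [l] does not vanish on it. *)
pose c i := cokermx A i j; pose u := \sum_i c i *: e i.
have u0 : u = 0.
  apply: nd => v; rewrite /u [LHS](linfunct_sum _ _ (bl v)).
  have : (\row_i b (e i) v <= A)%MS by apply/PA; exists v.
  rewrite submxE => /eqP/rowP/(_ j); rewrite !mxE => e0; rewrite -[RHS]e0.
  by apply: eq_bigr => i _; rewrite (linfunctZ (bl v)) mxE mulrC.
case: wj; rewrite !mxE -[RHS](linfunct0 ll) -u0 /u (linfunct_sum _ _ ll).
by apply: eq_bigr => i _; rewrite (linfunctZ ll) mxE mulrC.
Qed.

Lemma findim_surj (U V : lmodType k) (f : U -> V) :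
  (forall c u v, f (c *: u + v) = c *: f u + f v) -> (forall v, exists u, f u = v) ->
  findim U -> findim V.
Proof.
move=> fl fs [n [e eU]]; exists n, (f \o e) => v; have [u <-] := fs v.
have f0 : f 0 = 0 by have := fl (-1) 0 0; rewrite !scaleN1r oppr0 addr0 addNr.
have [c ->] := eU u; exists c; elim/big_rec2: _ => [//|i x y _ <-]; exact: fl.
Qed.

Lemma findim_vect (V : vectType k) : findim V.
Proof.
exists (\dim {:V}), (fun i => (vbasis {:V})`_i) => v.
by exists (fun i => coord (vbasis {:V}) i v); exact: coord_vbasis (memvf v).
Qed.

(** Linearity is asked on [P] only, because [f] will send a pair of matrices to a chain map, which
    makes sense only where the chain condition holds. *)
Lemma findim_sub (V : vectType k) (P : V -> Prop) (U : lmodType k) (f : V -> U) :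
  (forall u, P u -> forall v, P v -> forall c, f (c *: u + v) = c *: f u + f v) ->
  P 0 -> (forall a u v, P u -> P v -> P (a *: u + v)) ->
  (forall u, exists v, P v /\ f v = u) -> findim U.
Proof.
move=> fl P0 PL fs.
have [||A PA] := @linclosed_mx (dim V) (fun w => P (r2v w)).
- by rewrite linear0.
- by move=> a u v Pu Pv; rewrite linearP; exact: PL.
have Pr i : P (r2v (row i A)) by apply/PA; exact: row_sub.
exists (dim V), (fun i => f (r2v (row i A))) => u; have [v [Pv <-]] := fs u.
have /PA/submxP[c vc] : P (r2v (v2r v)) by rewrite v2rK.
exists (fun i => c 0 i); rewrite -[v]v2rK vc mulmx_sum_row linear_sum /=.
have f0 : f 0 = 0 by have := fl 0 P0 0 P0 (-1); rewrite !scaleN1r oppr0 addr0 addNr.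
suff : P (\sum_i r2v (c 0 i *: row i A)) /\
  f (\sum_i r2v (c 0 i *: row i A)) = \sum_i c 0 i *: f (r2v (row i A)) by case.
elim/big_rec2: _ => // i x y _ [Py <-]; rewrite linearZ /=; split; first exact: PL.
exact: fl.
Qed.
End LinearAlgebra.

(** * Linear categories and Serre pairs *)

Section Isomorphisms.
Variables (k : fieldType) (C : lincat k).
Implicit Types X Y Z : C.

Lemma is_iso_id X : is_iso (idm X).
Proof. by exists (idm X); rewrite comp1l. Qed.

Lemma is_iso_comp X Y Z (g : hom Y Z) (f : hom X Y) :
  is_iso g -> is_iso f -> is_iso (g \oc f).
Proof.
move=> [g' [g'g gg']] [f' [f'f ff']]; exists (f' \oc g'); split.
- by rewrite compA -(compA f') g'g comp1r.
- by rewrite compA -(compA g) ff' comp1r.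
Qed.

Lemma iso_monic X Y Z (f : hom Y Z) (g h : hom X Y) : is_iso f -> f \oc g = f \oc h -> g = h.
Proof. by move=> [f' [f'f _]] e; rewrite -[g]comp1l -[h]comp1l -f'f -!compA e. Qed.
Lemma iso_epic X Y Z (f : hom X Y) (g h : hom Y Z) : is_iso f -> g \oc f = h \oc f -> g = h.
Proof. by move=> [f' [_ ff']] e; rewrite -[g]comp1r -[h]comp1r -ff' !compA e. Qed.

Lemma isomorphic_refl X : isomorphic X X.
Proof. by exists (idm X); exact: is_iso_id. Qed.
Lemma isomorphic_sym X Y : isomorphic X Y -> isomorphic Y X.
Proof. by move=> [f [g [gf fg]]]; exists g, f. Qed.
Lemma isomorphic_trans Y X Z : isomorphic X Y -> isomorphic Y Z -> isomorphic X Z.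
Proof. by move=> [f fi] [g gi]; exists (g \oc f); exact: is_iso_comp. Qed.

Lemma dsum2P X Y Z : is_direct_sum2 X Y Z <->
  exists (i1 : hom Y X) (i2 : hom Z X) (p1 : hom X Y) (p2 : hom X Z),
  [/\ p1 \oc i1 = idm Y, p2 \oc i2 = idm Z, p1 \oc i2 = 0, p2 \oc i1 = 0
    & i1 \oc p1 + i2 \oc p2 = idm X].
Proof.
split.
- move=> [i [p [pi pi0 s]]].
  exists (i ord0), (i (lift ord0 ord0)), (p ord0), (p (lift ord0 ord0)).
  split; [exact: pi ord0|exact: pi (lift ord0 ord0)|exact: (pi0 ord0 (lift ord0 ord0) isT)|exact: (pi0 (lift ord0 ord0) ord0 isT)|].
  by rewrite -s big_ord_recl big_ord_recl big_ord0 addr0.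
- move=> [i1 [i2 [p1 [p2 [e11 e22 e12 e21 s]]]]].
  pose T (j : 'I_2) := if j == ord0 then Y else Z.
  exists (fun j : 'I_2 => if j == ord0 as b return hom (if b then Y else Z) X then i1 else i2).
  exists (fun j : 'I_2 => if j == ord0 as b return hom X (if b then Y else Z) then p1 else p2).
  split.
  + by move=> j; case: (j == ord0).
  + by move=> [[|[|?]] //= ?] [[|[|?]] //= ?].
  + by rewrite big_ord_recl big_ord_recl big_ord0 addr0.
Qed.

Lemma isomorphic_dsum2 X Y Z X' : is_direct_sum2 X Y Z -> isomorphic X X' ->
  is_direct_sum2 X' Y Z.
Proof.
move=> /dsum2P[i1 [i2 [p1 [p2 [e11 e22 e12 e21 s]]]]] [f [g [gf fg]]].
apply/dsum2P; exists (f \oc i1), (f \oc i2), (p1 \oc g), (p2 \oc g).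
have E A B (a : hom X A) (b : hom B X) : (a \oc g) \oc (f \oc b) = a \oc b.
  by rewrite compA -(compA a) gf comp1r.
rewrite !E; split=> //.
by rewrite !compA -compDl -!(compA f) -compDr s comp1r.
Qed.

Lemma is_zero_hom_l X Y (f : hom X Y) : is_zero X -> f = 0.
Proof. by move=> X0; rewrite -[f]comp1r X0 comp0r. Qed.
Lemma is_zero_hom_r X Y (f : hom X Y) : is_zero Y -> f = 0.
Proof. by move=> Y0; rewrite -[f]comp1l Y0 comp0l. Qed.
End Isomorphisms.

Section FunctorProperties.
Variables (k : fieldType).
Implicit Types C D : lincat k.

Lemma fmapN C D (F : functor C D) (X Y : C) (f : hom X Y) : fmap F (- f) = - fmap F f.
Proof. by rewrite -scaleN1r fmapZ scaleN1r. Qed.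

Lemma fmap_iso C D (F : functor C D) (X Y : C) (f : hom X Y) : is_iso f -> is_iso (fmap F f).
Proof. by move=> [g [gf fg]]; exists (fmap F g); rewrite -!fmapM gf fg !fmap1. Qed.

Lemma fmap_isomorphic C D (F : functor C D) (X Y : C) :
  isomorphic X Y -> isomorphic (F X) (F Y).
Proof. by move=> [f fi]; exists (fmap F f); exact: fmap_iso. Qed.

Lemma fmap_dsum2 C D (F : functor C D) (X Y Z : C) :
  is_direct_sum2 X Y Z -> is_direct_sum2 (F X) (F Y) (F Z).
Proof.
move=> /dsum2P[i1 [i2 [p1 [p2 [e11 e22 e12 e21 s]]]]]; apply/dsum2P.
exists (fmap F i1), (fmap F i2), (fmap F p1), (fmap F p2).
by rewrite -!fmapM e11 e22 e12 e21 !fmap1 !fmap0 -fmapD s fmap1.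
Qed.

Definition faithful C D (F : functor C D) :=
  forall (X Y : C) (f : hom X Y), fmap F f = 0 -> f = 0.
Definition full C D (F : functor C D) :=
  forall (X Y : C) (g : hom (F X) (F Y)), exists f : hom X Y, fmap F f = g.
Definition esurj C D (F : functor C D) := forall Y : D, exists X : C, isomorphic (F X) Y.

Lemma faithful_inj C D (F : functor C D) : faithful F ->
  forall (X Y : C) (f g : hom X Y), fmap F f = fmap F g -> f = g.
Proof.
move=> Ff X Y f g e; apply/eqP; rewrite -subr_eq0; apply/eqP; apply: Ff.
by rewrite fmapD fmapN e subrr.
Qed.

Lemma ff_iso C D (F : functor C D) : faithful F -> full F ->
  forall (X Y : C) (f : hom X Y), is_iso (fmap F f) -> is_iso f.
Proof.
move=> Ff Fu X Y f [g [gf fg]]; have [h hg] := Fu _ _ g; exists h.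
by split; apply: (faithful_inj Ff); rewrite fmapM fmap1 hg.
Qed.

Lemma ff_isomorphic C D (F : functor C D) : faithful F -> full F ->
  forall X Y : C, isomorphic (F X) (F Y) -> isomorphic X Y.
Proof.
move=> Ff Fu X Y [f fi]; have [g gf] := Fu _ _ f; exists g.
by apply: (ff_iso Ff Fu); rewrite gf.
Qed.

Lemma natiso_idP C D (F : functor C D) (G : functor D C) :
  natiso (compfunctor G F) (idfunctor C) <->
  exists phi : forall X, hom (G (F X)) X, (forall X, is_iso (phi X)) /\
    (forall X Y (f : hom X Y), phi Y \oc fmap G (fmap F f) = f \oc phi X).
Proof. by []. Qed.

Section QuasiInverse.
Variables (C D : lincat k) (F : functor C D).
Hypotheses (Ff : faithful F) (Fu : full F) (Fe : esurj F).

Lemma equivalence_quasi_inverse : exists G : functor D C, quasi_inverse F G.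
Proof.
pose G0 Y := projT1 (cid (Fe Y)).
pose e Y : hom (F (G0 Y)) Y := projT1 (cid (projT2 (cid (Fe Y)))).
have ei Y : is_iso (e Y) := projT2 (cid (projT2 (cid (Fe Y)))).
have exG Y Z (g : hom Y Z) : exists f : hom (G0 Y) (G0 Z), e Z \oc fmap F f = g \oc e Y.
  have [e' [e1 e2]] := ei Z; have [f fE] := Fu (e' \oc (g \oc e Y)).
  by exists f; rewrite fE compA e2 comp1l.
pose G1 Y Z (g : hom Y Z) := projT1 (cid (exG Y Z g)).
have G1E Y Z (g : hom Y Z) : e Z \oc fmap F (G1 Y Z g) = g \oc e Y := projT2 (cid (exG Y Z g)).
have G1U Y Z (f f' : hom (G0 Y) (G0 Z)) : e Z \oc fmap F f = e Z \oc fmap F f' -> f = f'.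
  by move=> /(iso_monic (ei Z)); exact: faithful_inj.
have g1 Y : G1 Y Y (idm Y) = idm (G0 Y) by apply: G1U; rewrite G1E fmap1 comp1l comp1r.
have gM X Y Z (g : hom Y Z) (f : hom X Y) : G1 X Z (g \oc f) = G1 Y Z g \oc G1 X Y f.
  by apply: G1U; rewrite G1E fmapM compA G1E -!compA G1E.
have gL X Y c (f g : hom X Y) : G1 X Y (c *: f + g) = c *: G1 X Y f + G1 X Y g.
  by apply: G1U; rewrite G1E fmap_lin comp_linl comp_linr !G1E.
exists (Functor g1 gM gL); split; last by apply/natiso_idP; exists e; split=> // X Y f; exact: G1E.
apply/natiso_idP.
have exa X : exists f : hom (G0 (F X)) X, fmap F f = e (F X) := Fu (e (F X)).
exists (fun X => projT1 (cid (exa X))); split=> [X|X Y f].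
  by apply: (ff_iso Ff Fu); rewrite (projT2 (cid (exa X))); exact: ei.
apply: (faithful_inj Ff); rewrite !fmapM (projT2 (cid (exa X))) (projT2 (cid (exa Y))).
exact: G1E.
Qed.
End QuasiInverse.

Lemma natiso_sym C D (F G : functor C D) : natiso F G -> natiso G F.
Proof.
move=> [phi [phii phin]]; exists (fun X => projT1 (cid (phii X))); split=> [X|X Y f].
  by case: cid => g /= [gf fg]; exists (phi X).
case: cid => g /= [g1 g2]; case: cid => h /= [h1 h2].
by apply: (iso_monic (phii Y)); rewrite !compA g2 comp1l phin -compA h2 comp1r.
Qed.

Lemma natiso_trans C D (F G K : functor C D) : natiso F G -> natiso G K -> natiso F K.
Proof.
move=> [phi [phii phin]] [psi [psii psin]].
exists (fun X => psi X \oc phi X); split=> [X|X Y f]; first exact: is_iso_comp.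
by rewrite -compA phin compA psin compA.
Qed.

Lemma quasi_inverse_sym C D (F : functor C D) (G : functor D C) :
  quasi_inverse F G -> quasi_inverse G F.
Proof. by case. Qed.

Lemma quasi_inverse_faithful C D (F : functor C D) (G : functor D C) :
  quasi_inverse F G -> faithful F.
Proof.
move=> [/natiso_idP[phi [phii phin]] _] X Y f f0.
by apply: (iso_epic (phii X)); rewrite comp0l -phin f0 fmap0 comp0r.
Qed.

Lemma quasi_inverse_full C D (F : functor C D) (G : functor D C) :
  quasi_inverse F G -> full F.
Proof.
move=> FG X Y g; have Gf := quasi_inverse_faithful (quasi_inverse_sym FG).
have [/natiso_idP[phi [phii phin]] _] := FG; have [psi [psi1 psi2]] := phii X.
exists (phi Y \oc fmap G g \oc psi); apply: (faithful_inj Gf).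
by apply: (iso_monic (phii Y)); rewrite phin -compA psi1 comp1r.
Qed.

Lemma quasi_inverse_esurj C D (F : functor C D) (G : functor D C) :
  quasi_inverse F G -> esurj F.
Proof. by move=> [_ /natiso_idP[phi [phii _]]] Y; exists (G Y), (phi Y). Qed.
End FunctorProperties.

(** * Serre duality through trace functionals *)

Section Serre.
Variables (k : fieldType) (D : lincat k).
Implicit Types X Y Z : D.

Section Nondegeneracy.
Variables (Z Y : D) (t : hom Z Y -> k).

Definition nondegl X := forall f : hom X Y, (forall g : hom Z X, t (f \oc g) = 0) -> f = 0.
Definition nondegr X := forall g : hom Z X, (forall f : hom X Y, t (f \oc g) = 0) -> g = 0.
Definition nondeg X := nondegl X /\ nondegr X.

Lemma nondeg_iso X X' : isomorphic X X' -> nondeg X -> nondeg X'.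
Proof.
move=> [u [v [vu uv]]] [nl nr]; split=> [f f0|g g0].
- rewrite -[f]comp1r -uv compA (nl (f \oc u)) ?comp0l// => g.
  by rewrite -compA f0.
- rewrite -[g]comp1l -uv -compA (nr (v \oc g)) ?comp0r// => f.
  by rewrite compA g0.
Qed.

(** With [nondeg_iso] and [nondeg_zero], this reduces nondegeneracy in the derived category to
    shifted modules. *)
Lemma nondeg_sum X X1 X2 : is_direct_sum2 X X1 X2 -> nondeg X1 -> nondeg X2 -> nondeg X.
Proof.
move=> /dsum2P[i1 [i2 [p1 [p2 [_ _ _ _ s]]]]] [l1 r1] [l2 r2]; split=> [f f0|g g0].
- have f1 : f \oc i1 = 0 by apply: l1 => g; rewrite -compA; exact: f0.
  have f2 : f \oc i2 = 0 by apply: l2 => g; rewrite -compA; exact: f0.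
  by rewrite -[f]comp1r -s compDr !compA f1 f2 !comp0l addr0.
- have g1 : p1 \oc g = 0 by apply: r1 => f; rewrite compA; exact: g0.
  have g2 : p2 \oc g = 0 by apply: r2 => f; rewrite compA; exact: g0.
  by rewrite -[g]comp1l -s compDl -!compA g1 g2 !comp0r addr0.
Qed.

Lemma nondeg_zero X : is_zero X -> nondeg X.
Proof. by move=> X0; split=> h _; [exact: is_zero_hom_l|exact: is_zero_hom_r]. Qed.

(* Y is the image of Z under a Serre functor *)
Definition serre_pair := linfunct t /\ forall X, nondeg X.
End Nondegeneracy.

Hypothesis fd : forall X Y, findim (hom X Y).

Lemma serre_reprr Z Y (t : hom Z Y -> k) X (l : hom X Y -> k) : serre_pair t -> linfunct l ->
  exists g : hom Z X, forall f, l f = t (f \oc g).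
Proof.
move=> [tl nd]; apply: perfect_pairing => //.
- by move=> g c f f'; rewrite comp_linl tl.
- by move=> f c g g'; rewrite comp_linr tl.
- exact: (nd X).1.
Qed.
Lemma serre_reprl Z Y (t : hom Z Y -> k) X (l : hom Z X -> k) : serre_pair t -> linfunct l ->
  exists f : hom X Y, forall g, l g = t (f \oc g).
Proof.
move=> [tl nd]; apply: (@perfect_pairing _ _ _ (fun g f => t (f \oc g))) => //.
- by move=> g c f f'; rewrite comp_linr tl.
- by move=> f c g g'; rewrite comp_linl tl.
- exact: (nd X).2.
Qed.

Lemma serre_pair_iso Z Z' Y Y' (t : hom Z Y -> k) :
  isomorphic Z Z' -> isomorphic Y Y' -> serre_pair t ->
  exists t' : hom Z' Y' -> k, serre_pair t'.
Proof.
move=> [u [u' [u1 u2]]] [v [v' [v1 v2]]] [tl nd].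
exists (fun w => t (v' \oc w \oc u)); split=> [c f f'|X].
  by rewrite comp_linr comp_linl tl.
split=> [f f0|g g0].
- rewrite -[f]comp1l -v2 -compA; suff -> : v' \oc f = 0 by rewrite comp0r.
  apply: (nd X).1 => g; have := f0 (g \oc u'); rewrite !compA.
  by rewrite -(compA _ u') u1 comp1r.
- rewrite -[g]comp1r -u2 compA; suff -> : g \oc u = 0 by rewrite comp0l.
  apply: (nd X).2 => f; have := g0 (v \oc f); rewrite !compA.
  by rewrite v1 comp1l.
Qed.

Lemma serre_pair_sum Z Z1 Z2 Y Y1 Y2 (t1 : hom Z1 Y1 -> k) (t2 : hom Z2 Y2 -> k) :
  is_direct_sum2 Z Z1 Z2 -> is_direct_sum2 Y Y1 Y2 -> serre_pair t1 -> serre_pair t2 ->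
  exists t : hom Z Y -> k, serre_pair t.
Proof.
move=> /dsum2P[i1 [i2 [p1 [p2 [pi1 pi2 pi12 pi21 s]]]]].
move=> /dsum2P[j1 [j2 [q1 [q2 [qj1 qj2 qj12 qj21 r]]]]] [l1 n1] [l2 n2].
exists (fun w => t1 (q1 \oc w \oc i1) + t2 (q2 \oc w \oc i2)); split=> [c f f'|X].
  by rewrite !comp_linr !comp_linl l1 l2 mulrDr addrACA.
split=> [f f0|g g0].
- have f1 : q1 \oc f = 0.
    apply: (n1 X).1 => g; have := f0 (g \oc p1).
    rewrite !compA -!(compA _ p1) pi1 pi12 comp1r !comp0r.
    by rewrite (linfunct0 l2) addr0.
  have f2 : q2 \oc f = 0.
    apply: (n2 X).1 => g; have := f0 (g \oc p2).
    rewrite !compA -!(compA _ p2) pi2 pi21 comp1r !comp0r.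
    by rewrite (linfunct0 l1) add0r.
  by rewrite -[f]comp1l -r compDl -!compA f1 f2 !comp0r addr0.
- have g1 : g \oc i1 = 0.
    apply: (n1 X).2 => f; have := g0 (j1 \oc f).
    rewrite !compA qj1 qj21 comp1l !comp0l.
    by rewrite (linfunct0 l2) addr0.
  have g2 : g \oc i2 = 0.
    apply: (n2 X).2 => f; have := g0 (j2 \oc f).
    rewrite !compA qj2 qj12 comp1l !comp0l.
    by rewrite (linfunct0 l1) add0r.
  by rewrite -[g]comp1r -s compDr !compA g1 g2 !comp0l addr0.
Qed.

Lemma serre_pair_zero Z Y : is_zero Z -> is_zero Y ->
  exists t : hom Z Y -> k, serre_pair t.
Proof.
move=> Z0 Y0; exists (fun _ => 0); split=> [c f g|X]; first by rewrite mulr0 addr0.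
by split=> f _; [exact: is_zero_hom_r|exact: is_zero_hom_l].
Qed.

Lemma serre_pair_functor (F : functor D D) Z Y (t : hom Z Y -> k) :
  faithful F -> full F -> esurj F -> serre_pair t ->
  exists t' : hom (F Z) (F Y) -> k, serre_pair t'.
Proof.
move=> Ff Fu Fe [tl nd].
pose t' (w : hom (F Z) (F Y)) := t (projT1 (cid (Fu _ _ w))).
have t'E w : t' (fmap F w) = t w.
  by rewrite /t'; case: cid => w' /= /(faithful_inj Ff) ->.
exists t'; split=> [c f f'|X].
  by have [g <-] := Fu _ _ f; have [g' <-] := Fu _ _ f'; rewrite -fmap_lin !t'E tl.
have [X' XX'] := Fe X; apply: nondeg_iso XX' _; split=> [f f0|g g0].
- have [h hf] := Fu _ _ f; rewrite -hf ((nd X').1 h) ?fmap0// => g.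
  by rewrite -t'E fmapM hf f0.
- have [h hg] := Fu _ _ g; rewrite -hg ((nd X').2 h) ?fmap0// => f.
  by rewrite -t'E fmapM hg g0.
Qed.

(** Each trace is represented through the other one; the two representing maps are inverse because
    composing them changes no value of the trace, and the trace is nondegenerate. *)
Lemma serre_pair_uniqr Z Y Y' (t : hom Z Y -> k) (t' : hom Z Y' -> k) :
  serre_pair t -> serre_pair t' ->
  exists v : hom Y Y', is_iso v /\ forall w, t' (v \oc w) = t w.
Proof.
move=> st st'.
have [v vE] := serre_reprl st' st.1; have [v' v'E] := serre_reprl st st'.1.
exists v; split=> [|w]; last by rewrite vE.
exists v'; split; apply/eqP; rewrite -subr_eq0; apply/eqP.
- apply: (st.2 _).1 => g; rewrite compDl compNl comp1l linfunctD ?linfunctN; try exact: st.1.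
  by rewrite -compA -v'E -vE subrr.
- apply: (st'.2 _).1 => g; rewrite compDl compNl comp1l linfunctD ?linfunctN; try exact: st'.1.
  by rewrite -compA -vE -v'E subrr.
Qed.

Lemma serre_pair_uniql Z Z' Y (t : hom Z Y -> k) (t' : hom Z' Y -> k) :
  serre_pair t -> serre_pair t' ->
  exists v : hom Z' Z, is_iso v /\ forall w, t' (w \oc v) = t w.
Proof.
move=> st st'.
have [v vE] := serre_reprr st' st.1; have [v' v'E] := serre_reprr st st'.1.
exists v; split=> [|w]; last by rewrite vE.
exists v'; split; apply/eqP; rewrite -subr_eq0; apply/eqP.
- apply: (st'.2 _).2 => g; rewrite compDr compNr comp1r linfunctD ?linfunctN; try exact: st'.1.
  by rewrite compA -vE -v'E subrr.
- apply: (st.2 _).2 => g; rewrite compDr compNr comp1r linfunctD ?linfunctN; try exact: st.1.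
  by rewrite compA -v'E -vE subrr.
Qed.

Section SerreFunctor.
Variable sh : functor D D.
Hypotheses (shf : faithful sh) (shu : full sh).
Hypothesis exT : forall X, exists (T : D) (t : hom X (sh T) -> k), serre_pair t.
Hypothesis exZ : forall Y, exists (Z : D) (t : hom Z (sh Y) -> k), serre_pair t.

Definition serre_trace (tau : functor D D) (t : forall X, hom X (sh (tau X)) -> k) :=
  (forall X, serre_pair (t X)) /\
  (forall X X' (u : hom X X') (g : hom X' (sh (tau X))),
    t X' (fmap sh (fmap tau u) \oc g) = t X (g \oc u)).

(** On morphisms, [tau u] is the transpose of precomposition with [u] under the traces. Uniqueness
    of the transpose makes it a functor, nondegeneracy on the other side makes it faithful and full,
    and [exZ] with uniqueness of partners makes it essentially surjective. *)
Lemma serre_functor_exists : exists (tau tau' : functor D D) (t : forall X, hom X (sh (tau X)) -> k),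
  serre_trace t /\ quasi_inverse tau tau'.
Proof.
pose T X := projT1 (cid (exT X)).
pose t X : hom X (sh (T X)) -> k := projT1 (cid (projT2 (cid (exT X)))).
have st X : serre_pair (t X) := projT2 (cid (projT2 (cid (exT X)))).
have exu X X' (u : hom X X') : exists v : hom (T X) (T X'),
    forall g, t X' (fmap sh v \oc g) = t X (g \oc u).
  have ll : linfunct (fun g => t X (g \oc u)).
    by move=> c f f'; rewrite comp_linl (st X).1.
  have [w wE] := serre_reprl (st X') ll; have [v vw] := shu w.
  by exists v => g; rewrite vw wE.
pose m X X' (u : hom X X') := projT1 (cid (exu X X' u)).
have mE X X' (u : hom X X') g : t X' (fmap sh (m X X' u) \oc g) = t X (g \oc u).
  exact: (projT2 (cid (exu X X' u))).
have mU X X' (v v' : hom (T X) (T X')) :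
    (forall g, t X' (fmap sh v \oc g) = t X' (fmap sh v' \oc g)) -> v = v'.
  move=> e; apply: (faithful_inj shf); apply/eqP; rewrite -subr_eq0; apply/eqP.
  apply: ((st X').2 _).1 => g; rewrite compDl compNl linfunctD ?linfunctN; try exact: (st X').1.
  by rewrite e subrr.
have m1 X : m X X (idm X) = idm (T X) by apply: mU => g; rewrite mE fmap1 comp1l comp1r.
have mM X Y Z (g : hom Y Z) (f : hom X Y) : m X Z (g \oc f) = m Y Z g \oc m X Y f.
  by apply: mU => h; rewrite mE fmapM -compA mE -compA mE compA.
have mL X Y c (f g : hom X Y) : m X Y (c *: f + g) = c *: m X Y f + m X Y g.
  apply: mU => h; rewrite mE fmap_lin comp_linl comp_linr (st X).1 (st Y).1.
  by rewrite !mE.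
pose tau := Functor m1 mM mL.
have tf : faithful tau.
  move=> X X' u u0; apply: ((st X).2 _).2 => f.
  have m0 : m X X' u = 0 := u0.
  by rewrite -mE m0 fmap0 comp0l; exact: linfunct0 (st X').1.
have tu : full tau.
  move=> X X' v; have ll : linfunct (fun g => t X' (fmap sh v \oc g)).
    by move=> c f f'; rewrite comp_linr (st X').1.
  have [u uE] := serre_reprr (st X) ll; exists u; apply: mU => g.
  by rewrite mE uE.
have te : esurj tau.
  move=> Y; have [Z [s ss]] := exZ Y; exists Z.
  have [v [vi _]] := serre_pair_uniqr (st Z) ss.
  by apply: (ff_isomorphic shf shu); exists v.
have [tau' q] := equivalence_quasi_inverse tf tu te.
by exists tau, tau', t.
Qed.

(** The trace at [tau' Y] is carried along the isomorphism from [tau (tau' Y)] to [Y]; the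
    naturality of that isomorphism converts naturality in the source into naturality in [Y]. *)
Lemma serre_trace_inverse (tau tau' : functor D D) (t : forall X, hom X (sh (tau X)) -> k) :
  serre_trace t -> quasi_inverse tau tau' ->
  exists s : forall Y, hom (tau' Y) (sh Y) -> k,
    (forall Y, serre_pair (s Y)) /\
    (forall Y Y' (u : hom Y Y') (w : hom (tau' Y') (sh Y)),
      s Y' (fmap sh u \oc w) = s Y (w \oc fmap tau' u)).
Proof.
move=> [st tn] [_ /natiso_idP[eta [etai etan]]].
pose eta' Y := projT1 (cid (etai Y)).
have e1 Y : eta' Y \oc eta Y = idm _ := (projT2 (cid (etai Y))).1.
have e2 Y : eta Y \oc eta' Y = idm _ := (projT2 (cid (etai Y))).2.
exists (fun Y w => t (tau' Y) (fmap sh (eta' Y) \oc w)); split=> [Y|Y Y' u w].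
  split=> [c f g|X]; first by rewrite comp_linr (st _).1.
  split=> [f f0|g g0].
  - apply: (@iso_monic _ _ _ _ _ (fmap sh (eta' Y))).
      by apply: fmap_iso; exists (eta Y).
    by rewrite comp0r; apply: ((st (tau' Y)).2 _).1 => g; rewrite -compA f0.
  - apply: ((st (tau' Y)).2 _).2 => f.
    have := g0 (fmap sh (eta Y) \oc f).
    by rewrite !compA -fmapM e1 fmap1 comp1l.
have := tn _ _ (fmap tau' u) (fmap sh (eta' Y) \oc w); rewrite compA -fmapM.
suff -> : fmap tau (fmap tau' u) \oc eta' Y = eta' Y' \oc u by rewrite fmapM !compA.
by apply: (iso_monic (etai Y')); rewrite compA etan -compA e2 comp1r compA e2 comp1l.
Qed.
End SerreFunctor.
End Serre.

(** * Powers of an autoequivalence *)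

Lemma int_updown (P : int -> Prop) (i0 : int) :
  P i0 -> (forall i, P i -> P (i + 1)) -> (forall i, P (i + 1) -> P i) -> forall i, P i.
Proof.
move=> P0 Pup Pdn i; rewrite -(subrK i0 i) addrC.
case: (i - i0) => n.
- elim: n => [|n IH]; first by rewrite addr0.
  have -> : i0 + n.+1%:Z = i0 + n%:Z + 1 by lia.
  exact: Pup IH.
- elim: n => [|n IH]; apply: Pdn; first by have -> : i0 + Negz 0 + 1 = i0 by lia.
  by have -> : i0 + Negz n.+1 + 1 = i0 + Negz n by lia.
Qed.

Section Powers.
Variables (k : fieldType) (C : lincat k) (F0 G0 : functor C C).
Hypothesis FG : quasi_inverse F0 G0.
Let Ff : faithful F0 := quasi_inverse_faithful FG.
Let Fu : full F0 := quasi_inverse_full FG.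

(* A sequence of objects standing for (F0^n X), n in Z.  The indices of sp_map
   are related by an equation, so that no transport is needed. *)
Record spectrum := Spectrum {
  sp :> int -> C;
  sp_map : forall m n : int, m + 1 = n -> hom (F0 (sp m)) (sp n);
  sp_iso : forall m n (e : m + 1 = n), is_iso (sp_map e)
}.

Section Family.
Variables (A B : spectrum) (j : int).

(** A map of degree [j] between spectra, compatible with the structure maps. Taking [n] with a proof
    of [i + j = n] allows differently bracketed sums as target index. *)
Definition is_family (g : forall i n : int, i + j = n -> hom (A i) (B n)) :=
  forall (i n : int) (e : i + j = n) i' n' (e' : i' + j = n') (h : i + 1 = i') (h' : n + 1 = n'),
    g i' n' e' \oc sp_map A h = sp_map B h' \oc fmap F0 (g i n e).

Lemma family_irr (g : forall i n : int, i + j = n -> hom (A i) (B n)) (i n : int) (e e' : i + j = n) :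
  g i n e = g i n e'.
Proof. by rewrite (Prop_irrelevance e e'). Qed.

(** One component determines the next one because the structure maps are invertible, and the
    previous one because [F0] is also faithful. All coherence laws of the action rest on this
    rigidity. *)
Lemma family_uniq g g' : is_family g -> is_family g' ->
  forall (i0 n0 : int) (e0 : i0 + j = n0), g i0 n0 e0 = g' i0 n0 e0 ->
  forall (i n : int) (e : i + j = n), g i n e = g' i n e.
Proof.
move=> gF g'F i0 n0 e0 gg'.
apply: (@int_updown (fun i => forall n (e : i + j = n), g i n e = g' i n e) i0) => [n e|i IH n e|i IH n e].
- by subst n0; subst n.
- have e1 : i + j = n - 1 by lia.
  have h' : n - 1 + 1 = n by lia.
  apply: (iso_epic (sp_iso A (erefl (i + 1)))).
  by rewrite (gF _ _ e1 _ _ e _ h') (g'F _ _ e1 _ _ e _ h') IH.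
- have e1 : i + 1 + j = n + 1 by lia.
  apply: (faithful_inj Ff); apply: (iso_monic (sp_iso B (erefl (n + 1)))).
  by rewrite -(gF _ _ e _ _ e1 (erefl _)) -(g'F _ _ e _ _ e1 (erefl _)) IH.
Qed.

Lemma family_iso g : is_family g ->
  forall (i0 n0 : int) (e0 : i0 + j = n0), is_iso (g i0 n0 e0) ->
  forall (i n : int) (e : i + j = n), is_iso (g i n e).
Proof.
move=> gF i0 n0 e0 gi.
apply: (@int_updown (fun i => forall n (e : i + j = n), is_iso (g i n e)) i0) => [n e|i IH n e|i IH n e].
- by subst n0; subst n.
- have e1 : i + j = n - 1 by lia.
  have h' : n - 1 + 1 = n by lia.
  have [a [a1 a2]] := sp_iso A (erefl (i + 1)).
  rewrite -[g _ _ _]comp1r -a2 compA (gF _ _ e1 _ _ e _ h').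
  apply: is_iso_comp; last by exists (sp_map A (erefl (i + 1))).
  by apply: is_iso_comp; [exact: sp_iso|apply: fmap_iso; exact: IH].
- have e1 : i + 1 + j = n + 1 by lia.
  apply: (ff_iso Ff Fu); have [b [b1 b2]] := sp_iso B (erefl (n + 1)).
  rewrite -[fmap _ _]comp1l -b1 -compA -(gF _ _ e _ _ e1 (erefl _)).
  apply: is_iso_comp; first by exists (sp_map B (erefl (n + 1))).
  by apply: is_iso_comp; [exact: IH|exact: sp_iso].
Qed.

Section Existence.
Variable u : forall n : int, 0 + j = n -> hom (A 0) (B n).

Let ainv (X : spectrum) m n (e : m + 1 = n) := projT1 (cid (sp_iso X e)).
Let ainvl (X : spectrum) m n (e : m + 1 = n) : ainv X e \oc sp_map X e = idm _ :=
  (projT2 (cid (sp_iso X e))).1.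
Let ainvr (X : spectrum) m n (e : m + 1 = n) : sp_map X e \oc ainv X e = idm _ :=
  (projT2 (cid (sp_iso X e))).2.
Let pre X Y (g : hom (F0 X) (F0 Y)) := projT1 (cid (Fu g)).
Let preE X Y (g : hom (F0 X) (F0 Y)) : fmap F0 (pre g) = g := projT2 (cid (Fu g)).

Fact up_eq1 (m : nat) n : m.+1%:Z + j = n -> m%:Z + j = n - 1. Proof. by lia. Qed.
Fact up_eq2 (n : int) : n - 1 + 1 = n. Proof. by lia. Qed.
Fact up_eq3 (m : nat) : m%:Z + 1 = m.+1%:Z. Proof. by lia. Qed.
Fact dn_eq1 n : Negz 0 + j = n -> 0 + j = n + 1. Proof. by lia. Qed.
Fact dn_eq2 : Negz 0 + 1 = 0. Proof. by []. Qed.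
Fact dn_eq3 (m : nat) n : Negz m.+1 + j = n -> Negz m + j = n + 1. Proof. by lia. Qed.
Fact dn_eq4 (m : nat) : Negz m.+1 + 1 = Negz m. Proof. by lia. Qed.

Let step_up i n n1 (g : hom (A i) (B n)) i' (h : i + 1 = i') (h' : n + 1 = n1) :
  hom (A i') (B n1) := sp_map B h' \oc fmap F0 g \oc ainv A h.
Let step_dn i n n1 i' (g : hom (A i') (B n1)) (h : i + 1 = i') (h' : n + 1 = n1) :
  hom (A i) (B n) := pre (ainv B h' \oc g \oc sp_map A h).

Let Fixpoint up (m : nat) : forall n : int, m%:Z + j = n -> hom (A m%:Z) (B n) :=
  match m with
  | 0%N => u
  | m'.+1 => fun (n : int) e => step_up (@up m' (n - 1) (up_eq1 e)) (up_eq3 m') (up_eq2 n)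
  end.
Let Fixpoint dn (m : nat) : forall n : int, Negz m + j = n -> hom (A (Negz m)) (B n) :=
  match m with
  | 0%N => fun (n : int) e => step_dn (u (dn_eq1 e)) dn_eq2 (erefl (n + 1))
  | m'.+1 => fun (n : int) e => step_dn (@dn m' (n + 1) (dn_eq3 e)) (dn_eq4 m') (erefl (n + 1))
  end.
Let g (i : int) : forall n : int, i + j = n -> hom (A i) (B n) :=
  match i with Posz m => @up m | Negz m => @dn m end.

(** Upwards, [F0] is applied and the result conjugated by the structure maps; downwards, the
    conjugate is lifted through the full functor [F0]. *)
Lemma family_exists : exists2 g, is_family g & forall n (e : 0 + j = n), g 0 n e = u e.
Proof.
exists g => // i n e i' n' e' h h'.
have upE m p (f : forall n, m + j = n -> hom (A m) (B n)) q (e1 : m + j = p) (e2 : m + j = q)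
    (h1 : p + 1 = n') (h2 : q + 1 = n') :
    sp_map B h1 \oc fmap F0 (f p e1) = sp_map B h2 \oc fmap F0 (f q e2).
  have epq : p = q by lia.
  by move: e1 h1; rewrite epq => e1 h1; rewrite (Prop_irrelevance e1 e2) (Prop_irrelevance h1 h2).
have dnE m q (f : forall n, m + j = n -> hom (A m) (B n)) (e1 : m + j = n') (e2 : m + j = q)
    (h1 : n + 1 = n') (h2 : n + 1 = q) :
    ainv B h1 \oc f n' e1 = ainv B h2 \oc f q e2.
  have epq : q = n' by lia.
  by move: e2 h2; rewrite epq => e2 h2; rewrite (Prop_irrelevance e1 e2) (Prop_irrelevance h1 h2).
case: i i' e e' h => [m|m] [m'|m'] e e' h; try (exfalso; lia).
- have em : m' = m.+1 by lia.
  subst m'; rewrite -[g e']/(step_up _ _ _) /step_up (Prop_irrelevance (up_eq3 m) h).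
  by rewrite -compA ainvl comp1r; exact: upE.
- have [em em'] : m = 0%N /\ m' = 0%N by lia.
  subst m m'; rewrite -[g e]/(step_dn _ _ _) /step_dn preE (Prop_irrelevance dn_eq2 h).
  rewrite !compA; congr (_ \oc _); rewrite -compA -(dnE _ _ u e' _ h').
  by rewrite compA ainvr comp1l.
- have em : m = m'.+1 by lia.
  subst m; rewrite -[g e]/(step_dn _ _ _) /step_dn preE (Prop_irrelevance (dn_eq4 m') h).
  rewrite !compA; congr (_ \oc _); rewrite -compA -(dnE _ _ (@dn m') e' _ h').
  by rewrite compA ainvr comp1l.
Qed.
End Existence.

Definition transport (X : spectrum) p q (e : p = q) : hom (X p) (X q) :=
  match e in _ = r return hom (X p) (X r) with erefl => idm (X p) end.

Lemma transport_id (X : spectrum) p (e : p = p) : transport X e = idm (X p).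
Proof. by rewrite (Prop_irrelevance e erefl). Qed.

Lemma extension_exists (f : hom (A 0) (B j)) :
  exists2 g, is_family g & forall e : 0 + j = j, g 0 j e = f.
Proof.
have e0 n : 0 + j = n -> j = n by lia.
have [g gF gu] := family_exists (fun n e => transport B (e0 n e) \oc f).
by exists g => // e; rewrite gu transport_id comp1l.
Qed.

Definition extension (f : hom (A 0) (B j)) : forall i n : int, i + j = n -> hom (A i) (B n) :=
  s2val (cid2 (extension_exists f)).
Lemma extensionF (f : hom (A 0) (B j)) : is_family (extension f).
Proof. by rewrite /extension; case: cid2. Qed.
Lemma extensionE (f : hom (A 0) (B j)) (e : 0 + j = j) : extension f e = f.
Proof. by rewrite /extension; case: cid2. Qed.
End Family.

Lemma transport_family (A : spectrum) :
  is_family (fun i n (e : i + 0 = n) => transport A (etrans (esym (addr0 i)) e)).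
Proof.
move=> i n e i' n' e' h h'.
have ein : n = i by lia.
have ein' : n' = i' by lia.
move: e e' h'; rewrite ein ein' => e e' h'.
by rewrite !transport_id fmap1 comp1l comp1r (Prop_irrelevance h h').
Qed.

Definition family_comp (A B B' : spectrum) (j j' j'' : int) (q : j + j' = j'')
    (g : forall i n : int, i + j' = n -> hom (B i) (B' n)) (f : forall i n : int, i + j = n -> hom (A i) (B n)) :
    forall i n : int, i + j'' = n -> hom (A i) (B' n) :=
  fun i n e => g (i + j) n (etrans (etrans (esym (addrA i j j')) (congr1 (+%R i) q)) e)
    \oc f i (i + j) erefl.

Lemma family_compE (A B B' : spectrum) (j j' j'' : int) (q : j + j' = j'')
    (g : forall i n : int, i + j' = n -> hom (B i) (B' n)) (f : forall i n : int, i + j = n -> hom (A i) (B n))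
    (i m n : int) (e : i + j'' = n) (e1 : i + j = m) (e2 : m + j' = n) :
  family_comp q g f e = g m n e2 \oc f i m e1.
Proof. by subst m; rewrite /family_comp (family_irr g _ e2). Qed.

Lemma family_compF (A B B' : spectrum) (j j' j'' : int) (q : j + j' = j'')
    (g : forall i n : int, i + j' = n -> hom (B i) (B' n)) (f : forall i n : int, i + j = n -> hom (A i) (B n)) :
  is_family g -> is_family f -> is_family (family_comp q g f).
Proof.
move=> gF fF i n e i' n' e' h h'.
have e1 : i + j = i + j by [].
have e2 : i + j + j' = n by rewrite -addrA q.
have e1' : i' + j = i' + j by [].
have e2' : i' + j + j' = n' by rewrite -addrA q.
have hh : i + j + 1 = i' + j by lia.
rewrite (family_compE q g f e e1 e2) (family_compE q g f e' e1' e2').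
by rewrite -compA (fF _ _ e1 _ _ e1' h hh) compA (gF _ _ e2 _ _ e2' hh h') -compA fmapM.
Qed.

Lemma family_lin (A B : spectrum) (j : int) c (g f : forall i n : int, i + j = n -> hom (A i) (B n)) :
  is_family g -> is_family f -> is_family (fun i n e => c *: g i n e + f i n e).
Proof.
move=> gF fF i n e i' n' e' h h'.
by rewrite comp_linl fmap_lin comp_linr (gF _ _ e _ _ e' h h') (fF _ _ e _ _ e' h h').
Qed.

Section SpectrumOf.
Variable X : C.

Definition power_ob (n : int) : C :=
  match n with Posz m => iter m F0 X | Negz m => iter m.+1 G0 X end.

Lemma power_map_exists m n (e : m + 1 = n) :
  exists f : hom (F0 (power_ob m)) (power_ob n), is_iso f.
Proof.
have [_ /natiso_idP[eps [epsi _]]] := FG.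
case: m n e => [m|m] [n|n] e; try (exfalso; lia).
- have en : n = m.+1 by lia.
  by subst n; exists (idm _); exact: is_iso_id.
- have [em en] : m = 0%N /\ n = 0%N by lia.
  by subst m n; exists (eps X); exact: epsi.
- have em : m = n.+1 by lia.
  by subst m; exists (eps (iter n.+1 G0 X)); exact: epsi.
Qed.

Definition spectrum_of : spectrum :=
  @Spectrum power_ob (fun m n e => projT1 (cid (power_map_exists e)))
    (fun m n e => projT2 (cid (power_map_exists e))).
End SpectrumOf.
Notation S := spectrum_of.

Definition power_map (n : int) (X Y : C) (f : hom X Y) : hom (S X n) (S Y n) :=
  @extension (S X) (S Y) 0 f n n (addr0 n).

Lemma power_mapE (n : int) (X Y : C) (f : hom X Y) (g : forall i n : int, i + 0 = n -> hom (S X i) (S Y n)) :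
  is_family g -> g 0 0 (addr0 0) = f -> g n n (addr0 n) = power_map n f.
Proof.
move=> gF gf; apply: family_uniq gF (@extensionF _ _ _ _) _ _ (addr0 0) _ _ _ _.
by rewrite extensionE.
Qed.

Definition power (n : int) : functor C C.
Proof.
exists (fun X => S X n) (@power_map n).
- move=> X; rewrite -(power_mapE n (@transport_family (S X))) ?transport_id//.
- move=> X Y Z g f.
  pose gf := family_comp (addr0 0) (@extension (S Y) (S Z) 0 g) (@extension (S X) (S Y) 0 f).
  have gfF : is_family gf by apply: family_compF; exact: extensionF.
  rewrite -(power_mapE n gfF) /gf.
    by rewrite (family_compE _ _ _ _ (addr0 n) (addr0 n)).
  by rewrite (family_compE _ _ _ _ (addr0 0) (addr0 0)) !extensionE.
- move=> X Y c f g.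
  have gfF := family_lin c (@extensionF (S X) (S Y) 0 f) (@extensionF (S X) (S Y) 0 g).
  by rewrite -(power_mapE n gfF) ?extensionE.
Defined.

(** Index 0 of the spectrum of [power j X] is index [j] of the spectrum of [X] by conversion, so the
    identity there extends to a family of degree [j]. *)
Definition power_add i j n (e : i + j = n) (X : C) : hom (power i (power j X)) (power n X) :=
  @extension (S (S X j)) (S X) j (idm _) i n e.

(** Naturality and associativity of the addition maps each equate two families of the same degree;
    at index 0 they are composites of identities and one common map, and [family_uniq] spreads the
    equality to all indices. *)
Lemma power_zaction : exists F : zaction C, natiso (F 1) F0.
Proof.
have q0 : forall X, is_iso (idm X : hom X (power 0 X)) by move=> X; exact: is_iso_id.
have qD : forall i j n (e : i + j = n) X, is_iso (power_add e X).
  move=> i j n e X; apply: (family_iso (@extensionF _ _ _ _) (e0 := add0r j)).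
  by rewrite extensionE; exact: is_iso_id.
have n0 : forall X Y (f : hom X Y),
    (idm Y : hom Y (power 0 Y)) \oc f = fmap (power 0) f \oc (idm X : hom X (power 0 X)).
  move=> X Y f; rewrite comp1l.
  have -> : fmap (power 0) f = f by exact: (@extensionE (S X) (S Y) 0 f (addr0 0)).
  by rewrite comp1r.
have nD : forall i j n (e : i + j = n) X Y (f : hom X Y),
    power_add e Y \oc fmap (power i) (fmap (power j) f) = fmap (power n) f \oc power_add e X.
  move=> i j n e X Y f.
  pose g1 := family_comp (add0r j) (@extension (S (S Y j)) (S Y) j (idm _))
    (@extension (S (S X j)) (S (S Y j)) 0 (power_map j f)).
  pose g2 := family_comp (addr0 j) (@extension (S X) (S Y) 0 f)
    (@extension (S (S X j)) (S X) j (idm _)).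
  have g1F : is_family g1 by apply: family_compF; exact: extensionF.
  have g2F : is_family g2 by apply: family_compF; exact: extensionF.
  have E : forall i n e, g1 i n e = g2 i n e.
    apply: (family_uniq g1F g2F (e0 := add0r j)); rewrite /g1 /g2.
    rewrite (family_compE _ _ _ _ (addr0 0) (add0r j)) (family_compE _ _ _ _ (add0r j) (addr0 j)).
    by rewrite !extensionE comp1l comp1r.
  have := E i n e; rewrite /g1 /g2.
  by rewrite (family_compE _ _ _ _ (addr0 i) e) (family_compE _ _ _ _ e (addr0 n)).
have n0l : forall i (e : 0 + i = i) X,
    power_add e X \oc (idm _ : hom (power i X) (power 0 (power i X))) = idm (power i X).
  by move=> i e X; rewrite comp1r; exact: (@extensionE (S (S X i)) (S X) i (idm _) e).
have n0r : forall i (e : i + 0 = i) X,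
    power_add e X \oc fmap (power i) (idm X : hom X (power 0 X)) = idm (power i X).
  move=> i e X; have -> : fmap (power i) (idm X : hom X (power 0 X)) = idm (power i X).
    exact: (fmap1 (power i)).
  rewrite comp1r (Prop_irrelevance e (addr0 i)).
  exact: (fmap1 (power i)).
have nA : forall i j l a b n (ea : i + j = a) (en : a + l = n) (eb : j + l = b)
      (en' : i + b = n) X,
    power_add en X \oc power_add ea (power l X) = power_add en' X \oc fmap (power i) (power_add eb X).
  move=> i j l a b n ea en eb en' X.
  pose g1 := family_comp eb (@extension (S (S X l)) (S X) l (idm _))
    (@extension (S (S (S X l) j)) (S (S X l)) j (idm _)).
  pose g2 := family_comp (add0r b) (@extension (S (S X b)) (S X) b (idm _))
    (@extension (S (S (S X l) j)) (S (S X b)) 0 (power_add eb X)).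
  have g1F : is_family g1 by apply: family_compF; exact: extensionF.
  have g2F : is_family g2 by apply: family_compF; exact: extensionF.
  have E : forall i n e, g1 i n e = g2 i n e.
    apply: (family_uniq g1F g2F (e0 := add0r b)); rewrite /g1 /g2.
    rewrite (family_compE _ _ _ _ (add0r j) eb) (family_compE _ _ _ _ (addr0 0) (add0r b)).
    by rewrite !extensionE comp1l comp1r.
  have := E i n en'; rewrite /g1 /g2.
  by rewrite (family_compE _ _ _ _ ea en) (family_compE _ _ _ _ (addr0 i) en').
exists (ZAction q0 qD n0 nD n0l n0r nA).
apply: natiso_sym; exists (fun X => @sp_map (S X) 0 1 erefl); split=> [X|X Y f].
  exact: (@sp_iso (S X) 0 1 erefl).
have := @extensionF (S X) (S Y) 0 f 0 0 (addr0 0) 1 1 (addr0 1) erefl erefl.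
by rewrite extensionE => <-.
Qed.
End Powers.

(** * Modules *)

Section ModuleMaps.
Variables (k : fieldType) (H : falgType k).
Implicit Types X Y Z P Q S : modcat H.

Lemma mapp_comp X Y Z (g : hom Y Z) (f : hom X Y) v : mapp (g \oc f) v = mapp g (mapp f v).
Proof. by rewrite /mapp vsval_comp mulmxA. Qed.
Lemma mapp_id X v : mapp (idm X) v = v.
Proof. exact: mulmx1. Qed.
Lemma mapp_linl X Y c (f g : hom X Y) v : mapp (c *: f + g) v = c *: mapp f v + mapp g v.
Proof. by rewrite /mapp vsval_lin mulmxDr -scalemxAr. Qed.
Lemma mapp_linr X Y c (f : hom X Y) v w : mapp f (c *: v + w) = c *: mapp f v + mapp f w.
Proof. by rewrite /mapp mulmxDl -scalemxAl. Qed.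
Lemma mapp0 X Y (f : hom X Y) : mapp f 0 = 0.
Proof. exact: mul0mx. Qed.
Lemma mapp0l X Y v : mapp (0 : hom X Y) v = 0.
Proof. exact: mulmx0. Qed.
Lemma mappD X Y (f : hom X Y) v w : mapp f (v + w) = mapp f v + mapp f w.
Proof. exact: mulmxDl. Qed.
Lemma mappDl X Y (f g : hom X Y) v : mapp (f + g) v = mapp f v + mapp g v.
Proof. exact: mulmxDr. Qed.
Lemma mappNl X Y (f : hom X Y) v : mapp (- f) v = - mapp f v.
Proof. exact: mulmxN. Qed.
Lemma mappB X Y (f : hom X Y) v w : mapp f (v - w) = mapp f v - mapp f w.
Proof. exact: mulmxBl. Qed.
Lemma mapp_sum X Y (f : hom X Y) I (r : seq I) (F : I -> 'rV_(mdim X)) :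
  mapp f (\sum_(i <- r) F i) = \sum_(i <- r) mapp f (F i).
Proof. exact: mulmx_suml. Qed.
Lemma mapp_act X Y (f : hom X Y) v a : mapp f (v *m mact X a) = mapp f v *m mact Y a.
Proof. by rewrite /mapp -!mulmxA modhomP. Qed.

Lemma mx_fun_eq m n (A B : 'M[k]_(m, n)) : (forall v : 'rV_m, v *m A = v *m B) -> A = B.
Proof. by move=> AB; apply/row_matrixP => i; rewrite !rowE AB. Qed.

Lemma hom_ext X Y (f g : hom X Y) : (forall v, mapp f v = mapp g v) -> f = g.
Proof. by move=> fg; apply: subvs_inj; exact: mx_fun_eq. Qed.

Lemma hom_fun X Y (f : 'rV[k]_(mdim X) -> 'rV[k]_(mdim Y)) :
  (forall c u v, f (c *: u + v) = c *: f u + f v) ->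
  (forall v a, f (v *m mact X a) = f v *m mact Y a) ->
  exists h : hom X Y, forall v, mapp h v = f v.
Proof.
move=> fl fa; pose A : 'M_(mdim X, mdim Y) := \matrix_i f (delta_mx 0 i).
have f0 : f 0 = 0 by have := fl (-1) 0 0; rewrite !scaleN1r oppr0 addr0 addNr.
have AE v : v *m A = f v.
  rewrite mulmx_sum_row {2}[v]row_sum_delta.
  elim/big_rec2: _ => [|i x y _ ->]; first by rewrite f0.
  by rewrite fl rowK.
have AH a : mact X a *m A = A *m mact Y a.
  by apply: mx_fun_eq => v; rewrite !mulmxA !AE fa.
by exists (mk_modhom AH) => v; exact: AE.
Qed.

Lemma mono_eq0 X Y (f : hom X Y) : mono f <-> forall v, mapp f v = 0 -> v = 0.
Proof.
split=> [fm v fv|f0 v w fvw]; first by apply: fm; rewrite fv mapp0.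
by apply/eqP; rewrite -subr_eq0; apply/eqP/f0; rewrite mappB fvw subrr.
Qed.

Lemma mono_cancel X Y Z (i : hom Y Z) (f g : hom X Y) : mono i -> i \oc f = i \oc g -> f = g.
Proof. by move=> im e; apply: hom_ext => v; apply: im; rewrite -!mapp_comp e. Qed.
Lemma epi_cancel X Y Z (p : hom X Y) (f g : hom Y Z) : epi p -> f \oc p = g \oc p -> f = g.
Proof. by move=> pe e; apply: hom_ext => v; have [w <-] := pe v; rewrite -!mapp_comp e. Qed.

Lemma mono_factor X Y Z (i : hom Y Z) (f : hom X Z) :
  mono i -> (forall v, exists w, mapp i w = mapp f v) -> exists g : hom X Y, i \oc g = f.
Proof.
move=> im ex; pose g v := projT1 (cid (ex v)).
have gE v : mapp i (g v) = mapp f v := projT2 (cid (ex v)).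
have [c u v|v a|h hE] := @hom_fun X Y g.
- by apply: im; rewrite mapp_linr !gE mapp_linr.
- by apply: im; rewrite mapp_act !gE mapp_act.
by exists h; apply: hom_ext => v; rewrite mapp_comp hE gE.
Qed.

Lemma epi_factor X Y Z (p : hom X Y) (f : hom X Z) :
  epi p -> (forall v, mapp p v = 0 -> mapp f v = 0) -> exists g : hom Y Z, g \oc p = f.
Proof.
move=> pe pf; pose s v := projT1 (cid (pe v)).
have sE v : mapp p (s v) = v := projT2 (cid (pe v)).
have pU v w : mapp p v = mapp p w -> mapp f v = mapp f w.
  by move=> e; apply/eqP; rewrite -subr_eq0 -mappB pf// mappB e subrr.
have [c u v|v a|h hE] := @hom_fun Y Z (fun v => mapp f (s v)).
- by rewrite -mapp_linr; apply: pU; rewrite mapp_linr !sE.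
- by rewrite -mapp_act; apply: pU; rewrite mapp_act !sE.
by exists h; apply: hom_ext => v; rewrite mapp_comp hE; apply: pU; rewrite sE.
Qed.

Definition submodule X (U : 'rV[k]_(mdim X) -> Prop) :=
  [/\ U 0, forall c u v, U u -> U v -> U (c *: u + v) & forall u a, U u -> U (u *m mact X a)].

(** The module lives on the coordinates for a row basis of [U]; the pseudo-inverse of that basis
    reads off the coordinates of its image under the action. *)
Lemma submodule_exists X U : @submodule X U ->
  exists S (i : hom S X), mono i /\ forall v, U v <-> exists s, mapp i s = v.
Proof.
move=> [U0 UL UA]; have [A AP] := linclosed_mx U0 UL.
pose B := row_base A; have BA v : (v <= B)%MS = (v <= A)%MS by rewrite eq_row_base.
have Bfree : row_free B by exact: row_base_free.
clearbody B.
have stab a : (B *m mact X a <= B)%MS.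
  apply/row_subP => i; rewrite row_mul BA; apply/AP/UA/AP.
  by rewrite -BA; exact: row_sub.
pose act a := B *m mact X a *m pinvmx B.
have actB a : act a *m B = B *m mact X a by rewrite mulmxKpV.
have Binj m (C C' : 'M_(m, _)) : C *m B = C' *m B -> C = C'.
  by move=> e; apply: (row_free_inj Bfree).
have actl : linear act.
  move=> c a b; apply: Binj; rewrite mulmxDl -scalemxAl !actB linearP mulmxDr.
  by rewrite -scalemxAr.
have act1 : act 1 = 1%:M by apply: Binj; rewrite actB mact1 mulmx1 mul1mx.
have actM a b : act (a * b) = act a *m act b.
  by apply: Binj; rewrite -[RHS]mulmxA !actB mactM !mulmxA actB.
pose L : {linear H -> 'M[k]_(\rank A)} :=
  HB.pack act (GRing.isLinear.Build k H 'M[k]_(\rank A) _ act actl).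
pose S : modcat H := @FdMod k H (\rank A) L act1 actM.
have BH a : mact S a *m B = B *m mact X a by exact: actB.
exists S, (@mk_modhom k H S X B BH); split=> [v w e|v].
  by apply: (row_free_inj Bfree).
rewrite AP -BA; split=> [/submxP[s ->]|[s <-]]; first by exists s.
exact: submxMl.
Qed.

Lemma kernel_exists X Y (f : hom X Y) :
  exists S (i : hom S X), mono i /\ forall v, mapp f v = 0 <-> exists s, mapp i s = v.
Proof.
apply: (@submodule_exists X (fun v => mapp f v = 0)); split; first exact: mapp0.
  by move=> c u v fu fv; rewrite mapp_linr fu fv scaler0 addr0.
by move=> u a fu; rewrite mapp_act fu mul0mx.
Qed.

Lemma image_submodule X Y (f : hom X Y) : @submodule Y (fun w => exists v, mapp f v = w).
Proof.
split; first by exists 0; exact: mapp0.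
  by move=> c _ _ [u <-] [v <-]; exists (c *: u + v); rewrite mapp_linr.
by move=> _ a [u <-]; exists (u *m mact X a); rewrite mapp_act.
Qed.

Lemma image_exists X Y (f : hom X Y) :
  exists S (i : hom S Y) (p : hom X S), [/\ mono i, epi p & i \oc p = f].
Proof.
have [S [i [im iE]]] := submodule_exists (image_submodule f).
have [|p pE] := @mono_factor X S Y i f im; first by move=> v; apply/iE; exists v.
exists S, i, p; split=> // s; have /iE[v vE] : exists s', mapp i s' = mapp i s by exists s.
by exists v; apply: im; rewrite -mapp_comp pE.
Qed.

Lemma quotient_exists X U : @submodule X U ->
  exists Q (p : hom X Q), epi p /\ forall v, U v <-> mapp p v = 0.
Proof.
move=> [U0 UL UA]; have [A AP] := linclosed_mx U0 UL.
pose B := col_base (cokermx A).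
have UB v : U v <-> v *m B = 0.
  rewrite AP submxE; split=> [/eqP vA|vB].
    have : v *m B *m row_base (cokermx A) = 0 by rewrite -mulmxA mulmx_base.
    rewrite -[RHS](mul0mx _ (row_base (cokermx A))).
    by move=> e; apply: (row_free_inj (row_base_free _)).
  by rewrite -(mulmx_base (cokermx A)) mulmxA vB mul0mx.
have Bfull : row_full B by exact: col_base_full.
clearbody B.
have [C pB] : exists C, C *m B = 1%:M by exists (pinvmx B); exact: mulVpmx.
pose act a := C *m mact X a *m B.
have Bact a : B *m act a = mact X a *m B.
  apply: mx_fun_eq => v; have : U (v - v *m B *m C).
    by apply/UB; rewrite mulmxBl -(mulmxA (v *m B)) pB mulmx1 subrr.
  move=> Uv; have /UB := UA _ a Uv; rewrite !mulmxBl => /eqP; rewrite subr_eq0 => /eqP e.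
  by rewrite /act !mulmxA e.
have actl : linear act.
  by move=> c a b; rewrite /act linearP mulmxDr mulmxDl -scalemxAr -scalemxAl.
have act1 : act 1 = 1%:M by rewrite /act mact1 mulmx1.
have actM a b : act (a * b) = act a *m act b.
  have -> : act a *m act b = C *m (mact X a *m (B *m act b)) by rewrite /act !mulmxA.
  by rewrite Bact /act mactM !mulmxA.
pose L : {linear H -> 'M[k]_(\rank (cokermx A))} :=
  HB.pack act (GRing.isLinear.Build k H 'M[k]_(\rank (cokermx A)) _ act actl).
pose Q : modcat H := @FdMod k H (\rank (cokermx A)) L act1 actM.
have BH a : mact X a *m B = B *m mact Q a by rewrite -Bact.
exists Q, (@mk_modhom k H X Q B BH); split=> [w|v]; last exact: UB.
by exists (w *m C); rewrite /mapp /= -mulmxA pB mulmx1.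
Qed.

Lemma coker_exists X Y (f : hom X Y) :
  exists Q (p : hom Y Q), epi p /\ forall v, (exists u, mapp f u = v) <-> mapp p v = 0.
Proof.
exact: quotient_exists (image_submodule f).
Qed.

Lemma projective_lift P X Y (a : hom X Y) (f : hom P Y) : projective P ->
  (forall v, exists w, mapp a w = mapp f v) -> exists g : hom P X, a \oc g = f.
Proof.
move=> Pp ex; have [S [i [p [im pe ip]]]] := image_exists a.
have [|f' f'E] := @mono_factor P S Y i f im.
  by move=> v; have [w wE] := ex v; exists (mapp p w); rewrite -mapp_comp ip.
have [g gE] := Pp _ _ p f' pe; exists g.
by rewrite -ip -compA gE.
Qed.

Lemma zeromod_homl X (f g : hom (zeromod H) X) : f = g.
Proof. by apply: hom_ext => v; rewrite [v]thinmx0 !mapp0. Qed.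
Lemma zeromod_homr X (f g : hom X (zeromod H)) : f = g.
Proof. by apply: hom_ext => v; rewrite [LHS]thinmx0 [RHS]thinmx0. Qed.

Section DsumMaps.
Variables M N : modcat H.

Fact dsum_mactE a : mact (dsum M N) a = block_mx (mact M a) 0 0 (mact N a). Proof. by []. Qed.
Fact dinl_proof a : mact M a *m row_mx 1%:M 0 = row_mx 1%:M 0 *m mact (dsum M N) a.
Proof. by rewrite dsum_mactE mul_mx_row mul_row_block !mulmx1 !mulmx0 !mul1mx !mul0mx !addr0. Qed.
Fact dinr_proof a : mact N a *m row_mx 0 1%:M = row_mx 0 1%:M *m mact (dsum M N) a.
Proof. by rewrite dsum_mactE mul_mx_row mul_row_block !mulmx1 !mulmx0 !mul1mx !mul0mx !add0r. Qed.
Fact dprl_proof a : mact (dsum M N) a *m col_mx 1%:M 0 = col_mx 1%:M 0 *m mact M a.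
Proof. by rewrite dsum_mactE mul_block_col mul_col_mx !mulmx1 !mulmx0 !mul1mx !mul0mx !addr0. Qed.
Fact dprr_proof a : mact (dsum M N) a *m col_mx 0 1%:M = col_mx 0 1%:M *m mact N a.
Proof. by rewrite dsum_mactE mul_block_col mul_col_mx !mulmx1 !mulmx0 !mul1mx !mul0mx !add0r. Qed.

Definition dinl : hom M (dsum M N) := @mk_modhom k H M (dsum M N) _ dinl_proof.
Definition dinr : hom N (dsum M N) := @mk_modhom k H N (dsum M N) _ dinr_proof.
Definition dprl : hom (dsum M N) M := @mk_modhom k H (dsum M N) M _ dprl_proof.
Definition dprr : hom (dsum M N) N := @mk_modhom k H (dsum M N) N _ dprr_proof.

Lemma dprl_inl : dprl \oc dinl = idm M.
Proof. by apply: subvs_inj; rewrite /= mul_row_col !mulmx1 mulmx0 addr0. Qed.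
Lemma dprr_inr : dprr \oc dinr = idm N.
Proof. by apply: subvs_inj; rewrite /= mul_row_col !mulmx1 mulmx0 add0r. Qed.
Lemma dprl_inr : dprl \oc dinr = 0.
Proof. by apply: subvs_inj; rewrite /= mul_row_col !mulmx1 !mulmx0 addr0. Qed.
Lemma dprr_inl : dprr \oc dinl = 0.
Proof. by apply: subvs_inj; rewrite /= mul_row_col !mulmx1 !mulmx0 addr0. Qed.
Lemma dsum_id : dinl \oc dprl + dinr \oc dprr = idm (dsum M N).
Proof.
apply: subvs_inj; rewrite /= !mul_col_row !mulmx1 !mulmx0 add_block_mx !addr0 !add0r.
by rewrite -scalar_mx_block.
Qed.

Lemma dsum_structure : exists (i1 : hom M (dsum M N)) (i2 : hom N (dsum M N))
    (p1 : hom (dsum M N) M) (p2 : hom (dsum M N) N),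
  [/\ p1 \oc i1 = idm M, p2 \oc i2 = idm N, p1 \oc i2 = 0, p2 \oc i1 = 0
    & i1 \oc p1 + i2 \oc p2 = idm (dsum M N)].
Proof.
exists dinl, dinr, dprl, dprr; split; [exact: dprl_inl|exact: dprr_inr|exact: dprl_inr|
  exact: dprr_inl|exact: dsum_id].
Qed.

Lemma dsum_vec_eq v w : mapp dprl v = mapp dprl w -> mapp dprr v = mapp dprr w -> v = w.
Proof. by move=> e1 e2; rewrite -[v]mapp_id -[w]mapp_id -dsum_id !mappDl !mapp_comp e1 e2. Qed.
Lemma dprl_vec a b : mapp dprl (mapp dinl a + mapp dinr b) = a.
Proof. by rewrite mappD -!mapp_comp dprl_inl dprl_inr mapp_id mapp0l addr0. Qed.
Lemma dprr_vec a b : mapp dprr (mapp dinl a + mapp dinr b) = b.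
Proof. by rewrite mappD -!mapp_comp dprr_inl dprr_inr mapp_id mapp0l add0r. Qed.
End DsumMaps.

End ModuleMaps.

Section RegularModule.
Variables (k : fieldType) (H : falgType k).
Implicit Types X Y Z P Q S : modcat H.

Definition reg_vec (x : H) : 'rV[k]_(mdim (regmod H)) := v2r x.

Lemma reg_vec_surj v : exists x, reg_vec x = v.
Proof. by exists (r2v (v : 'rV[k]_(dim H)) : H); exact: r2vK. Qed.
Lemma reg_vec_inj : injective reg_vec.
Proof. exact: v2r_inj. Qed.
Lemma reg_vec_lin c x y : reg_vec (c *: x + y) = c *: reg_vec x + reg_vec y.
Proof. by rewrite /reg_vec linearP. Qed.
Lemma reg_vec_act x a : reg_vec x *m mact (regmod H) a = reg_vec (x * a).
Proof. exact: mod_ofE. Qed.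
Lemma lmul_vec a x : mapp (lmul a) (reg_vec x) = reg_vec (a * x).
Proof. exact: lmulE. Qed.
End RegularModule.

(** * Projective modules, dual bases and resolutions *)

Section ProjectiveModules.
Variables (k : fieldType) (H : falgType k).
Implicit Types X Y Z P Q S : modcat H.
Notation R := (regmod H).
Notation rv := (@reg_vec k H).
Local Opaque regmod.

Lemma reg_hom_exists Y y : exists f : hom R Y, forall x, mapp f (rv x) = y *m mact Y x.
Proof.
pose r (v : 'rV[k]_(mdim R)) : H := projT1 (cid (reg_vec_surj v)).
have rE v : rv (r v) = v := projT2 (cid (reg_vec_surj v)).
have rl c u v : r (c *: u + v) = c *: r u + r v.
  by apply: reg_vec_inj; rewrite rE reg_vec_lin !rE.
have ra v a : r (v *m mact R a) = r v * a.
  by apply: reg_vec_inj; rewrite rE -reg_vec_act rE.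
have [||f fE] := @hom_fun k H R Y (fun v => y *m mact Y (r v)).
- by move=> c u v; rewrite rl linearP mulmxDr -scalemxAr.
- by move=> v a; rewrite ra mactM mulmxA.
by exists f => x; rewrite fE; congr (_ *m mact Y _); apply: reg_vec_inj; rewrite rE.
Qed.

Lemma reg_hom_ext Y (f g : hom R Y) : mapp f (rv 1) = mapp g (rv 1) -> f = g.
Proof.
move=> fg; apply: hom_ext => v; have [x <-] := reg_vec_surj v.
by rewrite -[x]mul1r -reg_vec_act !mapp_act fg.
Qed.

(** The formula v = sum p_i xi_i(v) of the dual basis lemma. The element xi_i(v) of [H] appears as
    any [a i] with that coordinate vector, since maps to [regmod] take values in row vectors. *)
Definition dual_basis P n (p : 'I_n -> 'rV[k]_(mdim P)) (xi : 'I_n -> hom P R) :=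
  forall (v : 'rV[k]_(mdim P)) (a : 'I_n -> H), (forall i, mapp (xi i) v = rv (a i)) ->
    v = \sum_i p i *m mact P (a i).

Definition has_dual_basis P := exists n (p : 'I_n -> 'rV[k]_(mdim P)) (xi : 'I_n -> hom P R),
  dual_basis p xi.

Lemma regmod_projective : projective R.
Proof.
move=> X Y p f pe; have [x xE] := pe (mapp f (rv 1)).
have [g gE] := reg_hom_exists x; exists g; apply: reg_hom_ext.
by rewrite mapp_comp gE mact1 mulmx1.
Qed.

Lemma regmod_dual_basis : has_dual_basis R.
Proof.
exists 1%N, (fun=> rv 1), (fun=> idm R) => v a va.
have := va ord0; rewrite mapp_id => ->; rewrite big_ord_recl big_ord0 addr0.
by rewrite reg_vec_act mul1r.
Qed.

Lemma zeromod_projective : projective (zeromod H).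
Proof. by move=> X Y p f pe; exists 0; exact: zeromod_homl. Qed.
Lemma zeromod_dual_basis : has_dual_basis (zeromod H).
Proof. by exists 0%N, (fun=> 0), (fun=> 0) => v a _; rewrite [LHS]thinmx0 [RHS]thinmx0. Qed.

Lemma retract_projective P Q (i : hom Q P) (r : hom P Q) :
  r \oc i = idm Q -> projective P -> projective Q.
Proof.
move=> ri Pp X Y p f pe; have [g gE] := Pp _ _ p (f \oc r) pe.
by exists (g \oc i); rewrite compA gE -compA ri comp1r.
Qed.

Lemma retract_dual_basis P Q (i : hom Q P) (r : hom P Q) :
  r \oc i = idm Q -> has_dual_basis P -> has_dual_basis Q.
Proof.
move=> ri [n [p [xi px]]]; exists n, (fun j => mapp r (p j)), (fun j => xi j \oc i).
move=> v a va; rewrite -[LHS]mapp_id -ri mapp_comp.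
rewrite (px (mapp i v) a) => [|j]; last by rewrite -mapp_comp va.
by rewrite mapp_sum; apply: eq_bigr => j _; rewrite mapp_act.
Qed.

Lemma dsum_projective P Q : projective P -> projective Q -> projective (dsum P Q).
Proof.
have [i1 [i2 [p1 [p2 [_ _ _ _ s]]]]] := dsum_structure P Q.
move=> Pp Qp X Y p f pe.
have [g gE] := Pp _ _ p (f \oc i1) pe; have [h hE] := Qp _ _ p (f \oc i2) pe.
exists (g \oc p1 + h \oc p2); rewrite compDr !compA gE hE -!compA -compDr s.
exact: comp1r.
Qed.

Lemma dsum_dual_basis P Q : has_dual_basis P -> has_dual_basis Q -> has_dual_basis (dsum P Q).
Proof.
have [i1 [i2 [p1 [p2 [_ _ _ _ s]]]]] := dsum_structure P Q.
move=> [m [p [xi px]]] [n [q [eta qe]]].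
exists (m + n)%N.
exists (fun j => match split j with inl j => mapp i1 (p j) | inr j => mapp i2 (q j) end).
exists (fun j => match split j with inl j => xi j \oc p1 | inr j => eta j \oc p2 end).
move=> v a va; rewrite -[LHS]mapp_id -s mappDl !mapp_comp big_split_ord /=.
rewrite (px (mapp p1 v) (fun j => a (lshift n j))) => [|j]; last first.
  by rewrite -mapp_comp -va (unsplitK (inl j)).
rewrite (qe (mapp p2 v) (fun j => a (rshift m j))) => [|j]; last first.
  by rewrite -mapp_comp -va (unsplitK (inr j)).
rewrite !mapp_sum; congr (_ + _); apply: eq_bigr => j _.
  by rewrite (unsplitK (inl j)) mapp_act.
by rewrite (unsplitK (inr j)) mapp_act.
Qed.

(** Stated for any property inherited by adding a copy of [H], because the same free cover later
    provides projectivity, dual bases and Serre partners. *)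
Lemma free_cover (Phi : modcat H -> Prop) N : Phi (zeromod H) ->
  (forall F, Phi F -> Phi (dsum R F)) -> exists F (p : hom F N), Phi F /\ epi p.
Proof.
move=> Phi0 PhiD.
have cover (s : seq 'rV[k]_(mdim N)) : exists F (p : hom F N),
    Phi F /\ forall v, v \in s -> exists x, mapp p x = v.
  elim: s => [|v s [F [p [Fp ps]]]]; first by exists (zeromod H), 0.
  have [f fE] := reg_hom_exists v.
  have [i1 [i2 [p1 [p2 [e1 e2 e12 e21 _]]]]] := dsum_structure R F.
  exists (dsum R F), (f \oc p1 + p \oc p2); split; first exact: PhiD.
  move=> w; rewrite inE => /orP[/eqP ->|/ps[x <-]].
    exists (mapp i1 (rv 1)); rewrite mappDl !mapp_comp -!(mapp_comp _ i1) e1 e21.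
    by rewrite mapp_id mapp0l mapp0 addr0 fE mact1 mulmx1.
  exists (mapp i2 x); rewrite mappDl !mapp_comp -!(mapp_comp _ i2) e2 e12.
  by rewrite mapp_id mapp0l mapp0 add0r.
have [F [p [Fp ps]]] := cover [seq delta_mx 0 i | i : 'I_(mdim N)].
exists F, p; split=> // v.
have ex i : exists x, mapp p x = delta_mx 0 i.
  by apply: ps; apply/mapP; exists i; rewrite // mem_enum.
exists (\sum_i v 0 i *: projT1 (cid (ex i))).
rewrite [RHS]row_sum_delta mapp_sum; apply: eq_bigr => i _.
by rewrite -[_ *: _]addr0 mapp_linr mapp0 addr0 (projT2 (cid (ex i))).
Qed.

Lemma projective_cover N : exists P (p : hom P N), projective P /\ epi p.
Proof.
apply: free_cover => [|F]; first exact: zeromod_projective.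
exact: dsum_projective regmod_projective.
Qed.

Lemma projective_dual_basis P : projective P -> has_dual_basis P.
Proof.
move=> Pp; have [|F|F [p [Fd pe]]] := free_cover (Phi := has_dual_basis) P.
- exact: zeromod_dual_basis.
- exact: dsum_dual_basis regmod_dual_basis.
have [i iE] := Pp _ _ p (idm P) pe.
exact: retract_dual_basis iE Fd.
Qed.

Definition short_resolution Q P N (d : hom Q P) (p : hom P N) :=
  [/\ projective P, projective Q, epi p, mono d &
      forall v, mapp p v = 0 <-> exists w, mapp d w = v].

Lemma kernel_resolution P N (p : hom P N) : hereditary H -> projective P -> epi p ->
  exists Q (d : hom Q P), short_resolution d p.
Proof.
move=> hH Pp pe; have [Q [d [dm dE]]] := kernel_exists p.
by exists Q, d; split=> //; exact: hH Pp dm.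
Qed.

Lemma resolution_exists N : hereditary H ->
  exists Q P (d : hom Q P) (p : hom P N), short_resolution d p.
Proof.
move=> hH; have [P [p [Pp pe]]] := projective_cover N.
by have [Q [d dp]] := kernel_resolution hH Pp pe; exists Q, P, d, p.
Qed.

(** The image of [f] is a submodule of a projective, hence projective, so [X] splits over it; [r] is
    the projection to the kernel. *)
Lemma kernel_splits X Y (f : hom X Y) : hereditary H -> projective Y ->
  exists r : hom X X, f \oc r = 0 /\ forall v, mapp f v = 0 -> mapp r v = v.
Proof.
move=> hH Yp; have [S [i [p [im pe ip]]]] := image_exists f.
have [s sE] := hH _ _ i Yp im _ _ p (idm S) pe.
exists (idm X - s \oc p); split.
  by rewrite compDr compNr comp1r -{1}ip -ip -!compA (compA p) sE comp1l subrr.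
move=> v fv; rewrite mappDl mappNl mapp_id mapp_comp.
have -> : mapp p v = 0 by apply: im; rewrite -mapp_comp ip fv mapp0.
by rewrite mapp0 subr0.
Qed.
End ProjectiveModules.

(** * Maps from two-term complexes in the derived category *)

Section QuotientSpace.
Variables (k : fieldType) (V : lmodType k) (U : V -> Prop).
Hypothesis U0 : U 0.
Hypothesis UL : forall a u v, U u -> U v -> U (a *: u + v).

Let UD u v : U u -> U v -> U (u + v).
Proof. by move=> Uu Uv; rewrite -[u]scale1r; exact: UL. Qed.
Let UN u : U u -> U (- u).
Proof. by move=> Uu; rewrite -[- u]addr0 -scaleN1r; exact: UL. Qed.

(** A canonical representative: the choice depends only on the coset as a predicate, so the quotient
    becomes the subtype of chosen representatives. *)
Definition coset_repr (v : V) : V := choose (fun w => `[< U (w - v) >]) v.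

Fact coset_repr_mem v : U (coset_repr v - v).
Proof.
have vP : (fun w => `[< U (w - v) >]) v by apply/asboolP; rewrite subrr.
by have := @chooseP V (fun w => `[< U (w - v) >]) v vP => /asboolP.
Qed.

Fact coset_repr_eq u v : U (u - v) -> coset_repr u = coset_repr v.
Proof.
move=> uv; rewrite /coset_repr.
have /eq_choose -> : (fun w => `[< U (w - u) >]) =1 (fun w => `[< U (w - v) >]).
  move=> w; apply: asbool_equiv_eq; split=> Uw.
    by rewrite -[w](subrK u) -addrA; exact: UD.
  by rewrite -[w](subrK v) -addrA -[v - u]opprB; apply: UD => //; exact: UN.
apply: (@choose_id V (fun w => `[< U (w - v) >])); apply/asboolP => //.
by rewrite subrr.
Qed.

Definition quot_car : Type := {v : V | coset_repr v = v}.
HB.instance Definition _ := gen_eqMixin quot_car.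
HB.instance Definition _ := gen_choiceMixin quot_car.

Definition quot_class (v : V) : quot_car :=
  exist _ (coset_repr v) (coset_repr_eq (coset_repr_mem v)).

Lemma quot_classP u v : quot_class u = quot_class v <-> U (u - v).
Proof.
split=> [/(congr1 sval) /= e|uv]; last by apply: eq_exist; exact: coset_repr_eq.
have -> : u - v = - (coset_repr u - u) + (coset_repr v - v).
  by rewrite e opprB addrA subrK.
by apply: UD; [apply: UN|]; exact: coset_repr_mem.
Qed.

Lemma quot_class_sval (x : quot_car) : quot_class (sval x) = x.
Proof. by case: x => v ev; apply: eq_exist. Qed.

Let qD (x y : quot_car) := quot_class (sval x + sval y).
Let qN (x : quot_car) := quot_class (- sval x).
Let qZ a (x : quot_car) := quot_class (a *: sval x).

Let qDE u v : qD (quot_class u) (quot_class v) = quot_class (u + v).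
Proof. by apply/quot_classP; rewrite opprD addrACA; apply: UD; exact: coset_repr_mem. Qed.
Let qNE u : qN (quot_class u) = quot_class (- u).
Proof. by apply/quot_classP; rewrite -opprD; apply: UN; exact: coset_repr_mem. Qed.
Let qZE a u : qZ a (quot_class u) = quot_class (a *: u).
Proof.
apply/quot_classP; rewrite -scalerBr -[_ *: _]addr0.
by apply: UL => //; exact: coset_repr_mem.
Qed.

Fact quotDA : associative qD.
Proof.
move=> x y z; rewrite -[x]quot_class_sval -[y]quot_class_sval -[z]quot_class_sval.
by rewrite !qDE addrA.
Qed.
Fact quotDC : commutative qD.
Proof. by move=> x y; rewrite /qD addrC. Qed.
Fact quot0D : left_id (quot_class 0) qD.
Proof. by move=> x; rewrite -[x]quot_class_sval qDE add0r. Qed.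
Fact quotND : left_inverse (quot_class 0) qN qD.
Proof. by move=> x; rewrite -[x]quot_class_sval qNE qDE addNr. Qed.
HB.instance Definition _ := GRing.isZmodule.Build quot_car quotDA quotDC quot0D quotND.

Fact quotZA a b x : qZ a (qZ b x) = qZ (a * b) x.
Proof. by rewrite -[x]quot_class_sval !qZE scalerA. Qed.
Fact quotZ1 : left_id 1 qZ.
Proof. by move=> x; rewrite -[x]quot_class_sval qZE scale1r. Qed.
Fact quotZDr : right_distributive qZ +%R.
Proof.
move=> a x y; rewrite -[x]quot_class_sval -[y]quot_class_sval.
have E u v : quot_class u + quot_class v = quot_class (u + v) := qDE u v.
by rewrite E !qZE E scalerDr.
Qed.
Fact quotZDl x : {morph qZ^~ x : a b / a + b}.
Proof.
move=> a b; rewrite -[x]quot_class_sval.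
have E u v : quot_class u + quot_class v = quot_class (u + v) := qDE u v.
by rewrite !qZE E scalerDl.
Qed.
HB.instance Definition _ :=
  GRing.Zmodule_isLmodule.Build k quot_car quotZA quotZ1 quotZDr quotZDl.

Definition quotient : lmodType k := quot_car.
Definition qclass (v : V) : quotient := quot_class v.

Lemma qclass_lin c u v : qclass (c *: u + v) = c *: qclass u + qclass v.
Proof.
have E w z : quot_class w + quot_class z = quot_class (w + z) := qDE w z.
have F a w : a *: quot_class w = quot_class (a *: w) := qZE a w.
have -> : c *: qclass u = qclass (c *: u) by exact: F.
exact: esym (E _ _).
Qed.
Lemma qclassP u v : qclass u = qclass v <-> U (u - v). Proof. exact: quot_classP. Qed.
Lemma qclass_surj (x : quotient) : exists v, qclass v = x.
Proof. by exists (sval x); exact: quot_class_sval. Qed.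
Lemma qclass_eq0 v : qclass v = 0 <-> U v.
Proof. by rewrite -[0]/(qclass 0) qclassP subr0. Qed.
End QuotientSpace.

Section VectorSpaces.
Variable k : fieldType.

Definition is_lin (U V : lmodType k) (f : dprodv (fun _ : U => V)) :=
  forall c u v, f (c *: u + v) = c *: f u + f v.

Fact is_lin0 (U V : lmodType k) : @is_lin U V 0.
Proof.
move=> c u v; have z (w : U) : (0 : dprodv (fun _ : U => V)) w = 0 :> V by [].
by rewrite !z scaler0 addr0.
Qed.
Fact is_linL (U V : lmodType k) a (f g : dprodv (fun _ : U => V)) : is_lin f -> is_lin g -> is_lin (a *: f + g).
Proof.
move=> fl gl c u v; have E (w : U) : (a *: f + g) w = a *: f w + g w :> V by [].
by rewrite !E fl gl !scalerDr !scalerA [c * a]mulrC addrACA.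
Qed.

Definition linmap (U V : lmodType k) : lmodType k := subspace (@is_lin0 U V) (@is_linL U V).

Definition linmap_id U : linmap U U. Proof. by exists id. Defined.
Definition linmap_comp U V W (g : linmap V W) (f : linmap U V) : linmap U W.
Proof.
exists (fun u => sval g (sval f u)) => c u v.
by rewrite (svalP f) (svalP g).
Defined.

(* The objects are indices of vector spaces: the category of all vector spaces
   would be too large, in the sense of universes, to be a lincat. *)
Definition vect (I : Type) (E : I -> lmodType k) : lincat k.
Proof.
refine (@LinCat k I (fun i j => linmap (E i) (E j)) (fun i => linmap_id (E i))
  (fun i j l => @linmap_comp (E i) (E j) (E l)) _ _ _ _ _).
- by move=> X Y Z W h g f; apply: subsp_inj.
- by move=> X Y f; apply: subsp_inj.
- by move=> X Y f; apply: subsp_inj.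
- by move=> X Y Z c g g' f; apply: subsp_inj.
- move=> X Y Z c g f f'; apply: subsp_inj; apply: functional_extensionality_dep => u.
  exact: (svalP g).
Defined.

Lemma vect_iso (I : Type) (E : I -> lmodType k) (U V : vect E) (f : hom U V) : injective (sval f) ->
  (forall v, exists u, sval f u = v) -> is_iso f.
Proof.
move=> fi fs; pose g v := projT1 (cid (fs v)).
have fg v : sval f (g v) = v := projT2 (cid (fs v)).
have gl : @is_lin (E V) (E U) g.
  by move=> c u v; apply: fi; rewrite (svalP f) !fg.
exists (exist _ g gl); split; apply: subsp_inj; apply: functional_extensionality_dep => u //=.
by apply: fi; rewrite fg.
Qed.
End VectorSpaces.

(** * Homotopy classes of maps out of two-term complexes of projectives *)

Section TwoTermComplexes.
Variables (k : fieldType) (H : falgType k).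
Implicit Types X Y : cplxcat H.
Notation loc := (loc_functor (@quasi_iso k H)).

(* The cone of a quasi-isomorphism f is acyclic, and a map from a projective
   module to an acyclic complex lifts along the differential. *)
Lemma cone_lift X Y (f : hom X Y) P j (x : hom P (X (j + 1 + 1))) (y : hom P (Y (j + 1))) :
  quasi_iso f -> projective P -> cdiff X (j + 1 + 1) \oc x = 0 ->
  sval f (j + 1 + 1) \oc x = cdiff Y (j + 1) \oc y ->
  exists (x' : hom P (X (j + 1))) (y' : hom P (Y j)),
    cdiff X (j + 1) \oc x' = x /\ y = sval f (j + 1) \oc x' + cdiff Y j \oc y'.
Proof.
move=> fq Pp dx fx.
have [i1 [i2 [p1 [p2 [e1 e2 e12 e21 _]]]]] := dsum_structure (X (j + 1)) (Y j).
have [j1 [j2 [q1 [q2 [r1 r2 r12 r21 s]]]]] := dsum_structure (X (j + 1 + 1)) (Y (j + 1)).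
(* Up to sign, [al] is the differential of the cone of [f] leaving degree [j], and the hypotheses
   say that [(x, y)] takes values in the cycles of the next degree. Since the cone is exact there,
   these values lie in the image of [al], and projectivity of [P] gives the lift. *)
pose al := j1 \oc (cdiff X (j + 1) \oc p1) + j2 \oc (sval f (j + 1) \oc p1 + cdiff Y j \oc p2).
have [v|g gE] := @projective_lift _ _ P _ _ al (j1 \oc x + j2 \oc y) Pp.
  have x0 : mapp (cdiff X (j + 1 + 1)) (mapp x v) = 0 by rewrite -mapp_comp dx mapp0l.
  have fxv : mapp (cdiff Y (j + 1)) (mapp y v) = mapp (sval f (j + 1 + 1)) (mapp x v).
    by rewrite -!mapp_comp fx.
  have [a aE] := (fq (j + 1)).1 _ x0 (ex_intro _ _ fxv).
  have c0 : mapp (cdiff Y (j + 1)) (mapp y v - mapp (sval f (j + 1)) a) = 0.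
    rewrite mappB fxv -aE -!mapp_comp.
    by have -> := svalP f (j + 1); rewrite subrr.
  have [a' [da' [y' y'E]]] := (fq j).2 _ c0.
  exists (mapp i1 (a + a') + mapp i2 y').
  rewrite /al !mappDl !mapp_comp; congr (mapp j1 _ + mapp j2 _).
    rewrite mappD -!(mapp_comp p1) e1 e12 mapp_id mapp0l addr0.
    by rewrite mappD aE da' addr0.
  rewrite !mappDl !mapp_comp !(mappD p1) !(mappD p2) -!(mapp_comp p1) -!(mapp_comp p2).
  rewrite e1 e12 e2 e21 !mapp_id !mapp0l addr0 add0r y'E mappD.
  have Z (V : zmodType) (x1 x2 x3 : V) : x1 + x2 + (x3 - x1 - x2) = x3.
    by rewrite addrC -(addrA x3) -opprD subrK.
  exact: Z.
have q1al : q1 \oc al = cdiff X (j + 1) \oc p1.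
  by rewrite compDr (compA q1 j1) r1 comp1l (compA q1 j2) r12 comp0l addr0.
have q2al : q2 \oc al = sval f (j + 1) \oc p1 + cdiff Y j \oc p2.
  by rewrite compDr (compA q2 j1) r21 comp0l (compA q2 j2) r2 comp1l add0r.
exists (p1 \oc g), (p2 \oc g); split.
  rewrite compA -q1al -compA gE compDr (compA q1 j1) r1 comp1l (compA q1 j2) r12.
  by rewrite comp0l addr0.
rewrite !compA -compDl -q2al -compA gE compDr (compA q2 j1) r21 comp0l (compA q2 j2) r2.
by rewrite comp1l add0r.
Qed.

(* Negz n is - (n + 1); Negz 0 + 1 and the like reduce to the degrees written here. *)
Definition dif0 Y : hom (Y 0) (Y 1) := cdiff Y 0.
Definition dif1 Y : hom (Y (Negz 0)) (Y 0) := cdiff Y (Negz 0).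
Definition dif2 Y : hom (Y (Negz 1)) (Y (Negz 0)) := cdiff Y (Negz 1).
Definition dif3 Y : hom (Y (Negz 2)) (Y (Negz 1)) := cdiff Y (Negz 2).

Lemma dif1_nat X Y (g : hom X Y) : sval g 0 \oc dif1 X = dif1 Y \oc sval g (Negz 0).
Proof. exact: (svalP g (Negz 0)). Qed.
Lemma dif2_nat X Y (g : hom X Y) : sval g (Negz 0) \oc dif2 X = dif2 Y \oc sval g (Negz 1).
Proof. exact: (svalP g (Negz 1)). Qed.
Lemma dif01 Y : dif0 Y \oc dif1 Y = 0.
Proof. exact: (cdiff2 Y (Negz 0)). Qed.
Lemma dif12 Y : dif1 Y \oc dif2 Y = 0.
Proof. exact: (cdiff2 Y (Negz 1)). Qed.
Lemma sval_comp X Y Z (g : hom Y Z) (f : hom X Y) i : sval (g \oc f) i = sval g i \oc sval f i.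
Proof. by []. Qed.
Lemma sval_lin X Y c (g f : hom X Y) i : sval (c *: g + f) i = c *: sval g i + sval f i.
Proof. by []. Qed.
Lemma svalB X Y (g f : hom X Y) i : sval (g - f) i = sval g i - sval f i.
Proof. by []. Qed.

Lemma cone_lift0 X Y (g : hom X Y) P (y : hom P (Y 0)) : quasi_iso g -> projective P ->
  dif0 Y \oc y = 0 -> exists (x' : hom P (X 0)) (y' : hom P (Y (Negz 0))),
    dif0 X \oc x' = 0 /\ y = sval g 0 \oc x' + dif1 Y \oc y'.
Proof.
move=> gq Pp dy.
have [//| |x' [y' [e1 e2]]] := @cone_lift X Y g P (Negz 0) 0 y gq Pp; first exact: comp0r.
  by rewrite comp0r; exact: esym dy.
by exists x', y'.
Qed.
Lemma cone_lift1 X Y (g : hom X Y) P (x : hom P (X 0)) (y : hom P (Y (Negz 0))) :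
  quasi_iso g -> projective P -> dif0 X \oc x = 0 -> sval g 0 \oc x = dif1 Y \oc y ->
  exists (x' : hom P (X (Negz 0))) (y' : hom P (Y (Negz 1))),
    dif1 X \oc x' = x /\ y = sval g (Negz 0) \oc x' + dif2 Y \oc y'.
Proof. by move=> gq Pp dx dy; exact: (@cone_lift X Y g P (Negz 1) x y gq Pp dx dy). Qed.
Lemma cone_lift2 X Y (g : hom X Y) P (x : hom P (X (Negz 0))) (y : hom P (Y (Negz 1))) :
  quasi_iso g -> projective P -> dif1 X \oc x = 0 -> sval g (Negz 0) \oc x = dif2 Y \oc y ->
  exists (x' : hom P (X (Negz 1))) (y' : hom P (Y (Negz 2))),
    dif2 X \oc x' = x /\ y = sval g (Negz 1) \oc x' + dif3 Y \oc y'.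
Proof. by move=> gq Pp dx dy; exact: (@cone_lift X Y g P (Negz 2) x y gq Pp dx dy). Qed.

Section ChainMaps.
Variables (Q P : modcat H) (d : hom Q P).
Notation W := (two_term d : cplxcat H).

Section Constructor.
Variables (Y : cplxcat H) (a : hom P (Y 0)) (b : hom Q (Y (Negz 0))).
Hypothesis da : dif0 Y \oc a = 0.
Hypothesis db : dif1 Y \oc b = a \oc d.

Definition two_term_fun (i : int) : hom (two_term_ob Q P i) (Y i) :=
  match i return hom (two_term_ob Q P i) (Y i) with
  | Posz 0 => a | Negz 0 => b | _ => 0 end.

Fact two_term_fun_chain (i : int) :
  two_term_fun (i + 1) \oc two_term_diff d i = cdiff Y i \oc two_term_fun i.
Proof.
case: i => [[|i]|[|i]]; [|exact: zeromod_homl| |exact: zeromod_homl].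
- by rewrite [LHS]comp0r; exact: esym da.
- exact: esym db.
Qed.

Definition two_term_chain : hom W Y :=
  exist _ (two_term_fun : dprodv (fun i => hom (W i) (Y i))) two_term_fun_chain.

Lemma two_term_chain0 : sval two_term_chain 0 = a. Proof. by []. Qed.
Lemma two_term_chain1 : sval two_term_chain (Negz 0) = b. Proof. by []. Qed.
End Constructor.

Lemma two_term_chain_ext Y (f g : hom W Y) :
  sval f 0 = sval g 0 -> sval f (Negz 0) = sval g (Negz 0) -> f = g.
Proof.
move=> e0 e1; apply: subsp_inj; apply: functional_extensionality_dep.
by move=> [[|i]|[|i]] //; exact: zeromod_homl.
Qed.

Lemma two_term_cycle Y (f : hom W Y) : dif0 Y \oc sval f 0 = 0.
Proof. by apply: etrans (esym (svalP f 0)) _; exact: comp0r. Qed.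
Lemma two_term_boundary Y (f : hom W Y) :
  dif1 Y \oc sval f (Negz 0) = sval f 0 \oc d.
Proof. exact: esym (svalP f (Negz 0)). Qed.

(** Homotopy to zero; a homotopy has only the components [s] and [t] because the source is zero
    outside degrees -1 and 0. *)
Definition null_chain Y (f : hom W Y) := exists (s : hom P (Y (Negz 0))) (t : hom Q (Y (Negz 1))),
  sval f 0 = dif1 Y \oc s /\ sval f (Negz 0) = s \oc d + dif2 Y \oc t.

Fact null_chain0 Y : null_chain (0 : hom W Y).
Proof. by exists 0, 0; split; [rewrite comp0r|rewrite comp0l comp0r addr0]. Qed.
Fact null_chainL Y c (f g : hom W Y) : null_chain f -> null_chain g -> null_chain (c *: f + g).
Proof.
move=> [s [t [e0 e1]]] [s' [t' [e0' e1']]]; exists (c *: s + s'), (c *: t + t').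
by rewrite !sval_lin e0 e0' e1 e1' !comp_linr comp_linl scalerDr addrACA.
Qed.

Definition chain_classes Y : lmodType k := quotient (@null_chain0 Y) (@null_chainL Y).
Notation cl Y := (@qclass _ _ _ (@null_chain0 Y) (@null_chainL Y)).

Lemma null_chain_comp X Y (g : hom X Y) (f : hom W X) : null_chain f -> null_chain (g \oc f).
Proof.
move=> [s [t [e0 e1]]]; exists (sval g (Negz 0) \oc s), (sval g (Negz 1) \oc t).
by rewrite !sval_comp e0 e1 compDr !compA dif1_nat dif2_nat.
Qed.

Definition classes_map X Y (g : hom X Y) (x : chain_classes X) : chain_classes Y :=
  cl Y (g \oc (sval x : hom W X)).
Lemma classes_mapE X Y (g : hom X Y) (f : hom W X) : classes_map g (cl X f) = cl Y (g \oc f).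
Proof.
apply/qclassP; rewrite -compNr -compDr; apply: null_chain_comp.
exact: (coset_repr_mem (@null_chain0 X) f).
Qed.
Fact classes_map_lin X Y (g : hom X Y) : is_lin (classes_map g).
Proof.
move=> c x y; have [u <-] := qclass_surj x; have [v <-] := qclass_surj y.
by rewrite -qclass_lin !classes_mapE comp_linr qclass_lin.
Qed.

Lemma classes_map_linl X Y c (f g : hom X Y) x :
  classes_map (c *: f + g) x = c *: classes_map f x + classes_map g x.
Proof.
have [u <-] := qclass_surj x; rewrite !classes_mapE comp_linl.
exact: (qclass_lin (@null_chain0 Y) (@null_chainL Y)).
Qed.
Lemma classes_map1 X x : classes_map (idm X) x = x.
Proof. by have [u <-] := qclass_surj x; rewrite classes_mapE comp1l. Qed.
Lemma classes_mapM X Y Z (g : hom Y Z) (f : hom X Y) x :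
  classes_map (g \oc f) x = classes_map g (classes_map f x).
Proof. by have [u <-] := qclass_surj x; rewrite !classes_mapE compA. Qed.

Definition classes : functor (cplxcat H) (vect chain_classes).
Proof.
exists (fun Y => Y : vect chain_classes)
  (fun X Y g => exist _ (classes_map g : dprodv (fun _ => _)) (@classes_map_lin X Y g)).
- by move=> X; apply: subsp_inj; apply: functional_extensionality_dep; exact: classes_map1.
- by move=> X Y Z g f; apply: subsp_inj; apply: functional_extensionality_dep; exact: classes_mapM.
- move=> X Y c f g; apply: subsp_inj; apply: functional_extensionality_dep => x.
  exact: classes_map_linl.
Defined.

Hypotheses (Pp : projective P) (Qp : projective Q).

(** The component on [P] is lifted first, up to a boundary through [s]; the component on [Q],
    corrected by [s \oc d], is then lifted over it. *)
Lemma quasi_iso_surj X Y (g : hom X Y) (f : hom W Y) : quasi_iso g ->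
  exists f' : hom W X, null_chain (g \oc f' - f).
Proof.
move=> gq.
have [a [s [da aE]]] := cone_lift0 gq Pp (two_term_cycle f).
have [||b [t [db bE]]] := cone_lift1 (x := a \oc d) (y := sval f (Negz 0) - s \oc d) gq Qp.
- by rewrite compA da comp0l.
- by rewrite compDr compNr two_term_boundary aE compDl !compA addrK.
exists (two_term_chain da db), (- s), (- t); rewrite !svalB !sval_comp; split.
  by rewrite two_term_chain0 {1}aE compNr opprD addrA subrr add0r.
rewrite two_term_chain1 compNl compNr.
by rewrite -[sval f (Negz 0)](subrK (s \oc d)) bE !opprD !addrA subrr add0r addrC.
Qed.

Lemma quasi_iso_inj X Y (g : hom X Y) (f : hom W X) : quasi_iso g ->
  null_chain (g \oc f) -> null_chain f.
Proof.
move=> gq [s' [t' []]]; rewrite !sval_comp => e0 e1.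
have [s [s2 [ds sE]]] := cone_lift1 gq Pp (two_term_cycle f) e0.
have [|| t [t2 [dt tE]]] :=
    cone_lift2 (x := sval f (Negz 0) - s \oc d) (y := t' + s2 \oc d) gq Qp.
- by rewrite compDr compNr compA ds two_term_boundary subrr.
- rewrite compDr compNr e1 sE compDl compDr !compA.
  have Z (V : zmodType) (x1 x2 x3 : V) : x1 + x2 + x3 - x1 = x3 + x2.
    by rewrite -(addrA x1) (addrC x1) addrK addrC.
  exact: Z.
by exists s, t; rewrite ds dt addrC subrK.
Qed.

Lemma classes_inverts X Y (g : hom X Y) : quasi_iso g -> is_iso (fmap classes g).
Proof.
move=> gq; apply: vect_iso => [x y|y].
  have [u <-] := qclass_surj x; have [v <-] := qclass_surj y.
  rewrite [LHS]classes_mapE [RHS]classes_mapE => /qclassP.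
  rewrite -compNr -compDr => /(quasi_iso_inj gq) e.
  by apply/qclassP.
have [f <-] := qclass_surj y; have [f' f'E] := quasi_iso_surj f gq.
by exists (cl X f'); rewrite [LHS]classes_mapE; apply/qclassP.
Qed.

(** Homotopy classes of maps from [W] form a functor that inverts quasi-isomorphisms, so it extends
    to the localization. A map that becomes zero there acts as zero on classes, in particular on the
    class of the identity of [W]. *)
Lemma loc_eq0_null Y (f : hom W Y) : fmap loc f = 0 -> null_chain f.
Proof.
move=> f0; have e : fmap classes f = 0.
  by rewrite -(loc_liftE classes_inverts) f0 fmap0.
have := congr1 (fun h : hom (classes W) (classes Y) => sval h (cl W (idm W))) e.
by rewrite [LHS]classes_mapE comp1r => /qclass_eq0.
Qed.
End ChainMaps.
End TwoTermComplexes.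

Section Whiskering.
Variable k : fieldType.

Lemma scale_iso (C : lincat k) (X : C) (a : k) : a != 0 -> is_iso (a *: idm X).
Proof.
move=> a0; exists (a^-1 *: idm X); split; rewrite compZl compZr comp1l scalerA.
  by rewrite mulVf ?scale1r.
by rewrite mulfV ?scale1r.
Qed.
Lemma scale_central (C : lincat k) (X Y : C) (a : k) (f : hom X Y) :
  (a *: idm Y) \oc f = f \oc (a *: idm X).
Proof. by rewrite compZl compZr comp1l comp1r. Qed.

Lemma natiso_refl (C D : lincat k) (F : functor C D) : natiso F F.
Proof.
by exists (fun X => idm (F X)); split=> [X|X Y f]; [exact: is_iso_id|rewrite comp1l comp1r].
Qed.
Lemma natiso_compr (C D E : lincat k) (F G : functor D E) (A : functor C D) :
  natiso F G -> natiso (compfunctor F A) (compfunctor G A).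
Proof. by move=> [phi [phii phin]]; exists (fun X => phi (A X)); split=> [X|X Y f]; [exact: phii|exact: phin]. Qed.
Lemma natiso_compl (C D E : lincat k) (F G : functor C D) (A : functor D E) :
  natiso F G -> natiso (compfunctor A F) (compfunctor A G).
Proof.
move=> [phi [phii phin]]; exists (fun X => fmap A (phi X)); split=> [X|X Y f].
  exact: (fmap_iso A (phii X)).
have e := congr1 (fmap A) (phin X Y f); rewrite !fmapM in e; exact: e.
Qed.

Lemma natiso_lift_comp (C D : lincat k) (L : functor C D) (A B : functor D D) (A' B' : functor C C) :
  natiso (compfunctor A L) (compfunctor L A') -> natiso (compfunctor B L) (compfunctor L B') ->
  natiso (compfunctor (compfunctor A B) L) (compfunctor L (compfunctor A' B')).
Proof.
move=> a b; apply: natiso_trans (natiso_compr B' a).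
exact: (natiso_compl A b).
Qed.
Lemma natiso_lift_id (C D : lincat k) (L : functor C D) :
  natiso (compfunctor (idfunctor D) L) (compfunctor L (idfunctor C)).
Proof. exact: (natiso_refl L). Qed.

Lemma natiso_isomorphic (C D : lincat k) (F G : functor C D) X : natiso F G -> isomorphic (F X) (G X).
Proof. by move=> [phi [phii _]]; exists (phi X). Qed.
End Whiskering.

(** * Morphisms of the derived category as chain maps *)

Section DerivedHoms.
Variables (k : fieldType) (H : falgType k).
Implicit Types X Y : cplxcat H.
Notation loc := (loc_functor (@quasi_iso k H)).

Lemma mdim0_vec (X : modcat H) (v : 'rV[k]_(mdim X)) : mdim X = 0%N -> v = 0.
Proof. by move=> X0; apply/rowP => -[i lti]; exfalso; rewrite X0 in lti. Qed.
Lemma mdim0_homl (X Y : modcat H) (f g : hom X Y) : mdim X = 0%N -> f = g.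
Proof. by move=> X0; apply: hom_ext => v; rewrite (mdim0_vec v X0) !mapp0. Qed.

Definition acyclic X := forall i x, mapp (cdiff X (i + 1)) x = 0 ->
  exists y, mapp (cdiff X i) y = x.

(** The zero endomorphism of an acyclic complex is a quasi-isomorphism, hence becomes invertible. *)
Lemma acyclic_is_zero X : acyclic X -> is_zero (X : dercat H).
Proof.
move=> Xa; have q : quasi_iso (0 : hom X X).
  move=> i; split=> [x x0 _|y y0]; first exact: Xa.
  exists 0; split; first exact: mapp0.
  by rewrite mapp0 subr0; exact: Xa.
have [g [g0 _]] := loc_functor_iso q.
have e : fmap loc (0 : hom X X) = 0 := fmap0 loc X X.
by rewrite /is_zero -[LHS]g0 e comp0r.
Qed.

Lemma cone_acyclic (P : modcat H) : acyclic (two_term (idm P) : cplxcat H).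
Proof.
move=> [[|i]|[|[|i]]] x; try by move=> _; exists 0; apply: etrans (esym (mdim0_vec x _)); rewrite ?mapp0.
- by move=> _; exists x; exact: mapp_id.
- by move=> x0; exists 0; rewrite mapp0 -[x]mapp_id; exact: esym x0.
Qed.

Section NullHomotopic.
Variables (Q P : modcat H) (d : hom Q P).
Notation W := (two_term d : cplxcat H).

Section ThroughP.
Variables (Y : cplxcat H) (s : hom P (Y (Negz 0))).
Let K := (two_term (idm P) : cplxcat H).

(** A null-homotopic map is a sum of two parts that factor through acyclic complexes: the part of
    [s] through [P] in degrees -1 and 0, and the part of [t] through [Q] in degrees -2 and -1. Both
    therefore vanish in the localization. *)
Lemma factor_through_P : exists (u : hom W K) (v : hom K Y),
  sval (v \oc u) 0 = dif1 Y \oc s /\ sval (v \oc u) (Negz 0) = s \oc d.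
Proof.
have e1 : dif0 K \oc (idm P : hom P (K 0)) = 0 by exact: (@zeromod_homr _ _ P).
have e2 : dif1 K \oc (d : hom Q (K (Negz 0))) = (idm P : hom P (K 0)) \oc d by [].
have e3 : dif0 Y \oc (dif1 Y \oc s) = 0 by rewrite compA dif01 comp0l.
have e4 : dif1 Y \oc s = (dif1 Y \oc s) \oc idm P by rewrite comp1r.
exists (two_term_chain e1 e2), (two_term_chain e3 e4).
split; rewrite sval_comp; last by [].
by rewrite two_term_chain0; exact: comp1r.
Qed.
End ThroughP.

Section ThroughQ.
Variables (Y : cplxcat H) (t : hom Q (Y (Negz 1))).
Let K : cplxcat H := shift_cplx (two_term (idm Q) : cplxcat H).

Fact cone_shift_acyclic : acyclic K.
Proof.
move=> i x; rewrite mappN => /eqP; rewrite oppr_eq0 => /eqP x0.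
have [y yE] := cone_acyclic x0; exists (- y).
by rewrite mappN mapp_oppr opprK.
Qed.

Definition through_Q_fun (i : int) : hom (K i) (Y i) :=
  match i return hom (K i) (Y i) with
  (* The sign in degree -2 matches the sign that the shift puts on the differential of [K]. *)
  | Negz 0 => dif2 Y \oc t | Negz 1 => - t | _ => 0 end.

Fact through_Q_chain (i : int) :
  through_Q_fun (i + 1) \oc cdiff K i = cdiff Y i \oc through_Q_fun i.
Proof.
case: i => [i|[|[|i]]].
- by apply: mdim0_homl => /=; rewrite addn1.
- rewrite [LHS]comp0l [RHS](_ : _ = dif1 Y \oc (dif2 Y \oc t))//.
  by rewrite compA dif12 comp0l.
- rewrite [LHS](_ : _ = (dif2 Y \oc t) \oc - idm Q)// [RHS](_ : _ = dif2 Y \oc - t)//.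
  by rewrite !compNr comp1r.
- exact: mdim0_homl.
Qed.

Lemma factor_through_Q : exists (u : hom W K) (v : hom K Y),
  sval (v \oc u) 0 = 0 /\ sval (v \oc u) (Negz 0) = dif2 Y \oc t.
Proof.
have e1 : dif0 K \oc (0 : hom P (K 0)) = 0 by exact: comp0r.
have e2 : dif1 K \oc (idm Q : hom Q (K (Negz 0))) = (0 : hom P (K 0)) \oc d.
  exact: (@zeromod_homr _ _ Q).
pose v : hom K Y := exist _ (through_Q_fun : dprodv (fun i => hom (K i) (Y i))) through_Q_chain.
exists (two_term_chain e1 e2), v; rewrite !sval_comp two_term_chain0 two_term_chain1 comp0r.
by split=> //; exact: comp1r.
Qed.
End ThroughQ.

Lemma null_loc_eq0 Y (f : hom W Y) : null_chain f -> fmap loc f = 0.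
Proof.
move=> [s [t [e0 e1]]].
have [u [v [v0 v1]]] := factor_through_P s.
have [u' [v' [v0' v1']]] := factor_through_Q t.
have -> : f = v \oc u + v' \oc u'.
  have E (g h : hom W Y) i : sval (g + h) i = sval g i + sval h i by [].
  by apply: two_term_chain_ext; rewrite E ?v0 ?v1 ?v0' ?v1' ?e0 ?e1 ?addr0.
rewrite fmapD !fmapM.
rewrite (is_zero_hom_r (fmap loc u) (acyclic_is_zero (@cone_acyclic P))).
rewrite (is_zero_hom_r (fmap loc u') (acyclic_is_zero cone_shift_acyclic)).
by rewrite !comp0r addr0.
Qed.

Hypotheses (Pp : projective P) (Qp : projective Q).

(** Induction on formal terms replaces a calculus of fractions: the formal inverse of a
    quasi-isomorphism, applied to a chain map out of [W], is again a chain map because that chain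
    map lifts along the quasi-isomorphism up to homotopy. *)
Lemma lterm_two_term X Y (t : lterm (@quasi_iso k H) X Y) (g : hom W X) :
  exists g' : hom W Y, (lcls t : hom (X : dercat H) Y) \oc fmap loc g = fmap loc g'.
Proof.
elim: t g => {X Y}.
- by move=> X Y f g; exists (f \oc g); rewrite fmapM.
- move=> X Y s Ss g; have [f' f'E] := quasi_iso_surj Pp Qp g Ss; exists f'.
  have inv : (lcls (linv Ss) : hom (Y : dercat H) X) \oc fmap loc s = idm (X : dercat H).
    by rewrite -[LHS]lcls_comp; apply/lclsP; exact: leqv_invl.
  have e : fmap loc s \oc fmap loc f' = fmap loc g.
    apply/eqP; rewrite -subr_eq0 -fmapM -fmapN -fmapD; apply/eqP.
    exact: null_loc_eq0.
  by rewrite -e compA inv comp1l.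
- move=> X Y Z t IHt u IHu g; have [g1 g1E] := IHu g; have [g2 g2E] := IHt g1.
  exists g2; rewrite lcls_comp -[loc_comp _ _]/((lcls t : hom (Y : dercat H) Z) \oc lcls u).
  by rewrite -compA g1E g2E.
- move=> X Y t IHt u IHu g; have [g1 g1E] := IHt g; have [g2 g2E] := IHu g.
  exists (g1 + g2); rewrite fmapD -g1E -g2E lcls_add.
  by rewrite -[loc_add _ _]/((lcls t : hom (X : dercat H) Y) + lcls u) compDl.
- move=> X Y c t IHt g; have [g1 g1E] := IHt g.
  exists (c *: g1); rewrite fmapZ -g1E lcls_scale.
  by rewrite -[loc_scale _ _]/(c *: (lcls t : hom (X : dercat H) Y)) compZl.
Qed.

Lemma loc_two_term_full Y (phi : hom (W : dercat H) Y) : exists f : hom W Y, phi = fmap loc f.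
Proof.
have [g gE] := lterm_two_term (lrep phi) (idm W); exists g.
by rewrite -gE fmap1 comp1r lrepK.
Qed.

Lemma loc_two_term_eq0 Y (f : hom W Y) : fmap loc f = 0 <-> null_chain f.
Proof. by split; [exact: loc_eq0_null|exact: null_loc_eq0]. Qed.
End NullHomotopic.

(** Naturality for chain maps passes to formal inverses, because a commuting square whose horizontal
    maps are invertible may be read backwards, and to composites and linear combinations. *)
Lemma loc_natiso (E : lincat k) (A B : functor (dercat H) E) :
  natiso (compfunctor A loc) (compfunctor B loc) -> natiso A B.
Proof.
move=> [phi [phii phin]]; exists phi; split=> // X Y f.
have {}phin X' Y' (g : hom X' Y') : phi Y' \oc fmap A (fmap loc g) = fmap B (fmap loc g) \oc phi X'.
  exact: phin.
rewrite -(lrepK f); move: (lrep f) => {f} t; elim: t => {X Y}.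
- by move=> X Y f; exact: phin.
- move=> X Y s Ss.
  have [i1 i2] : (lcls (linv Ss) : hom (Y : dercat H) X) \oc fmap loc s = idm (X : dercat H) /\
      fmap loc s \oc (lcls (linv Ss) : hom (Y : dercat H) X) = idm (Y : dercat H).
    by split; rewrite -[LHS]lcls_comp; apply/lclsP; [exact: leqv_invl|exact: leqv_invr].
  have is_i : is_iso (fmap A (fmap loc s)) by apply: fmap_iso; exact: loc_functor_iso.
  apply: (iso_epic is_i).
  by rewrite -compA -fmapM i1 fmap1 comp1r -compA phin compA -fmapM i1 fmap1 comp1l.
- move=> X Y Z t IHt u IHu.
  rewrite lcls_comp -[loc_comp _ _]/((lcls t : hom (Y : dercat H) Z) \oc lcls u).
  by rewrite !fmapM compA IHt -compA IHu compA.
- move=> X Y t IHt u IHu.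
  rewrite lcls_add -[loc_add _ _]/((lcls t : hom (X : dercat H) Y) + lcls u).
  by rewrite !fmapD compDr compDl IHt IHu.
- move=> X Y c t IHt.
  rewrite lcls_scale -[loc_scale _ _]/(c *: (lcls t : hom (X : dercat H) Y)).
  by rewrite !fmapZ compZr compZl IHt.
Qed.

Lemma loc_lift_natiso (E : lincat k) (A : functor (cplxcat H) E)
    (AS : forall X Y (s : hom X Y), quasi_iso s -> is_iso (fmap A s)) :
  natiso (compfunctor (loc_lift AS) loc) A.
Proof.
exists (fun X => idm (A X)); split=> [X|X Y f]; first exact: is_iso_id.
by rewrite comp1l comp1r; exact: loc_liftE.
Qed.
End DerivedHoms.

(** * Translation of complexes by an arbitrary integer *)

Section Reindexing.
Variables (k : fieldType) (H : falgType k).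
Implicit Types X Y : cplxcat H.
Notation loc := (loc_functor (@quasi_iso k H)).

Definition cst X (i j : int) (e : i = j) : hom (X i) (X j) :=
  match e in _ = r return hom (X i) (X r) with erefl => idm (X i) end.

Lemma cst_id X i (e : i = i) : cst X e = idm (X i).
Proof. by rewrite (Prop_irrelevance e erefl). Qed.
Lemma cst_comp X i j l (e : i = j) (e' : j = l) : cst X e' \oc cst X e = cst X (etrans e e').
Proof. by subst l; subst j; rewrite comp1l. Qed.
Lemma cst_irr X i j (e e' : i = j) : cst X e = cst X e'.
Proof. by rewrite (Prop_irrelevance e e'). Qed.
Lemma cst_iso X i j (e : i = j) : is_iso (cst X e).
Proof. by subst j; exact: is_iso_id. Qed.
Lemma cst_diff X i j (e : i = j) (e' : i + 1 = j + 1) :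
  cdiff X j \oc cst X e = cst X e' \oc cdiff X i.
Proof. by subst j; rewrite !cst_id comp1l comp1r. Qed.
Lemma cst_nat X Y (f : hom X Y) i j (e : i = j) : sval f j \oc cst X e = cst Y e \oc sval f i.
Proof. by subst j; rewrite !cst_id comp1l comp1r. Qed.

Definition ediff X (i j : int) (e : i + 1 = j) : hom (X i) (X j) := cst X e \oc cdiff X i.

Lemma ediff_nat X Y (f : hom X Y) i j (e : i + 1 = j) :
  sval f j \oc ediff X e = ediff Y e \oc sval f i.
Proof. by rewrite /ediff compA cst_nat -compA (svalP f i) compA. Qed.

Lemma quasi_isoE X Y (f : hom X Y) : quasi_iso f <->
  forall a b c (e : a + 1 = b) (e' : b + 1 = c),
    (forall x, mapp (ediff X e') x = 0 ->
       (exists y, mapp (ediff Y e) y = mapp (sval f b) x) ->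
       exists x', mapp (ediff X e) x' = x) /\
    (forall y, mapp (ediff Y e') y = 0 ->
       exists x, mapp (ediff X e') x = 0 /\
         exists y', mapp (ediff Y e) y' = y - mapp (sval f b) x).
Proof.
have E Z i : @ediff Z i _ erefl = cdiff Z i by rewrite /ediff cst_id comp1l.
split=> [fq a b c e e'|fq i]; first by subst b; subst c; rewrite !E; exact: (fq a).
by have := fq i _ _ erefl erefl; rewrite !E.
Qed.

Section Reindex.
Variable n : int.

Fact reindex_eq (i : int) : i + n + 1 = i + 1 + n. Proof. by rewrite addrAC. Qed.

(** The degrees [i + n + 1] and [i + 1 + n] are equal but not convertible, so the differential ends
    with a transport [cst]. Since [n] may be negative, translations have inverses of the same
    form. *)
Definition reindex_cplx X : cplxcat H.
Proof.
exists (fun i => X (i + n)) (fun i => ediff X (reindex_eq i)).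
- move=> i; rewrite /ediff -compA (compA (cdiff X (i + 1 + n))).
  have e' : i + n + 1 + 1 = i + 1 + n + 1 by rewrite reindex_eq.
  by rewrite (cst_diff X _ e') -(compA _ (cdiff X _)) cdiff2 !comp0r.
- have [N XN] := cbounded X; exists (N + absz n)%N => i lti; apply: XN; lia.
Defined.

Definition reindex_chain X Y (f : hom X Y) : hom (reindex_cplx X) (reindex_cplx Y).
Proof. exists (fun i => sval f (i + n)) => i; exact: (ediff_nat f (reindex_eq i)). Defined.

Definition reindex_cplxcat : functor (cplxcat H) (cplxcat H).
Proof.
exists reindex_cplx reindex_chain.
- by move=> X; apply: subsp_inj.
- by move=> X Y Z g f; apply: subsp_inj.
- by move=> X Y c f g; apply: subsp_inj.
Defined.

Lemma ediff_reindex X i j (e : i + 1 = j) (e' : i + n + 1 = j + n) :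
  @ediff (reindex_cplx X) i j e = ediff X e'.
Proof.
subst j; rewrite {1}/ediff cst_id comp1l.
by rewrite (Prop_irrelevance e' (reindex_eq i)).
Qed.

Lemma reindex_quasi_iso X Y (f : hom X Y) : quasi_iso f -> quasi_iso (fmap reindex_cplxcat f).
Proof.
move=> /quasi_isoE fq; apply/quasi_isoE => a b c e e'.
have h : a + n + 1 = b + n by rewrite -e reindex_eq.
have h' : b + n + 1 = c + n by rewrite -e' reindex_eq.
rewrite !(ediff_reindex _ e h) !(ediff_reindex _ e' h').
exact: fq.
Qed.

Lemma reindex_inverts X Y (f : hom X Y) : quasi_iso f ->
  is_iso (fmap (compfunctor loc reindex_cplxcat) f).
Proof. by move=> /reindex_quasi_iso; exact: loc_functor_iso. Qed.

(* the functor X |-> X[n], without the sign on the differential *)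
Definition reindex : functor (dercat H) (dercat H) := loc_lift reindex_inverts.

End Reindex.

Lemma chain_iso X Y (f : hom X Y) : (forall i, is_iso (sval f i)) -> is_iso f.
Proof.
move=> fi; pose g i := projT1 (cid (fi i)).
have g1 i : g i \oc sval f i = idm (X i) := (projT2 (cid (fi i))).1.
have g2 i : sval f i \oc g i = idm (Y i) := (projT2 (cid (fi i))).2.
have gc : @is_chain _ _ Y X g.
  move=> i; apply: (iso_monic (fi (i + 1))).
  by rewrite !compA g2 comp1l (svalP f i) -compA g2 comp1r.
exists (exist _ (g : dprodv (fun i => hom (Y i) (X i))) gc).
by split; apply: subsp_inj; apply: functional_extensionality_dep => i; [exact: g1|exact: g2].
Qed.

Lemma reindexD_cplx m n p : m + n = p ->
  natiso (compfunctor (reindex_cplxcat m) (reindex_cplxcat n)) (reindex_cplxcat p).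
Proof.
move=> mnp; have e (i : int) : i + m + n = i + p by rewrite -addrA mnp.
have c X : @is_chain _ _ (reindex_cplx m (reindex_cplx n X)) (reindex_cplx p X)
    (fun i => cst X (e i)).
  move=> i; rewrite (_ : cdiff (reindex_cplx m (reindex_cplx n X)) i = ediff (reindex_cplx n X) (reindex_eq m i))//.
  have h : i + m + n + 1 = i + 1 + m + n by lia.
  rewrite (ediff_reindex _ _ h) (_ : cdiff (reindex_cplx p X) i = ediff X (reindex_eq p i))//.
  have h' : i + m + n + 1 = i + p + 1 by rewrite e.
  rewrite /ediff [LHS]compA cst_comp -[RHS]compA (cst_diff X (e i) h') [RHS]compA cst_comp.
  by congr (_ \oc _); exact: cst_irr.
exists (fun X => exist _ _ (c X)); split=> [X|X Y f]; first by apply: chain_iso => i; exact: (cst_iso X (e i)).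
apply: subsp_inj; apply: functional_extensionality_dep => i /=.
exact: esym (cst_nat f (e i)).
Qed.

Lemma reindex0_cplx : natiso (reindex_cplxcat 0) (idfunctor (cplxcat H)).
Proof.
have e (i : int) : i + 0 = i by rewrite addr0.
have c X : @is_chain _ _ (reindex_cplx 0 X) X (fun i => cst X (e i)).
  move=> i; rewrite (_ : cdiff (reindex_cplx 0 X) i = ediff X (reindex_eq 0 i))//.
  have h' : i + 0 + 1 = i + 1 by rewrite e.
  rewrite /ediff [LHS]compA cst_comp (cst_diff X (e i) h').
  by congr (_ \oc _); exact: cst_irr.
exists (fun X => exist _ _ (c X)); split=> [X|X Y f]; first by apply: chain_iso => i; exact: (cst_iso X (e i)).
apply: subsp_inj; apply: functional_extensionality_dep => i /=.
exact: esym (cst_nat f (e i)).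
Qed.

Lemma shift_reindex_cplx : natiso (shift_cplxcat H) (reindex_cplxcat 1).
Proof.
(* Alternating signs absorb the sign of the shifted differential; [absz i] has the parity of [i] in
   negative degrees as well. *)
pose s (i : int) : k := (-1) ^+ absz i.
have sS i : s (i + 1) = - s i.
  rewrite /s; case: i => n.
    have -> : absz (Posz n + 1) = n.+1 by lia.
    by rewrite exprS mulN1r.
  have -> : absz (Negz n + 1) = n by lia.
  by rewrite exprS mulN1r opprK.
have s0 i : s i != 0 by rewrite /s signr_eq0.
have c X : @is_chain _ _ (shift_cplx X) (reindex_cplx 1 X) (fun i => s i *: idm (X (i + 1))).
  move=> i; rewrite (_ : cdiff (shift_cplx X) i = - cdiff X (i + 1))//.
  rewrite (_ : cdiff (reindex_cplx 1 X) i = ediff X (reindex_eq 1 i))//.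
  by rewrite /ediff cst_id comp1l compNr compZl comp1l compZr comp1r sS scaleNr opprK.
exists (fun X => exist _ _ (c X)); split=> [X|X Y f].
  by apply: chain_iso => i; exact: (scale_iso (X (i + 1)) (s0 i)).
apply: subsp_inj; apply: functional_extensionality_dep => i.
exact: (scale_central (s i) (sval f (i + 1) : hom (X (i + 1)) (Y (i + 1)))).
Qed.

Lemma loc_natiso_lift (A' B' : functor (cplxcat H) (cplxcat H))
    (A B : functor (dercat H) (dercat H)) : natiso A' B' ->
  natiso (compfunctor A loc) (compfunctor loc A') ->
  natiso (compfunctor B loc) (compfunctor loc B') -> natiso A B.
Proof.
move=> AB' hA hB; apply: loc_natiso; apply: natiso_trans hA _.
exact: natiso_trans (natiso_compl loc AB') (natiso_sym hB).
Qed.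

Lemma reindex_loc n : natiso (compfunctor (reindex n) loc) (compfunctor loc (reindex_cplxcat n)).
Proof. exact: loc_lift_natiso. Qed.

Lemma reindexD m n p : m + n = p -> natiso (compfunctor (reindex m) (reindex n)) (reindex p).
Proof.
move=> mnp; apply: loc_natiso_lift (reindexD_cplx mnp) _ (reindex_loc p).
exact: natiso_lift_comp (reindex_loc m) (reindex_loc n).
Qed.

Lemma reindex0 : natiso (reindex 0) (idfunctor (dercat H)).
Proof. exact: loc_natiso_lift reindex0_cplx (reindex_loc 0) (natiso_lift_id loc). Qed.

Lemma shift_loc : natiso (compfunctor (shift H) loc) (compfunctor loc (shift_cplxcat H)).
Proof. exact: loc_lift_natiso. Qed.

Lemma shift_reindex : natiso (shift H) (reindex 1).
Proof. exact: loc_natiso_lift shift_reindex_cplx shift_loc (reindex_loc 1). Qed.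

Lemma reindex_quasi_inverse n : quasi_inverse (reindex n) (reindex (- n)).
Proof.
by split; apply: natiso_trans reindex0; apply: reindexD; rewrite ?addNr ?addrN.
Qed.

Lemma reindex_faithful n : faithful (reindex n).
Proof. exact: quasi_inverse_faithful (reindex_quasi_inverse n). Qed.
Lemma reindex_full n : full (reindex n).
Proof. exact: quasi_inverse_full (reindex_quasi_inverse n). Qed.
Lemma reindex_esurj n : esurj (reindex n).
Proof. exact: quasi_inverse_esurj (reindex_quasi_inverse n). Qed.

Lemma shift_quasi_inverse : quasi_inverse (shift H) (reindex (- 1)).
Proof.
have [a b] := reindex_quasi_inverse 1; split; apply: natiso_trans.
- exact: natiso_compl shift_reindex.
- exact: a.
- exact: natiso_compr shift_reindex.
- exact: b.
Qed.
Lemma shift_faithful : faithful (shift H).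
Proof. exact: quasi_inverse_faithful shift_quasi_inverse. Qed.
Lemma shift_full : full (shift H).
Proof. exact: quasi_inverse_full shift_quasi_inverse. Qed.
Lemma shift_esurj : esurj (shift H).
Proof. exact: quasi_inverse_esurj shift_quasi_inverse. Qed.

Lemma reindexD_iso m n (X : dercat H) : isomorphic (reindex m (reindex n X)) (reindex (m + n) X).
Proof. exact: (natiso_isomorphic X (reindexD (erefl (m + n)))). Qed.
Lemma reindex0_iso (X : dercat H) : isomorphic (reindex 0 X) X.
Proof. exact: (natiso_isomorphic X reindex0). Qed.
Lemma shift_reindex_iso (X : dercat H) : isomorphic (shift H X) (reindex 1 X).
Proof. exact: (natiso_isomorphic X shift_reindex). Qed.
End Reindexing.

(** * Splitting of complexes over a hereditary algebra *)

Section DirectSumDecomposition.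
Variables (k : fieldType) (H : falgType k).
Implicit Types X Y : cplxcat H.
Notation loc := (loc_functor (@quasi_iso k H)).

Section DsumComplex.
Variables X Y : cplxcat H.

Definition dsum_diff (i : int) : hom (dsum (X i) (Y i)) (dsum (X (i + 1)) (Y (i + 1))) :=
  dinl _ _ \oc (cdiff X i \oc dprl _ _) + dinr _ _ \oc (cdiff Y i \oc dprr _ _).

Lemma dprl_diff i : dprl _ _ \oc dsum_diff i = cdiff X i \oc dprl _ _.
Proof. by rewrite compDr !(compA (dprl _ _)) dprl_inl dprl_inr comp1l comp0l addr0. Qed.
Lemma dprr_diff i : dprr _ _ \oc dsum_diff i = cdiff Y i \oc dprr _ _.
Proof. by rewrite compDr !(compA (dprr _ _)) dprr_inl dprr_inr comp1l comp0l add0r. Qed.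

Lemma dsum_hom_eq (M N Z : modcat H) (f g : hom Z (dsum M N)) :
  dprl M N \oc f = dprl M N \oc g -> dprr M N \oc f = dprr M N \oc g -> f = g.
Proof. by move=> e1 e2; rewrite -[f]comp1l -[g]comp1l -dsum_id !compDl -!compA e1 e2. Qed.

Definition dsum_cplx : cplxcat H.
Proof.
exists (fun i => dsum (X i) (Y i)) dsum_diff.
- move=> i; apply: dsum_hom_eq; rewrite comp0r.
    by rewrite compA dprl_diff -compA dprl_diff compA cdiff2 comp0l.
  by rewrite compA dprr_diff -compA dprr_diff compA cdiff2 comp0l.
- have [n Xn] := cbounded X; have [m Ym] := cbounded Y; exists (n + m)%N => i lti.
  by rewrite [LHS]/(mdim (X i) + mdim (Y i))%N Xn ?Ym//; lia.
Defined.

Definition dsum_pr1 : hom dsum_cplx X.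
Proof. by exists (fun i => dprl (X i) (Y i)) => i; exact: dprl_diff. Defined.
Definition dsum_pr2 : hom dsum_cplx Y.
Proof. by exists (fun i => dprr (X i) (Y i)) => i; exact: dprr_diff. Defined.
Definition dsum_in1 : hom X dsum_cplx.
Proof.
exists (fun i => dinl (X i) (Y i)) => i; apply: dsum_hom_eq.
  by rewrite [RHS]compA dprl_diff -[RHS]compA [LHS]compA !dprl_inl comp1l comp1r.
by rewrite [RHS]compA dprr_diff -[RHS]compA [LHS]compA !dprr_inl comp0l comp0r.
Defined.
Definition dsum_in2 : hom Y dsum_cplx.
Proof.
exists (fun i => dinr (X i) (Y i)) => i; apply: dsum_hom_eq.
  by rewrite [RHS]compA dprl_diff -[RHS]compA [LHS]compA !dprl_inr comp0l comp0r.
by rewrite [RHS]compA dprr_diff -[RHS]compA [LHS]compA !dprr_inr comp1l comp1r.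
Defined.

Lemma dsum_cplxP : is_direct_sum2 dsum_cplx X Y.
Proof.
apply/dsum2P; exists dsum_in1, dsum_in2, dsum_pr1, dsum_pr2.
split; apply: subsp_inj; apply: functional_extensionality_dep => i.
- exact: dprl_inl.
- exact: dprr_inr.
- exact: dprl_inr.
- exact: dprr_inl.
- exact: dsum_id.
Qed.

Lemma dsum_boundary i v a b : mapp (cdiff X i) a = mapp (dprl _ _) v ->
  mapp (cdiff Y i) b = mapp (dprr _ _) v -> exists w, mapp (cdiff dsum_cplx i) w = v.
Proof.
move=> da db; exists (mapp (dinl _ _) a + mapp (dinr _ _) b); apply: dsum_vec_eq.
  by rewrite -mapp_comp [X in mapp X _]dprl_diff mapp_comp dprl_vec.
by rewrite -mapp_comp [X in mapp X _]dprr_diff mapp_comp dprr_vec.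
Qed.
Lemma dsum_cycle i v : mapp (cdiff dsum_cplx i) v = 0 ->
  mapp (cdiff X i) (mapp (dprl _ _) v) = 0 /\ mapp (cdiff Y i) (mapp (dprr _ _) v) = 0.
Proof.
move=> v0; rewrite -!mapp_comp -dprl_diff -dprr_diff !mapp_comp.
have -> : mapp (dsum_diff i) v = 0 by exact: v0.
by rewrite !mapp0.
Qed.
Lemma dsum_cycle_in i a b : mapp (cdiff X i) a = 0 -> mapp (cdiff Y i) b = 0 ->
  mapp (cdiff dsum_cplx i) (mapp (dinl _ _) a + mapp (dinr _ _) b) = 0.
Proof.
move=> a0 b0; apply: dsum_vec_eq; rewrite mapp0.
  by rewrite -mapp_comp [X in mapp X _]dprl_diff mapp_comp dprl_vec.
by rewrite -mapp_comp [X in mapp X _]dprr_diff mapp_comp dprr_vec.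
Qed.
End DsumComplex.

Lemma quasi_iso_zero_degree X Y (f : hom X Y) i : mdim (X (i + 1)) = 0%N -> mdim (Y (i + 1)) = 0%N ->
  (forall x, mapp (cdiff X (i + 1)) x = 0 ->
     (exists y, mapp (cdiff Y i) y = mapp (sval f (i + 1)) x) ->
     exists x', mapp (cdiff X i) x' = x) /\
  (forall y, mapp (cdiff Y (i + 1)) y = 0 ->
     exists x, mapp (cdiff X (i + 1)) x = 0 /\
       exists y', mapp (cdiff Y i) y' = y - mapp (sval f (i + 1)) x).
Proof.
move=> X0 Y0; split=> [x _ _|y _]; first by exists 0; rewrite (mdim0_vec x X0) mapp0.
exists 0; split; first exact: mapp0.
by exists 0; rewrite !mapp0 (mdim0_vec y Y0) subr0.
Qed.

Section Resolution.
Variables (Q P N : modcat H) (d : hom Q P) (p : hom P N).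
Hypothesis dp : short_resolution d p.

Let d0 : dif0 (stalk_cplx N) \oc (p : hom P (stalk_cplx N 0)) = 0.
Proof. exact: comp0l. Qed.
Let d1 : dif1 (stalk_cplx N) \oc (0 : hom Q (stalk_cplx N (Negz 0))) =
  (p : hom P (stalk_cplx N 0)) \oc d.
Proof.
rewrite comp0r; apply: hom_ext => v; rewrite mapp0l.
have [_ _ _ _ ex] := dp; apply: esym; apply: etrans (mapp_comp p d v) _.
by apply/ex; exists v.
Qed.

Definition resolution_map : hom (two_term d : cplxcat H) (stalk_cplx N) := two_term_chain d0 d1.

Lemma resolution_quasi_iso : quasi_iso resolution_map.
Proof.
(* The condition at [i] concerns degree i + 1: the second case is degree 0, where exactness at [P]
   and surjectivity of [p] enter, and the third is degree -1, where injectivity of [d] does. In the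
   other degrees both complexes are zero. *)
have [_ _ pe dm ex] := dp; case=> [i|[|[|i]]].
- by apply: quasi_iso_zero_degree => /=; rewrite addn1.
- split=> [x _ [y yE]|y _].
    by apply/ex; apply: etrans (esym yE) _; exact: mapp0l.
  have [x xE] := pe y; exists x; split; first exact: mapp0l.
  exists 0; rewrite mapp0; apply/esym/eqP; rewrite subr_eq0; apply/eqP.
  exact: esym xE.
- split=> [x x0 _|y _].
    by exists 0; rewrite mapp0; apply/esym; have /mono_eq0 := dm; apply; exact: x0.
  exists 0; split; first exact: mapp0.
  by exists 0; rewrite !mapp0 subr0; apply/esym; exact: mdim0_vec.
- exact: quasi_iso_zero_degree.
Qed.

Lemma resolution_iso : is_iso (fmap loc resolution_map).
Proof. by apply: loc_functor_iso; exact: resolution_quasi_iso. Qed.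
End Resolution.

Section Truncation.
Variables (X : cplxcat H) (S : modcat H) (j : hom S (X (Negz 0))) (d' : hom (X (Negz 1)) S).
Hypotheses (jm : mono j) (jE : forall v, mapp (dif1 X) v = 0 <-> exists s, mapp j s = v).
Hypothesis jd : j \oc d' = dif2 X.

(** The canonical truncation to degrees at most -1: [S] stands for the cycles of degree -1, so the
    cohomology of [X] below degree 0 is kept. *)
Definition trunc_ob (i : int) : modcat H :=
  match i with Posz _ => zeromod H | Negz 0 => S | Negz n.+1 => X (Negz n.+1) end.
Definition trunc_diff (i : int) : hom (trunc_ob i) (trunc_ob (i + 1)) :=
  match i return hom (trunc_ob i) (trunc_ob (i + 1)) with
  | Posz _ => 0 | Negz 0 => 0 | Negz 1 => d' | Negz n.+2 => cdiff X (Negz n.+2) end.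

Definition trunc : cplxcat H.
Proof.
exists trunc_ob trunc_diff.
- case=> [i|[|[|[|i]]]].
  + exact: comp0r.
  + exact: comp0r.
  + exact: comp0l.
  + apply: (mono_cancel jm); rewrite comp0r.
    apply: etrans (cdiff2 X (Negz 2)); rewrite compA.
    by congr (_ \oc _); exact: jd.
  + exact: (cdiff2 X (Negz i.+3)).
- have [n Xn] := cbounded X; exists n.+1 => -[i|[|i]] lti //.
  by apply: Xn; lia.
Defined.

Definition trunc_fun (i : int) : hom (trunc_ob i) (X i) :=
  match i return hom (trunc_ob i) (X i) with
  | Posz _ => 0 | Negz 0 => j | Negz n.+1 => idm _ end.

Fact trunc_fun_chain (i : int) : trunc_fun (i + 1) \oc trunc_diff i = cdiff X i \oc trunc_fun i.
Proof.
case: i => [i|[|[|i]]].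
- by rewrite [LHS]comp0r [RHS]comp0r.
- rewrite [LHS]comp0r; apply: hom_ext => s; rewrite mapp0l.
  by apply: esym; apply: etrans (mapp_comp (dif1 X) j s) _; apply/jE; exists s.
- by rewrite [RHS]comp1r; exact: jd.
- by rewrite [RHS]comp1r; exact: comp1l.
Qed.

Definition trunc_map : hom trunc X :=
  exist _ (trunc_fun : dprodv (fun i => hom (trunc i) (X i))) trunc_fun_chain.
End Truncation.

Lemma mono_mdim0 (M N : modcat H) (f : hom M N) : mono f -> mdim N = 0%N -> mdim M = 0%N.
Proof.
move=> fm N0; apply/eqP; rewrite -leqn0 leqNgt; apply/negP => M0.
have e : (delta_mx 0 (Ordinal M0) : 'rV[k]_(mdim M)) = 0.
  by move/mono_eq0: fm; apply; exact: mdim0_vec.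
by move/rowP/(_ (Ordinal M0)): e; rewrite !mxE !eqxx => /eqP; rewrite oner_eq0.
Qed.

(** The cohomology [N] in degree 0 is lifted to a chain map from a resolution Q -> P of [N] into
    [X]. Added to the inclusion of the truncation, it gives a quasi-isomorphism from the direct
    sum. *)
Lemma split_top_cohomology X : hereditary H -> (forall n, mdim (X (Posz n.+1)) = 0%N) ->
  exists (Y : cplxcat H) (N : modcat H),
    [/\ forall n, mdim (Y (Posz n)) = 0%N, forall i, mdim (X i) = 0%N -> mdim (Y i) = 0%N
      & is_direct_sum2 (X : dercat H) Y (stalk H N)].
Proof.
move=> hH X0.
have [N [h [he hE]]] := coker_exists (dif1 X).
have [P [p [Pp pe]]] := projective_cover (X 0).
have hpe : epi (h \oc p).
  by move=> w; have [v <-] := he w; have [u <-] := pe v; exists u; rewrite mapp_comp.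
have [Q [d dp]] := kernel_resolution hH Pp hpe; have [_ Qp _ dm dE] := dp.
(* This is where the hypothesis on [H] acts: [Q], a submodule of [P], is projective, so its map into
   the boundaries of degree 0 lifts to degree -1. *)
have [|q qE] := @projective_lift _ _ Q _ _ (dif1 X) (p \oc d) Qp.
  move=> v; apply/hE; rewrite -mapp_comp compA mapp_comp.
  by apply/dE; exists v.
have d0 : dif0 X \oc p = 0.
  by apply: hom_ext => v; rewrite mapp0l; apply: mdim0_vec; exact: X0.
pose sg : hom (two_term d : cplxcat H) X := two_term_chain d0 qE.
have [S [j [jm jE]]] := kernel_exists (dif1 X).
have [|d' jd] := @mono_factor _ _ _ _ _ j (dif2 X) jm.
  by move=> v; apply/jE; rewrite -mapp_comp dif12 mapp0l.
pose Y := trunc jm jd; pose tr : hom Y X := trunc_map jm jE jd.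
exists Y, N; split.
- by [].
- by case=> [i|[|i]] //=; exact: mono_mdim0 jm.
pose Phi := tr \oc dsum_pr1 Y (two_term d) + sg \oc dsum_pr2 Y (two_term d).
have PhiE i v : mapp (sval Phi i) v =
    mapp (sval tr i) (mapp (dprl _ _) v) + mapp (sval sg i) (mapp (dprr _ _) v).
  by rewrite -!mapp_comp -mappDl.
suff Phiq : quasi_iso Phi.
  apply: (isomorphic_dsum2 (X := (dsum_cplx Y (two_term d) : dercat H))); last first.
    by exists (fmap loc Phi); exact: loc_functor_iso.
  have /dsum2P[i1 [i2 [p1 [p2 [e1 e2 e12 e21 s]]]]] := fmap_dsum2 loc (dsum_cplxP Y (two_term d)).
  have [f' [f1 f2]] := resolution_iso dp.
  apply/dsum2P; exists i1, (i2 \oc f'), p1, (fmap loc (resolution_map dp) \oc p2).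
  split; first exact: e1.
  - by rewrite -compA (compA p2) e2 comp1l.
  - by rewrite compA e12 comp0l.
  - by rewrite -compA e21 comp0r.
  - by rewrite -(compA i2) (compA f') f1 comp1l.
(* As the condition at [i] concerns degree i + 1, the cases are positive degrees, degree 0 (seen by
   the resolution), degree -1 (where the truncation has the cycles), and lower degrees, where the
   truncation agrees with [X]. *)
case=> [i|[|[|i]]].
- apply: quasi_iso_zero_degree; rewrite -?[(_ + 1)%R]/(Posz (i + 1)) addn1; last exact: X0.
  by [].
- split=> [v _ [y yE]|y _].
    have e0 : mapp (sval Phi 0) v = mapp p (mapp (dprr _ _) v).
      rewrite PhiE [X in X + _](_ : _ = 0) ?add0r//.
      exact: mapp0l.
    have [|w wE] := (dE (mapp (dprr (zeromod H) P) v)).1.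
      by rewrite mapp_comp; apply/hE; exists y; rewrite [LHS]yE; exact: e0.
    apply: (@dsum_boundary Y (two_term d) (Negz 0) v 0 w); last exact: wE.
    by rewrite mapp0; apply/esym; exact: (@mdim0_vec _ _ (zeromod H)).
  have [x xE] := hpe (mapp h y); exists (mapp (dinl _ _) 0 + mapp (dinr _ _) x); split.
    by apply: dsum_cycle_in; [exact: mapp0|exact: mapp0l].
  have /hE[u uE] : mapp h (y - mapp p x) = 0 by rewrite mappB -mapp_comp xE subrr.
  exists u; rewrite [LHS]uE; congr (y - _).
  rewrite PhiE dprl_vec dprr_vec mapp0 add0r.
  by [].
- split=> [v /dsum_cycle[_ v2] [y yE]|y y0].
    have v20 : mapp (dprr S Q) v = 0 by move/mono_eq0: dm; apply; exact: v2.
    have key : mapp d' y = mapp (dprl S Q) v.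
      apply: (jm _ _); rewrite -mapp_comp jd; apply: etrans yE _.
      apply: etrans (PhiE (Negz 1 + 1) v) _; apply: etrans (addr0 _); congr (_ + _).
      by apply: etrans (mapp0 q); exact: (congr1 (mapp q) v20).
    apply: (@dsum_boundary Y (two_term d) (Negz 1) v y 0); first exact: key.
    by rewrite mapp0; exact: esym v20.
  have /jE[s sE] := y0.
  exists (mapp (dinl _ _) s + mapp (dinr _ _) 0); split.
    by apply: dsum_cycle_in; [exact: mapp0l|exact: mapp0].
  exists 0; rewrite mapp0 PhiE dprl_vec dprr_vec mapp0 addr0.
  by apply/esym/eqP; rewrite subr_eq0; apply/eqP; exact: esym sE.
- split=> [v _ [y yE]|y y0].
    apply: (@dsum_boundary Y (two_term d) (Negz i.+2) v y 0).
      apply: etrans yE _; rewrite PhiE; apply: etrans (addr0 _); congr (_ + _); last first.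
        by rewrite (mdim0_vec (mapp (dprr _ _) v))// mapp0.
      exact: mapp_id.
    by rewrite mapp0; apply/esym; exact: mdim0_vec.
  exists (mapp (dinl _ _) y + mapp (dinr _ _) 0); split.
    apply: dsum_cycle_in; last exact: mapp0.
    case: i y y0 => [|i] y y0; last exact: y0.
    by apply: (jm _ _); rewrite mapp0 -mapp_comp jd; exact: y0.
  exists 0; rewrite mapp0 PhiE dprl_vec dprr_vec mapp0 addr0.
  apply/esym/eqP; rewrite subr_eq0; apply/eqP.
  by apply: esym; exact: mapp_id.
Qed.

Lemma zero_complex X : (forall i, mdim (X i) = 0%N) -> is_zero (X : dercat H).
Proof.
move=> X0; apply: acyclic_is_zero => i x _; exists 0.
by rewrite mapp0; apply/esym; apply: mdim0_vec.
Qed.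

(* Over a hereditary algebra every complex is the direct sum of its shifted
   cohomology modules. *)
Lemma dercat_ind (Phi : dercat H -> Prop) (m : int) : hereditary H ->
  (forall X Y : dercat H, isomorphic X Y -> Phi X -> Phi Y) ->
  (forall X Y Z : dercat H, is_direct_sum2 X Y Z -> Phi Y -> Phi Z -> Phi X) ->
  (forall X : dercat H, is_zero X -> Phi X) ->
  (forall N j, (m <= j)%R -> Phi (reindex H j (stalk H N))) ->
  forall X : dercat H, (forall i, (- m < i)%R -> mdim ((X : cplx H) i) = 0%N) -> Phi X.
Proof.
move=> hH Phi_iso Phi_sum Phi_zero Phi_stalk.
(* [L] counts the degrees up to [n] in which [X] may be nonzero. Translation by [n] moves the top
   one to 0, where one module splits off; the bound on [n] keeps its shift [- n] at least [m]. *)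
suff main (L : nat) : forall (X : cplxcat H) (n : int), (n <= - m)%R ->
    (forall i, (n < i)%R || (i <= n - L%:Z)%R -> mdim (X i) = 0%N) -> Phi X.
  move=> X Xm; have [N XN] := cbounded (X : cplx H).
  apply: (main (N + absz m).+1 X (- m)) => [//|i /orP[/Xm//|lti]].
  by apply: XN; lia.
elim: L => [|L IH] X n nm Xn.
  apply: Phi_zero; apply: (@zero_complex X) => i; apply: Xn; lia.
have [|Y [N [Y0 Y1 XYN]]] := @split_top_cohomology (reindex_cplx n X) hH.
  by move=> i; apply: Xn; lia.
have e1 : isomorphic (reindex H (- n) (reindex H n X)) X.
  apply: isomorphic_trans (reindexD_iso _ _ _) _; rewrite addNr; exact: reindex0_iso.
apply: Phi_iso e1 _.
apply: Phi_sum (fmap_dsum2 (reindex H (- n)) XYN) _ _; last by apply: Phi_stalk; lia.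
apply: (IH (reindex_cplx (- n) Y) (n - 1)) => [|i lti]; first by lia.
rewrite -[LHS]/(mdim (Y (i + - n))); case E: (i + - n) => [j|j]; first exact: Y0.
by rewrite -E; apply: Y1; apply: (Xn (i + - n + n)); lia.
Qed.
End DirectSumDecomposition.

(** * Vanishing of morphisms *)

Section VanishingHoms.
Variables (k : fieldType) (C : lincat k).
Implicit Types X Y Z : C.

Definition hom0 X Y := forall f : hom X Y, f = 0.

Lemma hom0_isol X X' Y : isomorphic X X' -> hom0 X Y -> hom0 X' Y.
Proof. by move=> [u [v [_ uv]]] XY f; rewrite -[f]comp1r -uv compA (XY (f \oc u)) comp0l. Qed.
Lemma hom0_isor X Y Y' : isomorphic Y Y' -> hom0 X Y -> hom0 X Y'.
Proof. by move=> [u [v [_ uv]]] XY f; rewrite -[f]comp1l -uv -compA (XY (v \oc f)) comp0r. Qed.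
Lemma hom0_suml X X1 X2 Y : is_direct_sum2 X X1 X2 -> hom0 X1 Y -> hom0 X2 Y -> hom0 X Y.
Proof.
move=> /dsum2P[i1 [i2 [p1 [p2 [_ _ _ _ s]]]]] h1 h2 f.
by rewrite -[f]comp1r -s compDr !compA (h1 (f \oc i1)) (h2 (f \oc i2)) !comp0l addr0.
Qed.
Lemma hom0_sumr X Y Y1 Y2 : is_direct_sum2 Y Y1 Y2 -> hom0 X Y1 -> hom0 X Y2 -> hom0 X Y.
Proof.
move=> /dsum2P[i1 [i2 [p1 [p2 [_ _ _ _ s]]]]] h1 h2 f.
by rewrite -[f]comp1l -s compDl -!compA (h1 (p1 \oc f)) (h2 (p2 \oc f)) !comp0r addr0.
Qed.
Lemma hom0_zeror X Y : is_zero Y -> hom0 X Y.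
Proof. by move=> Y0 f; exact: is_zero_hom_r. Qed.

Lemma findim_hom_isol X X' Y : isomorphic X X' -> findim (hom X Y) -> findim (hom X' Y).
Proof.
move=> [u [v [_ uv]]]; apply: (@findim_surj _ _ _ (fun f : hom X Y => f \oc v)).
  by move=> c f g; exact: comp_linl.
by move=> f; exists (f \oc u); rewrite -compA uv comp1r.
Qed.
Lemma findim_hom_suml X X1 X2 Y : is_direct_sum2 X X1 X2 ->
  findim (hom X1 Y) -> findim (hom X2 Y) -> findim (hom X Y).
Proof.
move=> /dsum2P[i1 [i2 [p1 [p2 [_ _ _ _ s]]]]] [m [e eP]] [n [e' eP']].
exists (m + n)%N, (fun j => match split j with inl j => e j \oc p1 | inr j => e' j \oc p2 end).
move=> f; have [c cE] := eP (f \oc i1); have [c' cE'] := eP' (f \oc i2).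
exists (fun j => match split j with inl j => c j | inr j => c' j end).
rewrite -[LHS]comp1r -s compDr !compA cE cE' big_split_ord !comp_suml.
congr (_ + _); apply: eq_bigr => j _.
  by rewrite (unsplitK (inl j)) compZl.
by rewrite (unsplitK (inr j)) compZl.
Qed.
Lemma findim_hom0 X Y : hom0 X Y -> findim (hom X Y).
Proof. by move=> XY; exists 0%N, (fun=> 0) => f; exists (fun=> 0); rewrite big_ord0; exact: XY. Qed.
End VanishingHoms.

Lemma hom0_functor (k : fieldType) (C D : lincat k) (F : functor C D) X Y :
  faithful F -> hom0 (F X) (F Y) -> hom0 X Y.
Proof. by move=> Ff h f; apply: Ff; exact: h. Qed.
Lemma hom0_full (k : fieldType) (C D : lincat k) (F : functor C D) X Y :
  full F -> hom0 X Y -> hom0 (F X) (F Y).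
Proof. by move=> Fu h f; have [g <-] := Fu _ _ f; rewrite (h g) fmap0. Qed.
Lemma findim_hom_full (k : fieldType) (C D : lincat k) (F : functor C D) X Y :
  full F -> findim (hom X Y) -> findim (hom (F X) (F Y)).
Proof.
move=> Fu; apply: (@findim_surj _ _ _ (fun f : hom X Y => fmap F f)).
  by move=> c f g; exact: fmap_lin.
exact: Fu.
Qed.

Section TwoTermHoms.
Variables (k : fieldType) (H : falgType k).
Notation D := (dercat H).
Notation loc := (loc_functor (@quasi_iso k H)).

Lemma mdim0_homr (X Y : modcat H) (f g : hom X Y) : mdim Y = 0%N -> f = g.
Proof. by move=> Y0; apply: hom_ext => v; exact: etrans (mdim0_vec _ Y0) (esym (mdim0_vec _ Y0)). Qed.

Section Hom.
Variables (Q P : modcat H) (d : hom Q P).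
Hypotheses (Pp : projective P) (Qp : projective Q).
Notation W := (two_term d).

Lemma two_term_hom0 (Y : D) : mdim ((Y : cplx H) 0) = 0%N ->
  mdim ((Y : cplx H) (Negz 0)) = 0%N \/ mdim Q = 0%N -> hom0 W Y.
Proof.
move=> Y0 Y1 phi; have [f ->] := loc_two_term_full Pp Qp phi.
suff -> : f = 0 by exact: (fmap0 loc (two_term d : cplxcat H) (Y : cplxcat H)).
apply: two_term_chain_ext; first exact: mdim0_homr.
by case: Y1 => [Y1|Q0]; [exact: mdim0_homr|exact: mdim0_homl].
Qed.

Lemma two_term_findim (Y : D) : findim (hom W Y).
Proof.
pose V := (modhom P ((Y : cplx H) 0) * modhom Q ((Y : cplx H) (Negz 0)))%type.
pose cond (v : V) := dif0 (Y : cplxcat H) \oc (v.1 : hom P _) = 0 /\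
  dif1 (Y : cplxcat H) \oc (v.2 : hom Q _) = (v.1 : hom P _) \oc d.
(* Pairs that violate the chain condition get the default value 0, so linearity holds only on pairs
   satisfying it; this suffices for [findim_sub]. *)
pose chain (v : V) : hom (W : cplxcat H) Y :=
  match pselect (cond v) with
  | left c => two_term_chain c.1 c.2 | right _ => 0 end.
have chain0 v : cond v -> sval (chain v) 0 = v.1.
  by move=> vc; rewrite /chain; case: pselect.
have chain1 v : cond v -> sval (chain v) (Negz 0) = v.2.
  by move=> vc; rewrite /chain; case: pselect.
have condL a u v : cond u -> cond v -> cond (a *: u + v).
  move=> [u0 u1] [v0 v1]; split.
    by apply: etrans (comp_linr _ _ _ _) _; rewrite u0 v0 scaler0 addr0.
  apply: etrans (comp_linr _ _ _ _) _; rewrite u1 v1.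
  exact: esym (comp_linl _ _ _ _).
apply: (@findim_sub k V cond _ (fun v => fmap loc (chain v))).
- move=> u uc v vc c; rewrite -fmap_lin; congr fmap.
  have cc := condL c _ _ uc vc.
  apply: two_term_chain_ext; rewrite sval_lin.
    by rewrite (chain0 _ cc) (chain0 _ uc) (chain0 _ vc).
  by rewrite (chain1 _ cc) (chain1 _ uc) (chain1 _ vc).
- by split; rewrite ?comp0l; exact: comp0r.
- exact: condL.
- move=> phi; have [f ->] := loc_two_term_full Pp Qp phi.
  pose v : V := (sval f 0, sval f (Negz 0)).
  have vc : cond v by split; [exact: two_term_cycle|exact: two_term_boundary].
  exists v; split=> //; congr fmap.
  by apply: two_term_chain_ext; [exact: chain0|exact: chain1].
Qed.
End Hom.

Lemma resolution_isomorphic Q P N (d : hom Q P) (p : hom P N) : short_resolution d p ->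
  isomorphic (two_term d) (stalk H N).
Proof. by move=> dp; exists (fmap loc (resolution_map dp)); exact: resolution_iso. Qed.

Lemma projective_resolution P : projective P -> short_resolution (0 : hom (zeromod H) P) (idm P).
Proof.
move=> Pp; split=> //; first exact: zeromod_projective.
- by move=> v; exists v; rewrite mapp_id.
- by move=> v w _; rewrite [v]thinmx0 [w]thinmx0.
- move=> v; rewrite mapp_id; split=> [->|[w <-]]; last exact: mapp0l.
  by exists 0; exact: mapp0.
Qed.

Lemma stalk_hom0 N (Y : D) : hereditary H -> mdim ((Y : cplx H) 0) = 0%N ->
  mdim ((Y : cplx H) (Negz 0)) = 0%N -> hom0 (stalk H N) Y.
Proof.
move=> hH Y0 Y1; have [Q [P [d [p dp]]]] := resolution_exists N hH.
apply: hom0_isol (resolution_isomorphic dp) _; have [Pp Qp _ _ _] := dp.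
by apply: two_term_hom0 => //; left.
Qed.

Lemma projective_stalk_hom0 P (Y : D) : projective P -> mdim ((Y : cplx H) 0) = 0%N ->
  hom0 (stalk H P) Y.
Proof.
move=> Pp Y0; have dp := projective_resolution Pp; have [_ Qp _ _ _] := dp.
apply: hom0_isol (resolution_isomorphic dp) _.
by apply: two_term_hom0 => //; right.
Qed.

Lemma stalk_ob0 (N : modcat H) (i : int) : i != 0 -> mdim (stalk_ob N i) = 0%N.
Proof. by case: i => [[|i]|i]. Qed.

Lemma stalk_reindex_hom0 M N j : hereditary H -> j != 0 -> j != 1 ->
  hom0 (stalk H M) (reindex H j (stalk H N)).
Proof.
move=> hH j0 j1; apply: stalk_hom0 => //.
  by apply: (@stalk_ob0 N (0 + j)); rewrite add0r.
by apply: (@stalk_ob0 N (Negz 0 + j)); lia.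
Qed.

Lemma projective_reindex_hom0 P N j : projective P -> j != 0 ->
  hom0 (stalk H P) (reindex H j (stalk H N)).
Proof.
move=> Pp j0; apply: projective_stalk_hom0 => //.
by apply: (@stalk_ob0 N (0 + j)); rewrite add0r.
Qed.

Lemma hom0_reindexl j (X Y : D) : hom0 X (reindex H (- j) Y) -> hom0 (reindex H j X) Y.
Proof.
move=> h; have := hom0_full (@reindex_full _ H j) h; apply: hom0_isor.
apply: isomorphic_trans (reindexD_iso _ _ _) _; rewrite addrN; exact: reindex0_iso.
Qed.

Lemma dercat_findim : hereditary H -> forall X Y : D, findim (hom X Y).
Proof.
move=> hH X Y; have [n Xn] := cbounded (X : cplx H).
apply: (@dercat_ind k H (fun X => findim (hom X Y)) (- (Posz n)) hH).
- by move=> X1 X2; exact: findim_hom_isol.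
- by move=> X1 X2 X3; exact: findim_hom_suml.
- by move=> X1 X0; apply: findim_hom0 => f; exact: is_zero_hom_l.
- move=> N j _; have [Q [P [d [p dp]]]] := resolution_exists N hH.
  have [Pp Qp _ _ _] := dp.
  have [Y' YY'] := @reindex_esurj _ H j Y.
  have fdW : findim (hom (two_term d) Y') by exact: two_term_findim.
  have fdN := findim_hom_isol (resolution_isomorphic dp) fdW.
  have fdr := findim_hom_full (@reindex_full _ H j) fdN.
  have [u [v [vu uv]]] := YY'.
  apply: (@findim_surj _ _ _ (fun f : hom (reindex H j (stalk H N)) _ => u \oc f) _ _ fdr).
    by move=> c f g; exact: comp_linr.
  by move=> f; exists (v \oc f); rewrite compA uv comp1l.
- by move=> i lti; apply: Xn; lia.
Qed.

(* the aisle of complexes with cohomology in degrees <= - m *)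
Definition below (m : int) (X : D) : Prop :=
  forall Phi : D -> Prop,
  (forall X Y : D, isomorphic X Y -> Phi X -> Phi Y) ->
  (forall X Y Z : D, is_direct_sum2 X Y Z -> Phi Y -> Phi Z -> Phi X) ->
  (forall X : D, is_zero X -> Phi X) ->
  (forall N j, (m <= j)%R -> Phi (reindex H j (stalk H N))) -> Phi X.

Lemma belowP m (X : D) : hereditary H ->
  (forall i, (- m < i)%R -> mdim ((X : cplx H) i) = 0%N) -> below m X.
Proof. by move=> hH Xm Phi P1 P2 P3 P4; apply: (dercat_ind hH P1 P2 P3 P4). Qed.

Lemma below_iso m (X Y : D) : isomorphic X Y -> below m X -> below m Y.
Proof. by move=> XY bX Phi P1 P2 P3 P4; exact: P1 XY (bX Phi P1 P2 P3 P4). Qed.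
Lemma below_sum m (X Y Z : D) : is_direct_sum2 X Y Z -> below m Y -> below m Z -> below m X.
Proof. by move=> XYZ bY bZ Phi P1 P2 P3 P4; exact: P2 XYZ (bY Phi P1 P2 P3 P4) (bZ Phi P1 P2 P3 P4). Qed.
Lemma below_zero m (X : D) : is_zero X -> below m X.
Proof. by move=> X0 Phi P1 P2 P3 P4; exact: P3. Qed.
Lemma below_stalk m N j : (m <= j)%R -> below m (reindex H j (stalk H N)).
Proof. by move=> mj Phi P1 P2 P3 P4; exact: P4. Qed.
Lemma below_stalk0 N : below 0 (stalk H N).
Proof. by apply: below_iso (reindex0_iso _) _; exact: below_stalk. Qed.

Lemma below_le m n (X : D) : (n <= m)%R -> below m X -> below n X.
Proof.
move=> nm bX; apply: (bX (below n)).
- by move=> Y Z; exact: below_iso.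
- by move=> Y Z Z'; exact: below_sum.
- by move=> Y; exact: below_zero.
- by move=> N j mj; apply: below_stalk; lia.
Qed.

Lemma below_reindex m n (X : D) : below m X -> below (n + m) (reindex H n X).
Proof.
move=> bX; apply: (bX (fun X => below (n + m) (reindex H n X))).
- by move=> Y Z YZ; apply: below_iso; exact: fmap_isomorphic.
- by move=> Y Z Z' YZ; apply: below_sum; exact: fmap_dsum2.
- by move=> Y Y0; apply: below_zero; rewrite /is_zero -fmap1 Y0 fmap0.
- move=> N j mj; apply: below_iso (isomorphic_sym (reindexD_iso _ _ _)) _.
  by apply: below_stalk; lia.
Qed.

Lemma below_shift m (X : D) : below m X -> below (1 + m) (shift H X).
Proof.
move=> bX; apply: below_iso (isomorphic_sym (shift_reindex_iso _)) _.
exact: below_reindex.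
Qed.

Lemma stalk_below_hom0 N (X : D) : hereditary H -> below 2 X -> hom0 (stalk H N) X.
Proof.
move=> hH bX; apply: (bX (fun X => hom0 (stalk H N) X)).
- by move=> Y Z; exact: hom0_isor.
- by move=> Y Z Z'; exact: hom0_sumr.
- by move=> Y; exact: hom0_zeror.
- by move=> M j lej; apply: stalk_reindex_hom0 => //; lia.
Qed.

Lemma projective_below_hom0 P (X : D) : projective P -> below 1 X -> hom0 (stalk H P) X.
Proof.
move=> Pp bX; apply: (bX (fun X => hom0 (stalk H P) X)).
- by move=> Y Z; exact: hom0_isor.
- by move=> Y Z Z'; exact: hom0_sumr.
- by move=> Y; exact: hom0_zeror.
- by move=> M j lej; apply: projective_reindex_hom0 => //; lia.
Qed.

Lemma shift_projective_below_hom0 P (X : D) : projective P -> below 2 X ->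
  hom0 (shift H (stalk H P)) X.
Proof.
move=> Pp bX; apply: hom0_isol (isomorphic_sym (shift_reindex_iso _)) _.
apply: hom0_reindexl; apply: projective_below_hom0 => //.
exact: (@below_reindex 2 (- 1)).
Qed.

(** Composed with a projective resolution of [M], a morphism is represented by a chain map, whose
    component on [P] kills [Q] and hence descends to [M]. *)
Lemma stalk_full : hereditary H -> full (stalk H).
Proof.
move=> hH M N phi; have [Q [P [d [p dp]]]] := resolution_exists M hH.
have [Pp Qp pe _ ex] := dp.
have [f fE] := loc_two_term_full Pp Qp (phi \oc fmap loc (resolution_map dp)).
have ad : (sval f 0 : hom P N) \oc d = 0.
  by apply: etrans (esym (two_term_boundary f)) _; exact: comp0l.
have [|g gE] := @epi_factor _ _ _ _ _ p (sval f 0 : hom P N) pe.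
  by move=> v /ex[w <-]; apply: etrans (esym (mapp_comp _ _ _)) _; rewrite ad mapp0l.
exists g; apply: (iso_epic (resolution_iso dp)); rewrite fE.
have -> : f = stalk_map g \oc resolution_map dp.
  apply: two_term_chain_ext; rewrite sval_comp; first exact: esym gE.
  exact: zeromod_homr.
exact: esym (fmapM loc _ _).
Qed.

Lemma stalk_faithful : hereditary H -> faithful (stalk H).
Proof.
move=> hH M N g g0; have [Q [P [d [p dp]]]] := resolution_exists M hH.
have [Pp Qp pe _ ex] := dp.
have /loc_eq0_null : fmap loc (stalk_map g \oc resolution_map dp) = 0.
  rewrite fmapM; apply: etrans (congr1 (comp^~ _) g0) _; exact: comp0l.
move=> /(_ Pp Qp)[s [t [e0 _]]].
apply: (epi_cancel pe); rewrite comp0l; apply: etrans e0 _.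
exact: comp0l.
Qed.
End TwoTermHoms.

(** * Traces and derivations *)

Section TraceForm.
Variables (k : fieldType).

Lemma mx_functional m n (l : 'M[k]_(m, n) -> k) : linfunct l ->
  exists u : 'M[k]_(n, m), forall A, l A = \tr (u *m A).
Proof.
move=> ll; exists (\matrix_(i, j) l (delta_mx j i)) => A.
rewrite {1}[A]matrix_sum_delta (linfunct_sum _ _ ll) mxtrace_mulC /mxtrace.
apply: eq_bigr => i _; rewrite (linfunct_sum _ _ ll) mxE.
by apply: eq_bigr => j _; rewrite (linfunctZ ll) mxE.
Qed.

Lemma tr_nondeg m n (u : 'M[k]_(n, m)) : (forall A, \tr (u *m A) = 0) -> u = 0.
Proof.
move=> u0; apply/matrixP => i j; have := u0 (delta_mx j i).
rewrite mxtrace_mulC /mxtrace (bigD1 j)//= big1 => [|l lj]; last first.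
  by rewrite mxE big1// => s _; rewrite mxE (negbTE lj) mul0r.
rewrite addr0 mxE (bigD1 i)//= big1 => [|s si]; last by rewrite mxE (negbTE si) andbF mul0r.
by rewrite addr0 !mxE !eqxx mul1r.
Qed.

Lemma separating_functional (V : vectType k) (U : {vspace V}) v : v \notin U ->
  exists l : V -> k, [/\ linfunct l, forall u, u \in U -> l u = 0 & l v != 0].
Proof.
move=> vU; pose w x := x - projv U x.
have w0 : w v != 0.
  by apply: contra vU; rewrite subr_eq0 => /eqP ->; exact: memv_proj.
have /rowP/eqfunP : v2r (w v) <> 0.
  by move=> e; case/eqP: w0; apply: (can_inj v2rK); rewrite e linear0.
rewrite negb_forall => /existsP[i wi].
exists (fun x => v2r (w x) 0 i); split.
- by move=> c x y; rewrite /w linearP opprD addrACA -scalerBr linearP !mxE.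
- by move=> u uU; rewrite /w projv_id// subrr linear0 mxE.
- by rewrite mxE in wi.
Qed.

Lemma functional_factor (V V' : vectType k) (A : 'Hom(V, V')) (l : V -> k) : linfunct l ->
  (forall v, A v = 0 -> l v = 0) ->
  exists l' : V' -> k, linfunct l' /\ forall v, l v = l' (A v).
Proof.
move=> ll lA; exists (fun w => l ((A^-1)%VF w)); split=> [c x y|v].
  by rewrite linearP ll.
apply/eqP; rewrite -subr_eq0 -(linfunctN ll) -(linfunctD ll); apply/eqP/lA.
by rewrite linearB /= limg_lfunVK ?subrr// memv_img ?memvf.
Qed.

Lemma mx_fun_exists m n (f : 'rV[k]_m -> 'rV[k]_n) :
  (forall c u v, f (c *: u + v) = c *: f u + f v) ->
  exists A : 'M[k]_(m, n), forall v, v *m A = f v.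
Proof.
move=> fl; exists (\matrix_i f (delta_mx 0 i)) => v.
have f0 : f 0 = 0 by have := fl (-1) 0 0; rewrite !scaleN1r oppr0 addr0 addNr.
rewrite mulmx_sum_row {2}[v]row_sum_delta.
elim/big_rec2: _ => [|i x y _ ->]; first by rewrite f0.
by rewrite fl rowK.
Qed.
End TraceForm.

Section Derivations.
Variables (k : fieldType) (H : falgType k).
Implicit Types M N P : modcat H.
Notation n := (\dim {:H}).

Definition hbase (j : 'I_n) : H := (vbasis {:H})`_j.
Definition hcoord (j : 'I_n) : 'Hom(H, k^o) := linfun (coord (vbasis {:H}) j : H -> k^o).

Lemma hcoordE j x : hcoord j x = coord (vbasis {:H}) j x.
Proof. exact: lfunE. Qed.
Lemma hbase_sum (x : H) : x = \sum_j hcoord j x *: hbase j.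
Proof.
rewrite {1}(coord_vbasis (memvf x)); apply: eq_bigr => j _.
by rewrite hcoordE.
Qed.
Section Tensor.
Variables (W : vectType k).
Definition htensor_fun (phi : 'Hom(H, k^o)) (w : W) (x : H) : W := (phi x : k) *: w.
Lemma htensor_exists (phi : 'Hom(H, k^o)) (w : W) :
  exists d : 'Hom(H, W), forall x, d x = (phi x : k) *: w.
Proof.
have fl : linear (htensor_fun phi w).
  by move=> c x y; rewrite /htensor_fun linearP scalerDl scalerA.
pose f : {linear H -> W} := HB.pack (htensor_fun phi w)
  (GRing.isLinear.Build k H W _ (htensor_fun phi w) fl).
by exists (linfun f) => x; rewrite lfunE.
Qed.
Definition htensor phi w : 'Hom(H, W) := projT1 (cid (htensor_exists phi w)).
Lemma htensorE phi w x : htensor phi w x = (phi x : k) *: w.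
Proof. exact: (projT2 (cid (htensor_exists phi w))). Qed.

Lemma htensor_sum (d : 'Hom(H, W)) : d = \sum_j htensor (hcoord j) (d (hbase j)).
Proof.
apply/lfunP => x; rewrite sum_lfunE {1}[x]hbase_sum linear_sum.
by apply: eq_bigr => j _; rewrite linearZ htensorE.
Qed.
Lemma htensor_lin phi c (v w : W) : htensor phi (c *: v + w) = c *: htensor phi v + htensor phi w.
Proof.
apply/lfunP => x; rewrite add_lfunE scale_lfunE !htensorE scalerDr !scalerA.
by rewrite mulrC.
Qed.
End Tensor.

Lemma homH_functional m p (l : 'Hom(H, 'M[k]_(m, p)) -> k) : linfunct l ->
  exists u : 'I_n -> 'M[k]_(p, m), forall d, l d = \sum_j \tr (u j *m d (hbase j)).
Proof.
move=> ll; have ex j : exists u : 'M[k]_(p, m), forall A, l (htensor (hcoord j) A) = \tr (u *m A).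
  by apply: mx_functional => c A B; rewrite htensor_lin ll.
exists (fun j => projT1 (cid (ex j))) => d.
rewrite {1}[d]htensor_sum (linfunct_sum _ _ ll); apply: eq_bigr => j _.
exact: (projT2 (cid (ex j))).
Qed.

(** The transpose of [bar0] for the trace form: a tuple [u] represents the functional on cochains
    that pairs [u j] with the value at the basis element [hbase j]. *)
Definition cocommutator M N (u : 'I_n -> 'M[k]_(mdim M, mdim N)) : 'M[k]_(mdim M, mdim N) :=
  \sum_j (u j *m mact N (hbase j) - mact M (hbase j) *m u j).

Lemma tr_cocommutator M N (u : 'I_n -> 'M[k]_(mdim M, mdim N)) (f : 'M[k]_(mdim N, mdim M)) :
  \tr (cocommutator u *m f) = \sum_j \tr (u j *m bar0 N M f (hbase j)).
Proof.
rewrite /cocommutator mulmx_suml raddf_sum /=; apply: eq_bigr => j _.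
rewrite bar0E mulmxBl mulmxBr !raddfB /=; congr (_ - _).
  by rewrite mulmxA.
by rewrite -mulmxA mxtrace_mulC !mulmxA.
Qed.

(** The homomorphisms are the kernel of [bar0], and the annihilator of a kernel is the image of the
    transpose. *)
Lemma annihilator_hom M N (x : 'M[k]_(mdim M, mdim N)) :
  (forall f : hom N M, \tr (x *m vsval f) = 0) -> exists u, x = cocommutator u.
Proof.
move=> x0.
have ll : linfunct (fun f : 'M[k]_(mdim N, mdim M) => \tr (x *m f)).
  by move=> c f g; rewrite mulmxDr -scalemxAr linearP.
have [f f0|l' [ll' lE]] := functional_factor (A := bar0 N M) ll.
  have fh : f \in homsp N M by rewrite memv_ker f0.
  exact: (x0 (Subvs fh)).
have [u uE] := homH_functional ll'; exists u; apply/eqP; rewrite -subr_eq0; apply/eqP.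
by apply: tr_nondeg => f; rewrite mulmxBl raddfB /= lE uE tr_cocommutator subrr.
Qed.

(** The inner derivations are the image of [bar0], which consists of the cochains annihilated by the
    kernel of the transpose; otherwise a functional would separate [d] from the image. *)
Lemma annihilator_inner M N (d : 'Hom(H, 'M[k]_(mdim N, mdim M))) :
  (forall u : 'I_n -> 'M[k]_(mdim M, mdim N), cocommutator u = 0 ->
     \sum_j \tr (u j *m d (hbase j)) = 0) ->
  exists f, d = bar0 N M f.
Proof.
move=> d0; case: (boolP (d \in limg (bar0 N M))) => [/memv_imgP[f _ ->]|]; first by exists f.
move=> /separating_functional[l [ll lU]]; have [u uE] := homH_functional ll.
rewrite uE d0 ?eqxx//; apply: tr_nondeg => f.
by rewrite tr_cocommutator -uE lU// memv_img// memvf.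
Qed.

Lemma derivationP M N (d : 'Hom(H, 'M[k]_(mdim N, mdim M))) : d \in lker (bar1 N M) <->
  forall a b, d (a * b) = mact N a *m d b + d a *m mact M b.
Proof.
rewrite memv_ker; split=> [/eqP d0 a b|dab].
  have := bar1E d a b; rewrite d0 !zero_lfunE => /eqP.
  rewrite eq_sym addrAC subr_eq0 => /eqP ->; done.
apply/eqP/lfunP => a; apply/lfunP => b.
by rewrite bar1E !zero_lfunE dab addrAC subrr.
Qed.

(** Extensions of a projective split. In coordinates for a dual basis, the derivation is that of the
    linear map v |-> sum p_i d(xi_i(v)). *)
Lemma inner_projective P M (d : 'Hom(H, 'M[k]_(mdim P, mdim M))) : projective P ->
  d \in lker (bar1 P M) -> exists f, d = bar0 P M f.
Proof.
move=> /projective_dual_basis[m [p [xi px]]] /derivationP dd.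
pose a i (v : 'rV[k]_(mdim P)) : H := projT1 (cid (reg_vec_surj (mapp (xi i) v))).
have aE i v : reg_vec (a i v) = mapp (xi i) v := projT2 (cid (reg_vec_surj (mapp (xi i) v))).
have vE v : v = \sum_i p i *m mact P (a i v) by apply: px => i; rewrite aE.
have al i c u v : a i (c *: u + v) = c *: a i u + a i v.
  by apply: reg_vec_inj; rewrite reg_vec_lin !aE mapp_linr.
have aa i v b : a i (v *m mact P b) = a i v * b.
  by apply: reg_vec_inj; rewrite aE mapp_act -aE reg_vec_act.
have [|f fE] := @mx_fun_exists k (mdim P) (mdim M) (fun v => \sum_i p i *m d (a i v)).
  move=> c u v; rewrite scaler_sumr -big_split; apply: eq_bigr => i _ /=.
  by rewrite al linearP mulmxDr -scalemxAr.
exists f; apply/lfunP => b; rewrite bar0E; apply: mx_fun_eq => v.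
rewrite mulmxBr !mulmxA !fE mulmx_suml -sumrB.
rewrite {1}[v]vE mulmx_suml; apply: eq_bigr => i _.
by rewrite aa dd mulmxDr !mulmxA addrK.
Qed.
End Derivations.

(** * The bar complex of the dual of the algebra *)

Section ActionModules.
Variables (k : fieldType) (H : falgType k).

Lemma mapp_suml (X Y : modcat H) (I : Type) (s : seq I) (F : I -> hom X Y) v :
  mapp (\sum_(j <- s) F j) v = \sum_(j <- s) mapp (F j) v.
Proof.
elim: s => [|j s IH]; first by rewrite !big_nil mapp0l.
by rewrite !big_cons mappDl IH.
Qed.

Section One.
Variables (W : vectType k) (r : raction H W).

Definition mod_vec (w : W) : 'rV[k]_(mdim (mod_of r)) := v2r w.
Lemma mod_vec_surj v : exists w, mod_vec w = v.
Proof. by exists (r2v (v : 'rV[k]_(dim W)) : W); exact: r2vK. Qed.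
Lemma mod_vec_inj : injective mod_vec.
Proof. exact: v2r_inj. Qed.
Lemma mod_vec_lin c x y : mod_vec (c *: x + y) = c *: mod_vec x + mod_vec y.
Proof. by rewrite /mod_vec linearP. Qed.
Lemma mod_vec_act x a : mod_vec x *m mact (mod_of r) a = mod_vec (r x a).
Proof. exact: mod_ofE. Qed.

Lemma mod_vec0 : mod_vec 0 = 0.
Proof. by rewrite /mod_vec linear0. Qed.
Lemma mod_vecZ c x : mod_vec (c *: x) = c *: mod_vec x.
Proof. by rewrite -[c *: x]addr0 mod_vec_lin mod_vec0 addr0. Qed.

Lemma mod_vec_sum I (s : seq I) (F : I -> W) :
  mod_vec (\sum_(i <- s) F i) = \sum_(i <- s) mod_vec (F i).
Proof. by rewrite /mod_vec linear_sum. Qed.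

Lemma mod_hom_exists (N : modcat H) (f : W -> 'rV[k]_(mdim N)) :
  (forall c u v, f (c *: u + v) = c *: f u + f v) ->
  (forall w a, f (r w a) = f w *m mact N a) ->
  exists h : hom (mod_of r : modcat H) N, forall w, mapp h (mod_vec w) = f w.
Proof.
move=> fl fa.
pose s (v : 'rV[k]_(mdim (mod_of r))) : W := (r2v (v : 'rV[k]_(dim W))).
have sE w : s (mod_vec w) = w := v2rK w.
have [c u v|v a|h hE] := @hom_fun k H (mod_of r) N (fun v => f (s v)).
- have [x <-] := mod_vec_surj u; have [y <-] := mod_vec_surj v.
  by rewrite -mod_vec_lin !sE fl.
- by have [x <-] := mod_vec_surj v; rewrite mod_vec_act !sE fa.
by exists h => w; rewrite hE sE.
Qed.

Lemma mod_hom_ext (N : modcat H) (f g : hom (mod_of r : modcat H) N) :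
  (forall w, mapp f (mod_vec w) = mapp g (mod_vec w)) -> f = g.
Proof. by move=> fg; apply: hom_ext => v; have [w <-] := mod_vec_surj v. Qed.

Definition ract_end (a : H) : 'End(W) :=
  let f : {linear W -> W} := HB.pack (r^~ a)
    (GRing.isLinear.Build k W W _ (r^~ a) (ract_linl r a)) in linfun f.
Lemma ract_endE a w : ract_end a w = r w a.
Proof. exact: lfunE. Qed.
End One.

Section Two.
Variables (W W' : vectType k) (r : raction H W) (r' : raction H W').

Lemma mod_map_exists (f : W -> W') : (forall c u v, f (c *: u + v) = c *: f u + f v) ->
  (forall w a, f (r w a) = r' (f w) a) ->
  exists h : hom (mod_of r : modcat H) (mod_of r'),
    forall w, mapp h (mod_vec r w) = mod_vec r' (f w).
Proof.
move=> fl fa; apply: (@mod_hom_exists _ r (mod_of r') (fun w => mod_vec r' (f w))).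
  by move=> c u v; rewrite fl mod_vec_lin.
by move=> w a; rewrite fa mod_vec_act.
Qed.
End Two.

Section Pointwise.
Variables (W : vectType k) (r : raction H W).

Definition pointwise_fun (d : 'Hom(H, W)) (a : H) : 'Hom(H, W) := (ract_end r a \o d)%VF.
Lemma pointwise_funE d a x : pointwise_fun d a x = r (d x) a.
Proof. by rewrite comp_lfunE ract_endE. Qed.
Fact pointwise_linl a : linear (pointwise_fun^~ a).
Proof.
by move=> c d d'; apply/lfunP => x; rewrite add_lfunE scale_lfunE !pointwise_funE
  add_lfunE scale_lfunE ract_linl.
Qed.
Fact pointwise_linr d : linear (pointwise_fun d).
Proof.
by move=> c a b; apply/lfunP => x; rewrite add_lfunE scale_lfunE !pointwise_funE ract_linr.
Qed.
Fact pointwise1 d : pointwise_fun d 1 = d.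
Proof. by apply/lfunP => x; rewrite pointwise_funE ract1. Qed.
Fact pointwiseM d a b : pointwise_fun d (a * b) = pointwise_fun (pointwise_fun d a) b.
Proof. by apply/lfunP => x; rewrite !pointwise_funE ractM. Qed.
Definition pointwise : raction H 'Hom(H, W) :=
  RAction pointwise_linl pointwise_linr pointwise1 pointwiseM.
Lemma pointwiseE d a x : pointwise d a x = r (d x) a.
Proof. exact: pointwise_funE. Qed.

Lemma pointwise_in j : exists h : hom (mod_of r : modcat H) (mod_of pointwise),
  forall w, mapp h (mod_vec r w) = mod_vec pointwise (htensor (hcoord j) w).
Proof.
apply: mod_map_exists => [c u v|w a]; first exact: htensor_lin.
apply/lfunP => x; rewrite pointwiseE !htensorE.
by rewrite -!ract_endE linearZ.
Qed.

Lemma pointwise_ev j : exists h : hom (mod_of pointwise : modcat H) (mod_of r),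
  forall d, mapp h (mod_vec pointwise d) = mod_vec r (d (hbase j)).
Proof.
apply: (@mod_map_exists _ _ _ _ (fun d : 'Hom(H, W) => d (hbase j))) => [c u v|w a].
  by rewrite add_lfunE scale_lfunE.
by rewrite pointwiseE.
Qed.

(** Linear maps from [H] to [W], with [H] acting on the values, form one copy of [W] for each basis
    element of [H]; the lifts on these copies are added up. *)
Lemma pointwise_projective : projective (mod_of r : modcat H) ->
  projective (mod_of pointwise : modcat H).
Proof.
move=> rp X Y p f pe.
pose i j := projT1 (cid (pointwise_in j)).
have iE j w : mapp (i j) (mod_vec r w) = mod_vec pointwise (htensor (hcoord j) w).
  exact: (projT2 (cid (pointwise_in j))).
pose e j := projT1 (cid (pointwise_ev j)).
have eE j d : mapp (e j) (mod_vec pointwise d) = mod_vec r (d (hbase j)).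
  exact: (projT2 (cid (pointwise_ev j))).
have ex j : exists g, p \oc g = f \oc i j := rp _ _ p (f \oc i j) pe.
pose g j := projT1 (cid (ex j)).
have gE j : p \oc g j = f \oc i j := projT2 (cid (ex j)).
exists (\sum_j g j \oc e j); apply: mod_hom_ext => d.
rewrite comp_sumr mapp_suml [in RHS](htensor_sum d) mod_vec_sum mapp_sum.
apply: eq_bigr => j _.
by rewrite compA gE !mapp_comp eE iE.
Qed.
End Pointwise.
End ActionModules.

Section DualModule.
Variables (k : fieldType) (H : falgType k).
Notation DM := (dualmod H).

Lemma coord_functional (W : vectType k) (l : W -> k) : linfunct l -> forall w,
  v2r w *m (\col_i l (r2v (delta_mx 0 i))) = (l w)%:M.
Proof.
move=> ll w; apply/matrixP => i j; rewrite !ord1 [RHS]mxE mulr1n mxE.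
rewrite -[in RHS](v2rK w) [in RHS](row_sum_delta (v2r w)) linear_sum (linfunct_sum _ _ ll).
by apply: eq_bigr => s _; rewrite linearZ (linfunctZ ll) mxE.
Qed.

Definition dual_vec (phi : 'Hom(H, k^o)) : 'rV[k]_(mdim DM) := mod_vec (dual_act H) phi.
Definition eval_col (x : H) : 'cV[k]_(mdim DM) :=
  \col_i ((r2v (delta_mx 0 i : 'rV[k]_(dim 'Hom(H, k^o))) : 'Hom(H, k^o)) x : k).

Lemma dual_vec_eval phi x : dual_vec phi *m eval_col x = ((phi x : k))%:M.
Proof.
apply: (@coord_functional 'Hom(H, k^o) (fun phi => phi x)) => c f g.
by rewrite add_lfunE scale_lfunE.
Qed.

Lemma dual_eq_mx n (A B : 'M[k]_(mdim DM, n)) :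
  (forall phi, dual_vec phi *m A = dual_vec phi *m B) -> A = B.
Proof. exact: dual_mx_eq. Qed.
Lemma dual_vec_lmul a phi : dual_vec phi *m vsval (dual_lmul a) = dual_vec (dual_lmul_fun a phi).
Proof. exact: dual_lmulE. Qed.
Lemma dual_vec_act a phi : dual_vec phi *m mact DM a = dual_vec (dual_fun phi a).
Proof. exact: mod_ofE. Qed.
Lemma dual_lmul_funE a (phi : 'Hom(H, k^o)) x : dual_lmul_fun a phi x = phi (x * a).
Proof. by rewrite comp_lfunE lfunE. Qed.
Lemma dual_funE a (phi : 'Hom(H, k^o)) x : dual_fun phi a x = phi (a * x).
Proof. by rewrite comp_lfunE lfunE. Qed.
Lemma dual_vec_sum I (s : seq I) (F : I -> 'Hom(H, k^o)) :
  dual_vec (\sum_(i <- s) F i) = \sum_(i <- s) dual_vec (F i).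
Proof. exact: mod_vec_sum. Qed.
Lemma dual_vecZ c phi : dual_vec (c *: phi) = c *: dual_vec phi.
Proof. exact: mod_vecZ. Qed.
Lemma dual_lmulMvec a b : vsval (dual_lmul (a * b)) =
  vsval (dual_lmul b) *m vsval (dual_lmul a) :> 'M[k]_(mdim DM).
Proof. by rewrite dual_lmulM. Qed.
Lemma dual_lmul1vec : vsval (dual_lmul 1) = 1%:M :> 'M[k]_(mdim DM).
Proof. by rewrite dual_lmul1. Qed.
Lemma dual_lmul_linvec c a b : vsval (dual_lmul (c *: a + b)) =
  c *: vsval (dual_lmul a) + vsval (dual_lmul b) :> 'M[k]_(mdim DM).
Proof. by rewrite dual_lmul_linr. Qed.

Lemma functional_sum (phi : 'Hom(H, k^o)) : phi = \sum_j (phi (hbase j) : k) *: hcoord j.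
Proof.
apply/lfunP => x; rewrite sum_lfunE {1}[x]hbase_sum linear_sum.
apply: eq_bigr => j _; rewrite linearZ scale_lfunE /=.
exact: mulrC.
Qed.
End DualModule.

Section KernelModule.
Variables (k : fieldType) (H : falgType k) (W W' : vectType k).
Variables (r : raction H W) (r' : raction H W') (f : 'Hom(W, W')).

Definition ker_sp : vectType k := subvs_of (lker f).
Definition kval (z : ker_sp) : W := vsval z.
Lemma kval_lin c z z' : kval (c *: z + z') = c *: kval z + kval z'.
Proof. by []. Qed.
Lemma kval_inj : injective kval.
Proof. exact: subvs_inj. Qed.
Lemma kvalP z : f (kval z) = 0.
Proof. by have := subvsP z; rewrite memv_ker => /eqP. Qed.
Lemma kval_exists w : f w = 0 -> exists z, kval z = w.
Proof.
move=> fw; have wf : w \in lker f by rewrite memv_ker fw.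
by exists (Subvs wf).
Qed.

Hypothesis fr : forall w a, f (r w a) = r' (f w) a.
Lemma ker_act_exists z a : exists z', kval z' = r (kval z) a.
Proof.
apply: kval_exists; rewrite fr kvalP.
by rewrite -ract_endE linear0.
Qed.
Definition ker_act_fun z a : ker_sp := projT1 (cid (ker_act_exists z a)).
Lemma kval_act_fun z a : kval (ker_act_fun z a) = r (kval z) a.
Proof. exact: (projT2 (cid (ker_act_exists z a))). Qed.
Fact ker_act_linl a : linear (ker_act_fun^~ a).
Proof.
by move=> s c d; apply: kval_inj; rewrite kval_lin !kval_act_fun kval_lin ract_linl.
Qed.
Fact ker_act_linr c : linear (ker_act_fun c).
Proof. by move=> s a b; apply: kval_inj; rewrite kval_lin !kval_act_fun ract_linr. Qed.
Fact ker_act_1 c : ker_act_fun c 1 = c.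
Proof. by apply: kval_inj; rewrite kval_act_fun ract1. Qed.
Fact ker_act_M c a b : ker_act_fun c (a * b) = ker_act_fun (ker_act_fun c a) b.
Proof. by apply: kval_inj; rewrite !kval_act_fun ractM. Qed.
Definition ker_act : raction H ker_sp := RAction ker_act_linl ker_act_linr ker_act_1 ker_act_M.
Lemma kval_act z a : kval (ker_act z a) = r (kval z) a.
Proof. exact: kval_act_fun. Qed.

(** The image of [f] is a submodule of a projective, so the kernel is a direct summand. It is also
    kept as a concrete subspace through [kval], on which cocycles can be evaluated. *)
Lemma ker_retract : hereditary H -> projective (mod_of r' : modcat H) ->
  exists (i : hom (mod_of ker_act : modcat H) (mod_of r)) (p : hom (mod_of r : modcat H) (mod_of ker_act)),
    p \oc i = idm (mod_of ker_act : modcat H) /\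
    forall z, mapp i (mod_vec ker_act z) = mod_vec r (kval z).
Proof.
move=> hH r'p.
have [|h hE] := @mod_map_exists _ _ _ _ r r' f (linearP f).
  by move=> d a; exact: fr.
have [s [hs sE]] := kernel_splits h hH r'p.
have [|i iE] := @mod_map_exists _ _ _ _ ker_act r kval kval_lin.
  by move=> z a; exact: kval_act.
have im : mono i.
  move=> u v; have [z <-] := mod_vec_surj u; have [z' <-] := mod_vec_surj v.
  by rewrite !iE => /mod_vec_inj/kval_inj ->.
have [v|q qE] := mono_factor (f := s) im.
  have [d dE] := mod_vec_surj (mapp s v).
  have [|z zE] := @kval_exists d.
    by apply: (@mod_vec_inj _ _ _ r'); rewrite -hE dE -mapp_comp hs mapp0l mod_vec0.
  by exists (mod_vec ker_act z); rewrite iE zE.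
exists i, q; split=> //; apply: (mono_cancel im); rewrite comp1r compA qE.
apply: mod_hom_ext => z; rewrite mapp_comp iE; apply: sE.
by rewrite hE kvalP mod_vec0.
Qed.
End KernelModule.

(** * Cochains and cocycles on the dual module as projective modules *)

Section BarModules.
Variables (k : fieldType) (H : falgType k).
Implicit Types M N : modcat H.
Notation DM := (dualmod H).
Notation n := (\dim {:H}).

Lemma mact_hbase N (x : H) : mact N x = \sum_i (hcoord i x : k) *: mact N (hbase i).
Proof.
rewrite {1}[x]hbase_sum linear_sum; apply: eq_bigr => i _; exact: linearZ.
Qed.

(** Invariance of the canonical element sum phi_i (x) h_i given by dual bases: letting [a] act on
    the functionals phi_i amounts to multiplying the h_i by [a] on the right. *)
Lemma dual_lmul_act N p (A : 'M[k]_(mdim DM, p)) (x : 'M[k]_(p, mdim N)) a :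
  \sum_i dual_vec (dual_lmul_fun a (hcoord i)) *m A *m x *m mact N (hbase i) =
  (\sum_i dual_vec (hcoord i) *m A *m x *m mact N (hbase i)) *m mact N a.
Proof.
transitivity (\sum_i \sum_j (hcoord i (hbase j * a) : k) *:
    (dual_vec (hcoord j) *m A *m x *m mact N (hbase i))).
  apply: eq_bigr => i _; rewrite {1}[dual_lmul_fun _ _]functional_sum dual_vec_sum !mulmx_suml.
  by apply: eq_bigr => j _; rewrite dual_lmul_funE dual_vecZ -!scalemxAl.
rewrite exchange_big mulmx_suml; apply: eq_bigr => j _ /=.
rewrite -[RHS]mulmxA -mactM [mact N (_ * a)]mact_hbase mulmx_sumr.
by apply: eq_bigr => i _; rewrite -scalemxAr.
Qed.

(** The adjunction between homomorphisms from [N] to DH and functionals on [N]: a functional [l]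
    corresponds to the map sending v to the functional a |-> l(v a), whose value at 1 recovers
    [l]. *)
Lemma dual_hom_exists N (l : 'cV[k]_(mdim N)) : exists2 Th : hom N DM,
  vsval Th = \sum_i mact N (hbase i) *m l *m dual_vec (hcoord i) & vsval Th *m eval_col 1 = l.
Proof.
have [Th0 ThE] : exists Th : 'M[k]_(mdim N, mdim DM),
    Th = \sum_i mact N (hbase i) *m l *m dual_vec (hcoord i) by eexists.
have Thh a : mact N a *m Th0 = Th0 *m mact DM a.
  rewrite ThE mulmx_sumr mulmx_suml.
  transitivity (\sum_i \sum_j (hcoord j (a * hbase i) : k) *:
      (mact N (hbase j) *m l *m dual_vec (hcoord i))).
    apply: eq_bigr => i _; rewrite !mulmxA -mactM [mact N (a * _)]mact_hbase !mulmx_suml.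
    by apply: eq_bigr => j _; rewrite -!scalemxAl.
  rewrite exchange_big; apply: eq_bigr => j _ /=.
  rewrite -mulmxA dual_vec_act [dual_fun _ _]functional_sum dual_vec_sum mulmx_sumr.
  by apply: eq_bigr => i _; rewrite dual_funE dual_vecZ -scalemxAr.
exists (mk_modhom Thh : hom N DM); first exact: ThE.
transitivity (mact N 1 *m l); last by rewrite mact1 mul1mx.
have -> : vsval (mk_modhom Thh) = Th0 by [].
rewrite ThE [mact N 1]mact_hbase !mulmx_suml; apply: eq_bigr => i _.
rewrite -[LHS]mulmxA [_ *m eval_col 1]dual_vec_eval mul_mx_scalar -scalemxAl; exact: erefl.
Qed.

Section OneModule.
Variable M : modcat H.
Notation Wm := 'M[k]_(mdim DM, mdim M).

Definition bar_act0_fun (c : Wm) (a : H) : Wm := vsval (dual_lmul a) *m c.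
Fact bar_act0_linl a : linear (bar_act0_fun^~ a).
Proof. by move=> s c d; rewrite /bar_act0_fun mulmxDr -scalemxAr. Qed.
Fact bar_act0_linr c : linear (bar_act0_fun c).
Proof. by move=> s a b; rewrite /bar_act0_fun dual_lmul_linvec mulmxDl -scalemxAl. Qed.
Fact bar_act0_1 c : bar_act0_fun c 1 = c.
Proof. by rewrite /bar_act0_fun dual_lmul1vec mul1mx. Qed.
Fact bar_act0_M c a b : bar_act0_fun c (a * b) = bar_act0_fun (bar_act0_fun c a) b.
Proof. by rewrite /bar_act0_fun dual_lmulMvec mulmxA. Qed.
(* Hom_k(DH, M) is isomorphic to M (x)_k H. *)
Definition bar_act0 : raction H Wm :=
  RAction bar_act0_linl bar_act0_linr bar_act0_1 bar_act0_M.
Lemma bar_act0E c a : bar_act0 c a = vsval (dual_lmul a) *m c. Proof. by []. Qed.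
Definition bar_mod0 : modcat H := mod_of bar_act0.

(* m (x) 1 *)
Definition bar_elt (m : 'rV[k]_(mdim M)) : Wm := eval_col 1 *m m.

Lemma bar_elt_vec phi m : dual_vec phi *m bar_elt m = (phi 1 : k) *: m.
Proof. by rewrite mulmxA dual_vec_eval mul_scalar_mx. Qed.

Lemma bar_elt_act m a phi : dual_vec phi *m bar_act0 (bar_elt m) a = (phi a : k) *: m.
Proof. by rewrite mulmxA dual_vec_lmul bar_elt_vec dual_lmul_funE mul1r. Qed.

Lemma bar_elt_lin s m m' : bar_elt (s *: m + m') = s *: bar_elt m + bar_elt m'.
Proof. by rewrite /bar_elt mulmxDr -scalemxAr. Qed.

Lemma bar_elt_sum (c : Wm) : c = \sum_i bar_act0 (bar_elt (dual_vec (hcoord i) *m c)) (hbase i).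
Proof.
apply: dual_eq_mx => phi; rewrite mulmx_sumr {1}[phi]functional_sum dual_vec_sum mulmx_suml.
by apply: eq_bigr => i _; rewrite bar_elt_act dual_vecZ -scalemxAl.
Qed.

Section Maps.
Variable N : modcat H.

(** The [H]-linear extension of [x] from [M] to M (x) H, written in dual bases: [c] corresponds to
    the sum of the phi_i(c) (x) h_i. *)
Definition bar_fun0 (x : 'M[k]_(mdim M, mdim N)) (c : Wm) : 'rV[k]_(mdim N) :=
  \sum_i dual_vec (hcoord i) *m c *m x *m mact N (hbase i).

Lemma bar_fun0_lin x s c d : bar_fun0 x (s *: c + d) = s *: bar_fun0 x c + bar_fun0 x d.
Proof.
rewrite /bar_fun0 scaler_sumr -big_split; apply: eq_bigr => i _ /=.
by rewrite mulmxDr -scalemxAr !mulmxDl -!scalemxAl.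
Qed.

Lemma bar_fun0_act x c a : bar_fun0 x (bar_act0 c a) = bar_fun0 x c *m mact N a.
Proof.
rewrite -dual_lmul_act; apply: eq_bigr => i _.
by rewrite bar_act0E mulmxA dual_vec_lmul.
Qed.

Lemma bar_fun0_elt x m : bar_fun0 x (bar_elt m) = m *m x.
Proof.
transitivity (m *m x *m mact N 1); last by rewrite mact1 mulmx1.
rewrite [mact N 1]mact_hbase mulmx_sumr; apply: eq_bigr => i _.
by rewrite bar_elt_vec -!scalemxAl -scalemxAr.
Qed.

Lemma bar_hom0_exists x : exists h : hom bar_mod0 N, forall c, mapp h (mod_vec bar_act0 c) = bar_fun0 x c.
Proof. by apply: mod_hom_exists => [s c d|c a]; [exact: bar_fun0_lin|exact: bar_fun0_act]. Qed.

(** A homomorphism on the free module M (x) H is determined by its restriction to M (x) 1, which is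
    an arbitrary matrix; liftings can thus be done on matrices. *)
Lemma bar_hom0_fun (h : hom bar_mod0 N) :
  exists x, forall c, mapp h (mod_vec bar_act0 c) = bar_fun0 x c.
Proof.
have [s m m'|x xE] := @mx_fun_exists k _ _ (fun m => mapp h (mod_vec bar_act0 (bar_elt m))).
  by rewrite bar_elt_lin mod_vec_lin mapp_linr.
exists x => c; rewrite {1}[c]bar_elt_sum mod_vec_sum mapp_sum.
by apply: eq_bigr => i _; rewrite -mod_vec_act mapp_act -xE.
Qed.
End Maps.

Lemma epi_mx_lift (X Y : modcat H) (p : hom X Y) m (y : 'M[k]_(m, mdim Y)) : epi p ->
  exists x, x *m vsval p = y.
Proof.
move=> pe; exists (\matrix_i projT1 (cid (pe (row i y)))).
apply/row_matrixP => i; rewrite row_mul rowK.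
exact: (projT2 (cid (pe (row i y)))).
Qed.

Lemma bar_mod0_projective : projective bar_mod0.
Proof.
move=> X Y p f pe; have [y yE] := bar_hom0_fun f.
have [x xy] := epi_mx_lift y pe; have [g gE] := bar_hom0_exists x.
exists g; apply: mod_hom_ext => c; rewrite mapp_comp gE yE /bar_fun0 mapp_sum.
by apply: eq_bigr => i _; rewrite mapp_act /mapp -xy !mulmxA.
Qed.

Notation Z1 := (lker (bar1 DM M)).

Definition bar_act1 : raction H 'Hom(H, Wm) := pointwise bar_act0.

Lemma bar_act1_cochain d a : bar_act1 d a = ext1_cochain (dual_lmul a) (idm M) d.
Proof.
by apply/lfunP => x; rewrite ext1_cochainE [vsval (idm M)]/(1%:M) mulmx1 pointwiseE.
Qed.

Definition bar_act2 : raction H 'Hom(H, 'Hom(H, Wm)) := pointwise bar_act1.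

Lemma bar1_act d a : bar1 DM M (bar_act1 d a) = bar_act2 (bar1 DM M d) a.
Proof.
apply/lfunP => x; apply/lfunP => y; rewrite bar1E !pointwiseE bar1E.
rewrite !bar_act0E mulmxDr mulmxBr; congr (_ + _); last by rewrite mulmxA.
by congr (_ - _); rewrite !mulmxA (modhomP (dual_lmul a)).
Qed.

Definition bar_Z1 := ker_sp (bar1 DM M).
Definition bar_actZ : raction H bar_Z1 := ker_act bar1_act.
Definition bar_modZ : modcat H := mod_of bar_actZ.

Lemma bar_actZE (z : bar_Z1) a x : kval (bar_actZ z a) x = bar_act0 (kval z x) a.
Proof. by rewrite kval_act pointwiseE. Qed.

Lemma bar_mod2_projective : projective (mod_of bar_act2 : modcat H).
Proof. by do 2!apply: pointwise_projective; exact: bar_mod0_projective. Qed.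

Lemma bar_modZ_retract : hereditary H ->
  exists (i : hom bar_modZ (mod_of bar_act1 : modcat H)) (r : hom (mod_of bar_act1 : modcat H) bar_modZ),
    r \oc i = idm bar_modZ /\
    forall z, mapp i (mod_vec bar_actZ z) = mod_vec bar_act1 (kval z).
Proof. move=> hH; exact: ker_retract hH bar_mod2_projective. Qed.

Lemma bar_modZ_projective : hereditary H -> projective bar_modZ.
Proof.
move=> hH; have [i [r [ri _]]] := bar_modZ_retract hH; apply: (retract_projective ri).
by apply: pointwise_projective; exact: bar_mod0_projective.
Qed.

Section MapsZ.
Variable N : modcat H.
Implicit Types u : 'I_n -> 'M[k]_(mdim M, mdim N).

Definition bar_fun1 u (z : 'Hom(H, Wm)) : 'rV[k]_(mdim N) := \sum_j bar_fun0 (u j) (z (hbase j)).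

Lemma bar_fun1_lin u s z z' : bar_fun1 u (s *: z + z') = s *: bar_fun1 u z + bar_fun1 u z'.
Proof.
rewrite /bar_fun1 scaler_sumr -big_split; apply: eq_bigr => j _ /=.
by rewrite add_lfunE scale_lfunE bar_fun0_lin.
Qed.

Lemma bar_homZ_exists u : exists h : hom bar_modZ N,
  forall z, mapp h (mod_vec bar_actZ z) = bar_fun1 u (kval z).
Proof.
apply: (@mod_hom_exists _ _ _ _ N (fun z => bar_fun1 u (kval z))) => [s z z'|z a].
  by rewrite kval_lin bar_fun1_lin.
rewrite /bar_fun1 mulmx_suml; apply: eq_bigr => j _.
by rewrite bar_actZE bar_fun0_act.
Qed.

(** The cocycles are a direct summand of all 1-cochains, so [h] extends to the cochains, which are
    sums of copies of M (x) H; each copy contributes one matrix. *)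
Lemma bar_homZ_fun (h : hom bar_modZ N) : hereditary H ->
  exists u, forall z, mapp h (mod_vec bar_actZ z) = bar_fun1 u (kval z).
Proof.
move=> hH; have [i [r [ri iE]]] := bar_modZ_retract hH.
pose inj j := projT1 (cid (pointwise_in bar_act0 j)).
have injE j w : mapp (inj j) (mod_vec bar_act0 w) = mod_vec bar_act1 (htensor (hcoord j) w).
  exact: (projT2 (cid (pointwise_in bar_act0 j))).
have ex j := bar_hom0_fun (h \oc r \oc inj j).
exists (fun j => projT1 (cid (ex j))) => z.
have -> v : mapp h v = mapp (h \oc r) (mapp i v).
  by rewrite -mapp_comp -compA ri comp1r.
rewrite iE {1}[kval z]htensor_sum mod_vec_sum mapp_sum.
apply: eq_bigr => j _; rewrite -injE -mapp_comp.
exact: (projT2 (cid (ex j))).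
Qed.

(** The link between the two descriptions: restricting a map on cocycles along C^0 -> Z^1 takes the
    cocommutator of its matrices. Homotopies of maps out of the bar complex are thereby
    cocommutators. *)
Lemma bar_fun1_bar0 u m : bar_fun1 u (bar0 DM M (bar_elt m)) = m *m cocommutator u.
Proof.
rewrite /cocommutator mulmx_sumr; apply: eq_bigr => j _.
have step phi : dual_vec phi *m bar0 DM M (bar_elt m) (hbase j) =
    (phi (hbase j) : k) *: m - (phi 1 : k) *: (m *m mact M (hbase j)).
  rewrite bar0E mulmxBr [X in _ - X]mulmxA bar_elt_vec -scalemxAl; congr (_ - _).
  by rewrite mulmxA dual_vec_act bar_elt_vec dual_funE mulr1.
transitivity (m *m u j *m mact N (hbase j) - m *m mact M (hbase j) *m u j *m mact N 1).
  rewrite [mact N (hbase j)]mact_hbase [mact N 1]mact_hbase !mulmx_sumr -sumrB.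
  apply: eq_bigr => i _; rewrite step !mulmxBl -!scalemxAl -!scalemxAr.
  by [].
by rewrite mact1 mulmx1 mulmxBr !mulmxA.
Qed.

(** A coordinate of the value at [z] is the trace pairing of [u] with a derivation: the coordinate
    functional of [N] defines a map from [N] to DH, along which the cocycle [z] is pulled back. *)
Lemma bar_fun1_annihilated u z : z \in Z1 ->
  (forall d, d \in lker (bar1 N M) -> \sum_j \tr (u j *m d (hbase j)) = 0) ->
  bar_fun1 u z = 0.
Proof.
move=> zZ u0; apply/rowP => s; rewrite [RHS]mxE.
pose l : 'cV[k]_(mdim N) := delta_mx s 0.
have -> : bar_fun1 u z 0 s = \tr (bar_fun1 u z *m l).
  by rewrite /mxtrace big_ord1 -colE mxE.
have [Th ThE _] := dual_hom_exists l.
have := u0 _ (ext1_cochain_ker Th (idm M) zZ) => <-.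
rewrite mulmx_suml raddf_sum /=; apply: eq_bigr => j _.
rewrite ext1_cochainE [vsval (idm M)]/(1%:M) mulmx1 ThE.
rewrite mulmx_suml mulmx_suml mulmx_sumr !raddf_sum /=; apply: eq_bigr => i _.
transitivity (\tr ((dual_vec (hcoord i) *m z (hbase j)) *m (u j *m (mact N (hbase i) *m l)))).
  by rewrite !mulmxA.
by rewrite mxtrace_mulC !mulmxA.
Qed.

Lemma bar_fun1_comp N' (f : hom N N') u z : mapp f (bar_fun1 u z) =
  \sum_j \sum_i dual_vec (hcoord i) *m z (hbase j) *m (u j *m vsval f) *m mact N' (hbase i).
Proof.
rewrite mapp_sum; apply: eq_bigr => j _; rewrite mapp_sum; apply: eq_bigr => i _.
by rewrite mapp_act /mapp !mulmxA.
Qed.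
End MapsZ.
End OneModule.
End BarModules.

Section BarPresentation.
Variables (k : fieldType) (H : falgType k).
Implicit Types M N : modcat H.
Notation DM := (dualmod H).

Lemma kval_ker (W W' : vectType k) (f : 'Hom(W, W')) (z : ker_sp f) : kval z \in lker f.
Proof. by rewrite memv_ker kvalP. Qed.

Lemma qcls_eq0_mem (V : vectType k) (Z B : {vspace V}) v : v \in Z -> qcls Z B v = 0 -> v \in B.
Proof. by move=> vZ v0; have := qcls_sub B vZ; rewrite v0 [vsval 0]linear0 subr0. Qed.

Section Coker.
Variable M : modcat H.
Notation Wm := 'M[k]_(mdim DM, mdim M).
Notation cls := (qcls (lker (bar1 DM M)) (limg (bar0 DM M))).

Lemma bar_iota_exists : exists h : hom (bar_mod0 M) (bar_modZ M),
  forall c z, kval z = bar0 DM M c ->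
    mapp h (mod_vec (bar_act0 M) c) = mod_vec (bar_actZ M) z.
Proof.
have ex c : exists z : bar_Z1 M, kval z = bar0 DM M c.
  apply: kval_exists; apply/eqP; rewrite -memv_ker.
  by apply: (subvP (bar1_bar0 DM M)); rewrite memv_img// memvf.
pose f c := projT1 (cid (ex c)).
have fE c : kval (f c) = bar0 DM M c := projT2 (cid (ex c)).
have [c u v|c a|h hE] := @mod_map_exists _ _ _ _ (bar_act0 M) (bar_actZ M) f.
- by apply: kval_inj; rewrite kval_lin !fE linearP.
- apply: kval_inj; rewrite kval_act !fE; apply/lfunP => x.
  by rewrite pointwiseE !bar0E !bar_act0E mulmxBr !mulmxA (modhomP (dual_lmul a)).
exists h => c z zE; rewrite hE; congr mod_vec.
by apply: kval_inj; rewrite fE zE.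
Qed.
Definition bar_iota : hom (bar_mod0 M) (bar_modZ M) := projT1 (cid bar_iota_exists).
Lemma bar_iotaE c z : kval z = bar0 DM M c ->
  mapp bar_iota (mod_vec (bar_act0 M) c) = mod_vec (bar_actZ M) z.
Proof. exact: (projT2 (cid bar_iota_exists)). Qed.
Lemma bar_iota_val c : exists z, kval z = bar0 DM M c /\
  mapp bar_iota (mod_vec (bar_act0 M) c) = mod_vec (bar_actZ M) z.
Proof.
have [z zE] := mod_vec_surj (mapp bar_iota (mod_vec (bar_act0 M) c)).
have ex : exists z : bar_Z1 M, kval z = bar0 DM M c.
  apply: kval_exists; apply/eqP; rewrite -memv_ker.
  by apply: (subvP (bar1_bar0 DM M)); rewrite memv_img// memvf.
by have [y yE] := ex; exists y; split=> //; exact: bar_iotaE.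
Qed.

Lemma tau_inv_act_cls a z : z \in lker (bar1 DM M) ->
  tau_inv_act M (cls z) a = cls (ext1_cochain (dual_lmul a) (idm M) z).
Proof. exact: ext1_map_cls. Qed.

Lemma bar_pi_exists : exists h : hom (bar_modZ M) (tau_inv H M),
  forall z, mapp h (mod_vec (bar_actZ M) z) = mod_vec (tau_inv_act M) (cls (kval z)).
Proof.
apply: (@mod_map_exists _ _ _ _ (bar_actZ M) (tau_inv_act M) (fun z => cls (kval z))) => [c u v|z a].
  by rewrite kval_lin linearP.
by rewrite kval_act tau_inv_act_cls ?kval_ker// bar_act1_cochain.
Qed.
Definition bar_pi : hom (bar_modZ M) (tau_inv H M) := projT1 (cid bar_pi_exists).
Lemma bar_piE z : mapp bar_pi (mod_vec (bar_actZ M) z) = mod_vec (tau_inv_act M) (cls (kval z)).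
Proof. exact: (projT2 (cid bar_pi_exists)). Qed.

Lemma bar_pi_epi : epi bar_pi.
Proof.
move=> v; have [x <-] := mod_vec_surj (r := tau_inv_act M) v.
have [|z zE] := @kval_exists _ _ _ (bar1 DM M) (vsval x).
  by apply/eqP; rewrite -memv_ker; exact: memv_quot.
by exists (mod_vec (bar_actZ M) z); rewrite bar_piE zE qclsK.
Qed.

Lemma bar_pi_ker v : mapp bar_pi v = 0 <-> exists w, mapp bar_iota w = v.
Proof.
have [z <-] := mod_vec_surj (r := bar_actZ M) v; rewrite bar_piE; split=> [z0|[w]].
  have c0 : cls (kval z) = 0.
    by apply: (@mod_vec_inj _ _ _ (tau_inv_act M)); rewrite z0 mod_vec0.
  have := qcls_eq0_mem (kval_ker z) c0.
  move=> /memv_imgP[c _ zE]; exists (mod_vec (bar_act0 M) c); exact: bar_iotaE.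
have [c <-] := mod_vec_surj (r := bar_act0 M) w.
have [y [yE ->]] := bar_iota_val c; move=> /mod_vec_inj <-.
by rewrite yE qcls_eq0 ?mod_vec0// memv_img// memvf.
Qed.
End Coker.

Section Functoriality.
Variables (M M' : modcat H) (w : hom M M').
Notation cls M := (qcls (lker (bar1 DM M)) (limg (bar0 DM M))).

Lemma bar_map0_exists : exists h : hom (bar_mod0 M) (bar_mod0 M'),
  forall c, mapp h (mod_vec (bar_act0 M) c) = mod_vec (bar_act0 M') (c *m vsval w).
Proof.
apply: (@mod_map_exists _ _ _ _ (bar_act0 M) (bar_act0 M') (fun c => c *m vsval w)) => [c u v|c a].
  by rewrite mulmxDl -scalemxAl.
by rewrite !bar_act0E mulmxA.
Qed.
Definition bar_map0 : hom (bar_mod0 M) (bar_mod0 M') := projT1 (cid bar_map0_exists).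
Lemma bar_map0E c : mapp bar_map0 (mod_vec (bar_act0 M) c) = mod_vec (bar_act0 M') (c *m vsval w).
Proof. exact: (projT2 (cid bar_map0_exists)). Qed.

Lemma bar_mapZ_exists : exists h : hom (bar_modZ M) (bar_modZ M'),
  forall z z', kval z' = ext1_cochain (idm DM) w (kval z) ->
    mapp h (mod_vec (bar_actZ M) z) = mod_vec (bar_actZ M') z'.
Proof.
have ex (z : bar_Z1 M) : exists z' : bar_Z1 M', kval z' = ext1_cochain (idm DM) w (kval z).
  by apply: kval_exists; apply/eqP; rewrite -memv_ker ext1_cochain_ker// kval_ker.
pose f c := projT1 (cid (ex c)).
have fE c : kval (f c) = ext1_cochain (idm DM) w (kval c) := projT2 (cid (ex c)).
have [c u v|c a|h hE] := @mod_map_exists _ _ _ _ (bar_actZ M) (bar_actZ M') f.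
- apply: kval_inj; rewrite kval_lin !fE kval_lin; exact: ext1_cochain_linear.
- apply: kval_inj; rewrite fE; apply/lfunP => x.
  rewrite bar_actZE fE !ext1_cochainE bar_actZE !bar_act0E [vsval (idm DM)]/(1%:M).
  by rewrite !mul1mx mulmxA.
exists h => z z' zE; rewrite hE; congr mod_vec.
by apply: kval_inj; rewrite fE zE.
Qed.
Definition bar_mapZ : hom (bar_modZ M) (bar_modZ M') := projT1 (cid bar_mapZ_exists).
Lemma bar_mapZE z : exists z', kval z' = ext1_cochain (idm DM) w (kval z) /\
  mapp bar_mapZ (mod_vec (bar_actZ M) z) = mod_vec (bar_actZ M') z'.
Proof.
have [z' zE] : exists z' : bar_Z1 M', kval z' = ext1_cochain (idm DM) w (kval z).
  by apply: kval_exists; apply/eqP; rewrite -memv_ker ext1_cochain_ker// kval_ker.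
by exists z'; split=> //; exact: (projT2 (cid bar_mapZ_exists)).
Qed.

Lemma bar_iota_nat : bar_mapZ \oc bar_iota M = bar_iota M' \oc bar_map0.
Proof.
apply: mod_hom_ext => c; rewrite !mapp_comp bar_map0E.
have [z [zE ->]] := bar_iota_val c; have [y [yE ->]] := bar_mapZE z.
have [x [xE ->]] := bar_iota_val (c *m vsval w); congr mod_vec.
apply: kval_inj; rewrite yE xE zE; apply/lfunP => a.
rewrite ext1_cochainE !bar0E [vsval (idm DM)]/(1%:M) mul1mx mulmxBl !mulmxA.
by congr (_ - _); rewrite -!mulmxA (modhomP w).
Qed.

Lemma bar_pi_nat : bar_pi M' \oc bar_mapZ = fmap (tau_inv H) w \oc bar_pi M.
Proof.
apply: mod_hom_ext => z; rewrite !mapp_comp bar_piE.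
have [y [yE ->]] := bar_mapZE z; rewrite bar_piE yE.
rewrite [RHS]tau_inv_mapE; congr v2r.
by rewrite ext1_map_cls// kval_ker.
Qed.
End Functoriality.
End BarPresentation.

(** * Serre pairs in the derived category *)

Section SerreModules.
Variables (k : fieldType).

(* If e is an idempotent of F and (F, I) is a Serre pair, then the idempotent of I
   corresponding to e cuts out the partner of the image of e. *)
Lemma serre_pair_retract (C : lincat k) (P F I : C) (i : hom P F) (r : hom F P) (t : hom F I -> k) :
  (forall X Y : C, findim (hom X Y)) ->
  (forall (X : C) (e : hom X X), e \oc e = e ->
     exists (Y : C) (j : hom Y X) (q : hom X Y), q \oc j = idm Y /\ j \oc q = e) ->
  r \oc i = idm P -> serre_pair t -> exists (J : C) (t' : hom P J -> k), serre_pair t'.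
Proof.
move=> fd split_idem ri tS; have [tl nd] := tS.
have re : i \oc r \oc (i \oc r) = i \oc r by rewrite -compA (compA r) ri comp1l.
have [|e eE] := serre_reprl fd (X := I) (l := fun g => t (g \oc (i \oc r))) tS.
  by move=> c g g'; rewrite comp_linl tl.
have ee : e \oc e = e.
  apply/eqP; rewrite -subr_eq0; apply/eqP/(nd I).1 => g.
  rewrite compDl compNl (linfunctD tl) (linfunctN tl) -compA -!eE -compA.
  rewrite -(eE (g \oc (i \oc r))) -compA re; exact: subrr.
have [J [j [q [qj jq]]]] := split_idem I e ee.
have ej : e \oc j = j by rewrite -jq -compA qj comp1r.
have qe : q \oc e = q by rewrite -jq compA qj comp1l.
exists J, (fun x => t (j \oc x \oc r)); split=> [c x y|X].
  by rewrite comp_linr comp_linl tl.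
split=> [f f0|g g0].
- suff jf : j \oc f = 0 by rewrite -[f]comp1l -qj -compA jf comp0r.
  apply: (nd X).1 => g; rewrite -ej -!compA -eE.
  by have := f0 (g \oc i); rewrite !compA.
- suff gr : g \oc r = 0 by rewrite -[g]comp1r -ri compA gr comp0l.
  apply: (nd X).2 => f; have := g0 (q \oc f); rewrite !compA jq => <-.
  rewrite -!compA -eE -!compA; congr (t (f \oc (g \oc _))).
  by rewrite compA ri comp1l.
Qed.

Variable H : falgType k.
Implicit Types M N P Q : modcat H.
Notation R := (regmod H).
Notation DM := (dualmod H).

Lemma modcat_findim M N : findim (hom M N).
Proof. exact: findim_vect. Qed.

Lemma modcat_split_idempotent M (e : hom M M) : e \oc e = e ->
  exists N (j : hom N M) (q : hom M N), q \oc j = idm N /\ j \oc q = e.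
Proof.
move=> ee; have [N [j [q [jm qe jq]]]] := image_exists e; exists N, j, q; split=> //.
apply: (mono_cancel jm); apply: (epi_cancel qe).
by rewrite comp1r compA jq -compA jq ee.
Qed.

Lemma dual_act_eval a : mact DM a *m eval_col 1 = eval_col a :> 'cV[k]_(mdim DM).
Proof.
by apply: dual_eq_mx => phi; rewrite mulmxA dual_vec_act !dual_vec_eval dual_funE mulr1.
Qed.

(** The trace evaluates f(1) at 1. Under Hom(H, X) = X and Hom(X, DH) = DX the pairing becomes
    evaluation of functionals on vectors. *)
Lemma regmod_serre_pair : exists t : hom R DM -> k, serre_pair t.
Proof.
exists (fun f => (mapp f (reg_vec 1) *m eval_col 1) 0 0); split=> [c f g|X].
  by rewrite mapp_linl mulmxDl -scalemxAl !mxE.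
split=> [f f0|g g0].
- apply: hom_ext => v; rewrite mapp0l.
  have [phi phiE] := mod_vec_surj (r := dual_act H) (mapp f v); rewrite -phiE.
  suff -> : phi = 0 by exact: mod_vec0.
  apply/lfunP => a; rewrite zero_lfunE.
  have [g gE] := reg_hom_exists (v *m mact X a); have := f0 g.
  rewrite mapp_comp gE mact1 mulmx1 mapp_act -mulmxA dual_act_eval -phiE.
  by rewrite [_ *m _](dual_vec_eval phi a) mxE eqxx mulr1n.
- apply: reg_hom_ext; rewrite mapp0l; apply/rowP => s; rewrite [RHS]mxE.
  have [h _ hE] := dual_hom_exists (delta_mx s 0 : 'cV[k]_(mdim X)).
  by have := g0 h; rewrite mapp_comp /mapp -mulmxA hE -colE mxE.
Qed.

Lemma projective_serre_pair P : projective P -> exists I (t : hom P I -> k), serre_pair t.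
Proof.
move=> Pp; pose Phi (F : modcat H) := exists I (t : hom F I -> k), serre_pair t.
have [||F [p [[I [t tS]] pe]]] := @free_cover _ _ Phi P.
- have z0 : is_zero (zeromod H : modcat H) by exact: zeromod_homl.
  by have [t tS] := serre_pair_zero z0 z0; exists (zeromod H), t.
- move=> F [I [t tS]]; have [t1 t1S] := regmod_serre_pair.
  have s1 : is_direct_sum2 (dsum R F : modcat H) R F.
    by apply/dsum2P; exact: dsum_structure.
  have s2 : is_direct_sum2 (dsum DM I : modcat H) DM I.
    by apply/dsum2P; exact: dsum_structure.
  by have [t2 t2S] := serre_pair_sum s1 s2 t1S tS; exists (dsum DM I), t2.
- have [i pi] := Pp _ _ p (idm P) pe.
  exact: serre_pair_retract modcat_findim modcat_split_idempotent pi tS.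
Qed.

(** The map nu d, characterized by the property that composing with it is transpose to composing
    with [d]. *)
Lemma nakayama_map Q P J I (tQ : hom Q J -> k) (tP : hom P I -> k) (d : hom Q P) :
  serre_pair tQ -> serre_pair tP ->
  exists n : hom J I, forall M (w : hom P M) (h : hom M J), tP (n \oc h \oc w) = tQ (h \oc (w \oc d)).
Proof.
move=> [tl _] tPS.
have [|n nE] := serre_reprl modcat_findim (X := J) (l := fun g => tQ (g \oc d)) tPS.
  by move=> c g g'; rewrite comp_linl tl.
by exists n => M w h; rewrite -compA -nE compA.
Qed.

Lemma functional_factor_fun (V V' : vectType k) (f : V -> V') (l : V -> k) :
  (forall c u v, f (c *: u + v) = c *: f u + f v) -> linfunct l ->
  (forall v, f v = 0 -> l v = 0) ->
  exists l' : V' -> k, linfunct l' /\ forall v, l v = l' (f v).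
Proof.
move=> fl ll lf.
pose g : {linear V -> V'} := HB.pack f (GRing.isLinear.Build k V V' _ f fl).
have gE v : linfun g v = f v by rewrite lfunE.
have [v|l' [ll' lE]] := functional_factor (A := linfun g) ll; first by rewrite gE; exact: lf.
by exists l'; split=> // v; rewrite lE gE.
Qed.

(** The partner of a source object is injective in the module category: a map to [I] is a functional
    on maps from [P], and functionals extend along the injection of Hom(P, A) into Hom(P, B). *)
Lemma serre_injective P I (t : hom P I -> k) A B (i : hom A B) (b : hom A I) :
  serre_pair t -> mono i -> exists b' : hom B I, b' \oc i = b.
Proof.
move=> tS im; have [tl nd] := tS.
have [|||l' [ll' lE]] := @functional_factor_fun (modhom P A) (modhom P B)
  (fun w => (i \oc (w : hom P A)) : hom P B) (fun w => t (b \oc (w : hom P A))).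
- move=> c u v; exact: (@comp_linr _ (modcat H) _ _ _ c i u v).
- move=> c u v; apply: etrans (tl _ _ _); congr t.
  exact: (@comp_linr _ (modcat H) _ _ _ c b u v).
- move=> w iw; have w0 : (w : hom P A) = 0.
    by apply: (mono_cancel im); rewrite comp0r; exact: iw.
  by rewrite [w]w0 comp0r (linfunct0 tl).
have [b' b'E] := serre_reprl modcat_findim (X := B) (l := l') tS ll'.
exists b'; apply/eqP; rewrite -subr_eq0; apply/eqP/(nd A).1 => w.
rewrite compDl compNl (linfunctD tl) (linfunctN tl) -compA -b'E.
by rewrite -(lE w) subrr.
Qed.
End SerreModules.

Section SerreDerived.
Variables (k : fieldType) (H : falgType k).
Notation D := (dercat H).
Notation loc := (loc_functor (@quasi_iso k H)).
Hypothesis hH : hereditary H.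

Lemma nondeg_stalks (Z Y : D) (t : hom Z Y -> k) :
  (forall N j, nondeg t (reindex H j (stalk H N))) -> forall X, nondeg t X.
Proof.
move=> tN X; have [n Xn] := cbounded (X : cplx H).
apply: (@dercat_ind k H (nondeg t) (- (Posz n)) hH).
- by move=> X1 X2; exact: nondeg_iso.
- by move=> X1 X2 X3; exact: nondeg_sum.
- by move=> X1; exact: nondeg_zero.
- by move=> N j _; exact: tN.
- by move=> i lti; apply: Xn; lia.
Qed.

Lemma nondeg_hom0 (Z Y X : D) (t : hom Z Y -> k) : hom0 X Y -> hom0 Z X -> nondeg t X.
Proof. by move=> XY ZX; split=> [f _|g _]; [exact: XY|exact: ZX]. Qed.

Section TwoTerm.
Variables (Q P : modcat H) (d : hom Q P).
Hypotheses (Pp : projective P) (Qp : projective Q).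
Notation Z := (two_term d).

Lemma two_term_functional (Y : D) (l : hom (Z : cplxcat H) (Y : cplxcat H) -> k) : linfunct l ->
  (forall f, null_chain f -> l f = 0) ->
  exists t : hom Z Y -> k, linfunct t /\ forall f, t (fmap loc f) = l f.
Proof.
move=> ll l0.
pose f (phi : hom Z Y) := projT1 (cid (loc_two_term_full Pp Qp phi)).
have fE phi : phi = fmap loc (f phi) := projT2 (cid (loc_two_term_full Pp Qp phi)).
have lf g phi : phi = fmap loc g -> l (f phi) = l g.
  move=> phiE; apply/eqP; rewrite -subr_eq0 -(linfunctN ll) -(linfunctD ll); apply/eqP/l0.
  apply/(loc_two_term_eq0 Pp Qp); rewrite fmapD fmapN -fE phiE; exact: subrr.
exists (fun phi => l (f phi)); split=> [c x y|g]; last exact: lf.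
rewrite -ll; apply: lf; rewrite fmap_lin -!fE; exact: erefl.
Qed.

Section IntoResolution.
Variables (Q' P' M : modcat H) (d' : hom Q' P') (p' : hom P' M).
Hypothesis res : short_resolution d' p'.
Notation W := (two_term d').

Lemma res_zero : p' \oc d' = 0.
Proof.
have [_ _ _ _ ex] := res; apply: hom_ext => v; rewrite mapp_comp mapp0l.
by apply/ex; exists v.
Qed.

Lemma res_factor_ker A (f : hom A P') : p' \oc f = 0 -> exists g : hom A Q', d' \oc g = f.
Proof.
have [_ _ _ dm ex] := res; move=> pf; apply: mono_factor => // v.
by apply/ex; rewrite -mapp_comp pf mapp0l.
Qed.

Lemma res_factor_coker A (f : hom P' A) : f \oc d' = 0 -> exists g : hom M A, g \oc p' = f.
Proof.
have [_ _ pe _ ex] := res; move=> fd; apply: epi_factor => // v /ex[w <-].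
by rewrite -mapp_comp fd mapp0l.
Qed.

(** With [chain_into_exists], this describes the maps from [Z] to the module [M] as the maps from
    [P] to [M] that vanish on [d]. *)
Lemma chain_into_null (g : hom (Z : cplxcat H) (W : cplxcat H)) :
  p' \oc sval g 0 = 0 -> null_chain g.
Proof.
have [_ _ _ dm _] := res; move=> /res_factor_ker[s sE]; exists s, 0; split; first exact: esym sE.
rewrite comp0r addr0; apply: (mono_cancel dm); rewrite compA.
apply: etrans (two_term_boundary g) _; congr (_ \oc d); exact: esym sE.
Qed.

Lemma chain_into_of_map (a : hom P P') : p' \oc a \oc d = 0 ->
  exists g : hom (Z : cplxcat H) (W : cplxcat H), sval g 0 = a.
Proof.
move=> pad; have [|b bE] := @res_factor_ker _ (a \oc d); first by rewrite compA.
have c0 : dif0 (W : cplxcat H) \oc (a : hom P ((W : cplxcat H) 0)) = 0 by exact: zeromod_homr.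
by exists (@two_term_chain _ _ _ _ d (W : cplxcat H) a b c0 bE).
Qed.

Lemma chain_into_exists (w : hom P M) : w \oc d = 0 ->
  exists g : hom (Z : cplxcat H) (W : cplxcat H), p' \oc sval g 0 = w.
Proof.
have [_ _ pe _ _] := res; move=> wd; have [a aE] := Pp w pe.
have [|g gE] := @chain_into_of_map a; first by rewrite aE.
by exists g; rewrite gE.
Qed.

(** With [chain_into_shift_exists], this describes the maps from [Z] to M[1] as the maps from [Q] to
    [M] modulo those extending along [d]. *)
Lemma chain_into_shift_null (g : hom (Z : cplxcat H) (shift_cplx (W : cplxcat H))) (w : hom P M) :
  p' \oc (sval g (Negz 0) : hom Q P') = w \oc d -> null_chain g.
Proof.
have [_ _ pe dm _] := res; move=> gw; have [s sE] := Pp w pe.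
have [|t tE] := @res_factor_ker _ ((sval g (Negz 0) : hom Q P') - s \oc d).
  by rewrite compDr compNr gw compA sE subrr.
exists s, (- t); split; first exact: zeromod_homr.
have -> : dif2 (shift_cplx (W : cplxcat H)) = - d' by [].
rewrite compNl compNr opprK; apply/esym; apply: etrans (congr1 (+%R (s \oc d)) tE) _.
by rewrite addrC subrK.
Qed.

Lemma chain_into_shift_exists (b : hom Q P') :
  exists g : hom (Z : cplxcat H) (shift_cplx (W : cplxcat H)), sval g (Negz 0) = b.
Proof.
pose Y := shift_cplx (W : cplxcat H).
have c0 : dif0 Y \oc (0 : hom P (Y 0)) = 0 by exact: comp0r.
have c1 : dif1 Y \oc (b : hom Q (Y (Negz 0))) = (0 : hom P (Y 0)) \oc d by exact: zeromod_homr.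
by exists (two_term_chain c0 c1).
Qed.

Lemma two_term_reindex_hom0 j : j != 0 -> j != 1 -> hom0 Z (reindex H j (stalk H M)).
Proof.
move=> j0 j1; apply: two_term_hom0 => //.
  by apply: (@stalk_ob0 _ _ M (0 + j)); rewrite add0r.
by left; apply: (@stalk_ob0 _ _ M (Negz 0 + j)); lia.
Qed.
End IntoResolution.
End TwoTerm.
End SerreDerived.

(** * The Serre partner of a two-term complex of projectives *)

Section SerrePairs.
Variables (k : fieldType) (H : falgType k).
Notation D := (dercat H).
Notation loc := (loc_functor (@quasi_iso k H)).
Hypothesis hH : hereditary H.

Lemma shift_loc_map (X Y : cplxcat H) (f : hom X Y) :
  fmap (shift H) (fmap loc f) = fmap loc (fmap (shift_cplxcat H) f).
Proof. exact: loc_liftE. Qed.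

Lemma shift_two_term_full (Q P : modcat H) (d : hom Q P) (Y : cplxcat H)
    (phi : hom (shift H (two_term d)) (shift H (Y : D))) : projective P -> projective Q ->
  exists f : hom (two_term d : cplxcat H) Y, phi = fmap loc (fmap (shift_cplxcat H) f).
Proof.
move=> Pp Qp; have [psi psiE] := @shift_full _ H _ _ phi.
have [f fE] := loc_two_term_full Pp Qp psi.
by exists f; rewrite -shift_loc_map -fE psiE.
Qed.

Section CoTwoTerm.
Variables (J I : modcat H) (n : hom J I).
(** Placed in degrees 0 and 1, so that the partner, of the form X[1] as Serre pairs require, has [J]
    in degree -1, [I] in degree 0 and differential [- n]. *)
Definition cotwo_term_ob (i : int) : modcat H :=
  match i with Posz 0 => J | Posz 1 => I | _ => zeromod H end.
Definition cotwo_term_diff (i : int) : hom (cotwo_term_ob i) (cotwo_term_ob (i + 1)) :=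
  match i return hom (cotwo_term_ob i) (cotwo_term_ob (i + 1)) with
  | Posz 0 => n | _ => 0 end.
Definition cotwo_term : cplxcat H.
Proof.
exists cotwo_term_ob cotwo_term_diff.
- by move=> -[[|i]|i]; [exact: comp0l|exact: comp0r|exact: comp0r].
- by exists 1%N => -[[|[|i]]|i].
Defined.
End CoTwoTerm.

Lemma reindex_two_term (Q P M : modcat H) (d : hom Q P) (p : hom P M) j : short_resolution d p ->
  isomorphic (reindex H j (two_term d)) (reindex H j (stalk H M)).
Proof. by move=> /resolution_isomorphic; exact: fmap_isomorphic. Qed.

Lemma shift_two_term (Q P M : modcat H) (d : hom Q P) (p : hom P M) : short_resolution d p ->
  isomorphic (shift H (two_term d)) (reindex H 1 (stalk H M)).
Proof.
move=> dp; apply: isomorphic_trans (shift_reindex_iso _) _.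
exact: reindex_two_term dp.
Qed.

Lemma two_term_extension_hom0 (Q P : modcat H) (d : hom Q P) (Y : cplxcat H) :
  projective P -> projective Q -> mdim (Y 0) = 0%N ->
  (forall b : hom Q (Y (Negz 0)), exists s : hom P (Y (Negz 0)), s \oc d = b) ->
  hom0 (two_term d : D) (Y : D).
Proof.
move=> Pp Qp Y0 ext phi; have [f fE] := loc_two_term_full Pp Qp phi; rewrite fE.
apply/(loc_two_term_eq0 Pp Qp); have [s sE] := ext (sval f (Negz 0)).
exists s, 0; rewrite comp0r addr0; split; first exact: mdim0_homr.
exact: esym sE.
Qed.

Section NakayamaPair.
Variables (Q P : modcat H) (d : hom Q P) (J I : modcat H) (n : hom J I).
Variables (tQ : hom Q J -> k) (tP : hom P I -> k).
Hypotheses (Pp : projective P) (Qp : projective Q).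
Hypotheses (tQS : serre_pair tQ) (tPS : serre_pair tP).
Hypothesis nE : forall M (w : hom P M) (h : hom M J),
  tP (n \oc h \oc w) = tQ (h \oc (w \oc d)).
Notation Z := (two_term d).
Notation Y := (shift_cplx (cotwo_term n)).

Definition nakayama_trace (f : hom (Z : cplxcat H) Y) : k :=
  tP (sval f 0 : hom P I) + tQ (sval f (Negz 0) : hom Q J).

Lemma nakayama_trace_linfunct : linfunct nakayama_trace.
Proof.
by move=> c f g; rewrite /nakayama_trace !sval_lin tPS.1 tQS.1 mulrDr addrACA.
Qed.

(** The sign of the shifted differential makes the contributions - tP(n s) and tQ(s d) cancel, which
    is why the trace is a sum and not a difference. *)
Lemma nakayama_trace_null f : null_chain f -> nakayama_trace f = 0.
Proof.
move=> [s [t [e0 e1]]]; rewrite /nakayama_trace e0 e1.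
have -> : dif1 Y = - n by [].
have -> : dif2 Y \oc t = 0 by rewrite [dif2 Y](_ : _ = 0) ?comp0l//; exact: zeromod_homl.
rewrite compNl (linfunctN tPS.1) addr0.
have := nE (idm P) (s : hom P J); rewrite comp1r comp1l => ->.
exact: addNr.
Qed.

Lemma nakayama_ext M (h h' : hom M I) :
  (forall w : hom P M, tP (h \oc w) = tP (h' \oc w)) -> h = h'.
Proof.
move=> hw; apply/eqP; rewrite -subr_eq0; apply/eqP/(tPS.2 M).1 => w.
by rewrite compDl compNl (linfunctD tPS.1) (linfunctN tPS.1) hw subrr.
Qed.

Lemma nakayama_ext_source M (v v' : hom Q M) :
  (forall h : hom M J, tQ (h \oc v) = tQ (h \oc v')) -> v = v'.
Proof.
move=> hv; apply/eqP; rewrite -subr_eq0; apply/eqP/(tQS.2 M).2 => h.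
by rewrite compDr compNr (linfunctD tQS.1) (linfunctN tQS.1) hv subrr.
Qed.

(** Composition with [n] is the transpose of composition with [d]; a functional on Hom(P, M) that
    kills the kernel of the latter factors through Hom(Q, M), and the factor is represented by a map
    to [J]. *)
Lemma nakayama_factor M (h : hom M I) :
  (forall w : hom P M, w \oc d = 0 -> tP (h \oc w) = 0) -> exists h' : hom M J, h = n \oc h'.
Proof.
move=> h0.
have [|||l' [ll' lE]] := @functional_factor_fun k (modhom P M) (modhom Q M)
  (fun w => ((w : hom P M) \oc d) : hom Q M) (fun w => tP (h \oc (w : hom P M))).
- move=> c u v; exact: (@comp_linl _ (modcat H) _ _ _ c u v d).
- move=> c u v; apply: etrans (tPS.1 _ _ _); congr tP.
  exact: (@comp_linr _ (modcat H) _ _ _ c h u v).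
- exact: h0.
have [h' h'E] := serre_reprl (@modcat_findim k H) (X := M) (l := l') tQS ll'.
exists h'; apply: nakayama_ext => w; rewrite nE -h'E; exact: lE.
Qed.

Lemma nakayama_cofactor M (v : hom Q M) :
  (forall h : hom M J, n \oc h = 0 -> tQ (h \oc v) = 0) -> exists w : hom P M, v = w \oc d.
Proof.
move=> v0.
have [|||l' [ll' lE]] := @functional_factor_fun k (modhom M J) (modhom M I)
  (fun h => (n \oc (h : hom M J)) : hom M I) (fun h => tQ ((h : hom M J) \oc v)).
- move=> c h h'; exact: (@comp_linr _ (modcat H) _ _ _ c n h h').
- move=> c h h'; apply: etrans (tQS.1 _ _ _); congr tQ.
  exact: (@comp_linl _ (modcat H) _ _ _ c h h' v).
- exact: v0.
have [w wE] := serre_reprr (@modcat_findim k H) (X := M) (l := l') tPS ll'.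
exists w; apply: nakayama_ext_source => h; rewrite -nE -wE; exact: lE.
Qed.

Section Resolution.
Variables (t : hom (Z : D) (Y : D) -> k).
Hypothesis tE : forall f : hom (Z : cplxcat H) Y, t (fmap loc f) = nakayama_trace f.
Lemma nakayama_traceM (X : cplxcat H) (f : hom X Y) (g : hom (Z : cplxcat H) X) :
  t (fmap loc f \oc fmap loc g) = nakayama_trace (f \oc g).
Proof. exact: etrans (congr1 t (esym (fmapM loc f g))) (tE _). Qed.

Variables (Q' P' M : modcat H) (d' : hom Q' P') (p' : hom P' M).
Hypothesis res : short_resolution d' p'.
Notation W := (two_term d').

Lemma nakayama_nondeg0 : nondeg t (W : D).
Proof.
have [P'p Q'p p'e d'm _] := res.
have Y0 (a : hom P' I) (b : hom Q' J) : dif0 Y \oc (a : hom P' (Y 0)) = 0.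
  exact: zeromod_homr.
have dE : dif1 Y = - n by [].
split=> [phi phi0|psi psi0].
- have [f fE] := loc_two_term_full P'p Q'p phi; subst phi.
  apply/(loc_two_term_eq0 P'p Q'p).
  (* As [J] is injective, the component on Q' extends to [s] on P'. Removing this homotopy leaves a
     map [h] from [M] to [I]; the vanishing of the pairing makes [h] factor through [n], and the
     factor corrects [s] to a null-homotopy. *)
  have [s sE] := serre_injective (sval f (Negz 0) : hom Q' J) tQS d'm.
  have fb : (sval f 0 : hom P' I) \oc d' = - n \oc (sval f (Negz 0) : hom Q' J).
    exact: esym (two_term_boundary f).
  have [|h hE] := res_factor_coker res (f := (sval f 0 : hom P' I) + n \oc s).
    by rewrite compDl fb -compA sE compNl addNr.
  have [|h' h'E] := nakayama_factor (h := h).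
    move=> w wd; have [g gE] := chain_into_exists Pp res wd.
    have := etrans (esym (nakayama_traceM f g)) (phi0 (fmap loc g)); rewrite /nakayama_trace !sval_comp -gE compA hE.
    rewrite compDl (linfunctD tPS.1) nE.
    have -> : s \oc ((sval g 0 : hom P P') \oc d) = sval f (Negz 0) \oc sval g (Negz 0).
      rewrite -sE -compA; congr (_ \oc _); exact: esym (two_term_boundary g).
    by [].
  exists (s - h' \oc p'), 0; rewrite comp0r addr0; split.
    rewrite dE compNl compDr compNr compA -h'E hE opprB.
    exact: esym (addrK _ _).
  rewrite compDl compNl -compA (res_zero res) comp0r subr0; exact: esym sE.
- have [g gE] := loc_two_term_full Pp Qp psi; subst psi.
  apply/(loc_two_term_eq0 Pp Qp); apply: (chain_into_null res).
  apply: (tPS.2 M).2 => h.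
  have c0 : dif0 Y \oc ((h \oc p' : hom P' I) : hom P' (Y 0)) = 0 by exact: zeromod_homr.
  have c1 : dif1 Y \oc ((0 : hom Q' J) : hom Q' (Y (Negz 0))) =
      ((h \oc p' : hom P' I) : hom P' (Y 0)) \oc d'.
    by rewrite comp0r; apply/esym; rewrite -compA (res_zero res) comp0r.
  have := etrans (esym (nakayama_traceM _ g)) (psi0 (fmap loc (two_term_chain c0 c1))).
  rewrite /nakayama_trace !sval_comp two_term_chain1 comp0l (linfunct0 tQS.1) addr0.
  by rewrite two_term_chain0 -compA.
Qed.

Lemma nakayama_nondeg1 : nondeg t (shift H (W : D)).
Proof.
have [P'p Q'p p'e d'm _] := res.
split=> [phi phi0|psi psi0].
- have [f fE] := shift_two_term_full (Y := cotwo_term n) phi P'p Q'p; subst phi.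
  have fb : (sval f 0 : hom P' J) \oc d' = 0.
    by apply: etrans (esym (two_term_boundary f)) _; rewrite [dif1 _](_ : _ = 0) ?comp0l.
  have fc : n \oc (sval f 0 : hom P' J) = 0 by exact: (two_term_cycle f).
  have [h hE] := res_factor_coker res fb.
  suff h0 : h = 0.
    have f0 : f = 0.
      apply: two_term_chain_ext; last exact: zeromod_homr.
      by apply: etrans (esym hE) _; rewrite h0 comp0l.
    rewrite f0; exact: etrans (congr1 (fmap loc) (fmap0 (shift_cplxcat H) _ _)) (fmap0 loc _ _).
  apply: (tQS.2 M).1 => v.
  have [b bE] : exists b : hom Q P', p' \oc b = v := Qp v p'e.
  have [g gE] := chain_into_shift_exists (Q := Q) (P := P) d d' b.
  have := etrans (esym (nakayama_traceM (fmap (shift_cplxcat H) f) g)) (phi0 (fmap loc g)); rewrite /nakayama_trace !sval_comp.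
  rewrite [sval g 0](_ : _ = 0); last exact: zeromod_homr.
  rewrite comp0r (linfunct0 tPS.1) add0r gE => <-.
  by congr tQ; rewrite -bE compA hE.
- have [g gE] := loc_two_term_full Pp Qp psi; subst psi; apply/(loc_two_term_eq0 Pp Qp).
  have [|w wE] := nakayama_cofactor (v := p' \oc (sval g (Negz 0) : hom Q P')).
    move=> h nh.
    have c0 : dif0 (cotwo_term n) \oc ((h \oc p' : hom P' J) : hom P' (cotwo_term n 0)) = 0.
      by rewrite compA [dif0 _ \oc _]nh comp0l.
    have c1 : dif1 (cotwo_term n) \oc (0 : hom Q' (cotwo_term n (Negz 0))) =
        ((h \oc p' : hom P' J) : hom P' (cotwo_term n 0)) \oc d'.
      by rewrite comp0r; apply/esym; rewrite -compA (res_zero res) comp0r.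
    have := etrans (esym (nakayama_traceM _ g))
      (psi0 (fmap loc (fmap (shift_cplxcat H) (two_term_chain c0 c1)))).
    rewrite /nakayama_trace !sval_comp.
    rewrite [sval g 0](_ : _ = 0); last exact: zeromod_homr.
    rewrite comp0r (linfunct0 tPS.1) add0r => <-.
    by congr tQ; rewrite compA.
  exact: (@chain_into_shift_null k H Q P d Pp Q' P' M d' p' res g w wE).
Qed.

Lemma nakayama_hom0 (j : int) : j != 0 -> j != 1 -> hom0 (reindex H j (stalk H M)) (Y : D).
Proof.
have [P'p Q'p p'e d'm _] := res.
move=> j0 j1; apply: hom0_isol (reindex_two_term j res) _; apply: hom0_reindexl.
case: (eqVneq j (- 1)) => [->|jN]; last first.
  have Yz (i : int) : i != 0 -> i != - 1 -> mdim (Y i) = 0%N.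
    have cz (l : int) : l != 0 -> l != 1 -> mdim (cotwo_term_ob J I l) = 0%N.
      by case: l => [[|[|l]]|l].
    by move=> i0 iN; apply: (cz (i + 1)); lia.
  apply: two_term_hom0 => //; first by apply: (Yz (0 + - j)); lia.
  by left; apply: (Yz (Negz 0 + - j)); lia.
(* For j = -1 the translated target has [I] in degree -1 and nothing in degree 0, so degrees alone
   do not suffice; maps into the injective [I] extend along [d'], hence are null-homotopic. *)
have inj (b : hom Q' I) : exists s : hom P' I, s \oc d' = b by exact: serre_injective tPS d'm.
exact: (@two_term_extension_hom0 Q' P' d' (reindex_cplx (- (- 1)) Y) P'p Q'p erefl inj).
Qed.
End Resolution.

Lemma nakayama_serre_pair : exists t : hom (Z : D) (Y : D) -> k, serre_pair t.
Proof.
have [t [tl tE]] := two_term_functional Pp Qp (Y := (Y : D)) nakayama_trace_linfunct nakayama_trace_null.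
exists t; split=> //; apply: (@nondeg_stalks _ _ hH _ _ t) => M j.
have [Q' [P' [d' [p' res]]]] := resolution_exists M hH.
case: (eqVneq j 0) => [->|j0].
  apply: nondeg_iso (isomorphic_sym (reindex0_iso _)) _.
  apply: nondeg_iso (resolution_isomorphic res) _.
  exact: (nakayama_nondeg0 tE res).
case: (eqVneq j 1) => [->|j1].
  apply: nondeg_iso (shift_two_term res) _.
  exact: (nakayama_nondeg1 tE res).
apply: nondeg_hom0; first exact: (@nakayama_hom0 _ _ _ _ _ res j j0 j1).
exact: two_term_reindex_hom0.
Qed.
End NakayamaPair.

Lemma stalk_serre_partner N : exists (Y : D) (t : hom (stalk H N) Y -> k), serre_pair t.
Proof.
have [Q [P [d [p res]]]] := resolution_exists N hH; have [Pp Qp _ _ _] := res.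
have [I [tP tPS]] := projective_serre_pair Pp; have [J [tQ tQS]] := projective_serre_pair Qp.
have [n nE] := nakayama_map d tQS tPS.
have [t tS] := nakayama_serre_pair Pp Qp tQS tPS nE.
have [t' t'S] := serre_pair_iso (resolution_isomorphic res) (isomorphic_refl _) tS.
by eexists; exists t'.
Qed.
End SerrePairs.

(** * The trace pairing of the bar complex with a shifted module *)

Section BarPair.
Variables (k : fieldType) (H : falgType k).
Notation D := (dercat H).
Notation loc := (loc_functor (@quasi_iso k H)).
Notation DM := (dualmod H).
Notation nH := (\dim {:H}).

Lemma mono_mx_ext (A B : modcat H) (i : hom A B) m (y : 'M[k]_(mdim A, m)) : mono i ->
  exists x : 'M[k]_(mdim B, m), vsval i *m x = y.
Proof.
move=> /mono_eq0 im; have /row_freeP[c cE] : row_free (vsval i) by exact: inj_row_free.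
by exists (c *m y); rewrite mulmxA cE mul1mx.
Qed.

Lemma hom_mx_exists (A B : modcat H) (x : 'M[k]_(mdim A, mdim B)) :
  (forall a, bar0 A B x a = 0) -> exists f : hom A B, vsval f = x.
Proof.
move=> x0; have fx a : mact A a *m x = x *m mact B a.
  by apply/eqP; rewrite -subr_eq0 -bar0E x0.
by exists (mk_modhom fx).
Qed.

Section OneModule.
Variable M : modcat H.
Notation C0 := (bar_mod0 M).
Notation Z1 := (bar_modZ M).

Section BarMatrix.
Variable N : modcat H.
(* the matrix of the restriction to M (x) 1 *)
Definition bar_mx (b : hom C0 N) : 'M[k]_(mdim M, mdim N) := projT1 (cid (bar_hom0_fun b)).
Lemma bar_mxE b c : mapp b (mod_vec (bar_act0 M) c) = bar_fun0 (bar_mx b) c.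
Proof. exact: (projT2 (cid (bar_hom0_fun b))). Qed.
Lemma bar_mx_elt b m : mapp b (mod_vec (bar_act0 M) (bar_elt m)) = m *m bar_mx b.
Proof. by rewrite bar_mxE bar_fun0_elt. Qed.
Lemma bar_mx_inj b b' : bar_mx b = bar_mx b' -> b = b'.
Proof. by move=> e; apply: mod_hom_ext => c; rewrite !bar_mxE e. Qed.
Lemma bar_mx_uniq b x : (forall m, mapp b (mod_vec (bar_act0 M) (bar_elt m)) = m *m x) -> bar_mx b = x.
Proof. by move=> bx; apply: mx_fun_eq => m; rewrite -bx bar_mx_elt. Qed.
Lemma bar_mx_lin c b b' : bar_mx (c *: b + b') = c *: bar_mx b + bar_mx b'.
Proof.
apply: bar_mx_uniq => m; rewrite mapp_linl !bar_mx_elt mulmxDr.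
by rewrite -scalemxAr.
Qed.
Lemma bar_mx_exists x : exists b, bar_mx b = x.
Proof.
have [b bE] := bar_hom0_exists x; exists b; apply: bar_mx_uniq => m.
by rewrite bE bar_fun0_elt.
Qed.
Lemma bar_mx_iota (s : hom Z1 N) u :
  (forall z, mapp s (mod_vec (bar_actZ M) z) = bar_fun1 u (kval z)) ->
  bar_mx (s \oc bar_iota M) = cocommutator u.
Proof.
move=> sE; apply: bar_mx_uniq => m; rewrite mapp_comp.
have [z [zE ->]] := bar_iota_val (bar_elt m).
by rewrite sE zE bar_fun1_bar0.
Qed.
End BarMatrix.

Lemma bar_mx_comp N N' (h : hom N N') (b : hom C0 N) : bar_mx (h \oc b) = bar_mx b *m vsval h.
Proof. by apply: bar_mx_uniq => m; rewrite mapp_comp bar_mx_elt mulmxA. Qed.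

Lemma bar_homZ_comp N N' (h : hom N N') (s : hom Z1 N) u :
  (forall z, mapp s (mod_vec (bar_actZ M) z) = bar_fun1 u (kval z)) ->
  forall z, mapp (h \oc s) (mod_vec (bar_actZ M) z) = bar_fun1 (fun j => u j *m vsval h) (kval z).
Proof. by move=> sE z; rewrite mapp_comp sE bar_fun1_comp. Qed.

Notation Z := (two_term (bar_iota M)).
Notation Y := (shift_cplx (stalk_cplx M)).

Definition bar_trace (f : hom (Z : cplxcat H) Y) : k := \tr (bar_mx (sval f (Negz 0) : hom C0 M)).

Lemma bar_trace_linfunct : linfunct bar_trace.
Proof. by move=> c f g; rewrite /bar_trace sval_lin bar_mx_lin linearP. Qed.

Hypothesis hH : hereditary H.

(** A homotopy changes the matrix by a sum of commutators of endomorphisms of [M], and commutators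
    have trace zero. *)
Lemma bar_trace_null f : null_chain f -> bar_trace f = 0.
Proof.
move=> [s [t [_ e1]]]; rewrite /bar_trace e1.
have -> : dif2 Y \oc t = 0 by rewrite [dif2 Y](_ : _ = 0) ?comp0l//; exact: zeromod_homl.
rewrite addr0; have [u uE] := bar_homZ_fun (s : hom Z1 M) hH.
rewrite [bar_mx _](bar_mx_iota uE) -[cocommutator u]mulmx1 tr_cocommutator big1// => j _.
by rewrite bar0E mulmx1 mul1mx subrr mulmx0 mxtrace0.
Qed.

Section Resolution.
Variables (t : hom (Z : D) (Y : D) -> k).
Hypothesis tE : forall f : hom (Z : cplxcat H) Y, t (fmap loc f) = bar_trace f.

Lemma bar_traceM (X : cplxcat H) (f : hom X Y) (g : hom (Z : cplxcat H) X) :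
  t (fmap loc f \oc fmap loc g) = bar_trace (f \oc g).
Proof. exact: etrans (congr1 t (esym (fmapM loc f g))) (tE _). Qed.

Variables (Q P N : modcat H) (d : hom Q P) (p : hom P N).
Hypothesis res : short_resolution d p.
Notation W := (two_term d).

(** If [phi] is a k-linear extension of [f] along [d], then [bar0 P M phi] is a cocycle for the
    extension class of [f]; the trace pairs it with the matrices of [g]. *)
Lemma bar_trace_comp (f : hom (W : cplxcat H) Y) (g : hom (Z : cplxcat H) (W : cplxcat H)) phi u :
  vsval d *m phi = vsval (sval f (Negz 0) : hom Q M) ->
  (forall z, mapp (sval g 0 : hom Z1 P) (mod_vec (bar_actZ M) z) = bar_fun1 u (kval z)) ->
  bar_trace (f \oc g) = \sum_j \tr (u j *m bar0 P M phi (hbase j)).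
Proof.
move=> phiE gE; rewrite -tr_cocommutator -(bar_mx_iota gE) /bar_trace sval_comp.
rewrite [bar_mx _](bar_mx_comp (sval f (Negz 0) : hom Q M) (sval g (Negz 0) : hom C0 Q)).
rewrite -phiE mulmxA -bar_mx_comp; congr (\tr (bar_mx _ *m _)).
exact: (two_term_boundary g).
Qed.

Lemma bar_nondeg0 : nondeg t (W : D).
Proof.
have [Pp Qp pe dm ex] := res.
have Cp := @bar_mod0_projective _ _ M; have Zp := @bar_modZ_projective _ _ M hH.
have dp0 : vsval d *m vsval p = 0 by rewrite -vsval_comp (res_zero res).
split=> [psi psi0|psi psi0].
- have [f fE] := loc_two_term_full Pp Qp psi; subst psi.
  apply/(loc_two_term_eq0 Pp Qp).
  have [phi phiE] := mono_mx_ext (vsval (sval f (Negz 0) : hom Q M)) dm.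
  have dphi a : vsval d *m bar0 P M phi a = 0.
    rewrite bar0E mulmxBr !mulmxA -(modhomP d) phiE -mulmxA phiE.
    by rewrite (modhomP (sval f (Negz 0) : hom Q M)) subrr.
  have [s sE] := epi_mx_lift 1%:M pe.
  have [x xE] : exists x, vsval p *m s - 1%:M = x *m vsval d.
    have ker i : exists w, mapp d w = row i (vsval p *m s - 1%:M).
      by apply/ex; rewrite /mapp -row_mul mulmxBl mul1mx -mulmxA sE mulmx1 subrr row0.
    exists (\matrix_i projT1 (cid (ker i))); apply/row_matrixP => i.
    by rewrite row_mul rowK; exact: esym (projT2 (cid (ker i))).
  (* The inner derivation of [phi] vanishes on [Q], so it descends along the linear section [s] to a
     cochain [dh] on [N], representing the class of [f] in Ext^1(N, M). *)
  pose dh : 'Hom(H, 'M[k]_(mdim N, mdim M)) := (linfun (mulmx s) \o bar0 P M phi)%VF.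
  have dhE a : vsval p *m dh a = bar0 P M phi a.
    rewrite comp_lfunE lfunE /= mulmxA; apply/eqP; rewrite -subr_eq0.
    by rewrite -{2}[bar0 P M phi a]mul1mx -mulmxBl xE -mulmxA dphi mulmx0.
  (* A tuple with zero cocommutator lifts to a chain map into the resolution, so the hypothesis on
     the pairing says exactly that [dh] is inner. Subtracting the inner part makes [phi] an
     [H]-linear extension of [f], that is, a homotopy. *)
  have [u u0|f' f'E] := annihilator_inner (d := dh).
    pose v j := projT1 (cid (epi_mx_lift (u j) pe)).
    have vE j : v j *m vsval p = u j := projT2 (cid (epi_mx_lift (u j) pe)).
    have [a aE] := bar_homZ_exists v.
    have [|g gE] := chain_into_of_map (d := bar_iota M) res (a := a).
      apply: bar_mx_inj; rewrite (bar_mx_iota (bar_homZ_comp p aE)).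
      have -> : cocommutator (fun j => v j *m vsval p) = cocommutator u.
        by congr (cocommutator _); apply: functional_extensionality_dep => j; exact: vE.
      by rewrite u0; apply/esym/bar_mx_uniq => m; rewrite mapp0l mulmx0.
    rewrite -gE in aE.
    have := etrans (esym (bar_traceM f g)) (psi0 (fmap loc g)).
    rewrite (bar_trace_comp phiE aE) => h; apply: etrans h; apply: eq_bigr => j _.
    by rewrite -vE -dhE mulmxA.
  have [a|r rE] := @hom_mx_exists P M (phi - vsval p *m f').
    rewrite linearB add_lfunE opp_lfunE -dhE f'E !bar0E mulmxBr !mulmxA (modhomP p).
    exact: subrr.
  exists r, 0; rewrite comp0r addr0; split; first exact: zeromod_homr.
  apply: subvs_inj; rewrite vsval_comp rE mulmxBr phiE mulmxA dp0 mul0mx subr0.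
  by [].
- have [g gE] := loc_two_term_full Zp Cp psi; subst psi.
  apply/(loc_two_term_eq0 Zp Cp); apply: (chain_into_null res).
  have [u uE] := bar_homZ_fun (sval g 0 : hom Z1 P) hH.
  apply: mod_hom_ext => z; rewrite mapp0l (bar_homZ_comp p uE).
  apply: bar_fun1_annihilated; first exact: kval_ker.
  (* Conversely, a derivation on [N] becomes inner on [P]; the restriction to [Q] of the matrix
     [phi] is [H]-linear and gives a chain map with this extension class, to be used as test map. *)
  move=> dl dlZ; have [phi phiE] := inner_projective Pp (ext1_cochain_ker p (idm M) dlZ).
  have phiE' a : bar0 P M phi a = vsval p *m dl a.
    by rewrite -phiE ext1_cochainE [vsval (idm M)]/(1%:M) mulmx1.
  have [a|r rE] := @hom_mx_exists Q M (vsval d *m phi).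
    rewrite bar0E mulmxA (modhomP d) -!mulmxA -mulmxBr -bar0E phiE'.
    by rewrite mulmxA dp0 mul0mx.
  have c0 : dif0 Y \oc (0 : hom P (Y 0)) = 0 by exact: comp0r.
  have c1 : dif1 Y \oc (r : hom Q (Y (Negz 0))) = (0 : hom P (Y 0)) \oc d by exact: zeromod_homr.
  have := etrans (esym (bar_traceM (two_term_chain c0 c1) g))
    (psi0 (fmap loc (two_term_chain c0 c1))).
  rewrite (@bar_trace_comp (two_term_chain c0 c1) g phi u (esym rE) uE) => h; apply: etrans h.
  by apply: eq_bigr => j _; rewrite phiE' mulmxA.
Qed.

(** Here Hom(N, M) is paired with the matrices from [M] to [N] modulo cocommutators; the two halves
    are the nondegeneracy of the trace and [annihilator_hom]. *)
Lemma bar_nondeg1 : nondeg t (shift H (W : D)).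
Proof.
have [Pp Qp pe dm ex] := res.
have Cp := @bar_mod0_projective _ _ M; have Zp := @bar_modZ_projective _ _ M hH.
split=> [psi psi0|psi psi0].
- have [f fE] := shift_two_term_full (Y := stalk_cplx M) psi Pp Qp; subst psi.
  have fb : (sval f 0 : hom P M) \oc d = 0.
    by apply: etrans (esym (two_term_boundary f)) _; rewrite [dif1 _](_ : _ = 0) ?comp0l.
  have [h hE] := res_factor_coker res fb.
  suff h0 : h = 0.
    have f0 : f = 0.
      apply: two_term_chain_ext; last exact: zeromod_homr.
      by apply: etrans (esym hE) _; rewrite h0 comp0l.
    rewrite f0; exact: etrans (congr1 (fmap loc) (fmap0 (shift_cplxcat H) _ _)) (fmap0 loc _ _).
  apply: subvs_inj; apply: tr_nondeg => A.
  have [b bE] := bar_mx_exists A; have [b' b'E] := Cp _ _ p b pe.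
  have [g gE] := chain_into_shift_exists (bar_iota M) d b'.
  have := etrans (esym (bar_traceM (fmap (shift_cplxcat H) f) g)) (psi0 (fmap loc g)).
  rewrite /bar_trace sval_comp gE => e; apply: etrans e.
  rewrite mxtrace_mulC -bE -bar_mx_comp; congr (\tr (bar_mx _)).
  by rewrite -b'E compA hE.
- have [g gE] := loc_two_term_full Zp Cp psi; subst psi; apply/(loc_two_term_eq0 Zp Cp).
  have [h|u uE] := annihilator_hom (x := bar_mx (p \oc (sval g (Negz 0) : hom C0 P))).
    have c0 : dif0 (stalk_cplx M) \oc ((h \oc p : hom P M) : hom P (stalk_cplx M 0)) = 0.
      exact: comp0l.
    have c1 : dif1 (stalk_cplx M) \oc (0 : hom Q (stalk_cplx M (Negz 0))) =
        ((h \oc p : hom P M) : hom P (stalk_cplx M 0)) \oc d.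
      by rewrite comp0r; apply/esym; rewrite -compA (res_zero res) comp0r.
    have := etrans (esym (bar_traceM _ g))
      (psi0 (fmap loc (fmap (shift_cplxcat H) (two_term_chain c0 c1)))).
    rewrite /bar_trace sval_comp => e; apply: etrans e; rewrite -bar_mx_comp; congr (\tr (bar_mx _)).
    exact: compA.
  have [w wE] := bar_homZ_exists u.
  have e : p \oc (sval g (Negz 0) : hom C0 P) = w \oc bar_iota M.
    by apply: bar_mx_inj; rewrite uE (bar_mx_iota wE).
  exact: (@chain_into_shift_null k H _ _ _ Zp Q P N d p res g w e).
Qed.
End Resolution.

Lemma bar_hom0 N (j : int) : j != 0 -> j != 1 -> hom0 (reindex H j (stalk H N)) (Y : D).
Proof.
move=> j0 j1; apply: hom0_reindexl; apply: stalk_hom0 => //.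
  by apply: (@stalk_ob0 _ _ M (0 + - j + 1)); lia.
by apply: (@stalk_ob0 _ _ M (Negz 0 + - j + 1)); lia.
Qed.

Lemma bar_serre_pair : exists t : hom (Z : D) (Y : D) -> k,
  serre_pair t /\ forall f : hom (Z : cplxcat H) Y, t (fmap loc f) = bar_trace f.
Proof.
have Cp := @bar_mod0_projective _ _ M; have Zp := @bar_modZ_projective _ _ M hH.
have [t [tl tE]] := two_term_functional Zp Cp (Y := (Y : D)) bar_trace_linfunct bar_trace_null.
exists t; split=> //; split=> //; apply: (@nondeg_stalks _ _ hH _ _ t) => N j.
have [Q' [P' [d' [p' res]]]] := resolution_exists N hH.
case: (eqVneq j 0) => [->|j0].
  apply: nondeg_iso (isomorphic_sym (reindex0_iso _)) _.
  apply: nondeg_iso (resolution_isomorphic res) _.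
  exact: (bar_nondeg0 tE res).
case: (eqVneq j 1) => [->|j1].
  apply: nondeg_iso (shift_two_term res) _.
  exact: (bar_nondeg1 tE res).
apply: nondeg_hom0; first exact: (@bar_hom0 N j j0 j1).
exact: (@two_term_reindex_hom0 _ _ _ _ _ Zp Cp N j j0 j1).
Qed.
End OneModule.
End BarPair.

(** * The Auslander-Reiten translation *)

Section TraceForms.
Variables (k : fieldType) (C : lincat k).
Implicit Types X Y Z : C.

Lemma serre_trace_AR (sh tau : functor C C) (t : forall X, hom X (sh (tau X)) -> k) :
  (forall X Y, findim (hom X Y)) -> serre_trace t ->
  exists beta : forall X Y : C, hom X Y -> hom Y (sh (tau X)) -> k,
  (forall X Y c (f f' : hom X Y) (h : hom Y (sh (tau X))),
    beta X Y (c *: f + f') h = c * beta X Y f h + beta X Y f' h) /\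
  (forall X Y c (f : hom X Y) (h h' : hom Y (sh (tau X))),
    beta X Y f (c *: h + h') = c * beta X Y f h + beta X Y f h') /\
  (forall X Y Y' (f : hom X Y) (g : hom Y Y') (h : hom Y' (sh (tau X))),
    beta X Y' (g \oc f) h = beta X Y f (h \oc g)) /\
  (forall X X' Y (u : hom X X') (f : hom X' Y) (h : hom Y (sh (tau X))),
    beta X Y (f \oc u) h = beta X' Y f (fmap sh (fmap tau u) \oc h)) /\
  (forall X Y (l : {linear hom X Y -> k^o}),
    exists! h : hom Y (sh (tau X)), forall f, l f = beta X Y f h).
Proof.
move=> fd [st tn]; exists (fun X Y f h => t X (h \oc f)); split.
  by move=> X Y c f f' h; rewrite comp_linr (st X).1.
split; first by move=> X Y c f h h'; rewrite comp_linl (st X).1.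
split; first by move=> X Y Y' f g h; rewrite compA.
split; first by move=> X X' Y u f h; rewrite compA -tn compA.
move=> X Y l; have [|h hE] := serre_reprl fd (l := fun f => l f : k) (st X).
  by move=> c f g; rewrite linearP.
exists h; split=> // h' h'E; apply/eqP; rewrite -subr_eq0; apply/eqP.
apply: ((st X).2 Y).1 => g.
by rewrite compDl compNl (linfunctD (st X).1) (linfunctN (st X).1) -hE -h'E subrr.
Qed.

(** Comparison maps that respect traces are natural as soon as the traces are, since both composites
    have the same pairing with every test map. *)
Lemma serre_compare_nat A1 A2 Z1 Z2 Y1 Y2 (s1 : hom A1 Y1 -> k) (s2 : hom A2 Y2 -> k)
    (t1 : hom Z1 Y1 -> k) (t2 : hom Z2 Y2 -> k) (v1 : hom A1 Z1) (v2 : hom A2 Z2)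
    (a : hom A1 A2) (z : hom Z1 Z2) (y : hom Y1 Y2) :
  serre_pair s1 -> (forall w, s1 (w \oc v1) = t1 w) -> (forall w, s2 (w \oc v2) = t2 w) ->
  (forall w : hom A2 Y1, s2 (y \oc w) = s1 (w \oc a)) ->
  (forall f : hom Z2 Y1, t2 (y \oc f) = t1 (f \oc z)) -> z \oc v1 = v2 \oc a.
Proof.
move=> s1S v1E v2E sa tz; apply/eqP; rewrite -subr_eq0; apply/eqP/(s1S.2 _).2 => f.
rewrite compDr compNr (linfunctD s1S.1) (linfunctN s1S.1).
by rewrite !compA v1E -tz -v2E -compA sa subrr.
Qed.

Lemma serre_partner_shift (sh : functor C C) X Y (t : hom X Y -> k) : esurj sh ->
  serre_pair t -> exists T (t' : hom X (sh T) -> k), serre_pair t'.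
Proof.
move=> she tS; have [T TY] := she Y; exists T.
exact: serre_pair_iso (isomorphic_refl _) (isomorphic_sym TY) tS.
Qed.

Lemma quasi_inverse_exists (F G F' G' : functor C C) : quasi_inverse F G -> quasi_inverse F' G' ->
  exists K, quasi_inverse (compfunctor F F') K.
Proof.
move=> FG FG'; apply: equivalence_quasi_inverse.
- move=> X Y f f0; apply: (quasi_inverse_faithful FG'); exact: (quasi_inverse_faithful FG f0).
- move=> X Y h; have [h' h'E] := quasi_inverse_full FG h; have [f fE] := quasi_inverse_full FG' h'.
  by exists f; rewrite -h'E -fE.
- move=> Y; have [X XY] := quasi_inverse_esurj FG Y; have [X' X'X] := quasi_inverse_esurj FG' X.
  by exists X'; exact: isomorphic_trans (fmap_isomorphic F X'X) XY.
Qed.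
End TraceForms.

Section DerivedSerre.
Variables (k : fieldType) (H : falgType k).
Notation D := (dercat H).
Notation loc := (loc_functor (@quasi_iso k H)).
Hypothesis hH : hereditary H.

Lemma serre_partner_right (X : D) : exists (Y : D) (t : hom X Y -> k), serre_pair t.
Proof.
have [n Xn] := cbounded (X : cplx H).
apply: (@dercat_ind k H (fun X : D => exists (Y : D) (t : hom X Y -> k), serre_pair t)
  (- (Posz n)) hH).
- move=> X1 X2 XX [Y [t tS]]; exists Y.
  exact: serre_pair_iso XX (isomorphic_refl _) tS.
- move=> X0 X1 X2 XX [Y1 [t1 t1S]] [Y2 [t2 t2S]]; exists (dsum_cplx Y1 Y2 : D).
  exact: serre_pair_sum XX (fmap_dsum2 loc (dsum_cplxP Y1 Y2)) t1S t2S.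
- by move=> X0 X00; exists X0; exact: serre_pair_zero.
- move=> N j _; have [Y [t tS]] := stalk_serre_partner hH N; exists (reindex H j Y).
  exact: serre_pair_functor (@reindex_faithful _ _ _) (@reindex_full _ _ _) (@reindex_esurj _ _ _) tS.
- by move=> i lti; apply: Xn; lia.
Qed.

Lemma serre_partner_left (Y : D) : exists (X : D) (t : hom X Y -> k), serre_pair t.
Proof.
have [n Yn] := cbounded (Y : cplx H).
apply: (@dercat_ind k H (fun Y : D => exists (X : D) (t : hom X Y -> k), serre_pair t)
  (- (Posz n)) hH).
- move=> X1 X2 XX [Y' [t tS]]; exists Y'.
  exact: serre_pair_iso (isomorphic_refl _) XX tS.
- move=> X0 X1 X2 XX [Y1 [t1 t1S]] [Y2 [t2 t2S]]; exists (dsum_cplx Y1 Y2 : D).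
  exact: serre_pair_sum (fmap_dsum2 loc (dsum_cplxP Y1 Y2)) XX t1S t2S.
- by move=> X0 X00; exists X0; exact: serre_pair_zero.
(* The bar complex is paired with N[1], so its translate by j - 1 is paired with N[j]. *)
- move=> N j _; have [t [tS _]] := bar_serre_pair N hH.
  have [t' t'S] := serre_pair_functor (@reindex_faithful _ _ (j - 1))
    (@reindex_full _ _ (j - 1)) (@reindex_esurj _ _ (j - 1)) tS.
  exists (reindex H (j - 1) (two_term (bar_iota N))).
  apply: serre_pair_iso (isomorphic_refl _) _ t'S.
  apply: isomorphic_trans (fmap_isomorphic _ (shift_reindex_iso (stalk H N))) _.
  apply: isomorphic_trans (reindexD_iso _ _ _) _; rewrite subrK.
  exact: isomorphic_refl.
- by move=> i lti; apply: Yn; lia.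
Qed.

Lemma AR_translation_exists : exists (tau tau' : functor D D) (s : forall Y, hom (tau' Y) (shift H Y) -> k),
  [/\ AR_translation tau, quasi_inverse tau tau', forall Y, serre_pair (s Y)
    & forall Y Y' (u : hom Y Y') (w : hom (tau' Y') (shift H Y)),
        s Y' (fmap (shift H) u \oc w) = s Y (w \oc fmap tau' u)].
Proof.
have fd := dercat_findim hH.
have [X|Y|tau [tau' [t [tS tq]]]] := serre_functor_exists fd (@shift_faithful _ H) (@shift_full _ H).
- have [Y [t tS]] := serre_partner_right X.
  exact: serre_partner_shift (@shift_esurj _ H) tS.
- exact: serre_partner_left.
have [s [sS sn]] := serre_trace_inverse tS tq.
exists tau, tau', s; split=> //.
exact: serre_trace_AR fd tS.
Qed.

Lemma cluster_action (tau tau' : functor D D) : AR_translation tau -> quasi_inverse tau tau' ->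
  exists F : zaction D, cluster_functor (F 1) /\ natiso (F 1) (compfunctor (shift H) tau').
Proof.
move=> tauAR tq.
have [K Kq] := quasi_inverse_exists (@shift_quasi_inverse _ H) (quasi_inverse_sym tq).
have [F Fn] := power_zaction Kq; exists F; split=> //.
by exists tau, tau'; split.
Qed.

Section BarObjects.
Section Maps.
Variables (M M' : modcat H) (w : hom M M').
Notation Z M := (two_term (bar_iota M)).

Lemma bar_chain_proof0 : dif0 (Z M' : cplxcat H) \oc (bar_mapZ w : hom (bar_modZ M) ((Z M' : cplxcat H) 0)) = 0.
Proof. exact: zeromod_homr. Qed.
Definition bar_chain : hom (Z M : cplxcat H) (Z M' : cplxcat H) :=
  @two_term_chain _ _ _ _ (bar_iota M) (Z M' : cplxcat H) (bar_mapZ w) (bar_map0 w)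
    bar_chain_proof0 (esym (bar_iota_nat w)).

Lemma bar_map0_elt m : mapp (bar_map0 w) (mod_vec (bar_act0 M) (bar_elt m)) =
  mod_vec (bar_act0 M') (bar_elt (m *m vsval w)).
Proof. by rewrite bar_map0E /bar_elt mulmxA. Qed.

Lemma bar_trace_nat (f : hom (Z M' : cplxcat H) (shift_cplx (stalk_cplx M))) :
  bar_trace (fmap (shift_cplxcat H) (fmap (stalk_cplxcat H) w) \oc f) = bar_trace (f \oc bar_chain).
Proof.
rewrite /bar_trace !sval_comp.
transitivity (\tr (bar_mx (sval f (Negz 0) : hom (bar_mod0 M') M) *m vsval w)).
  by rewrite -bar_mx_comp.
rewrite mxtrace_mulC; congr (\tr _); apply/esym/bar_mx_uniq => m.
rewrite mapp_comp [mapp _ (mod_vec _ _)]bar_map0_elt.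
by rewrite [LHS](bar_mx_elt (sval f (Negz 0) : hom (bar_mod0 M') M)) mulmxA.
Qed.
End Maps.

Section Projection.
Variable M : modcat H.
Notation Z := (two_term (bar_iota M)).

Lemma bar_pi_iota : bar_pi M \oc bar_iota M = 0.
Proof.
by apply: hom_ext => v; rewrite mapp_comp mapp0l; apply/bar_pi_ker; exists v.
Qed.

Lemma bar_proj_proof0 : dif0 (stalk_cplx (tau_inv H M)) \oc
  (bar_pi M : hom (bar_modZ M) (stalk_cplx (tau_inv H M) 0)) = 0.
Proof. exact: comp0l. Qed.
Lemma bar_proj_proof1 : dif1 (stalk_cplx (tau_inv H M)) \oc
  (0 : hom (bar_mod0 M) (stalk_cplx (tau_inv H M) (Negz 0))) =
  (bar_pi M : hom (bar_modZ M) (stalk_cplx (tau_inv H M) 0)) \oc bar_iota M.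
Proof. by rewrite comp0r; exact: esym bar_pi_iota. Qed.
Definition bar_proj : hom (Z : cplxcat H) (stalk_cplx (tau_inv H M)) :=
  two_term_chain bar_proj_proof0 bar_proj_proof1.
End Projection.

Lemma bar_proj_nat M M' (w : hom M M') :
  bar_proj M' \oc bar_chain w = fmap (stalk_cplxcat H) (fmap (tau_inv H) w) \oc bar_proj M.
Proof.
apply: two_term_chain_ext; first exact: (bar_pi_nat w).
exact: zeromod_homr.
Qed.

Lemma bar_below M : below 0 (two_term (bar_iota M) : D).
Proof. by apply: belowP => // -[[|i]|i]; rewrite ?oppr0 ?ltxx. Qed.

(** The image of C^0 in Z^1 is projective, so C^0 splits as image plus kernel. The image with Z^1
    resolves the cokernel, and the kernel sits alone in degree -1. *)
Lemma bar_split M : exists (K : D) (j : hom K (two_term (bar_iota M)))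
    (s : hom (two_term (bar_iota M)) K) (i : hom (stalk H (tau_inv H M)) (two_term (bar_iota M))),
  [/\ below 1 K, fmap loc (bar_proj M) \oc i = idm _ &
      i \oc fmap loc (bar_proj M) + j \oc s = idm _].
Proof.
have Zp := bar_modZ_projective (M := M) hH.
have [S [iS [q [im qe iq]]]] := image_exists (bar_iota M).
have Sp := hH Zp im.
have [sg sgE] := Sp _ _ q (idm S) qe.
have res : short_resolution iS (bar_pi M).
  split=> //; first exact: bar_pi_epi.
  move=> v; split=> [/bar_pi_ker[w <-]|[w <-]].
    by exists (mapp q w); rewrite -mapp_comp iq.
  by have [u <-] := qe w; apply/bar_pi_ker; exists u; rewrite -iq mapp_comp.
have [K [kap [km kE]]] := kernel_exists (bar_iota M).
have ik : bar_iota M \oc kap = 0.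
  by apply: hom_ext => v; rewrite mapp_comp mapp0l; apply/kE; exists v.
have [|r rE] := mono_factor (f := idm _ - sg \oc q) km.
  move=> v; apply/kE; rewrite -mapp_comp compDr compNr comp1r -{1 2}iq -compA (compA q) sgE.
  by rewrite comp1l subrr mapp0l.
pose Z : cplxcat H := two_term (bar_iota M).
pose W : cplxcat H := two_term iS.
pose K' : cplxcat H := two_term (0 : hom K (zeromod H)).
have c0 (Q P : modcat H) (d : hom Q P) A (a : hom A P) :
    dif0 (two_term d : cplxcat H) \oc (a : hom A ((two_term d : cplxcat H) 0)) = 0.
  exact: zeromod_homr.
have e1 : iS \oc q = idm (bar_modZ M) \oc bar_iota M by rewrite comp1l.
have e2 : bar_iota M \oc sg = idm (bar_modZ M) \oc iS by rewrite comp1l -iq -compA sgE comp1r.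
have e3 : bar_iota M \oc kap = (0 : hom (zeromod H) (bar_modZ M)) \oc (0 : hom K (zeromod H)).
  by rewrite ik comp0l.
have e4 : (0 : hom K (zeromod H)) \oc r = (0 : hom (bar_modZ M) (zeromod H)) \oc bar_iota M.
  by rewrite !comp0l.
pose f1 : hom Z W := @two_term_chain _ _ _ _ (bar_iota M) W (idm (bar_modZ M)) q (c0 _ _ _ _ _) e1.
pose f2 : hom W Z := @two_term_chain _ _ _ _ iS Z (idm (bar_modZ M)) sg (c0 _ _ _ _ _) e2.
pose f3 : hom K' Z := @two_term_chain _ _ _ _ _ Z 0 kap (c0 _ _ _ _ _) e3.
pose f4 : hom Z K' := @two_term_chain _ _ _ _ (bar_iota M) K' 0 r (c0 _ _ _ _ _) e4.
have f12 : f1 \oc f2 = idm W.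
  by apply: two_term_chain_ext; [exact: comp1l|exact: sgE].
have f1234 : f2 \oc f1 + f3 \oc f4 = idm Z.
  apply: two_term_chain_ext.
    apply: etrans (congr2 +%R (comp1l _) (comp0l _ _)) _; exact: addr0.
  by apply: etrans (congr1 (+%R (sg \oc q)) rE) _; rewrite addrC subrK.
have pr : bar_proj M = resolution_map res \oc f1.
  by apply: two_term_chain_ext; [exact: esym (comp1r _)|exact: zeromod_homr].
have [v [vr rv]] := resolution_iso res.
have step (C E : lincat k) (L : functor C E) (A B N : C) (g1 : hom A B) (g2 : hom B A)
    (K0 : C) (g3 : hom K0 A) (g4 : hom A K0) (rho : hom B N) (u : hom (L N) (L B)) :
    g1 \oc g2 = idm B -> g2 \oc g1 + g3 \oc g4 = idm A ->
    u \oc fmap L rho = idm _ -> fmap L rho \oc u = idm _ ->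
    fmap L (rho \oc g1) \oc (fmap L g2 \oc u) = idm _ /\
    (fmap L g2 \oc u) \oc fmap L (rho \oc g1) + fmap L g3 \oc fmap L g4 = idm _.
  move=> h12 h1234 ur ru; split.
    rewrite fmapM -compA (compA (fmap L g1)) -fmapM h12 fmap1 comp1l.
    exact: ru.
  rewrite fmapM -compA (compA u) ur comp1l -!fmapM -fmapD h1234; exact: fmap1.
have [h1 h2] := step _ _ loc _ _ _ _ _ _ _ _ _ v f12 f1234 vr rv.
exists (K' : D), (fmap loc f3), (fmap loc f4), (fmap loc f2 \oc v); split.
- by apply: belowP => // -[[|i]|i] //; lia.
- rewrite pr; exact: h1.
- rewrite pr; exact: h2.
Qed.
End BarObjects.
End DerivedSerre.

(** * Orbit categories *)

Section Orbit.
Variables (k : fieldType) (C : lincat k) (F : zaction C).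
Notation O := (orbit_category F).
Implicit Types X Y Z V W : C.

Definition pow0_inv X : hom (F 0 X) X := projT1 (cid (pow0_iso F X)).
Lemma pow0_invl X : pow0_inv X \oc pow0 F X = idm X.
Proof. exact: (projT2 (cid (pow0_iso F X))).1. Qed.
Lemma pow0_invr X : pow0 F X \oc pow0_inv X = idm (F 0 X).
Proof. exact: (projT2 (cid (pow0_iso F X))).2. Qed.

Section Components.
Variables X Y : C.
Definition orb0 (f : hom (X : O) (Y : O)) : hom X Y := pow0_inv Y \oc sval f 0.
Definition orb1 (f : hom (X : O) (Y : O)) : hom X (F 1 Y) := sval f 1.

Lemma orb0_lin c (f g : hom (X : O) (Y : O)) : orb0 (c *: f + g) = c *: orb0 f + orb0 g.
Proof. exact: comp_linr. Qed.
Lemma orb1_lin c (f g : hom (X : O) (Y : O)) : orb1 (c *: f + g) = c *: orb1 f + orb1 g.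
Proof. by []. Qed.

Lemma orb0_0 : orb0 0 = 0.
Proof. exact: comp0r. Qed.
Lemma orb1_0 : orb1 0 = 0.
Proof. by []. Qed.

Definition orb_mk_fun (a : hom X Y) (x : hom X (F 1 Y)) : orbit_fun F X Y :=
  fun i : int => match i return hom X (F i Y) with
    | Posz 0 => pow0 F Y \oc a | Posz 1 => x | _ => 0 end.
Lemma orb_mk_fin a x : finite_support (orb_mk_fun a x).
Proof. by exists 1%N => -[[|[|i]]|i]. Qed.
Definition orb_mk a x : hom (X : O) (Y : O) := exist _ (orb_mk_fun a x) (orb_mk_fin a x).

Lemma orb_mk0 a x : orb0 (orb_mk a x) = a.
Proof. by rewrite /orb0 /= compA pow0_invl comp1l. Qed.
Lemma orb_mk1 a x : orb1 (orb_mk a x) = x.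
Proof. by []. Qed.

(** Under this condition a morphism of the orbit category is a pair in degrees 0 and 1, as in a
    trivial extension. *)
Definition short := forall n : int, n != 0 -> n != 1 -> hom0 X (F n Y).

Lemma orb_ext (f g : hom (X : O) (Y : O)) : short -> orb0 f = orb0 g -> orb1 f = orb1 g -> f = g.
Proof.
move=> XY e0 e1; apply: subsp_inj; apply: functional_extensionality_dep => i.
case: (eqVneq i 0) => [->|i0].
  by have := congr1 (comp (pow0 F Y)) e0; rewrite /orb0 !compA pow0_invr !comp1l.
case: (eqVneq i 1) => [->|i1]; first exact: e1.
by rewrite (XY i i0 i1 (sval f i)) (XY i i0 i1 (sval g i)).
Qed.

End Components.

Lemma orb0_id X : orb0 (idm (X : O)) = idm X.
Proof. exact: pow0_invl. Qed.
Lemma orb1_id X : orb1 (idm (X : O)) = 0.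
Proof. by []. Qed.

Lemma orbit_term0 X Y Z (g : hom (Y : O) (Z : O)) (f : hom (X : O) (Y : O)) i (e : 0 + i = i) :
  orbit_comp_term (sval g) (sval f) e = sval g i \oc orb0 f.
Proof.
rewrite /orbit_comp_term.
have -> : sval f 0 = pow0 F Y \oc orb0 f by rewrite /orb0 compA pow0_invr comp1l.
by rewrite compA -(compA _ _ (pow0 F Y)) -pow0_nat compA powD0l comp1l.
Qed.

Lemma orbit_term1 X Y Z (g : hom (Y : O) (Z : O)) (f : hom (X : O) (Y : O)) i (e : i + 0 = i) :
  orbit_comp_term (sval g) (sval f) e = fmap (F i) (orb0 g) \oc sval f i.
Proof.
rewrite /orbit_comp_term.
have -> : sval g 0 = pow0 F Z \oc orb0 g by rewrite /orb0 compA pow0_invr comp1l.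
by rewrite fmapM compA powD0r comp1l.
Qed.

Lemma orb0_comp X Y Z (g : hom (Y : O) (Z : O)) (f : hom (X : O) (Y : O)) :
  short X Y -> short Y Z -> orb0 (g \oc f) = orb0 g \oc orb0 f.
Proof.
move=> XY YZ; rewrite {1}/orb0 [sval (g \oc f) 0]/(orbit_comp_fun _ _ 0) /orbit_comp_fun.
rewrite (zsum_single (i := 0)) => [|i i0].
  by rewrite (orbit_comp_term_irr _ _ _ (addr0 0)) orbit_term0 compA.
case: (eqVneq i 1) => [->|i1]; last by apply: orbit_comp_term0r; exact: XY.
by apply: orbit_comp_term0l; apply: YZ.
Qed.

(** Only the two splittings of 1 as 0 + 1 survive: this is the multiplication rule of a trivial
    extension, and products of two degree one parts disappear. *)
Lemma orb1_comp X Y Z (g : hom (Y : O) (Z : O)) (f : hom (X : O) (Y : O)) :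
  short X Y -> short Y Z -> orb1 (g \oc f) = orb1 g \oc orb0 f + fmap (F 1) (orb0 g) \oc orb1 f.
Proof.
move=> XY YZ; pose G i : hom X (F 1 Z) := orbit_comp_term (sval g) (sval f) (subrKC i 1).
have GE : \sum_(i \in [set: int]) G i = G (- 1) + (G 0 + (G 1 + 0)).
  rewrite (@zsumE _ G 1) => [|i lti]; first by rewrite /zrange /= !big_cons big_nil.
  by apply: orbit_comp_term0r; apply: XY; lia.
have G0 : G (- 1) = 0 by apply: orbit_comp_term0r; exact: XY.
have G1 : G 0 = orb1 g \oc orb0 f.
  exact: etrans (orbit_comp_term_irr _ _ _ (add0r 1)) (orbit_term0 _ _ _).
have G2 : G 1 = fmap (F 1) (orb0 g) \oc orb1 f.
  exact: etrans (orbit_comp_term_irr _ _ _ (addr0 1)) (orbit_term1 _ _ _).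
by apply: etrans GE _; rewrite G0 G1 G2 add0r addr0.
Qed.

Definition orbit_functor : functor C O.
Proof.
unshelve refine (@Functor k C O (fun X : C => (X : O)) (fun X Y a => orb_mk a 0) _ _ _).
- move=> X; apply: subsp_inj; apply: functional_extensionality_dep => -[[|[|i]]|i] //=.
  exact: comp1r.
- move=> X Y Z g f; apply: subsp_inj; apply: functional_extensionality_dep => n.
  rewrite [RHS]/(orbit_comp_fun _ _ n) /orbit_comp_fun (zsum_single (i := 0)).
    rewrite (orbit_comp_term_irr _ _ _ (add0r n)) orbit_term0 orb_mk0.
    case: n => [[|[|n]]|n] /=; rewrite ?comp0l //; exact: compA.
  move=> i i0; apply: orbit_comp_term0r.
  by case: i i0 => [[|[|i]]|i].
- move=> X Y c f g; apply: subsp_inj; apply: functional_extensionality_dep => -[[|[|i]]|i] /=.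
  + exact: comp_linr.
  + by rewrite -[RHS]/(c *: 0 + 0) scaler0 addr0.
  + by rewrite -[RHS]/(c *: 0 + 0) scaler0 addr0.
  + by rewrite -[RHS]/(c *: 0 + 0) scaler0 addr0.
Defined.

Lemma orb0_functor X Y (a : hom X Y) : orb0 (fmap orbit_functor a) = a.
Proof. exact: orb_mk0. Qed.
Lemma orbit_findim X Y : (forall X Y, findim (hom X Y)) -> short X Y ->
  findim (hom (X : O) (Y : O)).
Proof.
move=> fd XY; have [m [e eE]] := fd X Y; have [n [e' e'E]] := fd X (F 1 Y).
exists (m + n)%N, (fun l => match split l with inl i => orb_mk (e i) 0 | inr j => orb_mk 0 (e' j) end).
move=> f; have [c cE] := eE (orb0 f); have [c' c'E] := e'E (orb1 f).
exists (fun l => match split l with inl i => c i | inr j => c' j end).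
apply: (orb_ext XY).
- have sum0 (I : Type) (s : seq I) (G : I -> hom (X : O) (Y : O)) :
      orb0 (\sum_(i <- s) G i) = \sum_(i <- s) orb0 (G i).
    elim: s => [|i s IH]; first by rewrite !big_nil /orb0 comp0r.
    by rewrite !big_cons -IH -[G i]scale1r orb0_lin !scale1r.
  have scal c0 g : orb0 (c0 *: g) = c0 *: orb0 g by exact: compZr.
  rewrite sum0 big_split_ord /= [X in _ = _ + X]big1 ?addr0 => [|j _].
    rewrite cE; apply: eq_bigr => i _; rewrite (unsplitK (inl i)) scal orb_mk0.
    by [].
  by rewrite (unsplitK (inr j)) scal orb_mk0 scaler0.
- have sum1 (I : Type) (s : seq I) (G : I -> hom (X : O) (Y : O)) :
      orb1 (\sum_(i <- s) G i) = \sum_(i <- s) orb1 (G i).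
    by elim: s => [|i s IH]; [rewrite !big_nil|rewrite !big_cons -IH].
  rewrite sum1 big_split_ord /= [X in _ = X + _]big1 ?add0r => [|j _].
    rewrite c'E; apply: eq_bigr => i _; rewrite (unsplitK (inr i)).
    by [].
  rewrite (unsplitK (inl j)); exact: scaler0.
Qed.
End Orbit.

(** * The endomorphism algebra in the orbit category as a matrix algebra *)

Section MatrixAlgebra.
Variable k : fieldType.

Lemma alg_iso_inverse (A B : algebra k) (f : acar B -> acar A) :
  (forall c x y, f (c *: x + y) = c *: f x + f y) -> f (aone B) = aone A ->
  (forall x y, f (amul x y) = amul (f x) (f y)) -> injective f ->
  (forall a, exists b, f b = a) -> alg_iso A B.
Proof.
move=> fl f1 fM fi fs; pose g a := projT1 (cid (fs a)).
have gE a : f (g a) = a := projT2 (cid (fs a)).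
have gl : linear g by move=> c x y; apply: fi; rewrite fl !gE.
pose G : {linear acar A -> acar B} := HB.pack g
  (GRing.isLinear.Build k (acar A) (acar B) _ g gl).
exists G; split.
- by exists f => [x|x]; [exact: gE|apply: fi; exact: gE].
- by apply: fi; rewrite f1; exact: gE.
- by move=> x y; apply: fi; rewrite fM [f (G _)]gE [f (G x)]gE [f (G y)]gE.
Qed.

Variables (C D : lincat k) (F : zaction D).
Variables (iota : functor C D) (sh : functor D D) (tm : functor C C) (T P : C).
Hypotheses (iff : faithful iota) (ifu : full iota) (shf : faithful sh) (shu : full sh).
Notation A := (iota T).
Notation B := (sh (iota P)).
Variable theta : forall M, hom (F 1 (iota M)) (sh (iota (tm M))).
Hypothesis theta_nat : forall M M' (w : hom M M'),
  theta M' \oc fmap (F 1) (fmap iota w) = fmap sh (fmap iota (fmap tm w)) \oc theta M.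
Variables (V : D) (i1 : hom A V) (i2 : hom B V) (p1 : hom V A) (p2 : hom V B).
Hypotheses (pi1 : p1 \oc i1 = idm A) (pi2 : p2 \oc i2 = idm B)
  (pi12 : p1 \oc i2 = 0) (pi21 : p2 \oc i1 = 0) (ip : i1 \oc p1 + i2 \oc p2 = idm V).
Hypotheses (VV : short F V V) (BA : hom0 B A) (VFB : hom0 V (F 1 B)).
Hypothesis theta_inj : forall X : D, X = A \/ X = B ->
  forall f : hom X (F 1 A), theta T \oc f = 0 -> f = 0.
Hypothesis theta_surj : forall X : D, X = A \/ X = B ->
  forall g : hom X (sh (iota (tm T))), exists f : hom X (F 1 A), theta T \oc f = g.
Notation O := (orbit_category F).

Definition unmap M N (f : hom (iota M) (iota N)) : hom M N := projT1 (cid (ifu f)).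
Lemma unmapE M N (f : hom (iota M) (iota N)) : fmap iota (unmap f) = f.
Proof. exact: (projT2 (cid (ifu f))). Qed.
Definition unshift M N (f : hom (sh (iota M)) (sh (iota N))) : hom M N :=
  unmap (projT1 (cid (shu f))).
Lemma unshiftE M N (f : hom (sh (iota M)) (sh (iota N))) : fmap sh (fmap iota (unshift f)) = f.
Proof. by rewrite unmapE; exact: (projT2 (cid (shu f))). Qed.
Lemma iota_inj M N (f g : hom M N) : fmap iota f = fmap iota g -> f = g.
Proof. exact: faithful_inj. Qed.
Lemma shiota_inj M N (f g : hom M N) : fmap sh (fmap iota f) = fmap sh (fmap iota g) -> f = g.
Proof. by move=> /(faithful_inj shf)/iota_inj. Qed.

(** The row (xi, x) of the matrix as a single map out of [V]. Projecting to F A loses nothing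
    because no map leads from [V] to F B. *)
Definition tri_part (f : hom (V : O) (V : O)) := theta T \oc fmap (F 1) p1 \oc orb1 f.

Notation tgt := (sh (iota (tm T))).
Definition matrix_of_pair (a : hom V V) (t : hom V tgt) : ext_car iota sh tm T P :=
  (unmap (p1 \oc a \oc i1), t \oc i1, unshift (t \oc i2), p2 \oc a \oc i1,
   unshift (p2 \oc a \oc i2)).

Definition matrix_of (f : hom (V : O) (V : O)) : ext_car iota sh tm T P :=
  matrix_of_pair (orb0 f) (tri_part f).

Lemma comp_split X Y (g : hom V Y) (f : hom X V) :
  g \oc f = (g \oc i1) \oc (p1 \oc f) + (g \oc i2) \oc (p2 \oc f).
Proof. by rewrite -{1}[f]comp1l -ip compDl compDr -!compA. Qed.

Lemma orb1_split X (f : hom X (F 1 V)) : fmap (F 1) p2 \oc f = 0 ->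
  f = fmap (F 1) i1 \oc (fmap (F 1) p1 \oc f).
Proof.
move=> f2; rewrite compA -fmapM; have := congr1 (fun e => fmap (F 1) e \oc f) ip.
rewrite fmapD fmap1 comp1l compDl [fmap _ (i2 \oc p2)]fmapM -compA f2 comp0r addr0.
by move=> ->.
Qed.

(** The degree one part of [f] lands in F A, on which [g] acts through its entry from [A] to [A];
    naturality of [theta] rewrites that action as tau^-1 of the entry, the left action in the matrix
    algebra. *)
Lemma tri_part_comp f g :
  tri_part (g \oc f) = (tri_part g \oc i1) \oc (p1 \oc orb0 f) + (tri_part g \oc i2) \oc (p2 \oc orb0 f)
    + fmap sh (fmap iota (fmap tm (unmap (p1 \oc orb0 g \oc i1)))) \oc tri_part f.
Proof.
have f2 : fmap (F 1) p2 \oc orb1 f = 0 by exact: VFB.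
have o1 : orb1 (g \oc f) = orb1 g \oc orb0 f + fmap (F 1) (orb0 g) \oc orb1 f by exact: orb1_comp.
rewrite {1}/tri_part o1 compDr compA -/(tri_part g) comp_split; congr (_ + _).
transitivity (theta T \oc fmap (F 1) (p1 \oc orb0 g \oc i1) \oc (fmap (F 1) p1 \oc orb1 f)).
  by rewrite {1}(orb1_split f2) !fmapM !compA.
by rewrite -{1}(unmapE (p1 \oc orb0 g \oc i1)) theta_nat /tri_part !compA.
Qed.

Lemma matrix_of_pair_lin c a b t t' :
  matrix_of_pair (c *: a + b) (c *: t + t') = c *: matrix_of_pair a t + matrix_of_pair b t'.
Proof.
rewrite /matrix_of_pair ext_lin_tuple; congr (_, _, _, _, _).
- by apply: iota_inj; rewrite fmap_lin !unmapE comp_linr comp_linl.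
- by rewrite comp_linl.
- by apply: shiota_inj; rewrite !fmap_lin !unshiftE comp_linl.
- by rewrite comp_linr comp_linl.
- by apply: shiota_inj; rewrite !fmap_lin !unshiftE comp_linr comp_linl.
Qed.

Lemma matrix_of_lin c f g : matrix_of (c *: f + g) = c *: matrix_of f + matrix_of g.
Proof.
have tl : tri_part (c *: f + g) = c *: tri_part f + tri_part g.
  by rewrite /tri_part orb1_lin comp_linr.
by rewrite /matrix_of tl orb0_lin matrix_of_pair_lin.
Qed.

Lemma matrix_of_one : matrix_of (idm (V : O)) = ext_one iota sh tm T P.
Proof.
have t0 : tri_part (idm (V : O)) = 0 by rewrite /tri_part orb1_id comp0r.
rewrite /matrix_of /ext_one t0 orb0_id /matrix_of_pair !comp0l !comp1r; congr (_, _, _, _, _).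
- by apply: iota_inj; rewrite unmapE fmap1.
- by apply: shiota_inj; rewrite unshiftE !fmap0.
- by [].
- by apply: shiota_inj; rewrite unshiftE !fmap1.
Qed.

Lemma matrix_of_pair_mul a b t t' :
  matrix_of_pair (b \oc a) ((t' \oc i1) \oc (p1 \oc a) + (t' \oc i2) \oc (p2 \oc a)
    + fmap sh (fmap iota (fmap tm (unmap (p1 \oc b \oc i1)))) \oc t) =
  ext_mul (matrix_of_pair b t') (matrix_of_pair a t).
Proof.
(* Since there are no maps from [B] to [A], the degree zero parts are lower triangular. *)
have za : p1 \oc a \oc i2 = 0 by exact: BA.
have zb : p1 \oc b \oc i2 = 0 by exact: BA.
rewrite /matrix_of_pair /ext_mul; congr (_, _, _, _, _).
- apply: iota_inj; rewrite fmapM !unmapE.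
  by rewrite compA (comp_split (p1 \oc b)) zb comp0l addr0 !compA.
- rewrite !compDl unmapE unshiftE -!compA.
  by rewrite -[RHS]addrA [RHS]addrC.
- apply: shiota_inj; rewrite !fmapD !fmapM !unshiftE !compDl.
  by rewrite -!compA (compA p1 a) za !comp0r add0r [LHS]addrC.
- rewrite compA (comp_split (p2 \oc b)) unmapE unshiftE compDl -!compA.
  by [].
- apply: shiota_inj; rewrite !fmapM !unshiftE compA (comp_split (p2 \oc b)) compDl -!compA.
  by rewrite (compA p1 a) za !comp0r add0r.
Qed.

Lemma matrix_of_mul g f : matrix_of (g \oc f) = ext_mul (matrix_of g) (matrix_of f).
Proof.
have o0 : orb0 (g \oc f) = orb0 g \oc orb0 f by exact: orb0_comp.
by rewrite {1}/matrix_of tri_part_comp o0 matrix_of_pair_mul.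
Qed.

Lemma matrix_of_inj : injective matrix_of.
Proof.
have ml := matrix_of_lin; suff inj0 f : matrix_of f = 0 -> f = 0.
  move=> f g e; apply/eqP; rewrite -subr_eq0; apply/eqP/inj0.
  have := ml (-1) g f; rewrite !scaleN1r [- g + f]addrC e => ->; exact: addNr.
rewrite /matrix_of /matrix_of_pair => -[e1 e2 e3 e4 e5]; apply: (orb_ext VV).
- rewrite orb0_0; move: (orb0 f) e1 e4 e5 => a e1 e4 e5.
  have a1 : p1 \oc a \oc i1 = 0 by rewrite -(unmapE (p1 \oc _ \oc _)) e1 fmap0.
  have a2 : p2 \oc a \oc i2 = 0 by rewrite -(unshiftE (p2 \oc _ \oc _)) e5 !fmap0.
  have a3 : p1 \oc a \oc i2 = 0 by exact: BA.
  have b1 : p1 \oc a = 0 by rewrite -[_ \oc a]comp1r comp_split a1 a3 !comp0l addr0.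
  have b2 : p2 \oc a = 0 by rewrite -[_ \oc a]comp1r comp_split a2 e4 !comp0l addr0.
  by rewrite -[a]comp1l comp_split b1 b2 !comp0r addr0.
- have f2 : fmap (F 1) p2 \oc orb1 f = 0 by exact: VFB.
  have t2 : tri_part f \oc i2 = 0 by rewrite -(unshiftE (_ \oc i2)) e3 !fmap0.
  have b1 : fmap (F 1) p1 \oc orb1 f \oc i1 = 0.
    by apply: theta_inj; [left|rewrite !compA; exact: e2].
  have b2 : fmap (F 1) p1 \oc orb1 f \oc i2 = 0.
    by apply: theta_inj; [right|rewrite !compA; exact: t2].
  rewrite (orb1_split f2) -[_ \oc orb1 f]comp1r -ip compDr !compA b1 b2 !comp0l addr0 orb1_0.
  exact: comp0r.
Qed.

Lemma matrix_of_surj m : exists f, matrix_of f = m.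
Proof.
case: m => [[[[b xi] x] m] u].
have [y1 y1E] := theta_surj (or_introl erefl) xi.
have [y2 y2E] := theta_surj (or_intror erefl) (fmap sh (fmap iota x)).
exists (orb_mk (i1 \oc fmap iota b \oc p1 + i2 \oc m \oc p1 + i2 \oc fmap sh (fmap iota u) \oc p2)
  (fmap (F 1) i1 \oc (y1 \oc p1 + y2 \oc p2))).
have tp : tri_part (orb_mk (i1 \oc fmap iota b \oc p1 + i2 \oc m \oc p1 +
    i2 \oc fmap sh (fmap iota u) \oc p2) (fmap (F 1) i1 \oc (y1 \oc p1 + y2 \oc p2))) =
    xi \oc p1 + fmap sh (fmap iota x) \oc p2.
  rewrite /tri_part orb_mk1 -compA (compA (fmap (F 1) p1)) -fmapM pi1 fmap1 comp1l compDr.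
  by rewrite !compA y1E y2E.
rewrite /matrix_of tp orb_mk0 /matrix_of_pair !compDr !compDl !compA pi1 pi2 pi12 pi21 !comp1l !comp0l.
rewrite -!compA pi1 pi2 pi12 pi21 !comp1r !comp0r !addr0 !add0r; congr (_, _, _, _, _).
- by apply: iota_inj; rewrite unmapE.
- by apply: shiota_inj; rewrite unshiftE.
- by apply: shiota_inj; rewrite unshiftE.
Qed.

Lemma ext_alg_iso : alg_iso (ext_alg iota sh tm T P) (endalg (V : O)).
Proof.
apply: (@alg_iso_inverse (ext_alg iota sh tm T P) (endalg (V : O)) matrix_of).
- exact: matrix_of_lin.
- exact: matrix_of_one.
- exact: matrix_of_mul.
- exact: matrix_of_inj.
- exact: matrix_of_surj.
Qed.
End MatrixAlgebra.

(** * Rigidity *)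

Section PowerEquivalences.
Variables (k : fieldType) (C : lincat k) (F : zaction C).

Lemma pow_cancel i j (e : i + j = 0) :
  natiso (compfunctor (F i) (F j)) (idfunctor C).
Proof.
exists (fun X => pow0_inv F X \oc powD F e X); split=> [X|X Y f].
  apply: is_iso_comp (powD_iso F e X).
  by exists (pow0 F X); split; [exact: pow0_invr|exact: pow0_invl].
rewrite /= -compA powD_nat !compA; congr (_ \oc _).
apply: (iso_monic (pow0_iso F Y)).
by rewrite !compA pow0_invr comp1l (pow0_nat F f) -compA pow0_invr comp1r.
Qed.

Lemma pow_quasi_inverse i : quasi_inverse (F i) (F (- i)).
Proof. by split; apply: pow_cancel; rewrite ?addNr ?addrN. Qed.

Lemma powD_isomorphic i j n X : i + j = n -> isomorphic (F i (F j X)) (F n X).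
Proof. by move=> e; exists (powD F e X); exact: powD_iso. Qed.

Lemma pow0_isomorphic X : isomorphic (F 0 X) X.
Proof. by apply: isomorphic_sym; exists (pow0 F X); exact: pow0_iso. Qed.
End PowerEquivalences.

Section SerreSymmetry.
Variables (k : fieldType) (C : lincat k) (sh tau' : functor C C) (s : forall Y, hom (tau' Y) (sh Y) -> k).
Hypothesis fd : forall X Y : C, findim (hom X Y).
Hypothesis sS : forall Y, serre_pair (@s Y).

(** An equivalence carries Serre pairs to Serre pairs, and partners are unique. *)
Lemma serre_inverse_commute (G : functor C C) : faithful G -> full G -> esurj G ->
  (forall Y, isomorphic (G (sh Y)) (sh (G Y))) ->
  forall Y, isomorphic (tau' (G Y)) (G (tau' Y)).
Proof.
move=> Gf Gu Ge Gsh Y; have [t tS] := serre_pair_functor Gf Gu Ge (sS Y).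
have [t' t'S] := serre_pair_iso (isomorphic_refl _) (Gsh Y) tS.
by have [v [vi _]] := serre_pair_uniql fd t'S (sS (G Y)); exists v.
Qed.

Variable F : zaction C.
Hypotheses (shf : faithful sh) (shu : full sh) (she : esurj sh).
Hypothesis F1 : forall X, isomorphic (F 1 X) (sh (tau' X)).

Lemma pow_shift n X : isomorphic (F (Posz n) (sh X)) (sh (F (Posz n) X)).
Proof.
have c := serre_inverse_commute shf shu she (fun Y => isomorphic_refl (sh (sh Y))).
elim: n X => [|n IH] X.
  exact: isomorphic_trans (pow0_isomorphic F _)
    (isomorphic_sym (fmap_isomorphic sh (pow0_isomorphic F X))).
have e : Posz n + 1 = Posz n.+1 by lia.
apply: isomorphic_trans (isomorphic_sym (powD_isomorphic F (sh X) e)) _.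
apply: (@isomorphic_trans _ _ (F n (sh (F 1 X)))).
  apply: fmap_isomorphic; apply: isomorphic_trans (F1 _) _; apply: fmap_isomorphic.
  apply: isomorphic_trans (c X) _; exact: isomorphic_sym (F1 X).
apply: isomorphic_trans (IH _) _; apply: fmap_isomorphic; exact: powD_isomorphic.
Qed.

(* the 2-Calabi-Yau symmetry Hom(Y, F^n X[1]) ~ D Hom(X, F^(-n-1) Y[1]) *)
Lemma pow_serre_hom0 n X Y : hom0 Y (F (Posz n) (sh X)) -> hom0 X (F (- Posz n.+1) (sh Y)).
Proof.
move=> YX; set m := Posz n.+1.
apply: (hom0_functor (quasi_inverse_faithful (pow_quasi_inverse F m))).
have e : m + - m = 0 by rewrite addrN.
apply: hom0_isor (isomorphic_sym (natiso_isomorphic (sh Y) (pow_cancel F e))) _.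
suff h : hom0 (tau' Y) (F m X).
  by move=> f; apply: ((sS Y).2 _).1 => g; rewrite (h g) comp0r (linfunct0 (sS Y).1).
apply: (hom0_functor shf); apply: hom0_isol (F1 Y) _.
apply: hom0_isor (pow_shift n.+1 X) _.
have e1 : 1 + Posz n = m by rewrite /m; lia.
apply: hom0_isor (powD_isomorphic F (sh X) e1) _.
exact: (hom0_full (quasi_inverse_full (pow_quasi_inverse F 1)) YX).
Qed.
End SerreSymmetry.

Section Rigidity.
Variables (k : fieldType) (H : falgType k).
Implicit Types T P : modcat H.
Notation R := (regmod H).
Notation rv := (@reg_vec k H).

Definition reg_hom T (v : 'rV[k]_(mdim T)) : hom R T := projT1 (cid (reg_hom_exists v)).
Lemma reg_homE T (v : 'rV[k]_(mdim T)) x : mapp (reg_hom v) (rv x) = v *m mact T x.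
Proof. exact: (projT2 (cid (reg_hom_exists v))). Qed.
Lemma reg_hom1 T (v : 'rV[k]_(mdim T)) : mapp (reg_hom v) (rv 1) = v.
Proof. by rewrite reg_homE mact1 mulmx1. Qed.
Lemma reg_hom_lin T c (u v : 'rV[k]_(mdim T)) : reg_hom (c *: u + v) = c *: reg_hom u + reg_hom v.
Proof. by apply: reg_hom_ext; rewrite mapp_linl !reg_hom1. Qed.
Lemma reg_hom_act T (v : 'rV[k]_(mdim T)) a : reg_hom (v *m mact T a) = reg_hom v \oc lmul a.
Proof. by apply: reg_hom_ext; rewrite mapp_comp lmul_vec mulr1 !reg_homE mact1 mulmx1. Qed.

(** The kernel of [p] is projective, so [d] splits over it; by minimality the splitting is onto
    [P1], which forces [d] to be injective. *)
Lemma min_presentation_resolution P1 P0 T (d : hom P1 P0) (p : hom P0 T) : hereditary H ->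
  min_presentation d p -> short_resolution d p.
Proof.
move=> hH [P1p P0p [pT _] [dK dmin]].
have pe : epi p by move=> y; apply/(pT y).
have [Q [i [im iE]]] := kernel_exists p.
have [|e eE] := mono_factor (f := d) im.
  by move=> v; apply/iE/dK; exists v.
have ee : epi e.
  move=> q; have /dK[v vE] : mapp p (mapp i q) = 0 by apply/iE; exists q.
  by exists v; apply: im; rewrite -mapp_comp eE.
have [s sE] := hH _ _ i P0p im _ _ e (idm Q) ee.
have se : epi s.
  apply: dmin => y /iE[q <-]; exists q.
  by rewrite mapp_comp -eE mapp_comp -(mapp_comp e) sE mapp_id.
have es : s \oc e = idm P1.
  by apply: (epi_cancel se); rewrite -compA sE comp1r comp1l.
split=> // v w; rewrite -eE !mapp_comp => /im evw.
by rewrite -[v]mapp_id -[w]mapp_id -es !mapp_comp evw.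
Qed.

(** One half of the Auslander-Reiten formula: a functional on Hom(P1, T) that kills the maps
    extending along [d] defines a map from [T] to D Tr T, sending v to g |-> l(v g), with v viewed
    as a map from [H] to [T]. *)
Lemma tau_rigid_extension P1 P0 T (d : hom P1 P0) : projective P1 ->
  (forall h : hom T (dtr d), h = 0) -> forall b : hom P1 T, exists s : hom P0 T, s \oc d = b.
Proof.
move=> P1p hT b.
have pre_lin : linear (fun s : modhom P0 T => ((s : hom P0 T) \oc d : hom P1 T) : modhom P1 T).
  by move=> c s s'; exact: (@comp_linl _ (modcat H) _ _ _ c s s' d).
pose pre : {linear modhom P0 T -> modhom P1 T} := HB.pack
  (fun s : modhom P0 T => ((s : hom P0 T) \oc d : hom P1 T) : modhom P1 T)
  (GRing.isLinear.Build k (modhom P0 T) (modhom P1 T) _ _ pre_lin).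
case: (boolP ((b : modhom P1 T) \in limg (linfun pre))) => [/memv_imgP[s _ ->]|].
  by exists s; exact: esym (lfunE pre s).
move=> /separating_functional[l [ll lU lb]].
have ld (s : hom P0 T) : l (s \oc d : hom P1 T) = 0.
  by apply: lU; apply/memv_imgP; exists s; [exact: memvf|exact: esym (lfunE pre s)].
have phi_lin v : linear (fun g : star P1 => l (reg_hom v \oc (g : hom P1 R) : hom P1 T) : k^o).
  move=> c g g'; apply: etrans (ll _ _ _); congr l.
  exact: (@comp_linr _ (modcat H) _ _ _ c (reg_hom v) g g').
pose phi v : {linear star P1 -> k^o} := HB.pack
  (fun g : star P1 => l (reg_hom v \oc (g : hom P1 R) : hom P1 T) : k^o)
  (GRing.isLinear.Build k (star P1) k^o _ _ (phi_lin v)).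
have phiE v (g : star P1) : linfun (phi v) g = l (reg_hom v \oc (g : hom P1 R) : hom P1 T).
  exact: lfunE.
have phi_ker v : linfun (phi v) \in lker (nu_map d).
  rewrite memv_ker nu_mapE; apply/eqP/lfunP => g.
  by rewrite zero_lfunE comp_lfunE phiE star_mapE compA ld.
pose r : raction H (dtr_space d) :=
  RAction (@dtr_linl _ _ _ _ d) (@dtr_linr _ _ _ _ d) (@dtr_1 _ _ _ _ d) (@dtr_M _ _ _ _ d).
have [c u v|v a|h hE] := @hom_fun _ _ T (mod_of r) (fun v => mod_vec r (Subvs (phi_ker v))).
- rewrite -mod_vec_lin; congr mod_vec; apply: subvs_inj; apply/lfunP => g.
  rewrite [LHS]phiE reg_hom_lin comp_linl ll [RHS]add_lfunE [X in _ = X + _]scale_lfunE.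
  by rewrite !phiE.
- rewrite mod_vec_act; congr mod_vec; apply: subvs_inj; apply/lfunP => g.
  rewrite [LHS]phiE [RHS]comp_lfunE star_lmulE phiE reg_hom_act.
  by rewrite compA.
have l0 v (g : star P1) : l (reg_hom v \oc (g : hom P1 R) : hom P1 T) = 0.
  have := hE v; rewrite (hT h) mapp0l => /esym e.
  have e' : Subvs (phi_ker v) = 0 by apply: (@mod_vec_inj _ _ _ r); rewrite e mod_vec0.
  by rewrite -phiE -[linfun (phi v)]/(vsval (Subvs (phi_ker v))) e' zero_lfunE.
(* By a dual basis of [P1], every map to [T] is a sum of maps through [H], on which the separating
   functional is now known to vanish. *)
have [m [q [xi qx]]] := projective_dual_basis P1p.
case/eqP: lb; have -> : b = \sum_i reg_hom (mapp b (q i)) \oc xi i.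
  apply: hom_ext => v; rewrite mapp_suml.
  pose a i := projT1 (cid (reg_vec_surj (mapp (xi i) v))).
  have aE i : reg_vec (a i) = mapp (xi i) v := projT2 (cid (reg_vec_surj (mapp (xi i) v))).
  have {1}-> : v = \sum_i q i *m mact P1 (a i) by apply: qx => i; rewrite aE.
  rewrite mapp_sum; apply: eq_bigr => i _.
  by rewrite mapp_comp -aE reg_homE mapp_act.
by rewrite (linfunct_sum _ _ ll) big1// => i _; exact: l0.
Qed.

Lemma tau_rigid_hom0 T : hereditary H -> tau_rigid T ->
  hom0 (stalk H T) (shift H (stalk H T)).
Proof.
move=> hH [X [[P1 [P0 [d [p [mp XD]]]]] hX]].
have res := min_presentation_resolution hH mp; have [P1p P0p _ _] := mp.
have hT (h : hom T (dtr d)) : h = 0.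
  have [u [v [vu uv]]] := XD.
  by rewrite -[h]comp1l -uv -compA (hX (v \oc h)) comp0r.
apply: hom0_isol (resolution_isomorphic res) _.
exact: (@two_term_extension_hom0 _ _ _ _ d (shift_cplx (stalk_cplx T)) P0p P1p erefl
  (tau_rigid_extension P1p hT)).
Qed.
End Rigidity.

(** * The object T + P[1] *)

Section SplitProjection.
Variables (k : fieldType) (C : lincat k) (sh : functor C C).
Variables (R S K : C) (pi : hom R S) (i : hom S R) (j : hom K R) (s : hom R K).
Hypotheses (pii : pi \oc i = idm S) (ip : i \oc pi + j \oc s = idm R).
Variables (G : C) (v : hom G (sh R)).
Hypothesis vi : is_iso v.

Lemma split_projection_inj X (f : hom X G) : hom0 X (sh K) -> fmap sh pi \oc v \oc f = 0 -> f = 0.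
Proof.
move=> XK f0; apply: (iso_monic vi); rewrite comp0r.
rewrite -[v \oc f]comp1l -fmap1 -ip fmapD compDl !fmapM -!compA (compA (fmap sh pi)) f0.
by rewrite (XK (fmap sh s \oc (v \oc f))) !comp0r addr0.
Qed.

Lemma split_projection_surj X (g : hom X (sh S)) : exists f : hom X G, fmap sh pi \oc v \oc f = g.
Proof.
have [v' [_ vv']] := vi; exists (v' \oc (fmap sh i \oc g)).
by rewrite -compA (compA v) vv' comp1l compA -fmapM pii fmap1 comp1l.
Qed.
End SplitProjection.

Section ClusterObject.
Variables (k : fieldType) (H : falgType k).
Notation D := (dercat H).
Notation loc := (loc_functor (@quasi_iso k H)).
Notation sh := (shift H).
Notation st := (stalk H).
Hypothesis hH : hereditary H.
Variables (tau' : functor D D) (s : forall Y, hom (tau' Y) (sh Y) -> k).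
Hypothesis sS : forall Y, serre_pair (@s Y).
Hypothesis sn : forall Y Y' (u : hom Y Y') (w : hom (tau' Y') (sh Y)),
  s (fmap sh u \oc w) = s (w \oc fmap tau' u).
Variable F : zaction D.
Hypothesis Fn : natiso (F 1) (compfunctor sh tau').

Let fd := dercat_findim hH.

Lemma pow1_isomorphic (X : D) : isomorphic (F 1 X) (sh (tau' X)).
Proof. exact: natiso_isomorphic Fn. Qed.

Lemma bar_comparison M : exists v : hom (tau' (st M)) (two_term (bar_iota M)),
  is_iso v /\ forall f : hom (two_term (bar_iota M) : cplxcat H) (shift_cplx (stalk_cplx M)),
    s (fmap loc f \oc v) = bar_trace f.
Proof.
have [t [tS tE]] := bar_serre_pair M hH.
have [v [vi vE]] := serre_pair_uniql fd tS (sS (st M)).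
exists v; split=> // f; exact: etrans (vE _) (tE f).
Qed.
Definition bar_cmp M := projT1 (cid (bar_comparison M)).
Lemma bar_cmp_iso M : is_iso (bar_cmp M).
Proof. exact: (projT2 (cid (bar_comparison M))).1. Qed.
Lemma bar_cmp_trace M (f : hom (two_term (bar_iota M) : cplxcat H) (shift_cplx (stalk_cplx M))) :
  s (fmap loc f \oc bar_cmp M) = bar_trace f.
Proof. exact: (projT2 (cid (bar_comparison M))).2. Qed.

Lemma bar_cmp_nat M M' (w : hom M M') :
  fmap loc (bar_chain w) \oc bar_cmp M = bar_cmp M' \oc fmap tau' (fmap st w).
Proof.
apply: (@serre_compare_nat _ _ _ _ _ _ _ _ _ _
  (fun f => s (f \oc bar_cmp M)) (fun f => s (f \oc bar_cmp M')) _ _ _ _ (fmap sh (fmap st w)) (sS _)) => //.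
move=> f; have Cp := @bar_mod0_projective _ _ M'; have Zp := @bar_modZ_projective _ _ M' hH.
have [g gE] := loc_two_term_full Zp Cp f.
have e1 : fmap sh (fmap st w) \oc f =
    fmap loc (fmap (shift_cplxcat H) (fmap (stalk_cplxcat H) w) \oc g).
  rewrite gE; apply: etrans _ (esym (fmapM loc _ g)); congr (_ \oc _).
  exact: shift_loc_map.
have e2 : f \oc fmap loc (bar_chain w) = fmap loc (g \oc bar_chain w).
  rewrite gE; exact: esym (fmapM loc g _).
rewrite e1 e2; apply: etrans (bar_cmp_trace _) _; apply: etrans (esym (bar_cmp_trace _)).
exact: bar_trace_nat.
Qed.

Definition pow1_map := projT1 (cid Fn).
Lemma pow1_map_iso X : is_iso (pow1_map X).
Proof. exact: (projT2 (cid Fn)).1. Qed.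
Lemma pow1_map_nat X Y (f : hom X Y) :
  pow1_map Y \oc fmap (F 1) f = fmap sh (fmap tau' f) \oc pow1_map X.
Proof. exact: (projT2 (cid Fn)).2. Qed.

(** F M is the shifted bar complex up to isomorphism; what follows is its projection to the summand
    given by tau^-1 M. The kernel is a summand K[1] that admits no map from T or P[1]. *)
Definition tau_inv_cmp M : hom (F 1 (st M)) (sh (st (tau_inv H M))) :=
  fmap sh (fmap loc (bar_proj M)) \oc (fmap sh (bar_cmp M) \oc pow1_map (st M)).

Lemma tau_inv_cmp_nat M M' (w : hom M M') :
  tau_inv_cmp M' \oc fmap (F 1) (fmap st w) = fmap sh (fmap st (fmap (tau_inv H) w)) \oc tau_inv_cmp M.
Proof.
have e : fmap loc (bar_proj M') \oc fmap loc (bar_chain w) =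
    fmap st (fmap (tau_inv H) w) \oc fmap loc (bar_proj M).
  apply: etrans (esym (fmapM loc _ _)) _; apply: etrans (fmapM loc _ _).
  by congr fmap; exact: bar_proj_nat.
have step (C : lincat k) (G : functor C C) (X X' Y Y' Z Z' W W' : C) (x : hom X X')
    (f : hom X (G Y)) (f' : hom X' (G Y')) (y : hom Y Y') (v : hom Y Z) (v' : hom Y' Z')
    (r : hom Z Z') (p : hom Z W) (p' : hom Z' W') (c : hom W W') :
    f' \oc x = fmap G y \oc f -> r \oc v = v' \oc y -> p' \oc r = c \oc p ->
    fmap G p' \oc (fmap G v' \oc f') \oc x = fmap G c \oc (fmap G p \oc (fmap G v \oc f)).
  move=> h0 h1 h2; rewrite -!compA h0 (compA (fmap G v')) -fmapM -h1 fmapM -!compA.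
  by rewrite (compA (fmap G p')) -fmapM h2 fmapM -compA.
exact: (step _ sh _ _ _ _ _ _ _ _ _ _ _ _ _ _ _ _ _ _ (pow1_map_nat (fmap st w)) (bar_cmp_nat w) e).
Qed.

Lemma tau_inv_cmp_inj M (X : D) (f : hom X (F 1 (st M))) :
  (forall K, below 2 K -> hom0 X K) -> tau_inv_cmp M \oc f = 0 -> f = 0.
Proof.
have [K [j [r [i [Kb pii ip]]]]] := bar_split hH M; move=> XK.
apply: (split_projection_inj ip).
  by apply: is_iso_comp (pow1_map_iso _); apply: fmap_iso; exact: bar_cmp_iso.
by apply: XK; exact: (@below_shift _ _ 1).
Qed.

Lemma tau_inv_cmp_surj M (X : D) (g : hom X (sh (st (tau_inv H M)))) :
  exists f : hom X (F 1 (st M)), tau_inv_cmp M \oc f = g.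
Proof.
have [K [j [r [i [Kb pii ip]]]]] := bar_split hH M.
apply: (split_projection_surj pii).
by apply: is_iso_comp (pow1_map_iso _); apply: fmap_iso; exact: bar_cmp_iso.
Qed.

Lemma reindex_shift_isomorphic j (Y : D) : isomorphic (reindex H j (sh Y)) (sh (reindex H j Y)).
Proof.
apply: isomorphic_trans (fmap_isomorphic _ (shift_reindex_iso _)) _.
apply: isomorphic_trans (reindexD_iso _ _ _) _.
apply: isomorphic_trans _ (isomorphic_sym (shift_reindex_iso _)).
rewrite addrC; exact: isomorphic_sym (reindexD_iso _ _ _).
Qed.

(** The inverse translate of a module is a complex in degrees -1 and 0, and the translation commutes
    with shifts, so checking modules is enough. Consequently each application of F raises the bound
    by one. *)
Lemma tau_inverse_below m (X : D) : below m X -> below m (tau' X).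
Proof.
move=> bX; apply: (bX (fun X => below m (tau' X))).
- by move=> Y Z YZ; apply: below_iso; exact: fmap_isomorphic.
- by move=> Y Z Z' YZ; apply: below_sum; exact: fmap_dsum2.
- by move=> Y Y0; apply: below_zero; rewrite /is_zero -fmap1 Y0 fmap0.
- move=> N j mj.
  apply: below_iso (isomorphic_sym (serre_inverse_commute fd sS (@reindex_faithful _ H j)
    (@reindex_full _ H j) (@reindex_esurj _ H j) (reindex_shift_isomorphic j) (st N))) _.
  apply: (@below_le _ _ (j + 0)); first by rewrite addr0.
  apply: below_reindex; apply: below_iso _ (bar_below hH N); apply: isomorphic_sym.
  by exists (bar_cmp N); exact: bar_cmp_iso.
Qed.

Lemma pow_below n m (X : D) : below m X -> below (Posz n + m) (F (Posz n) X).
Proof.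
elim: n m X => [|n IH] m X bX.
  by rewrite add0r; apply: below_iso (isomorphic_sym (pow0_isomorphic F X)) _.
have e : Posz n + 1 = Posz n.+1 by lia.
apply: below_iso (powD_isomorphic F X e) _.
have -> : Posz n.+1 + m = Posz n + (1 + m) by lia.
apply: IH; apply: below_iso (isomorphic_sym (pow1_isomorphic X)) _.
by apply: below_shift; exact: tau_inverse_below.
Qed.

Variables (T P : modcat H).
Hypotheses (Trigid : hom0 (st T) (sh (st T))) (Pp : projective P) (PT : forall f : hom P T, f = 0).
Notation A := (st T).
Notation B := (sh (st P)).
Variable V : D.
Hypothesis VAB : is_direct_sum2 V A B.

Lemma summand_below0 : below 0 V.
Proof.
apply: below_sum VAB _ _; first exact: below_stalk0.
by apply: (@below_le _ _ 1) => //; apply: (@below_shift _ _ 0); exact: below_stalk0.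
Qed.

Lemma object_below2_hom0 (X : D) : below 2 X -> hom0 V X.
Proof.
move=> bX; apply: hom0_suml VAB _ _; first exact: stalk_below_hom0.
exact: shift_projective_below_hom0.
Qed.

Lemma shifted_projective_hom0 : hom0 B A.
Proof.
apply: hom0_isol (isomorphic_sym (shift_reindex_iso _)) _; apply: hom0_reindexl.
exact: projective_reindex_hom0.
Qed.

Lemma projective_rigid_hom0 : hom0 B (sh A).
Proof.
apply: hom0_full (@shift_full _ H) _ => f.
by have [g <-] := stalk_full hH f; rewrite (PT g) fmap0.
Qed.

Lemma object_pow1_hom0 : hom0 V (F 1 B).
Proof.
apply: object_below2_hom0; apply: (@pow_below 1 1); apply: (@below_shift _ _ 0).
exact: below_stalk0.
Qed.

(** Positive powers move V[1] into [below 2], which receives nothing from [V]. For n = 0 what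
    remains is Ext^1(T, T) = 0 and Hom(P, T) = 0. *)
Lemma object_rigid_nonneg n : hom0 V (F (Posz n) (sh V)).
Proof.
have bV := below_shift summand_below0.
case: n => [|n]; last first.
  apply: object_below2_hom0.
  by apply: (@below_le _ _ (Posz n.+1 + (1 + 0))); [lia|exact: (@pow_below n.+1 _ _ bV)].
apply: hom0_isor (isomorphic_sym (pow0_isomorphic F _)) _.
have bB : below 2 (sh B).
  by apply: (@below_shift _ _ 1); apply: (@below_shift _ _ 0); exact: below_stalk0.
have sV := fmap_dsum2 sh VAB.
have VB : hom0 V (sh B) by exact: object_below2_hom0.
apply: hom0_sumr sV _ VB.
apply: hom0_suml VAB Trigid _; exact: projective_rigid_hom0.
Qed.

Lemma object_rigid n : hom0 V (F n (sh V)).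
Proof.
case: n => n; first exact: object_rigid_nonneg.
rewrite NegzE.
exact: (@pow_serre_hom0 _ _ _ _ _ fd sS F (@shift_faithful _ H) (@shift_full _ H)
  (@shift_esurj _ H) pow1_isomorphic n V V (@object_rigid_nonneg n)).
Qed.

Lemma object_short : short F V V.
Proof.
move=> n n0 n1; case: n n0 n1 => n n0 n1.
  apply: object_below2_hom0; apply: (@below_le _ _ (Posz n + 0)).
    by case: n n0 n1 => [|[|n]] //; lia.
  exact: (@pow_below n _ _ summand_below0).
(* The symmetry is formulated for shifted targets, so [V] is written as Y[1] before negative powers
   are traded for nonnegative ones. *)
have [Y YV] := @shift_esurj _ H V.
apply: hom0_isor (fmap_isomorphic (F (Negz n)) YV) _; rewrite NegzE.
suff h : hom0 Y (F (Posz n) (sh V)).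
  exact: (@pow_serre_hom0 _ _ _ _ _ fd sS F (@shift_faithful _ H) (@shift_full _ H)
    (@shift_esurj _ H) pow1_isomorphic n V Y h).
apply: (hom0_functor (@shift_faithful _ H)).
apply: hom0_isol (isomorphic_sym YV) _; apply: object_below2_hom0.
apply: (@below_le _ _ (1 + (Posz n + (1 + 0)))); first by lia.
exact: (below_shift (@pow_below n _ _ (below_shift summand_below0))).
Qed.

Lemma cluster_matrix_algebra_iso :
  alg_iso (cluster_matrix_algebra T P) (endalg (V : orbit_category F)).
Proof.
have [i1 [i2 [p1 [p2 [pi1 pi2 pi12 pi21 ip]]]]] := (dsum2P V A B).1 VAB.
have cl (X : D) : X = A \/ X = B -> forall K, below 2 K -> hom0 X K.
  case=> -> K Kb; first exact: stalk_below_hom0.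
  exact: shift_projective_below_hom0.
apply: (@ext_alg_iso _ _ _ F st sh (tau_inv H) T P (@stalk_faithful _ H hH) (@stalk_full _ H hH)
  (@shift_faithful _ H) (@shift_full _ H) tau_inv_cmp tau_inv_cmp_nat V i1 i2 p1 p2
  pi1 pi2 pi12 pi21 ip object_short shifted_projective_hom0 object_pow1_hom0).
- by move=> X XAB f; apply: tau_inv_cmp_inj; exact: cl.
- by move=> X XAB g; exact: tau_inv_cmp_surj.
Qed.
End ClusterObject.

(** * Krull-Schmidt *)

Section EndomorphismPolynomials.
Variables (k : fieldType) (C : lincat k) (X : C) (f : hom X X).

Definition hpow n : hom X X := iter n (comp f) (idm X).
Definition peval (p : {poly k}) : hom X X := \sum_(i < size p) p`_i *: hpow i.

Lemma pevalE n (p : {poly k}) : (size p <= n)%N -> peval p = \sum_(i < n) p`_i *: hpow i.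
Proof.
move=> pn; rewrite /peval (big_ord_widen n (fun i => p`_i *: hpow i) pn).
rewrite [RHS](bigID (fun i : 'I_n => (i < size p)%N)) /= [X in _ = _ + X]big1 ?addr0// => i.
by rewrite -leqNgt => pi; rewrite nth_default// scale0r.
Qed.

Lemma peval_lin c p q : peval (c *: p + q) = c *: peval p + peval q.
Proof.
have pn := leq_maxl (size p) (size q); have qn := leq_maxr (size p) (size q).
have n1 : (size (c *: p + q)%R <= maxn (size p) (size q))%N.
  apply: leq_trans (size_polyD _ _) _; rewrite geq_max qn andbT.
  exact: leq_trans (size_scale_leq _ _) pn.
rewrite (pevalE n1) (pevalE pn) (pevalE qn) scaler_sumr -big_split.
by apply: eq_bigr => i _ /=; rewrite coefD coefZ scalerDl scalerA.
Qed.

Lemma pevalC c : peval c%:P = c *: idm X.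
Proof.
by rewrite (@pevalE 1) ?size_polyC ?leq_b1// big_ord_recl big_ord0 addr0 coefC eqxx.
Qed.

Lemma pevalMX p : peval (p * 'X) = f \oc peval p.
Proof.
have pn : (size (p * 'X)%R <= (size p).+1)%N.
  by apply: leq_trans (size_polyMleq _ _) _; rewrite size_polyX addn2.
rewrite (pevalE pn) big_ord_recl coefMX eqxx scale0r add0r comp_sumr.
by apply: eq_bigr => i _; rewrite coefMX /= compZr.
Qed.

Lemma pevalM p q : peval (p * q) = peval p \oc peval q.
Proof.
have pevalD a b : peval (a + b) = peval a + peval b.
  by have := peval_lin 1 a b; rewrite !scale1r.
elim/poly_ind: p => [|p c IH].
  by rewrite mul0r -polyC0 pevalC scale0r comp0l.
rewrite mulrDl mulrAC !pevalD !pevalMX IH pevalC compDl compA; congr (_ + _).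
rewrite mul_polyC compZl comp1l -[c *: q]addr0 peval_lin -polyC0 pevalC scale0r.
exact: addr0.
Qed.

Lemma pevalXn n : peval 'X^n = hpow n.
Proof.
elim: n => [|n IH]; first by rewrite expr0 -polyC1 pevalC scale1r.
by rewrite exprSr pevalMX IH.
Qed.

(** The first n + 1 powers of [f] are combinations of n maps, so the matrix of coefficients has a
    nonzero left kernel. *)
Lemma annihilating_poly : findim (hom X X) -> exists2 p, p != 0 & peval p = 0.
Proof.
move=> [n [e eE]]; pose c i := projT1 (cid (eE (hpow i))).
have cE i : hpow i = \sum_j c i j *: e j := projT2 (cid (eE (hpow i))).
pose A := \matrix_(i < n.+1, j < n) c i j.
have : kermx A != 0.
  rewrite -mxrank_eq0 mxrank_ker subn_eq0 -ltnNge ltnS; exact: rank_leq_col.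
case/rowV0Pn=> v /sub_kermxP vA v0; exists (rVpoly v).
  by apply: contra v0 => /eqP v0; rewrite -[v]rVpolyK v0 linear0.
rewrite (@pevalE n.+1) ?size_poly//.
transitivity (\sum_j (v *m A) 0 j *: e j); last first.
  by rewrite vA big1// => j _; rewrite mxE scale0r.
transitivity (\sum_(i < n.+1) \sum_j (v 0 i * c i j) *: e j).
  apply: eq_bigr => i _; rewrite coef_rVpoly_ord cE scaler_sumr.
  by apply: eq_bigr => j _; rewrite scalerA.
rewrite exchange_big; apply: eq_bigr => j _ /=; rewrite mxE scaler_suml.
by apply: eq_bigr => i _; rewrite mxE.
Qed.

Definition trivial_idempotents := forall e : hom X X, e \oc e = e -> e = 0 \/ e = idm X.

(* Fitting: a polynomial annihilating f is q X^m with q coprime to X^m *)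
Lemma iso_or_nilpotent : findim (hom X X) -> trivial_idempotents ->
  is_iso f \/ exists n, hpow n = 0.
Proof.
move=> fd tid; have [p p0 pf] := annihilating_poly fd.
have [m [q qr pE]] := multiplicity_XsubC p 0; rewrite p0 /= in qr.
rewrite polyC0 subr0 in pE.
(* The exponent m + 1 leaves a factor [f] to invert even when m = 0. *)
have /Bezout_eq1_coprimepP[[u v] /= uv] : coprimep q ('X^(m.+1)).
  by apply: coprimep_expr; have := coprimep_XsubC q 0; rewrite polyC0 subr0 qr.
have pX : peval (q * 'X^(m.+1)) = 0.
  by rewrite exprSr mulrA -pE pevalMX pf comp0r.
have e1 : peval (u * q) + peval (v * 'X^(m.+1)) = idm X.
  have := peval_lin 1 (u * q) (v * 'X^(m.+1)); rewrite !scale1r uv => <-.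
  by rewrite -polyC1 pevalC scale1r.
have ee : peval (u * q) \oc peval (u * q) = peval (u * q).
  rewrite -[RHS]comp1r -e1 compDr -[in X in _ = _ + X]pevalM.
  have -> : u * q * (v * 'X^(m.+1)) = u * v * (q * 'X^(m.+1)) by rewrite mulrACA.
  by rewrite [peval (u * v * _)]pevalM pX comp0r addr0.
case: (tid _ ee) => [e0|e0].
- left; rewrite e0 add0r in e1; exists (peval (v * 'X^m)).
  rewrite -[in X in _ /\ X]pevalMX -mulrA -exprSr e1; split=> //.
  have fE : f = peval 'X by rewrite -['X]expr1 pevalXn /hpow /= comp1r.
  by rewrite {1}fE -pevalM -mulrA -exprSr e1.
- right; exists m.+1; rewrite -pevalXn -[LHS]comp1l -e0 -pevalM -mulrA pevalM pX.
  exact: comp0r.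
Qed.

(** The inverse is the finite geometric series in [f]. *)
Lemma nilpotent_sub_iso n : hpow n = 0 -> is_iso (idm X - f).
Proof.
have comm m : hpow m \oc f = f \oc hpow m.
  by elim: m => [|m IH]; rewrite ?comp1l ?comp1r// /hpow /= -compA -/(hpow m) IH.
have tel m : (idm X - f) \oc (\sum_(i < m) hpow i) = idm X - hpow m.
  elim: m => [|m IH]; first by rewrite big_ord0 comp0r subrr.
  by rewrite big_ord_recr compDr IH compDl comp1l compNl addrA subrK.
move=> fn; have c : (\sum_(i < n) hpow i) \oc (idm X - f) = (idm X - f) \oc (\sum_(i < n) hpow i).
  rewrite compDr compNr comp1r compDl compNl comp1l comp_suml comp_sumr; congr (_ - _).
  by apply: eq_bigr => i _; exact: comm.
by exists (\sum_(i < n) hpow i); rewrite c tel fn subr0.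
Qed.
End EndomorphismPolynomials.

Section KrullSchmidt.
Variables (k : fieldType) (C : lincat k).
Implicit Types X Y Z : C.

Definition split_idempotent X (e : hom X X) :=
  exists Y (j : hom Y X) (q : hom X Y), q \oc j = idm Y /\ j \oc q = e.
Definition idempotents_split X := forall e : hom X X, e \oc e = e -> split_idempotent e.
Definition retract Z X := exists (i : hom Z X) (p : hom X Z), p \oc i = idm Z.

Lemma summand_retract Z X : summand Z X -> retract Z X.
Proof. by move=> [Y /dsum2P[i1 [i2 [p1 [p2 [pi _ _ _ _]]]]]]; exists i1, p1. Qed.

Lemma idem_compl X (e : hom X X) : e \oc e = e -> (idm X - e) \oc (idm X - e) = idm X - e.
Proof.
by move=> ee; rewrite compDl comp1l compNl compDr comp1r compNr ee subrr subr0.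
Qed.

Lemma complement_zero X Y Z (j : hom Y X) (q : hom X Y) (j' : hom Z X) (q' : hom X Z) :
  q \oc j = idm Y -> q' \oc j' = idm Z -> j' \oc q' = idm X - j \oc q ->
  is_direct_sum2 X Y Z.
Proof.
move=> qj qj' jq'.
have e1 : q \oc (idm X - j \oc q) = 0 by rewrite compDr comp1r compNr compA qj comp1l subrr.
have e2 : (idm X - j \oc q) \oc j = 0 by rewrite compDl comp1l compNl -compA qj comp1r subrr.
apply/dsum2P; exists j, j', q, q'; split=> //.
- have -> : q \oc j' = q \oc (j' \oc q') \oc j' by rewrite -!compA qj' comp1r.
  by rewrite jq' e1 comp0l.
- have -> : q' \oc j = q' \oc ((j' \oc q') \oc j) by rewrite !compA qj' comp1l.
  by rewrite jq' e2 comp0r.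
- by rewrite jq' addrC subrK.
Qed.

Lemma split_complement X Y (j : hom Y X) (q : hom X Y) : idempotents_split X -> q \oc j = idm Y ->
  exists Z (j' : hom Z X) (q' : hom X Z),
    [/\ is_direct_sum2 X Y Z, q' \oc j' = idm Z & j' \oc q' = idm X - j \oc q].
Proof.
move=> Xs qj; have ee : (j \oc q) \oc (j \oc q) = j \oc q by rewrite -compA (compA q) qj comp1l.
have [Z [j' [q' [qj' jq']]]] := Xs _ (idem_compl ee).
by exists Z, j', q'; split=> //; exact: complement_zero qj qj' jq'.
Qed.

Lemma indecomposable_trivial X : indecomposable X -> idempotents_split X -> trivial_idempotents X.
Proof.
move=> [_ Xi] Xs e ee; have [Y [j [q [qj jq]]]] := Xs e ee.
have [Z [j' [q' [s2 qj' jq']]]] := split_complement Xs qj.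
rewrite jq in jq'.
case: (Xi _ _ s2) => [Y0|Z0].
  by left; rewrite -jq -[q]comp1l Y0 comp0l comp0r.
right; apply/eqP; rewrite eq_sym -subr_eq0 -jq' -[q']comp1l Z0 comp0l comp0r.
exact: eqxx.
Qed.

Lemma trivial_indecomposable X : ~ is_zero X -> trivial_idempotents X -> indecomposable X.
Proof.
move=> X0 Xt; split=> // Y Z /dsum2P[i1 [i2 [p1 [p2 [e1 e2 e12 e21 s]]]]].
have ee : (i1 \oc p1) \oc (i1 \oc p1) = i1 \oc p1 by rewrite -compA (compA p1) e1 comp1l.
case: (Xt _ ee) => e; [left|right].
  have h : p1 \oc (i1 \oc p1) \oc i1 = idm Y by rewrite compA e1 comp1l e1.
  by rewrite /is_zero -h e comp0r comp0l.
have h : p2 \oc (i1 \oc p1) \oc i2 = idm Z by rewrite e comp1r e2.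
by rewrite /is_zero -h -!compA e12 !comp0r.
Qed.

Lemma idempotents_split_retract Z X : retract Z X -> idempotents_split X -> idempotents_split Z.
Proof.
move=> [i [p pi]] Xs e ee.
have [|Y [j [q [qj jq]]]] := Xs (i \oc e \oc p).
  by rewrite -!compA (compA p) pi comp1l (compA e) ee.
have je : i \oc (e \oc (p \oc j)) = j by rewrite !compA -jq -compA qj comp1r.
have ipj : i \oc (p \oc j) = j by rewrite -{1}je (compA p) pi comp1l.
exists Y, (p \oc j), (q \oc i); split; last first.
  by rewrite -compA (compA j) jq !compA pi comp1l -compA pi comp1r.
by rewrite -compA ipj.
Qed.

Lemma findim_retract Z X : retract Z X -> findim (hom X X) -> findim (hom Z Z).
Proof.
move=> [i [p pi]]; apply: (@findim_surj _ _ _ (fun f : hom X X => p \oc f \oc i)).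
  by move=> c f g; rewrite comp_linr comp_linl.
move=> f; exists (i \oc f \oc p).
by rewrite !compA pi comp1l -compA pi comp1r.
Qed.

(** Locality of the endomorphism ring: after multiplication by the inverse of the sum, the first
    term is invertible or nilpotent, and in the latter case the remaining sum is invertible. *)
Lemma sum_iso X n (f : 'I_n -> hom X X) : findim (hom X X) -> trivial_idempotents X ->
  ~ is_zero X -> is_iso (\sum_j f j) -> exists j, is_iso (f j).
Proof.
move=> fd Xt X0; elim: n f => [|n IH] f.
  rewrite big_ord0 => -[g [g0 _]]; case: X0.
  by rewrite /is_zero -g0 comp0r.
rewrite big_ord_recl => -[g [gf fg]].
set r := \sum_(i < n) _ in gf fg; have sI : is_iso (f ord0 + r) by exists g.
case: (iso_or_nilpotent (g \oc f ord0) fd Xt) => [gi|[m gm]].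
  exists ord0.
  have -> : f ord0 = (f ord0 + r) \oc (g \oc f ord0) by rewrite compA fg comp1l.
  exact: is_iso_comp sI gi.
have ri : is_iso r.
  have -> : r = (f ord0 + r) \oc (idm X - g \oc f ord0).
    by rewrite compDr comp1r compNr compA fg comp1l [f ord0 + r]addrC addrK.
  exact: is_iso_comp sI (nilpotent_sub_iso gm).
by have [j ji] := IH _ ri; exists (lift ord0 j).
Qed.

(** The identity of [Z] is the sum of its passages through the [Y j], so one passage is invertible.
    This makes [Z] a retract of that [Y j], hence isomorphic to it. *)
Lemma krull_schmidt X n (Y : 'I_n -> C) Z : is_direct_sum X Y ->
  (forall j, trivial_idempotents (Y j)) -> retract Z X -> ~ is_zero Z ->
  trivial_idempotents Z -> findim (hom Z Z) -> exists j, isomorphic Z (Y j).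
Proof.
move=> [i [p [pi pi0 s]]] Yt [iZ [pZ piZ]] Z0 Zt fd.
have [j [g [g1 g2]]] : exists j, is_iso ((pZ \oc i j) \oc (p j \oc iZ)).
  apply: sum_iso => //; have -> : \sum_j (pZ \oc i j) \oc (p j \oc iZ) = idm Z.
    rewrite -piZ -[iZ in RHS]comp1l -s comp_suml comp_sumr.
    by apply: eq_bigr => j _; rewrite !compA.
  exact: is_iso_id.
pose a := p j \oc iZ; pose b := g \oc (pZ \oc i j).
have ba : b \oc a = idm Z by rewrite /b -compA.
exists j; exists a; exists b; split=> //.
have ee : (a \oc b) \oc (a \oc b) = a \oc b by rewrite -compA (compA b) ba comp1l.
case: (Yt j _ ee) => // e; case: Z0.
have h : b \oc (a \oc b) \oc a = idm Z by rewrite compA ba comp1l ba.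
by rewrite /is_zero -h e comp0r comp0l.
Qed.

Lemma num_summands_uniq X m n : num_summands X m -> num_summands X n -> m = n.
Proof.
have half p q : num_summands X p -> num_summands X q -> (p <= q)%N.
  move=> [Y [Y1 Yp _]] [Y' [_ _ Y'c]].
  have ex j := Y'c (Y j) (Y1 j).1 (Y1 j).2.
  pose g j := projT1 (cid (ex j)).
  have gE j : isomorphic (Y j) (Y' (g j)) := projT2 (cid (ex j)).
  have gi : injective g.
    move=> i j gij; apply: Yp; apply: isomorphic_trans (gE i) _; rewrite gij.
    exact: isomorphic_sym.
  by have := leq_card g gi; rewrite !card_ord.
by move=> Xm Xn; apply/eqP; rewrite eqn_leq !half.
Qed.

Lemma basic_num_summands X n (Y : 'I_n -> C) : findim (hom X X) -> idempotents_split X ->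
  is_direct_sum X Y -> (forall j, indecomposable (Y j)) -> pairwise_nonisomorphic Y ->
  num_summands X n.
Proof.
move=> fd Xs XY Yi Yp; have [i [p [pi pi0 s]]] := XY.
have Yr j : retract (Y j) X by exists (i j), (p j).
exists Y; split=> // [j|Z Zi ZX]; first by split=> //; have [Z [_ [_ [s2 _ _]]]] := split_complement Xs (pi j); exists Z.
have Zr := summand_retract ZX.
apply: (krull_schmidt XY _ Zr Zi.1 _ (findim_retract Zr fd)).
  by move=> j; exact: indecomposable_trivial (Yi j) (idempotents_split_retract (Yr j) Xs).
exact: indecomposable_trivial Zi (idempotents_split_retract Zr Xs).
Qed.

(* With n = e - e' and n X n = 0 the element u = e e' + (1 - e)(1 - e') is
   1 + n(2 e' - 1), hence invertible, and conjugates e' to e. *)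
Lemma split_idempotent_conj X (e e' : hom X X) : e \oc e = e -> e' \oc e' = e' ->
  (forall x, (e - e') \oc x \oc (e - e') = 0) -> split_idempotent e' -> split_idempotent e.
Proof.
move=> ee ee' nn [Y [j [q [qj jq]]]].
pose u := e \oc e' + (idm X - e) \oc (idm X - e').
have eu : e \oc u = u \oc e'.
  have z1 : e \oc (idm X - e) = 0 by rewrite compDr comp1r compNr ee subrr.
  have z2 : (idm X - e') \oc e' = 0 by rewrite compDl comp1l compNl ee' subrr.
  rewrite /u compDr [RHS]compDl (compA e e) ee -(compA e e') ee' (compA e (idm X - e)) z1.
  by rewrite comp0l -compA z2 comp0r.
pose v := u - idm X.
have vE : v = (e - e') \oc (e' + e' - idm X).
  have l : (idm X - e) \oc (idm X - e') = idm X - e' + (e \oc e' - e).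
    by rewrite compDl comp1l compNl compDr comp1r compNr opprB.
  have r : (e - e') \oc (e' + e' - idm X) = e \oc e' + e \oc e' - e - e'.
    by rewrite compDl compNl !compDr !compNr !comp1r ee' addrK.
  rewrite r /v /u l -[idm X - e' + _]addrA [idm X + _]addrC !addrA addrK.
  by rewrite (addrAC _ (- e')) [LHS]addrAC.
have vv : v \oc v = 0 by rewrite {2}vE compA {1}vE -(compA (e - e')) compA nn comp0l.
exists Y, (u \oc j), (q \oc (idm X - v)).
have uv : u = idm X + v by rewrite /v addrC subrK.
have wu : (idm X - v) \oc u = idm X.
  by rewrite uv compDl comp1l compNl compDr comp1r vv addr0 addrK.
have uw : u \oc (idm X - v) = idm X.
  by rewrite uv compDl comp1l compDr comp1r compNr vv oppr0 addr0 subrK.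
split; first by rewrite -!compA (compA _ u) wu comp1l.
by rewrite -compA (compA j) jq compA -eu -compA uw comp1r.
Qed.

Lemma split_idempotent_dsum X A B Y Y1 Y2 (i1 : hom A X) (i2 : hom B X) (p1 : hom X A) (p2 : hom X B)
    (e1 : hom A A) (e2 : hom B B) :
  p1 \oc i1 = idm A -> p2 \oc i2 = idm B -> p1 \oc i2 = 0 -> p2 \oc i1 = 0 ->
  (exists (j : hom Y1 A) (q : hom A Y1), q \oc j = idm Y1 /\ j \oc q = e1) ->
  (exists (j : hom Y2 B) (q : hom B Y2), q \oc j = idm Y2 /\ j \oc q = e2) ->
  is_direct_sum2 Y Y1 Y2 -> split_idempotent (i1 \oc e1 \oc p1 + i2 \oc e2 \oc p2).
Proof.
move=> pi1 pi2 pi12 pi21 [j1 [q1 [qj1 jq1]]] [j2 [q2 [qj2 jq2]]].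
move=> /dsum2P[l1 [l2 [r1 [r2 [rl1 rl2 rl12 rl21 s]]]]].
exists Y, (i1 \oc j1 \oc r1 + i2 \oc j2 \oc r2), (l1 \oc q1 \oc p1 + l2 \oc q2 \oc p2); split.
  rewrite compDl !compDr -!compA (compA p1) (compA p2) (compA p1 i2) (compA p2 i2).
  rewrite pi1 pi2 pi12 pi21 !comp1l !comp0l !comp0r addr0 add0r.
  by rewrite (compA q1) (compA q2) qj1 qj2 !comp1l.
rewrite compDl !compDr -!compA (compA r1) (compA r2) (compA r1 l2) (compA r2 l2).
rewrite rl1 rl2 rl12 rl21 !comp1l !comp0l !comp0r addr0 add0r.
by rewrite (compA j1) (compA j2) jq1 jq2.
Qed.

Lemma dsum_cat X A B m n (Y : 'I_m -> C) (Y' : 'I_n -> C) :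
  is_direct_sum2 X A B -> is_direct_sum A Y -> is_direct_sum B Y' ->
  is_direct_sum X (fun l : 'I_(m + n) => match split l with inl i => Y i | inr j => Y' j end).
Proof.
move=> /dsum2P[i1 [i2 [p1 [p2 [pi1 pi2 pi12 pi21 s]]]]] [i [p [pi pi0 t]]] [i' [p' [pi' pi0' t']]].
exists (fun l => match split l as z return hom (match z with inl a => Y a | inr b => Y' b end) X with
  | inl a => i1 \oc i a | inr b => i2 \oc i' b end).
exists (fun l => match split l as z return hom X (match z with inl a => Y a | inr b => Y' b end) with
  | inl a => p a \oc p1 | inr b => p' b \oc p2 end); split.
- move=> l; case: (split l) => a.
    by rewrite -compA (compA p1) pi1 comp1l pi.
  by rewrite -compA (compA p2) pi2 comp1l pi'.
- move=> l l' ll'.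
  have : split l != split l' by rewrite (inj_eq (can_inj (@splitK m n))).
  case: (split l) (split l') => a [] b ab; rewrite -!compA.
  + by rewrite (compA p1) pi1 comp1l pi0.
  + by rewrite (compA p1) pi12 comp0l comp0r.
  + by rewrite (compA p2) pi21 comp0l comp0r.
  + by rewrite (compA p2) pi2 comp1l pi0'.
- rewrite big_split_ord /=.
  rewrite -s -[in RHS](comp1l p1) -[in RHS](comp1l p2) -t -t' !comp_suml !comp_sumr.
  congr (_ + _); apply: eq_bigr => a _.
    by rewrite (unsplitK (inl a)) !compA.
  by rewrite (unsplitK (inr a)) !compA.
Qed.

Lemma hom0_retract X X' Y Y' : retract X' X -> retract Y' Y -> hom0 X Y -> hom0 X' Y'.
Proof.
move=> [i [p pi]] [j [q qj]] XY f.
by rewrite -[f]comp1l -qj -[f]comp1r -pi -!compA (compA j) (compA _ p) (XY (j \oc f \oc p)) comp0l comp0r.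
Qed.
End KrullSchmidt.

Lemma fmap_dsum (k : fieldType) (C D : lincat k) (F : functor C D) X n (Y : 'I_n -> C) :
  is_direct_sum X Y -> is_direct_sum (F X) (fun j => F (Y j)).
Proof.
move=> [i [p [pi pi0 s]]]; exists (fun j => fmap F (i j)), (fun j => fmap F (p j)); split.
- by move=> j; rewrite -fmapM pi fmap1.
- by move=> j l jl; rewrite -fmapM pi0// fmap0.
- by rewrite -fmap1 -s fmap_sum; apply: eq_bigr => j _; rewrite fmapM.
Qed.

Lemma fmap_split_idempotent (k : fieldType) (C D : lincat k) (F : functor C D) (X : C) (e : hom X X) :
  split_idempotent e -> split_idempotent (fmap F e).
Proof.
move=> [Y [j [q [qj jq]]]]; exists (F Y), (fmap F j), (fmap F q).
by rewrite -!fmapM qj jq fmap1.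
Qed.

(** * Summands of T + P[1] in the orbit category *)

Section IdempotentTransfer.
Variables (k : fieldType) (C : lincat k).

Lemma ff_trivial_idempotents (D : lincat k) (G : functor C D) (X : C) : faithful G -> full G ->
  trivial_idempotents X -> trivial_idempotents (G X).
Proof.
move=> Gf Gu Xt e ee; have [a ae] := Gu _ _ e; subst e.
have aa : a \oc a = a by apply: (faithful_inj Gf); rewrite fmapM.
by case: (Xt a aa) => ->; [left; rewrite fmap0|right; rewrite fmap1].
Qed.

Lemma ff_idempotents_split (D : lincat k) (G : functor C D) (X : C) : faithful G -> full G ->
  idempotents_split X -> idempotents_split (G X).
Proof.
move=> Gf Gu Xs e ee; have [a ae] := Gu _ _ e; subst e.
have aa : a \oc a = a by apply: (faithful_inj Gf); rewrite fmapM.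
exact: fmap_split_idempotent (Xs a aa).
Qed.

(** An idempotent of a triangular endomorphism algebra differs from its diagonal part by a map from
    [A] to [B], and such maps form an ideal of square zero. *)
Lemma triangular_idempotents_split (V A B : C) : is_direct_sum2 V A B -> hom0 B A ->
  (forall Y1 Y2 : C, exists Y, is_direct_sum2 Y Y1 Y2) ->
  idempotents_split A -> idempotents_split B -> idempotents_split V.
Proof.
move=> /dsum2P[i1 [i2 [p1 [p2 [pi1 pi2 pi12 pi21 s]]]]] BA sums As Bs e ee.
have mid X Y (g : hom V Y) (f : hom X V) :
    g \oc f = (g \oc i1) \oc (p1 \oc f) + (g \oc i2) \oc (p2 \oc f).
  by rewrite -{1}[f]comp1l -s compDl compDr -!compA.
have e12 : p1 \oc e \oc i2 = 0 by exact: BA.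
pose e1 := p1 \oc e \oc i1; pose e2 := p2 \oc e \oc i2.
have ee1 : e1 \oc e1 = e1.
  have h : p1 \oc (e \oc e) \oc i1 = e1 \oc e1.
    rewrite compA -(compA (p1 \oc e)) (mid _ _ (p1 \oc e)) e12 comp0l addr0.
    by rewrite /e1 !compA.
  by rewrite -h ee.
have ee2 : e2 \oc e2 = e2.
  have h : p2 \oc (e \oc e) \oc i2 = e2 \oc e2.
    rewrite compA -(compA (p2 \oc e)) (mid _ _ (p2 \oc e)) (compA p1 e) e12 comp0r add0r.
    by rewrite /e2 !compA.
  by rewrite -h ee.
have [Y1 [j1 [q1 [qj1 jq1]]]] := As e1 ee1; have [Y2 [j2 [q2 [qj2 jq2]]]] := Bs e2 ee2.
have [Y Ys] := sums Y1 Y2.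
pose e' := i1 \oc e1 \oc p1 + i2 \oc e2 \oc p2.
have e'S : split_idempotent e'.
  by apply: split_idempotent_dsum pi1 pi2 pi12 pi21 _ _ Ys; [exists j1, q1|exists j2, q2].
have e'e' : e' \oc e' = e'.
  by have [Z [j [q [qj <-]]]] := e'S; rewrite -compA (compA q) qj comp1l.
have ne : e - e' = i2 \oc (p2 \oc e \oc i1) \oc p1.
  have h1 : p1 \oc e = e1 \oc p1.
    by rewrite -[LHS]comp1r (mid _ _ (p1 \oc e) (idm V)) !comp1r e12 comp0l addr0.
  have h2 : p2 \oc e = (p2 \oc e \oc i1) \oc p1 + e2 \oc p2.
    by rewrite -[LHS]comp1r (mid _ _ (p2 \oc e) (idm V)) !comp1r.
  have h : e = i1 \oc (p1 \oc e) + i2 \oc (p2 \oc e) by rewrite !compA -compDl s comp1l.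
  apply/eqP; rewrite subr_eq; apply/eqP; apply: etrans h _.
  by rewrite h1 {1}h2 compDr !compA addrCA /e' /e1 /e2 !compA.
have nn x : (e - e') \oc x \oc (e - e') = 0.
  have x0 : p1 \oc x \oc i2 = 0 by exact: BA.
  rewrite ne (_ : _ \oc x \oc _ = i2 \oc (p2 \oc e \oc i1) \oc (p1 \oc x \oc i2) \oc
    (p2 \oc e \oc i1 \oc p1)); last by rewrite !compA.
  by rewrite x0 comp0r comp0l.
exact: split_idempotent_conj ee e'e' nn e'S.
Qed.

Variable F : zaction C.
Notation O := (orbit_category F).

(** The degree zero part of an idempotent is 0 or 1. The equation x = x a + F(a) x for the degree
    one part then reads x = 0 or x = x + x. *)
Lemma orb_trivial_idempotents (X : C) : short F X X -> trivial_idempotents X ->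
  trivial_idempotents (X : O).
Proof.
move=> XX Xt e ee.
have a2 : orb0 e \oc orb0 e = orb0 e by rewrite -orb0_comp// ee.
have x2 : orb1 e = orb1 e \oc orb0 e + fmap (F 1) (orb0 e) \oc orb1 e by rewrite -orb1_comp// ee.
case: (Xt _ a2) => a0; rewrite a0 in x2; [left|right]; apply: (orb_ext XX).
- by rewrite a0 orb0_0.
- by rewrite x2 comp0r fmap0 comp0l addr0 orb1_0.
- by rewrite a0 orb0_id.
- rewrite comp1r fmap1 comp1l in x2; rewrite orb1_id; apply: (addrI (orb1 e)).
  by rewrite addr0 -x2.
Qed.

Lemma orb_isomorphic (X Y : C) : short F X X -> short F X Y -> short F Y X -> short F Y Y ->
  isomorphic (X : O) (Y : O) -> isomorphic X Y.
Proof.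
move=> XX XY YX YY [f [g [gf fg]]]; exists (orb0 f), (orb0 g).
by rewrite -!orb0_comp// gf fg !orb0_id.
Qed.

Lemma orb_idempotents_split (V : C) : short F V V -> idempotents_split V ->
  idempotents_split (V : O).
Proof.
move=> VV Vs e ee.
have a2 : orb0 e \oc orb0 e = orb0 e by rewrite -orb0_comp// ee.
pose e' := fmap (orbit_functor F) (orb0 e).
have e'e' : e' \oc e' = e' by rewrite -fmapM a2.
(* [e] and [e'] share their degree zero part, so the difference lies in the degree one ideal, whose
   square is zero. *)
suff nn x : (e - e') \oc x \oc (e - e') = 0.
  have e'S : split_idempotent e' := fmap_split_idempotent (orbit_functor F) (Vs _ a2).
  exact: (@split_idempotent_conj _ O V e e' ee e'e' nn e'S).
have n0 : orb0 (e - e') = 0.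
  by rewrite addrC -scaleN1r orb0_lin orb0_functor scaleN1r addNr.
by apply: (orb_ext VV); rewrite ?orb0_comp ?orb1_comp ?orb0_comp ?n0 ?orb0_0 ?orb1_0
  ?comp0l ?comp0r ?fmap0 ?comp0l ?addr0.
Qed.
End IdempotentTransfer.

Section ClusterTilting.
Variables (k : fieldType) (H : falgType k).
Notation D := (dercat H).
Notation loc := (loc_functor (@quasi_iso k H)).
Notation sh := (shift H).
Notation st := (stalk H).
Hypothesis hH : hereditary H.

Lemma modcat_num_summands (M : modcat H) n (Y : 'I_n -> modcat H) :
  (forall j, indecomposable (Y j)) -> pairwise_nonisomorphic Y -> is_direct_sum M Y ->
  num_summands M n.
Proof.
move=> Yi Yp MY; apply: basic_num_summands MY Yi Yp; first exact: modcat_findim.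
exact: modcat_split_idempotent.
Qed.

Lemma dercat_sums (Y1 Y2 : D) : exists Y : D, is_direct_sum2 Y Y1 Y2.
Proof. by exists (dsum_cplx Y1 Y2 : D); exact: (fmap_dsum2 loc (dsum_cplxP Y1 Y2)). Qed.

Lemma modcat_trivial_idempotents (M : modcat H) : indecomposable M -> trivial_idempotents M.
Proof. by move=> Mi; apply: (indecomposable_trivial Mi); exact: modcat_split_idempotent. Qed.

Variables (F : zaction D) (T P : modcat H) (V : D).
Notation O := (orbit_category F).
Notation A := (st T).
Notation B := (sh (st P)).
Hypotheses (VAB : is_direct_sum2 V A B) (VV : short F V V) (BA : hom0 B A).
Variables (m n : nat) (Y : 'I_m -> modcat H) (Y' : 'I_n -> modcat H).
Hypotheses (Yi : forall j, indecomposable (Y j)) (Yp : pairwise_nonisomorphic Y) (TY : is_direct_sum T Y).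
Hypotheses (Yi' : forall j, indecomposable (Y' j)) (Yp' : pairwise_nonisomorphic Y')
  (PY' : is_direct_sum P Y').

Let W (l : 'I_(m + n)) : D := match split l with inl i => st (Y i) | inr j => sh (st (Y' j)) end.

Lemma family_dsum : is_direct_sum V W.
Proof. exact: dsum_cat VAB (fmap_dsum st TY) (fmap_dsum sh (fmap_dsum st PY')). Qed.

Lemma family_retract l : retract (W l) V.
Proof. by have [i [p [pi _ _]]] := family_dsum; exists (i l), (p l). Qed.

Lemma family_short l l' : short F (W l) (W l').
Proof.
move=> j j0 j1; apply: hom0_retract (family_retract l) _ (VV j0 j1).
have [i [p pi]] := family_retract l'; exists (fmap (F j) i), (fmap (F j) p).
by rewrite -fmapM pi fmap1.
Qed.

Lemma ff_nonzero (C E : lincat k) (G : functor C E) (X : C) : faithful G -> ~ is_zero X -> ~ is_zero (G X).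
Proof. by move=> Gf X0 G0; apply: X0; apply: Gf; rewrite fmap1. Qed.

Lemma family_nonzero l : ~ is_zero (W l).
Proof.
rewrite /W; case: (split l) => j.
  apply: ff_nonzero (stalk_faithful hH) _; exact: (Yi j).1.
apply: ff_nonzero (@shift_faithful _ H) _; apply: ff_nonzero (stalk_faithful hH) _.
exact: (Yi' j).1.
Qed.

Lemma family_trivial l : trivial_idempotents (W l).
Proof.
rewrite /W; case: (split l) => j.
  apply: ff_trivial_idempotents (stalk_faithful hH) (stalk_full hH) _.
  exact: modcat_trivial_idempotents.
apply: ff_trivial_idempotents (@shift_faithful _ H) (@shift_full _ H) _.
apply: ff_trivial_idempotents (stalk_faithful hH) (stalk_full hH) _.
exact: modcat_trivial_idempotents.
Qed.

Lemma family_hom0 i j : hom0 (sh (st (Y' j))) (st (Y i)).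
Proof.
have [a [b [ba _ _]]] := fmap_dsum st TY.
have [a' [b' [ba' _ _]]] := fmap_dsum sh (fmap_dsum st PY').
by apply: hom0_retract BA; [exists (a' j), (b' j)|exists (a i), (b i)].
Qed.

Lemma family_nonisomorphic l l' : isomorphic (W l) (W l') -> l = l'.
Proof.
have hz (C : lincat k) (X Z : C) : isomorphic X Z -> hom0 X Z -> is_zero X.
  by move=> [f [g [gf fg]]] XZ; rewrite /is_zero -gf (XZ f) comp0r.
move=> e; apply: (can_inj (@splitK m n)); move: e (@family_nonzero l) (@family_nonzero l').
rewrite /W; case: (split l) (split l') => j [] j' e n1 n2.
(* Within each kind, isomorphisms come from modules. A summand of T and one of P[1] cannot be
   isomorphic, since nothing maps from the latter to the former. *)
- by congr inl; apply: Yp; apply: (ff_isomorphic (stalk_faithful hH) (stalk_full hH)).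
- by case: n2; apply: hz (isomorphic_sym e) _; exact: family_hom0.
- by case: n1; apply: hz e _; exact: family_hom0.
- congr inr; apply: Yp'; apply: (ff_isomorphic (stalk_faithful hH) (stalk_full hH)).
  exact: (ff_isomorphic (@shift_faithful _ H) (@shift_full _ H)).
Qed.

Lemma orbit_family_dsum : is_direct_sum (V : O) (fun l => W l : O).
Proof. exact: (fmap_dsum (orbit_functor F) family_dsum). Qed.

Lemma orbit_family_indecomposable l : indecomposable (W l : O).
Proof.
apply: trivial_indecomposable.
  move=> W0; apply: (@family_nonzero l).
  by rewrite /is_zero -(orb0_id F) [idm _]W0 orb0_0.
exact: orb_trivial_idempotents (@family_short l l) (@family_trivial l).
Qed.

Lemma orbit_family_nonisomorphic : pairwise_nonisomorphic (fun l => W l : O).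
Proof.
move=> l l' e; apply: family_nonisomorphic.
by apply: (orb_isomorphic (F := F)) e; exact: family_short.
Qed.

Lemma orbit_object_basic : basic (V : O).
Proof.
exists (m + n)%N, (fun l => W l : O); split.
- exact: orbit_family_indecomposable.
- exact: orbit_family_nonisomorphic.
- exact: orbit_family_dsum.
Qed.

Lemma orbit_object_num_summands : num_summands (V : O) (m + n).
Proof.
apply: basic_num_summands orbit_family_dsum orbit_family_indecomposable orbit_family_nonisomorphic.
  exact: orbit_findim (dercat_findim hH) VV.
apply: orb_idempotents_split VV _; apply: triangular_idempotents_split VAB BA dercat_sums _ _.
  exact: ff_idempotents_split (stalk_faithful hH) (stalk_full hH) (@modcat_split_idempotent _ _ T).
apply: ff_idempotents_split (@shift_faithful _ H) (@shift_full _ H) _.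
exact: ff_idempotents_split (stalk_faithful hH) (stalk_full hH) (@modcat_split_idempotent _ _ P).
Qed.
End ClusterTilting.

Theorem theorem1p1 (k : closedFieldType) (H : falgType k) (T P : modcat H)
    (hH : hereditary H) (hT : basic T) (hP : basic P)
    (hA : silted T P (silted_matrix_algebra T P)) :
  cluster_tilted (cluster_matrix_algebra T P).
Proof.
have [[Trigid Pp PT [t [p [Tt Pn Hn]]]] _] := hA.
have [m [Y [Yi Yp TY]]] := hT; have [n [Y' [Yi' Yp' PY']]] := hP.
have tm := num_summands_uniq Tt (modcat_num_summands Yi Yp TY).
have pn := num_summands_uniq Pn (modcat_num_summands Yi' Yp' PY').
have [tau [tau' [s [tauAR tq sS sn]]]] := AR_translation_exists hH.
have [F [Fc Fn]] := cluster_action tauAR tq.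
have [V VAB] := dercat_sums (stalk H T) (shift H (stalk H P)).
have Tr := tau_rigid_hom0 hH Trigid.
have VV := object_short hH sS Fn Pp VAB.
have BA : hom0 (shift H (stalk H P)) (stalk H T) by exact: shifted_projective_hom0.
exists H, F, V; split=> //.
- split.
    move=> f; apply: subsp_inj; apply: functional_extensionality_dep => i.
    exact: (object_rigid hH sS Fn Tr Pp PT VAB).
  exists (t + p)%N; split=> //; rewrite tm pn.
  exact (orbit_object_num_summands hH VAB VV BA Yi Yp TY Yi' Yp' PY').
- exact (orbit_object_basic hH VAB VV BA Yi Yp TY Yi' Yp' PY').
- exact (cluster_matrix_algebra_iso hH sS sn Fn Pp VAB).
Qed.
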